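(* Let $\gamma\in(\frac23,1)$ and let $J$ be a $\gamma$-stable kernel on $\mathbb Z$ (as defined in the context) such that $J(x)\sim |x|^{-(1+\gamma)}$ as $|x|\to\infty$. Then $\beta_c(\rho)=\beta_0$ for all $\rho$ sufficiently small. Furthermore, $$\lim_{\rho\downarrow 0}\ \liminf_{\beta\downarrow\beta_0}\ \frac{F(\rho,\beta)}{F(\beta)}=1 .$$
   Context: A $\gamma$-stable kernel is a function $J:\mathbb Z\to\mathbb R_+$ with $\sum_x J(x)=1$, of the form $J(x)=\varphi(|x|)(1+|x|)^{-(1+\gamma)}$ with $\varphi$ positive and slowly varying at infinity, and which is moreover assumed to be non-increasing in $|x|$ (unimodality, standing assumption). $W=(W_t)_{t\ge0}$ denotes the continuous-time random walk started at $0$ which at rate $1$ makes a jump whose increment has distribution $J$ (increment $0$ allowed); its law is $\mathrm P$. For $\rho\in[0,1)$ let $X_t=W^{(1)}_{(1-\rho)t}$ and $Y_t=W^{(2)}_{\rho t}$, where $W^{(1)},W^{(2)}$ are independent copies of $W$; $\mathbf P,\mathbf E$ denote the law of and expectation with respect to $X$, and $\mathbb P,\mathbb E$ those for $Y$. The partition function of the Random Walk Pinning Model is $$Z^Y_{\beta,T}=\mathbf E\Big[\exp\Big(\beta\int_0^T \mathbf 1_{\{X_t=Y_t\}}\,dt\Big)\Big].$$ The quenched free energy is $F(\rho,\beta)=\lim_{T\to\infty}\frac1T\log Z^Y_{\beta,T}$ (the limit exists $\mathbb P$-a.s. and in $L^1(\mathbb P)$, is non-random and non-negative), $F(\beta):=F(0,\beta)$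 is the homogeneous (annealed) free energy, $\beta_c(\rho):=\inf\{\beta>0: F(\rho,\beta)>0\}$, and $\beta_0:=\big(\int_0^\infty \mathrm P(W_t=0)\,dt\big)^{-1}$, which satisfies $\beta_0=\beta_c(0)>0$. *)

(* Defs.v *)
From HB Require Import structures.
From mathcomp Require Import all_boot all_order all_algebra finmap.
From mathcomp Require Import all_classical all_reals all_analysis.
Import Order.TTheory GRing.Theory Num.Theory.
Import numFieldNormedType.Exports.

Set Implicit Arguments.
Unset Strict Implicit.
Unset Printing Implicit Defensive.

Local Open Scope classical_set_scope.
Local Open Scope ring_scope.

Section kernel.
Context {R : realType}.
Implicit Types (phi : R -> R) (J : int -> R) (gamma : R).

Definition slowly_varying phi : Prop :=
  measurable_fun (`[0, +oo[ : set R) phi /\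
  forall a : R, 0 < a -> phi (a * x) / phi x @[x --> +oo] --> (1 : R).

(* The last clause is the standing unimodality assumption. *)
Definition stable_kernel gamma J : Prop :=
  [/\ exists phi : R -> R,
        [/\ forall x : R, 0 <= x -> 0 < phi x,
            slowly_varying phi
          & forall x : int,
              J x = phi `|x|%:~R * (1 + `|x|%:~R) `^ (- (1 + gamma))],
      (\esum_(x in [set: int]) (J x)%:E)%E = 1%E
    & forall x y : int, `|x| <= `|y| -> J y <= J x].

(* The filter of |x| --> oo on the integers. *)
Definition absz_infty : set_system int :=
  filter_from [set: nat] (fun N => [set x : int | (N <= `|x|)%N]).

End kernel.

Section walk.
Context {d : measure_display} {O : measurableType d} {R : realType}.
Variable P : probability O R.

Definition mutually_independent (I : choiceType) (G : I -> set (set O)) : Prop :=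
  forall (K : {fset I}) (A : I -> set O),
    (forall i, i \in K -> G i (A i)) ->
    P (\bigcap_(i in [set` K]) A i) = (\prod_(i <- K) P (A i))%E.

(* The sigma-algebras generated by the holding times tau k and by the
   increments xi k; every subset of int is measurable. *)
Definition step_events (tau : nat -> O -> R) (xi : nat -> O -> int)
    (i : nat + nat) : set (set O) :=
  match i with
  | inl k => preimage_set_system [set: O] (tau k) measurable
  | inr k => preimage_set_system [set: O] (xi k) [set: set int]
  end.

Definition jump_time (tau : nat -> O -> R) (k : nat) (w : O) : R :=
  \sum_(i < k.+1) tau i w.

(* The sum over k is finitely supported almost surely; on the null event where
   infinitely many jumps occur before time t, \sum_(k \in _) may return 0. *)
Definition ctrw (J : int -> R) (W : R -> O -> int) : Prop :=
  exists (tau : nat -> {RV P >-> R}) (xi : nat -> O -> int),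
    [/\ forall k (x : int), measurable (xi k @^-1` [set x]),
        forall k (A : set R), measurable A ->
          distribution P (tau k) A = exponential_prob (1 : R) A,
        forall k (x : int), P (xi k @^-1` [set x]) = (J x)%:E,
        mutually_independent (step_events tau xi)
      & forall (t : R) (w : O), 0 <= t ->
          W t w = \sum_(k \in [set k | jump_time tau k w <= t]) xi k w].

(* beta_0; a divergent integral gives 0. *)
Definition beta0 (W : R -> O -> int) : R :=
  (fine (\int[lebesgue_measure]_(t in `[0%R, +oo[) P [set w | W t w = 0%R])%E)^-1.

Definition collision_time (X : R -> O -> int) (y : R -> int) (T : R) (w : O) : R :=
  \int[lebesgue_measure]_(t in `[0, T]) (X t w == y t)%:R.

(* Z^Y_{beta,T} for a process X under P and a fixed trajectory y of Y. *)
Definition partition_function (X : R -> O -> int) (y : R -> int) (beta T : R) : R :=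
  fine 'E_P[fun w => expR (beta * collision_time X y T w)].

End walk.

Section pinning.
Context {d1 d2 : measure_display} {O1 : measurableType d1}
  {O2 : measurableType d2} {R : realType}.
Variables (P1 : probability O1 R) (P2 : probability O2 R).
Variables (W1 : R -> O1 -> int) (W2 : R -> O2 -> int).

(* X and Y live on separate spaces, i.e. on the factors of the product space
   carrying the independent walks; a.s. refers to Y only. *)
Definition is_free_energy (rho beta f : R) : Prop :=
  let X t := W1 ((1 - rho) * t) in
  let Y t := W2 (rho * t) in
  {ae P2, forall w,
    T^-1 * ln (partition_function P1 X (Y ^~ w) beta T) @[T --> +oo] --> f}.

(* The a.s. limit is unique when it exists; otherwise the value is arbitrary. *)
Definition free_energy (rho beta : R) : R := get (is_free_energy rho beta).

Definition beta_c (rho : R) : \bar R :=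
  ereal_inf [set beta%:E | beta in [set b : R | 0 < b /\ 0 < free_energy rho b]].

End pinning.

(* Main.v *)
Require Import Defs.
From mathcomp Require Import all_boot all_order all_algebra finmap.
From mathcomp Require Import all_classical all_reals all_analysis.
From mathcomp Require Import measurable_realfun.
From mathcomp Require Import zify ring lra.
Import Order.TTheory GRing.Theory Num.Theory.
Import numFieldNormedType.Exports.

(** Why the theorem is true.

    Seen on a grid of mesh [h], the partition function at [rho = 0] is a sum
    over the contacts of the walk with [0], that is, a renewal sum with kernel
    [z * p (j * h) 0], where [z = expR (beta * h) - 1]. Its exponential growth
    rate is the tilt [phi] that turns this kernel into a probability. As [h]
    tends to [0] this reads [beta * G phi = 1], where [G phi] is the integral
    over [t >= 0] of [P (W t = 0) * expR (- phi * t)] (the function [green]).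
    [G] is positive and strictly decreasing, hence the critical point
    [(G 0)^-1], and the value of [F 0 beta] as the threshold of [critical].

    Upper bound. Both walks have the same increments, and the speeds [1 - rho]
    and [rho] add up to [1]; the average of the partition function over [Y] is
    therefore the homogeneous one, for every [rho]. Concavity of the logarithm
    gives [F rho beta <= F 0 beta] ([free_energy_upper]); in particular
    [F rho beta] vanishes below [beta_0].

    Lower bound. One has to show [(1 - eps) * F 0 beta <= F rho beta] for
    [rho <= rho_eps], with [rho_eps] independent of [beta]; this is
    [uniform_lower_bound]. Time is cut into blocks of [q] correlation lengths
    [l], of order [phi^-1]. Let [Bb] be the weight of the pinned paths that
    start in a window at the beginning of the block and stop in a window near
    its end. Its mean is at least of order [expR ((q - 4) * phi * l)]. Its
    variance is governed by a two-replica recursion ([E_ZbZb]) in which the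
    replicas interact only through [p ((1 - rho) * t) 0 <= (1 + C * rho) * p t 0]
    ([heat_slow]). This recursion has a supersolution ([Psi_super]) built from
    sums of products of renewal densities, of order [n `^ (al - 1)] with
    [al = gamma^-1 - 1]; the double sums converge, uniformly in the
    correlation length, exactly if [al < 1 / 2], that is, [gamma > 2 / 3]. The
    variance is then at most [C * rho] times the square of the mean, and a
    block is bad, in the sense that [Bb] is less than half its mean, with
    probability at most [C * rho] ([E_bad]). Good blocks are chained by single
    bridges of [X], bad blocks are jumped over ([chain_bound]). A bridge costs
    the logarithm of the displacement of [Y], which has mean [O(rho)] because
    [p t x] decays only polynomially in [x] ([heat_link], [glog_J]). Each
    block thus contributes at least [(q - 4) * phi * l - C * ln q] up to
    [O(rho)]: take [q] large, then [rho] small.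

    The free energy itself is constructed from block sums: cutting [ln Z] at
    multiples of a time [n] costs [O(ln n)] per block, uniformly in the mesh
    ([block_concentration]), so the expectations are Cauchy; a comparison of
    the grid with continuous time ([partition_mesh]) and the monotonicity of
    [Z] in time give the almost sure limit ([free_energy_exists]).

    The estimates on [p t x] use neither Fourier analysis nor a local limit
    theorem, only the properties collected in [heat]: the semigroup equation
    and symmetry give log-convexity of [p t 0], a self-consistent inequality
    gives its upper bound, tightness gives the lower bound, and the scenario
    of a single large jump gives the lower bound far away. *)

Set Implicit Arguments.
Unset Strict Implicit.
Unset Printing Implicit Defensive.

Local Open Scope classical_set_scope.
Local Open Scope ring_scope.

(** [apply: (via y)] splits a proof of [x <= z] at the middle term [y]. *)
Local Notation via y := (@le_trans _ _ y).
Local Notation cat_nat n := (@big_cat_nat _ _ _ n).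
Local Notation "\esum_ i F" := (\esum_(i in [set: _]) F)%E
 (at level 41, i at level 0, F at level 41, only parsing) : ring_scope.

(** * Densities and countable conditioning *)

Section density.
Context {d : measure_display} {T : measurableType d} {R : realType}.
Variables (mu nu : {measure set T -> \bar R}) (f : T -> R).
Hypotheses (mf : measurable_fun setT f) (f0 : forall x, 0 <= f x)
 (nuE : forall A, measurable A -> nu A = (\int[mu]_(x in A) (f x)%:E)%E).

Import HBNNSimple.
Local Open Scope ereal_scope.

Let density_nnsfun (g : {nnsfun T >-> R}) :
 \int[nu]_x (g x)%:E = \int[mu]_x ((g x)%:E * (f x)%:E).
have mfE : measurable_fun setT (EFin \o f) by exact/measurable_EFinP.
under [LHS]eq_integral do rewrite fimfunE -fsumEFin//.
rewrite [LHS]ge0_integral_fsum//; last 2 first.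
 - by move=> r; exact/measurable_EFinP/measurableT_comp.
 - by move=> n x _; rewrite EFinM nnfun_muleindic_ge0.
under [RHS]eq_integral.
 move=> x xD; rewrite fimfunE -fsumEFin// ge0_mule_fsuml; last first.
  by move=> r; rewrite EFinM nnfun_muleindic_ge0.
 over.
rewrite [RHS]ge0_integral_fsum//; last 2 first.
 - by move=> r; apply: emeasurable_funM => //; apply/measurable_EFinP; do 2 apply/measurableT_comp => //.
 - by move=> n x _; rewrite EFinM mule_ge0 ?lee_fin// -lee_fin nnfun_muleindic_ge0.
apply: eq_fsbigr => r _.
under [RHS]eq_integral do rewrite EFinM -muleA.
have [r0|r0] := ltP r 0%R.
 rewrite !integral0_eq// => x _.
  by rewrite preimage_nnfun0// indicE in_set0 !mul0e mule0.
 by rewrite preimage_nnfun0// indicE in_set0 mulr0.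
under [LHS]eq_integral do rewrite EFinM.
rewrite !ge0_integralZl//; first last.
- exact/measurable_EFinP.
- by move=> x _; rewrite mule_ge0// lee_fin.
- apply: emeasurable_funM => //; exact/measurable_EFinP.
congr (_ * _); rewrite integral_indic//= setIT nuE//.
rewrite integral_mkcond; apply: eq_integral => x _.
by rewrite patchE indicE; case: ifP => _; rewrite ?mul1e ?mul0e.
Qed.

Lemma integral_density (g : T -> \bar R) :
 measurable_fun setT g -> (forall x, 0 <= g x) ->
 \int[nu]_x g x = \int[mu]_x (g x * (f x)%:E).
move=> mg g0.
pose g_ := nnsfun_approx measurableT mg.
have mfE : measurable_fun setT (EFin \o f) by exact/measurable_EFinP.
transitivity (lim (\int[nu]_x (g_ n x)%:E @[n --> \oo])).
 rewrite -monotone_convergence//=.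
 - apply: eq_integral => ? /[!inE] xD; apply/esym/cvg_lim => //=.
  exact: cvg_nnsfun_approx.
 - by move=> n; exact/measurable_EFinP/measurable_funTS.
 - by move=> n ? _; rewrite lee_fin.
 - by move=> ? _ ? ? mn; rewrite lee_fin; exact/lefP/nd_nnsfun_approx.
transitivity (lim (\int[mu]_x ((g_ n x)%:E * (f x)%:E) @[n --> \oo])).
 by apply: congr_lim; apply/funext => n /=; exact: density_nnsfun.
rewrite -monotone_convergence//=.
- apply: eq_integral => x _.
 apply/cvg_lim => //=; apply: cvgeZr => //.
 exact: cvg_nnsfun_approx.
- by move=> n; apply: emeasurable_funM => //; exact/measurable_EFinP.
- by move=> n x _; rewrite mule_ge0// lee_fin.
- by move=> x _ m n mn; rewrite lee_wpmul2r ?lee_fin//; exact/lefP/nd_nnsfun_approx.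
Qed.
End density.

Lemma esumZl {R : realType} {T : choiceType} (D : set T) (a : T -> \bar R) (c : R) :
 0 <= c -> (forall i, 0 <= a i)%E ->
 (\esum_(i in D) (c%:E * a i) = c%:E * \esum_(i in D) a i)%E.
move=> c0 a0.
have H (e : R) (b : T -> \bar R) : 0 <= e -> (forall i, 0 <= b i)%E ->
  (\esum_(i in D) (e%:E * b i) <= e%:E * \esum_(i in D) b i)%E.
 move=> e0 b0; apply: ub_ereal_sup => _ [F [finF FD] <-].
 rewrite -ge0_mule_fsumr// lee_wpmul2l ?lee_fin//.
 by apply: ereal_sup_ubound; exists F.
have [->|cn0] := eqVneq c 0.
 by rewrite mul0e esum1// => i _; rewrite mul0e.
apply/eqP; rewrite eq_le H//=.
have cV : 0 <= c^-1 by rewrite invr_ge0.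
have := H c^-1 (fun i => c%:E * a i)%E cV (fun i => mule_ge0 _ (a0 i)).
rewrite lee_fin => /(_ c0) h.
have -> : (\esum_(i in D) a i = \esum_(i in D) (c^-1%:E * (c%:E * a i)))%E.
 by apply: eq_esum => i _; rewrite muleA -EFinM mulVf// mul1e.
apply: (le_trans (lee_wpmul2l _ h)); first by rewrite lee_fin.
by rewrite muleA -EFinM divff// mul1e.
Qed.

Section countable_conditioning.
Context {d : measure_display} {O : measurableType d} {R : realType}.
Variable P : probability O R.

Lemma eq_ler {dd} {T : porderType dd} (x y : T) : (x = y -> x <= y)%O.
by move->. Qed.

Lemma measurable_prop (Q : Prop) : measurable [set _ : O | Q].
by have [q|q] := pselect Q; [rewrite (_ : [set _ | _] = setT)//|rewrite (_ : [set _ | _] = set0)//];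
 apply/seteqP; split.
Qed.

Lemma measurable_preimage_countable {C : countType} (V : O -> C) (A : set C) :
 (forall x, measurable (V @^-1` [set x])) -> measurable (V @^-1` A).
move=> mV; rewrite (_ : V @^-1` A = \bigcup_(x : C) (if x \in A then V @^-1` [set x] else set0)).
 by apply: countable_bigcupT_measurable => // x; case: ifP.
apply/seteqP; split => w /=.
- by move=> Aw; exists (V w) => //; rewrite mem_set.
- by move=> [x _]; case: ifPn => //; rewrite inE => Ax /= ->.
Qed.

Lemma measurable_countable {d'} {S : measurableType d'} (C : countType) (V : O -> C) (h : C -> S) :
 (forall c, measurable (V @^-1` [set c])) -> measurable_fun setT (fun w => h (V w)).
by move=> mV _ B mB; rewrite setTI; exact: (measurable_preimage_countable (h @^-1` B) mV).
Qed.

Lemma measurable_diff (U V : O -> int) x : (forall y, measurable (U @^-1` [set y])) ->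
 (forall y, measurable (V @^-1` [set y])) -> measurable [set w | V w - U w = x].
move=> mU mV; rewrite (_ : [set w | _] = \bigcup_y (U @^-1` [set y] `&` V @^-1` [set x + y])).
 by apply: countable_bigcupT_measurable => // y; exact: measurableI.
apply/seteqP; split => w /=.
- by move=> <-; exists (U w) => //; split => //=; rewrite subrK.
- by move=> [y _ [/= h1 h2]]; rewrite h1 h2 addrK.
Qed.

(** Conditioning on a countable variable: the space splits into the level sets
    of [V], enumerated through [pickle]. *)
Lemma integral_countable_mul (C : countType) (V : O -> C) (h : C -> R) (k : O -> R) (A : set O) :
 (forall c, measurable (V @^-1` [set c])) -> measurable A -> (forall c, 0 <= h c) ->
 measurable_fun setT k -> (forall w, 0 <= k w) ->
 (\int[P]_(w in A) (h (V w) * k w)%:E =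
  \esum_(c in [set: C]) ((h c)%:E * \int[P]_(w in A `&` V @^-1` [set c]) (k w)%:E))%E.
move=> mV mA h0 mk k0.
pose F (n : nat) := if pickle_inv n is Some y then A `&` V @^-1` [set y : C] else set0.
pose H (n : nat) : R := if pickle_inv n is Some y then h y else 0.
have mF n : measurable (F n) by rewrite /F; case: pickle_inv => // y; exact: measurableI.
have AF : A = \bigcup_n F n.
 apply/seteqP; split => w.
 - by move=> Aw; exists (choice.pickle (V w)); [by []|rewrite /F pickleK_inv].
 - by move=> [n _]; rewrite /F; case: pickle_inv => // y [].
have tF : trivIset setT F.
 apply/trivIsetP => i j _ _ ij; rewrite -subset0 => w []; rewrite /F.
 case Ei: (pickle_inv i) => [y|//] [_ /= fy]; case Ej: (pickle_inv j) => [z|//] [_ /= fz].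
 have hi := @pickle_invK C i; have hj := @pickle_invK C j.
 by move: ij; rewrite -(hi) -(hj) Ei Ej /= -fy -fz eqxx.
have k0E D : forall w : O, D w -> (0 <= (k w)%:E)%E by move=> w _; rewrite lee_fin.
have mkE D : measurable_fun D (fun w => (k w)%:E).
 by apply: measurable_funTS; exact/measurable_EFinP.
have FH n : (\int[P]_(w in F n) (h (V w) * k w)%:E = (H n)%:E * \int[P]_(w in F n) (k w)%:E)%E.
 rewrite /F /H; case: pickle_inv => [y|]; last by rewrite !integral_set0 mule0.
 rewrite (eq_integral (fun w => (h y)%:E * (k w)%:E)%E); last first.
  by move=> w; rewrite inE => -[_ /= ->].
 have mAy : measurable (A `&` V @^-1` [set y]) by exact: measurableI.
 have hy : (0 <= (h y)%:E)%E by rewrite lee_fin.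
 exact: (@ge0_integralZl _ _ _ P _ mAy (fun x => (k x)%:E) (mkE _) (h y)%:E (fun w _ => k0E setT w Logic.I) hy).
have mh : measurable_fun setT (fun w => (h (V w) * k w)%:E : \bar R).
 apply/measurable_EFinP; apply: measurable_funM => //.
 exact: (@measurable_countable _ R _ V h).
rewrite [in LHS]AF ge0_integral_bigcup//; last 2 first.
- exact: measurable_funTS.
- by move=> x _; rewrite lee_fin mulr_ge0.
under eq_eseriesr do rewrite FH.
rewrite nneseries_esumT; last first.
 move=> n; rewrite mule_ge0//; first by rewrite lee_fin /H; case: pickle_inv.
 by apply: integral_ge0 => w _; rewrite lee_fin.
rewrite [RHS](_ : _ = \esum_(y in [set: C]) ((H (choice.pickle y))%:E * \int[P]_(w in F (choice.pickle y)) (k w)%:E))%E; last first.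
 by apply: eq_esum => y _; rewrite /F /H pickleK_inv.
rewrite [LHS](_ : _ = \esum_(n in range (@choice.pickle C)) ((H n)%:E * \int[P]_(w in F n) (k w)%:E))%E.
 rewrite (reindex_esum [set: C] _ choice.pickle)//.
 by apply: inj_bij => y z _ _; exact: (pcan_inj choice.pickleK).
rewrite [RHS]esum_mkcond; apply: eq_esum => n _.
case: ifPn => //; rewrite notin_setE => hn.
rewrite /F; case E: (pickle_inv n) => [y|]; last by rewrite integral_set0 mule0.
exfalso; apply: hn; exists y => //.
by have := @pickle_invK C n; rewrite E.
Qed.

Lemma integral_countable (C : countType) (V : O -> C) (h : C -> R) (A : set O) :
 (forall c, measurable (V @^-1` [set c])) -> measurable A -> (forall c, 0 <= h c) ->
 (\int[P]_(w in A) (h (V w))%:E =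
  \esum_(c in [set: C]) ((h c)%:E * P (A `&` V @^-1` [set c])))%E.
move=> mV mA h0.
transitivity (\int[P]_(w in A) (h (V w) * (cst 1 w))%:E)%E.
 by apply: eq_integral => w _; rewrite mulr1.
rewrite integral_countable_mul//; apply: eq_esum => c _.
by rewrite (@integral_cst _ _ _ P _ (measurableI _ _ mA (mV c)) 1%:E) mul1e.
Qed.

Lemma measure_countable_partition (C : countType) (V : O -> C) (A : set O) :
 (forall x, measurable (V @^-1` [set x])) -> measurable A ->
 P A = (\esum_(y in [set: C]) P (A `&` V @^-1` [set y]))%E.
move=> mV mA; have := @integral_countable C V (fun=> 1) A mV mA (fun=> ler01).
by rewrite integral_cst// mul1e => ->; apply: eq_esum => y _; rewrite mul1e.
Qed.
End countable_conditioning.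

(** * Independent families of events *)

Section independence.
Context {d : measure_display} {O : measurableType d} {R : realType}.
Variable P : probability O R.
Context {I : choiceType} (G : I -> set (set O)).
Hypotheses (Gm : forall i A, G i A -> measurable A) (GT : forall i, G i setT)
 (GI : forall i A B, G i A -> G i B -> G i (A `&` B)).

Definition rects (D : set I) : set (set O) :=
 [set B | exists (K : {fset I}) (A : I -> set O),
   [/\ [set` K] `<=` D, forall i, G i (A i)
    & B = \bigcap_(i in [set` K]) A i]].

Lemma rects_setI (D : set I) : setI_closed (rects D).
move=> _ _ [K [A [KD GA ->]]] [L [B [LD GB ->]]].
exists (K `|` L)%fset, (fun i => (if i \in K then A i else setT) `&`
  (if i \in L then B i else setT)); split.
- by move=> i /=; rewrite inE => /orP[/KD|/LD].
- by move=> i; apply: GI; case: ifP.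
apply/seteqP; split => w.
- move=> [hA hB] i _; split; case: ifPn => // iK; [exact: hA|exact: hB].
- move=> h; split => i /= iK.
 + by have := h i; rewrite /= inE iK => /(_ isT) [].
 + by have := h i; rewrite /= inE iK orbT => /(_ isT) [].
Qed.

Lemma rects_incl (D : set I) i A : D i -> G i A -> rects D A.
move=> Di GA; exists [fset i]%fset, (fun j => if j == i then A else setT).
split.
- by move=> j /=; rewrite inE => /eqP ->.
- by move=> j; case: ifPn => // /eqP ->.
- apply/seteqP; split => w.
 + by move=> Aw j /=; rewrite inE => ->.
 + by move=> /(_ i); rewrite /= inE eqxx; apply.
Qed.

Lemma rects_measurable (D : set I) A : rects D A -> measurable A.
move=> [K [B [_ GB ->]]]; apply: fin_bigcap_measurable => // i _.
exact: Gm (GB i).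
Qed.

Definition hist (D : set I) : set (set O) := <<s rects D >>.

Lemma hist_measurable (D : set I) A : hist D A -> measurable A.
apply: smallest_sub; last exact: rects_measurable.
exact: sigma_algebra_measurable.
Qed.

Hypothesis indep : mutually_independent P G.

(** The events [A] that satisfy the product rule against a fixed [B] form a
    lambda-system containing the pi-system [rects D]. *)
Lemma hist_indep (D : set I) i A B : ~ D i -> hist D A -> G i B ->
 P (A `&` B) = (P A * P B)%E.
move=> Di hA GB; move: A hA.
have mB := Gm GB.
pose H := [set A : set O | measurable A /\ P (A `&` B) = (P A * P B)%E].
suff : <<s rects D >> `<=` H by move=> sub A /sub [].
apply: lambda_system_subset => //; first exact: rects_setI.
- apply/dynkin_lambda_system; split.
 + by split => //; rewrite setTI probability_setT mul1e.
 + move=> A [mA PA]; split; first exact: measurableC.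
  rewrite setIC -setDE.
  rewrite (measureD mB mA); last by rewrite ltey_eq fin_num_measure.
  rewrite [X in (_ - X)%E](_ : _ = (P A * P B)%E); last by rewrite setIC.
  rewrite probability_setC// muleBl ?fin_num_measure//; first by rewrite mul1e.
 + move=> F tF HF; have mF n : measurable (F n) by have [] := HF n.
  split; first exact: bigcup_measurable.
  rewrite setI_bigcupl measure_bigcup//; last 2 first.
  * by move=> n _; exact: measurableI.
  * exact: trivIset_setIr.
  rewrite measure_bigcup//=.
  rewrite muleC -(@fineK _ (P B)) ?fin_num_measure// -nneseriesZl//=.
  by apply: eq_eseriesr => n _; rewrite fineK ?fin_num_measure// muleC; have [_ ->] := HF n.
- move=> A rA; split; first exact: rects_measurable rA.
 case: rA => [K [F [KD GF ->]]].
 have iK : i \notin K by apply/negP => /KD.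
 pose F' j := if j == i then B else F j.
 have GF' j : G j (F' j) by rewrite /F'; case: eqP => [->|_].
 have E1 : \bigcap_(j in [set` (i |` K)%fset]) F' j = \bigcap_(j in [set` K]) F j `&` B.
  apply/seteqP; split => w.
  + move=> h; split; last first.
    by have := h i; rewrite /F' eqxx; apply; rewrite /= !inE eqxx.
   move=> j /= jK; have := h j; rewrite /F' /= !inE jK orbT => /(_ isT).
   by case: eqP => // ji; rewrite ji (negbTE iK) in jK.
  + move=> [h Bw] j /=; rewrite !inE /F' => /orP[->//|jK]; case: eqP => // _.
   exact: h.
 have := @indep (i |` K)%fset F' (fun j _ => GF' j).
 rewrite E1 => ->; rewrite big_fsetU1//= /F' eqxx muleC; congr (_ * _)%E.
 have -> : P (\bigcap_(j in [set` K]) F j) = (\prod_(j <- K) P (F j))%E.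
  by apply: indep => j _; exact: GF.
 rewrite big_seq [RHS]big_seq; apply: eq_bigr => j jK.
 by case: eqP => // ji; rewrite -ji jK in iK.
Qed.
End independence.

(** * The walk seen from its jump times *)

Section ctrw_law.
Context {d : measure_display} {O : measurableType d} {R : realType}.
Variable P : probability O R.
Variables (J : int -> R) (tau : nat -> {RV P >-> R}) (xi : nat -> O -> int).
Hypothesis mxi : forall k (x : int), measurable (xi k @^-1` [set x]).
Hypothesis dtau : forall k (A : set R), measurable A ->
 distribution P (tau k) A = exponential_prob (1 : R) A.
Hypotheses (pxi : forall k (x : int), P (xi k @^-1` [set x]) = (J x)%:E)
 (ind : mutually_independent P (step_events tau xi)).

Notation steps := (step_events tau xi).

Lemma steps_measurable i A : steps i A -> measurable A.
case: i => k /= [B mB <-]; rewrite setTI; last exact: measurable_preimage_countable.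
by rewrite -[X in measurable X]setTI; exact: measurable_funP.
Qed.

Lemma steps_setT i : steps i setT.
by case: i => k /=; exists setT => //; rewrite setTI preimage_setT. Qed.

Lemma steps_setI i A B : steps i A -> steps i B -> steps i (A `&` B).
case: i => k /= [C mC <-] [D mD <-]; exists (C `&` D);
 rewrite ?setTI ?preimage_setI//; exact: measurableI.
Qed.

Notation hist := (hist steps).

Lemma hist_mem (D : set (nat + nat)) A : hist D A -> measurable A.
exact: (hist_measurable steps_measurable). Qed.

Lemma tau_hist D k : D (inl k) ->
 measurable_fun setT (tau k : g_sigma_algebraType (rects steps D) -> R).
move=> Dk _ B mB; rewrite setTI; apply: sub_sigma_algebra.
apply: rects_incl Dk _; [exact: steps_setT|].
by exists B => //; rewrite setTI.
Qed.

Lemma xi_hist D k (B : set int) : D (inr k) -> hist D (xi k @^-1` B).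
move=> Dk; apply: sub_sigma_algebra.
apply: rects_incl Dk _; [exact: steps_setT|].
by exists B => //; rewrite setTI.
Qed.

Definition T_ (n : nat) (w : O) : R := \sum_(i < n) tau i w.

Lemma T_S n w : T_ n.+1 w = T_ n w + tau n w.
by rewrite /T_ big_ord_recr. Qed.

Definition past n : set (nat + nat) :=
 [set i | match i with inl k => (k < n)%N | inr k => (k < n)%N end].

Lemma T_hist D n : (forall k, (k < n)%N -> D (inl k)) ->
 measurable_fun setT (T_ n : g_sigma_algebraType (rects steps D) -> R).
move=> Dn; rewrite /T_.
by apply: measurable_sum => i; apply: tau_hist; exact: Dn.
Qed.

Lemma tau_indep D k A (V : set R) : ~ D (inl k) -> hist D A -> measurable V ->
 P (A `&` tau k @^-1` V) = (P A * exponential_prob (1 : R) V)%E.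
move=> Dk hA mV; rewrite -(dtau k mV).
apply: (hist_indep steps_measurable steps_setT steps_setI ind Dk hA).
by exists V => //; rewrite setTI.
Qed.

Lemma xi_indep D k A x : ~ D (inr k) -> hist D A ->
 P (A `&` xi k @^-1` [set x]) = (P A * (J x)%:E)%E.
move=> Dk hA; rewrite -(pxi k).
apply: (hist_indep steps_measurable steps_setT steps_setI ind Dk hA).
by exists [set x] => //; rewrite setTI.
Qed.

(** A holding time unknown to [D] is integrated out: independence makes the
    joint law a product, and Tonelli applies. *)
Lemma tau_fubini D k (G : g_sigma_algebraType (rects steps D) * R -> \bar R) :
 ~ D (inl k) -> measurable_fun setT G -> (forall x, 0 <= G x)%E ->
 (\int[P]_w G (w, tau k w) =
  \int[P]_w \int[distribution P (tau k)]_u G (w, u))%E.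
move=> Dk mG G0.
pose Os := g_sigma_algebraType (rects steps D).
have mid : measurable_fun setT (idfun : O -> Os).
 by move=> _ B mB; rewrite setTI; exact: (hist_mem mB).
have mp : measurable_fun setT ((fun w => (w, tau k w)) : O -> Os * R).
 apply: (measurable_fun_pair mid); exact: measurable_funP.
pose X1 : {RV P >-> Os} := mfun_Sub (mem_set mid).
pose X : {RV P >-> (Os * R)%type} := mfun_Sub (mem_set mp).
pose e := distribution P (tau k).
have law B : measurable B -> (distribution P X1 \x e)%E B = distribution P X B.
 apply: product_measure_unique => A V mA mV.
 rewrite /= /distribution /pushforward /=.
 by rewrite -[RHS]/(P A * distribution P (tau k) V)%E dtau// -(tau_indep Dk mA mV).
transitivity (\int[distribution P X]_x G x)%E.
 by rewrite ge0_integral_distribution.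
rewrite (eq_measure_integral (distribution P X1 \x e)%E); last first.
 by move=> B mB _; exact/esym/law.
rewrite fubini_tonelli1//= ge0_integral_distribution//=.
- exact: measurable_fun_fubini_tonelli_F.
- by move=> x; apply: integral_ge0.
Qed.

Notation Om D := (g_sigma_algebraType (rects steps D)).
Notation mu := (@lebesgue_measure R).

Lemma tau_density k (g : R -> \bar R) : measurable_fun setT g ->
 (forall x, 0 <= g x)%E ->
 (\int[distribution P (tau k)]_u g u =
  \int[mu]_(u in `[0%R, +oo[) (g u * (expR (- u))%:E))%E.
move=> mg g0.
have e0 (x : R) : 0 <= exponential_pdf 1 x by exact: exponential_pdf_ge0.
have -> : (\int[distribution P (tau k)]_u g u =
      \int[mu]_x (g x * (exponential_pdf 1 x)%:E))%E.
 have mt : measurable_fun setT (tau k : O -> measurableTypeR R).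
  have h : measurable_fun setT (tau k : O -> R) by exact: measurable_funP.
  by move=> mT B mB; exact: (h mT B mB).
 pose X : {RV P >-> measurableTypeR R} :=
  @mfun_Sub _ _ O (measurableTypeR R) (tau k) (mem_set mt).
 rewrite ge0_integral_distribution// -[LHS](@ge0_integral_distribution _ _ _ _ _ P X g)//.
 exact: (@integral_density _ (measurableTypeR R) R mu (distribution P X)
  (exponential_pdf 1) (measurable_exponential_pdf 1) e0 (dtau k) g mg g0).
rewrite [RHS]integral_mkcond; apply: eq_integral => x _.
rewrite /exponential_pdf !patchE.
case: ifPn => _; rewrite ?mule0//.
by rewrite mul1r mulN1r.
Qed.

Definition poi (k : nat) (x : R) : R := expR (- x) * x ^+ k / k`!%:R.

Lemma poi_ge0 k x : 0 <= x -> 0 <= poi k x.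
by move=> x0; rewrite /poi divr_ge0// mulr_ge0 ?expR_ge0// exprn_ge0. Qed.

Lemma poi_int k (a b c : R) : 0 <= a -> a <= b -> b <= c ->
 (\int[mu]_(u in `[a, b]) ((poi k (c - u))%:E * (expR (- u))%:E) =
  (expR (- c) * ((c - a) ^+ k.+1 - (c - b) ^+ k.+1) / k.+1`!%:R)%:E)%E.
move=> a0 ab bc.
pose F (u : R) : R := - (expR (- c) * (c - u) ^+ k.+1 / k.+1`!%:R).
pose f (u : R) : R := expR (- c) * (c - u) ^+ k / k`!%:R.
transitivity (\int[mu]_(u in `[a, b]) (f u)%:E)%E.
 apply: eq_integral => u _; rewrite -EFinM; congr (_%:E).
 rewrite /poi /f opprB expRB expRN.
 have := expR_gt0 u; have := expR_gt0 c => ? ?.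
 by rewrite expRN; field; rewrite !gt_eqF// ltr0n fact_gt0.
have dF (u : R) : is_derive u 1 F (f u).
 pose g (v : R) : R := c - v.
 have dg : is_derive u 1 g (-1 : R).
  by rewrite /g -[X in is_derive _ _ _ X]sub0r; apply: is_deriveB.
 have dX := @is_deriveX _ _ g k u 1 (-1 : R) dg.
 have dZ := is_deriveZ (- (expR (- c) / k.+1`!%:R)) dX.
 have -> : F = - (expR (- c) / (k.+1)`!%:R) \*: g ^+ k.+1.
  by apply/funext => v; rewrite /F /g /= fctE /GRing.scale/=; ring.
 apply: is_derive_eq; rewrite /f /g /GRing.scale/= factS natrM.
 by field; rewrite !gt_eqF// ltr0n fact_gt0.
have cf : continuous f.
 move=> u; apply: cvgM; last exact: cvg_cst.
 apply: cvgM; first exact: cvg_cst.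
 apply: (@continuous_comp _ _ _ (fun u => c - u) (fun x => x ^+ k)).
  by apply: cvgB; [exact: cvg_cst|exact: cvg_id].
 exact: exprn_continuous.
have [->|anb] := eqVneq a b.
 by rewrite set_itv1 integral_set1 subrr mulr0 mul0r.
have altb : a < b by rewrite lt_neqAle anb.
rewrite (@continuous_FTC2 _ f F _ _ altb).
- by rewrite -EFinB /F; congr (_%:E); ring.
- exact: continuous_subspaceT.
- have cF : continuous F.
  by move=> u; apply: differentiable_continuous; apply/derivable1_diffP; have [] := dF u.
 split.
 + by move=> u _; have [] := dF u.
 + by apply: cvg_at_right_filter; exact: cF.
 + by apply: cvg_at_left_filter; exact: cF.
- by move=> u _; rewrite derive1E; have [] := dF u.
Qed.

Lemma ae_eq_measure (N A B : set O) : measurable N -> P N = 1%E ->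
 measurable A -> measurable B -> A `&` N = B `&` N -> P A = P B.
move=> mN PN mA mB AB.
have PNC : P (~` N) = 0%E by rewrite probability_setC// PN subee.
have E X : measurable X -> P X = P (X `&` N).
 move=> mX; rewrite -[X in P X = _](setUIDK X N) measureU//; last 3 first.
 - exact: measurableI.
 - exact: measurableD.
 - by rewrite setDE setIACA setICr setI0.
 rewrite [X in (_ + X)%E](_ : _ = 0%E) ?adde0//.
 apply/eqP; rewrite eq_le measure_ge0 andbT -PNC.
 apply: le_measure; rewrite ?inE; [exact: measurableD|exact: measurableC|].
 by move=> w [].
by rewrite (E A)// (E B)// AB.
Qed.

Fixpoint Jpow (k : nat) (x : int) : \bar R :=
 if k is k'.+1 then \esum_y (Jpow k' (x - y) * (J y)%:E)%E
 else (x == 0)%:R%:E.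

Lemma J_ge0 x : 0 <= J x.
by rewrite -lee_fin -(pxi 0%N x) measure_ge0. Qed.

Lemma Jpow_ge0 k x : (0 <= Jpow k x)%E.
elim: k x => [|k IH] x /=; first by rewrite lee_fin.
by apply: esum_ge0 => y _; rewrite mule_ge0// lee_fin J_ge0.
Qed.

Definition Xi (m k : nat) (w : O) : int := \sum_(i < k) xi (m + i)%N w.

Lemma XiS m k w : Xi m k.+1 w = Xi m k w + xi (m + k)%N w.
by rewrite /Xi big_ord_recr. Qed.

Lemma Xi_hist (D : set (nat + nat)) m k x :
 (forall i, (i < k)%N -> D (inr (m + i)%N)) -> hist D (Xi m k @^-1` [set x]).
elim: k x => [|k IH] x Dk.
 have -> : Xi m 0 = fun=> 0 by apply/funext => w; rewrite /Xi big_ord0.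
 rewrite preimage_cst; case: ifP => _;
  [exact: (@measurableT _ (Om D))|exact: (@measurable0 _ (Om D))].
rewrite (_ : _ @^-1` _ = \bigcup_(y : int) (Xi m k @^-1` [set x - y] `&` xi (m + k)%N @^-1` [set y])).
 apply: (@countable_bigcupT_measurable _ (Om D)) => // y.
 apply: (@measurableI _ (Om D)).
 - by apply: IH => i ik; apply: Dk; rewrite ltnS ltnW.
 - by apply: xi_hist; exact: Dk.
apply/seteqP; split => w /=; rewrite XiS.
- by move=> <-; exists (xi (m + k)%N w) => //; split => //=; rewrite addrK.
- by move=> [y _ [/= hx hy]]; rewrite hx hy subrK.
Qed.

(** All holding times but only the first [m] increments: the position of the
    clock may depend on every holding time. *)
Definition hD (m : nat) : set (nat + nat) :=
 [set i | match i with inl _ => True | inr j => (j < m)%N end].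

Lemma hist_sub (D D' : set (nat + nat)) A : D `<=` D' -> hist D A -> hist D' A.
move=> DD; apply: sub_sigma_algebra2 => B [K [F [KD FG ->]]].
by exists K, F; split => // i /KD/DD.
Qed.

Lemma Xi_indep m k C x : hist (hD m) C ->
 P (C `&` Xi m k @^-1` [set x]) = (P C * Jpow k x)%E.
move=> hC; have mC := hist_mem hC; elim: k x => [|k IH] x.
 rewrite /Xi; under eq_fun do rewrite big_ord0.
 rewrite preimage_cst /=; case: ifPn => h.
 - by rewrite setIT; move: h; rewrite inE /= => <-; rewrite eqxx mule1.
 - by rewrite setI0 measure0; move: h; rewrite notin_setE /= => /eqP; rewrite eq_sym => /negbTE ->; rewrite mule0.
have mXi k' y : measurable (Xi m k' @^-1` [set y]).
 by apply: (@hist_mem setT); apply: Xi_hist.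
rewrite (measure_countable_partition P (V := xi (m + k)%N)); [|exact: mxi|exact: measurableI].
have E y : P (C `&` Xi m k.+1 @^-1` [set x] `&` xi (m + k)%N @^-1` [set y]) =
  (P C * (Jpow k (x - y) * (J y)%:E))%E.
 rewrite muleA -IH -(@xi_indep (hD (m + k)%N) (m + k)%N) /=; [|by rewrite ltnn|]; last first.
  apply: (@measurableI _ (Om (hD (m + k)%N))).
  - apply: hist_sub hC => -[//|j] /= jm; exact: leq_trans jm (leq_addr _ _).
  - by apply: Xi_hist => i ik /=; rewrite ltn_add2l.
 congr (P _); apply/seteqP; split => w /=.
 - by move=> [[Cw]]; rewrite XiS => <- <-; rewrite addrK.
 - by move=> [[Cw hw] hy]; split => //; split => //; rewrite XiS hw hy subrK.
rewrite (eq_esum (fun y _ => E y)).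
rewrite -(@fineK _ (P C)) ?fin_num_measure// esumZl// ?fine_ge0 ?measure_ge0//.
by move=> y; rewrite mule_ge0 ?Jpow_ge0// lee_fin J_ge0.
Qed.

Lemma exp_tail (a : R) : 0 <= a ->
 (\int[mu]_(u in `[0%R, +oo[) ((a < u)%R%:R * expR (- u))%:E = (expR (- a))%:E)%E.
move=> a0.
have mG : measurable_fun setT (fun u : R => (\1_(`]a, +oo[%classic) u)%:E : \bar R).
 by apply/measurable_EFinP; exact: measurable_indic.
have G0 (u : R) : (0 <= (\1_(`]a, +oo[%classic) u)%:E :> \bar R)%E by rewrite lee_fin.
transitivity (\int[distribution P (tau 0%N)]_u (\1_(`]a, +oo[%classic) u)%:E)%E.
 rewrite (tau_density 0%N mG G0); apply: eq_integral => u _.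
 by rewrite indicE EFinM mem_setE in_itv/= andbT.
rewrite integral_indic// setIT.
have -> : `]a, +oo[%classic = ~` `]-oo, a]%classic by rewrite setCitvl.
rewrite -[LHS]/(distribution P (tau 0%N) (~` `]-oo, a]%classic)) probability_setC; last exact: measurable_itv.
rewrite [X in (_ - X)%E](_ : _ = (1 - (expR (- a))%:E)%E); last first.
 rewrite -[LHS]/(distribution P (tau 0%N) `]-oo, a]%classic) (dtau 0%N)//.
 have -> : exponential_prob (1 : R) `]-oo, a]%classic = exponential_prob (1 : R) `[0, a]%classic.
  rewrite /exponential_prob integral_mkcond [RHS]integral_mkcond.
  apply: eq_integral => x _; rewrite !patchE /exponential_pdf !mem_setE !patchE !in_itv/=.
  rewrite mem_setE in_itv/= andbT; case: (leP 0 x) => //= _.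
  by case: ifP.
 have [->|an0] := eqVneq a 0.
  rewrite set_itv1 /exponential_prob integral_set1 oppr0 expR0.
  by rewrite -EFinB subrr.
 by rewrite exponential_prob_itv0c ?mulN1r// lt_neqAle eq_sym an0.
by rewrite -!EFinB; congr (_%:E); ring.
Qed.

Definition N0 : set O := [set w | forall k, 0 < tau k w].

Lemma measurable_tau k : measurable_fun setT (tau k : O -> R).
exact: measurable_funP. Qed.

Lemma tau_gt_hist (D : set (nat + nat)) k (a : R) : D (inl k) ->
 hist D [set w | a < tau k w].
move=> Dk; have := @tau_hist D k Dk measurableT `]a, +oo[%classic (measurable_itv _).
rewrite setTI; congr (hist D _).
by apply/seteqP; split => w /=; rewrite in_itv/= andbT.
Qed.

Lemma N0_hist m : hist (hD m) N0.
rewrite (_ : N0 = \bigcap_k [set w | 0 < tau k w]); last first.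
 by apply/seteqP; split => w h k; [move=> _; exact: h|exact: h].
apply: (@bigcapT_measurable _ (Om (hD m))) => k.
exact: tau_gt_hist.
Qed.

Lemma measurable_N0 : measurable N0.
by apply: (@hist_mem (hD 0%N)); exact: N0_hist. Qed.

Lemma PN0 : P N0 = 1%E.
rewrite (_ : N0 = ~` (\bigcup_k (tau k @^-1` `]-oo, 0]%classic))); last first.
 rewrite setC_bigcup eqEsubset; split => w h k; first by move=> _ /=; rewrite in_itv/= leNgt h.
 by have := h k Logic.I; rewrite /= in_itv/= => /negP; rewrite -ltNge.
have mk k : measurable (tau k @^-1` `]-oo, 0]%classic).
 by rewrite -[X in measurable X]setTI; apply: measurable_tau => //; exact: measurable_itv.
rewrite probability_setC; last exact: bigcup_measurable.
rewrite [X in (_ - X)%E](_ : _ = 0%E) ?sube0//.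
apply: measure_negligible; first exact: bigcup_measurable.
apply: negligible_bigcup => k.
apply/negligibleP => //.
rewrite -[LHS]/(distribution P (tau k) `]-oo, 0]%classic) dtau//.
rewrite /exponential_prob -integral_itv_bndo_bndc//; last first.
 by apply: measurable_funTS; apply/measurable_EFinP; exact: measurable_exponential_pdf.
rewrite integral0_eq// => x /=; rewrite in_itv/= => x0.
by rewrite /exponential_pdf patchE mem_setE in_itv/= leNgt x0.
Qed.

Lemma T_le_hist (D : set (nat + nat)) n (B : set R) :
 (forall j, (j < n)%N -> D (inl j)) -> measurable B -> hist D (T_ n @^-1` B).
move=> Dn mB; have := @T_hist D n Dn measurableT B mB; by rewrite setTI.
Qed.

Lemma fubini_exp (D : set (nat + nat)) k C (U : O -> R) (g : R -> R -> R) :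
 ~ D (inl k) -> hist D C -> measurable_fun setT (U : Om D -> R) ->
 measurable_fun setT (fun z : R * R => g z.1 z.2) -> (forall x y, 0 <= g x y) ->
 (\int[P]_w (\1_C w * g (U w) (tau k w))%:E =
  \int[P]_w ((\1_C w)%:E * \int[mu]_(u in `[0%R, +oo[) (g (U w) u * expR (- u))%:E))%E.
move=> Dk hC mU mg g0.
pose G (z : Om D * R) : \bar R := (\1_(C : set (Om D)) z.1 * g (U z.1) z.2)%:E.
have mUf : measurable_fun setT (fun z : Om D * R => U z.1).
 exact: (measurableT_comp mU measurable_fst).
have mG : measurable_fun setT G.
 apply/measurable_EFinP; apply: measurable_funM.
 - have m1 : measurable_fun setT (\1_(C : set (Om D)) : Om D -> R) by exact: measurable_indic.
  exact: (measurableT_comp m1 measurable_fst).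
 - have m2 : measurable_fun setT (fun z : Om D * R => (U z.1, z.2)).
   by apply: measurable_fun_pair; [exact: mUf|exact: measurable_snd].
  exact: (measurableT_comp mg m2).
have G0 z : (0 <= G z)%E by rewrite lee_fin mulr_ge0.
transitivity (\int[P]_w G (w, tau k w))%E; first by [].
rewrite (tau_fubini Dk mG G0); apply: eq_integral => w _.
have mgw : measurable_fun setT (fun u => (g (U w) u)%:E).
 apply/measurable_EFinP.
 have m2 : measurable_fun setT (fun u : R => (U w, u)) by exact: measurable_fun_pair.
 exact: (measurableT_comp mg m2).
rewrite /G /=; under eq_integral do rewrite EFinM.
have gw0 u : (0 <= (g (U w) u)%:E)%E by rewrite lee_fin.
have cw0 : (0 <= (\1_C w)%:E :> \bar R)%E by rewrite lee_fin.
transitivity ((\1_C w)%:E * \int[distribution P (tau k)]_u (g (U w) u)%:E)%E.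
 exact: ge0_integralZl.
congr (_ * _)%E; rewrite tau_density//.
Qed.

(** * Sojourns between jumps *)

Lemma measurable_poi k : measurable_fun setT (poi k).
apply: measurable_funM => //; apply: measurable_funM; last exact: measurable_funX.
by apply: measurableT_comp => //; exact: measurable_expR.
Qed.

Lemma inner_int k (a c : R) : 0 <= a -> a <= c ->
 (\int[mu]_(u in `[0%R, +oo[)
   ((if (a < u)%R && (u <= c)%R then poi k (c - u) else 0) * expR (- u))%:E =
  (expR (- c) * (c - a) ^+ k.+1 / k.+1`!%:R)%:E)%E.
move=> a0 ac.
transitivity (\int[mu]_(u in `]a, c]) ((poi k (c - u))%:E * (expR (- u))%:E))%E.
 rewrite integral_mkcond [RHS]integral_mkcond; apply: eq_integral => u _.
 rewrite !patchE !mem_setE !in_itv/= andbT.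
 case: ifPn => [u0|u0].
  by case: ifPn => _; rewrite ?mul0r// EFinM.
 by case: ifPn => // /andP[au _]; rewrite (ltW (le_lt_trans a0 au)) in u0.
rewrite integral_itv_obnd_cbnd; last first.
 apply: measurable_funTS; apply: emeasurable_funM; apply/measurable_EFinP.
  by apply: measurableT_comp; [exact: measurable_poi|exact: measurable_funB].
 by apply: measurableT_comp; [exact: measurable_expR|exact: oppr_measurable].
by rewrite poi_int// subrr expr0n subr0.
Qed.

(** The event of being between jumps [n + k] and [n + k + 1] at time [t],
    unfolded one holding time at a time so that these can be integrated out
    successively. *)
Fixpoint EV (n k : nat) (t : R) : set O :=
 if k is k'.+1 then [set w | T_ n w <= t /\ 0 < tau n w] `&` EV n.+1 k' t
 else [set w | T_ n w <= t < T_ n.+1 w].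

Lemma sojournE n t : [set w | T_ n w <= t < T_ n.+1 w] =
 T_ n @^-1` `]-oo, t]%classic `&` T_ n.+1 @^-1` `]t, +oo[%classic.
by apply/seteqP; split => w /=; rewrite !in_itv/= andbT => /andP. Qed.

Lemma T_lt w m n : N0 w -> (m < n)%N -> T_ m w < T_ n w.
move=> Nw; elim: n => // n IH; rewrite ltnS leq_eqVlt T_S => /predU1P[->|/IH h].
 by rewrite ltrDl.
by rewrite (lt_trans h)// ltrDl.
Qed.

Lemma T_le w m n : N0 w -> (m <= n)%N -> T_ m w <= T_ n w.
by move=> Nw; rewrite leq_eqVlt => /predU1P[->//|/(T_lt Nw)/ltW]. Qed.

Lemma EVE n k t w : N0 w -> EV n k t w <-> T_ (n + k)%N w <= t < T_ (n + k).+1 w.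
move=> Nw; elim: k n => [|k IH] n /=; first by rewrite addn0.
rewrite addnS -addSn -IH; split; first by case.
move=> h; split => //; split; last exact: Nw.
have /andP[h1 _] := (IH n.+1).1 h.
by apply: le_trans h1; apply: T_le => //; rewrite addSn leqW// leq_addr.
Qed.

Definition phik k (t x : R) : R := if x <= t then poi k (t - x) else 0.

Lemma phik_ge0 k t x : 0 <= phik k t x.
by rewrite /phik; case: ifP => // xt; rewrite poi_ge0// subr_ge0. Qed.

Lemma measurable_phik k t : measurable_fun setT (phik k t).
apply: measurable_fun_ifT => //; first exact: measurable_fun_ler.
by apply: measurableT_comp; [exact: measurable_poi|exact: measurable_funB].
Qed.

Definition gI k (b : R -> R) (t t' x u : R) : R :=
 if [&& x <= t, b x < x + u & x + u <= t'] then poi k (t' - (x + u)) else 0.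

Lemma gI_ge0 k b t t' x u : 0 <= gI k b t t' x u.
by rewrite /gI; case: ifP => // /and3P[_ _ h]; rewrite poi_ge0// subr_ge0.
Qed.

Lemma measurable_gI k b t t' : measurable_fun setT b ->
 measurable_fun setT (fun z : R * R => gI k b t t' z.1 z.2).
move=> mb.
have ms : measurable_fun setT (fun z : R * R => z.1 + z.2).
 by apply: measurable_funD; [exact: measurable_fst|exact: measurable_snd].
apply: measurable_fun_ifT => //.
 apply: measurable_and.
  by apply: measurable_fun_ler => //; exact: measurable_fst.
 apply: measurable_and; last exact: measurable_fun_ler.
 by apply: measurable_fun_ltr => //; apply: measurableT_comp => //; exact: measurable_fst.
by apply: measurableT_comp; [exact: measurable_poi|exact: measurable_funB].
Qed.

Lemma gI_int k b t t' x : x <= t -> x <= b x -> b x <= t' ->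
 (\int[mu]_(u in `[0%R, +oo[) (gI k b t t' x u * expR (- u))%:E =
  (expR (- (t' - x)) * (t' - b x) ^+ k.+1 / k.+1`!%:R)%:E)%E.
move=> xt xb bt'.
rewrite (_ : t' - b x = (t' - x) - (b x - x)); last by ring.
rewrite -inner_int ?subr_ge0//; last by rewrite lerD2r.
apply: eq_integral => u _; congr (_ * _)%:E.
by rewrite /gI xt /= ltrBlDl lerBrDl; case: ifP => // _; congr poi; ring.
Qed.

Definition gT (t x u : R) : R := ((x <= t) && (t < x + u))%R%:R.

Lemma measurable_gT t : measurable_fun setT (fun z : R * R => gT t z.1 z.2).
have ms : measurable_fun setT (fun z : R * R => z.1 + z.2).
 by apply: measurable_funD; [exact: measurable_fst|exact: measurable_snd].
rewrite (_ : (fun z : R * R => gT t z.1 z.2) =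
 (fun z => if (z.1 <= t) && (t < z.1 + z.2) then 1 else 0)); last first.
 by apply/funext => z; rewrite /gT; case: ifP.
apply: measurable_fun_ifT => //; apply: measurable_and.
 by apply: measurable_fun_ler => //; exact: measurable_fst.
exact: measurable_fun_ltr.
Qed.

Lemma gT_int t x : x <= t ->
 (\int[mu]_(u in `[0%R, +oo[) (gT t x u * expR (- u))%:E = (expR (- (t - x)))%:E)%E.
move=> xt; rewrite -exp_tail ?subr_ge0//; apply: eq_integral => u _.
by rewrite /gT xt /= ltrBlDl.
Qed.

Definition knows (D : set (nat + nat)) n :=
 (forall j, (j < n)%N -> D (inl j)) /\ (forall j, (n <= j)%N -> ~ D (inl j)).

Lemma prob_integral (A : set O) : measurable A -> P A = (\int[P]_w (\1_A w)%:E)%E.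
by move=> mA; rewrite integral_indic// setIT. Qed.

Lemma knowsS D n : knows D n ->
 knows (D `|` [set inl n]) n.+1.
move=> [D1 D2]; split => j.
 by rewrite ltnS leq_eqVlt => /predU1P[->|/D1]; [right|left].
move=> nj [/D2|[] jn]; first by apply; exact: ltnW.
by move: nj; rewrite jn ltnn.
Qed.

Lemma knows_T D n m (B : set R) : knows D n -> (m <= n)%N -> measurable B ->
 hist D (T_ m @^-1` B).
by move=> [D1 _] mn mB; apply: T_le_hist => // j jm; apply: D1; exact: leq_trans mn.
Qed.

Lemma hist_I D A B : hist D A -> hist D B -> hist D (A `&` B).
exact: (@measurableI _ (Om D)). Qed.

Lemma integrate_next D n k (b : R -> R) (t t' : R) C : knows D n -> hist D C -> measurable_fun setT b ->
 (forall x, x <= t -> x <= b x <= t') ->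
 (\int[P]_w (\1_C w * gI k b t t' (T_ n w) (tau n w))%:E = \int[P]_w (\1_C w *
  (if T_ n w <= t then expR (- (t' - T_ n w)) * (t' - b (T_ n w)) ^+ k.+1 / k.+1`!%:R else 0))%:E)%E.
move=> kD hC mb bt.
rewrite (fubini_exp _ hC _ (measurable_gI k t t' mb)) //; last 3 first.
- exact: (kD.2 n (leqnn n)).
- by apply: T_hist => j; exact: kD.1.
- by move=> x y; exact: gI_ge0.
apply: eq_integral => w _; rewrite EFinM; congr (_ * _)%E.
case: ifPn => h; first by have /andP[b1 b2] := bt _ h; rewrite gI_int.
by rewrite integral0_eq// => u _; rewrite /gI (negbTE h) mul0r.
Qed.

(** Integrating the last unknown holding time against its exponential density
    turns the weight [poi k] into [poi k.+1] ([gI_int]). *)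
Lemma prob_EV D n k t C : knows D n -> hist D C ->
 measurable (C `&` EV n k t) /\
 P (C `&` EV n k t) = (\int[P]_w (\1_C w * phik k t (T_ n w))%:E)%E.
elim: k n D C => [|k IH] n D C kD hC.
 have mE : measurable (C `&` EV n 0 t).
  apply: measurableI; first exact: hist_mem hC.
  apply: (@hist_mem setT).
  by rewrite /= sojournE; apply: hist_I; apply: T_le_hist => //; exact: measurable_itv.
 split => //; rewrite prob_integral//.
 transitivity (\int[P]_w (\1_C w * gT t (T_ n w) (tau n w))%:E)%E.
  apply: eq_integral => w _; congr EFin.
  rewrite indicI /gT /= !indicE; congr (_ * _); congr (nat_of_bool _)%:R.
  by apply/idP/idP; rewrite ?inE /= T_S.
 rewrite (fubini_exp _ hC _ (measurable_gT t)) //; last 2 first.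
 - exact: (kD.2 n (leqnn n)).
 - by apply: T_hist => j; exact: kD.1.
 apply: eq_integral => w _; rewrite EFinM; congr (_ * _)%E.
 rewrite /phik; case: ifPn => [h|h].
  by rewrite gT_int// /poi expr0 fact0 mulr1 divr1.
 by rewrite integral0_eq// => u _; rewrite /gT (negbTE h) mul0r.
have hC' : hist (D `|` [set inl n]) (C `&` [set w | T_ n w <= t /\ 0 < tau n w]).
 apply: hist_I; first by apply: hist_sub hC; exact: subsetUl.
 rewrite (_ : [set w | _] = T_ n @^-1` `]-oo, t]%classic `&` [set w | 0 < tau n w]); last first.
  by apply/seteqP; split => w /=; rewrite in_itv.
 apply: hist_I; last by apply: tau_gt_hist; right.
 by apply: (knows_T (knowsS kD)) => //; exact: measurable_itv.
have [mE PE] := IH n.+1 _ _ (knowsS kD) hC'.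
rewrite /= setIA; split => //; rewrite PE.
transitivity (\int[P]_w (\1_C w * gI k id t t (T_ n w) (tau n w))%:E)%E.
 apply: eq_integral => w _; congr EFin.
 rewrite indicI /= -!mulrA; congr (_ * _).
 rewrite /gI /phik T_S ltrDl indicE.
 case: (boolP (w \in _)); rewrite ?inE ?notin_setE /=.
  by move=> [-> ->]; rewrite mul1r.
 move=> h; rewrite mul0r; case: ifPn => // /and3P[h1 h2 _].
 by exfalso; apply: h.
rewrite (integrate_next k kD hC (@measurable_id _ _ setT)); last by move=> x ->; rewrite lexx.
by apply: eq_integral => w _; rewrite /phik /poi.
Qed.

Definition In n t : set O := N0 `&` [set w | T_ n w <= t < T_ n.+1 w].

Lemma In_hist m n t : hist (hD m) (In n t).
apply: hist_I; first exact: N0_hist.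
by rewrite sojournE; apply: hist_I; apply: T_le_hist => //; exact: measurable_itv.
Qed.

Lemma measurable_In n t : measurable (In n t).
by apply: (@hist_mem (hD 0%N)); exact: In_hist. Qed.

Lemma prob_In D n t B : knows D n -> hist D B ->
 P (B `&` In n t) = (\int[P]_w (\1_B w * phik 0 t (T_ n w))%:E)%E.
move=> kD hB; have [mE <-] := prob_EV 0 t kD hB.
apply: (ae_eq_measure measurable_N0 PN0) => //.
 by apply: measurableI (measurable_In _ _); exact: hist_mem hB.
by apply/seteqP; split => w /=; rewrite /In /=; tauto.
Qed.

(** Loss of memory: given what is known up to the [n]-th jump and a current
    time between jumps [n] and [n + 1], the number of jumps in the next time
    span [s] is Poisson and independent of the past. *)
Lemma prob_In2 D n k t s B : knows D n -> hist D B -> 0 <= s ->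
 P (B `&` In n t `&` In (n + k) (t + s)) = ((poi k s)%:E * P (B `&` In n t))%E.
move=> kD hB s0; have mB := hist_mem hB.
have tts : t <= t + s by rewrite lerDl.
have mI := measurable_In.
have C1 : (\int[P]_w (\1_B w * (if T_ n w <= t then
   expR (- (t + s - T_ n w)) * s ^+ k / k`!%:R else 0))%:E =
  (poi k s)%:E * P (B `&` In n t))%E.
 rewrite (prob_In t kD hB) -ge0_integralZl//; last 3 first.
 - apply/measurable_EFinP; apply: measurable_funM; first exact: measurable_indic.
  apply: measurableT_comp; first exact: measurable_phik.
  rewrite /T_; apply: measurable_sum => i; exact: measurable_tau.
 - by move=> w _; rewrite lee_fin mulr_ge0// phik_ge0.
 - by rewrite lee_fin poi_ge0.
 apply: eq_integral => w _; rewrite -EFinM; congr EFin.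
 rewrite mulrCA; congr (_ * _); rewrite /phik; case: ifP => _; last by rewrite mulr0.
 rewrite /poi fact0 expr0 divr1 mulr1.
 have -> : - (t + s - T_ n w) = - s + - (t - T_ n w) by ring.
 by rewrite expRD; ring.
have k1 : knows (D `|` [set inl n]) n.+1 := knowsS kD.
case: k C1 => [|k] C1.
 have hC : hist D (B `&` T_ n @^-1` `]-oo, t]%classic).
  by apply: hist_I => //; apply: (knows_T kD) => //; exact: measurable_itv.
 have [mE PE] := prob_EV 0 (t + s) kD hC.
 rewrite -C1 addn0; transitivity (P (B `&` T_ n @^-1` `]-oo, t] `&` EV n 0 (t + s))).
  apply: (ae_eq_measure measurable_N0 PN0) => //.
   by apply: measurableI => //; exact: measurableI.
  apply/seteqP; split => w /=; rewrite /In /= in_itv/=.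
   by move=> [[[Bw [Nw /andP[h1 h2]]] [_ h3]] _]; do !split.
  move=> [[[Bw h1] /andP[h2 h3]] Nw]; do !split => //; rewrite ?h1 ?h2//=.
  exact: le_lt_trans h3.
 rewrite PE; apply: eq_integral => w _; congr EFin.
 have Ew : (w \in T_ n @^-1` `]-oo, t]%classic) = (T_ n w <= t).
  by apply/idP/idP; rewrite inE /= in_itv.
 rewrite indicI /= -mulrA; congr (_ * _); rewrite indicE Ew /phik.
 case: (boolP (T_ n w <= t)) => h; last by rewrite mul0r.
 by rewrite (le_trans h tts) mul1r /poi.
have hC : hist (D `|` [set inl n])
  (B `&` [set w | T_ n w <= t < T_ n.+1 w]).
 apply: hist_I; first by apply: hist_sub hB; exact: subsetUl.
 by rewrite sojournE; apply: hist_I; apply: (knows_T k1) => //; exact: measurable_itv.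
have [mE PE] := prob_EV k (t + s) k1 hC.
rewrite -C1; transitivity (P (B `&` [set w | T_ n w <= t < T_ n.+1 w] `&` EV n.+1 k (t + s))).
 apply: (ae_eq_measure measurable_N0 PN0) => //.
  by apply: measurableI => //; exact: measurableI.
 apply/seteqP; split => w.
  move=> [[[Bw [Nw h1]] [_ h2]] _]; split => //; split => //; apply/EVE => //.
  by rewrite addSn -addnS.
 move=> [[[Bw h1] /EVE h2] Nw]; do 3 (split => //).
 by rewrite addnS -addSn; exact: h2.
rewrite PE.
transitivity (\int[P]_w (\1_B w * gI k (fun=> t) t (t + s) (T_ n w) (tau n w))%:E)%E.
 apply: eq_integral => w _; congr EFin.
 rewrite indicI /= -!mulrA; congr (_ * _).
 rewrite /gI /phik T_S indicE.
 case: (boolP (w \in _)); rewrite ?inE ?notin_setE /= T_S.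
  by move=> /andP[-> ->]; rewrite mul1r.
 move=> h; rewrite mul0r; case: ifPn => // /and3P[h1 h2 _].
 by exfalso; apply: h; rewrite h1.
rewrite (integrate_next k kD hB (@measurable_cst _ _ _ _ setT t)); last by move=> x ->.
apply: eq_integral => w _; congr (_ * _)%:E; case: ifP => // _.
by rewrite /cst (_ : t + s - t = s)//; ring.
Qed.

(** * The Markov property *)

Lemma poi_sum (s : R) : 0 <= s -> (\sum_(0 <= k <oo) (poi k s)%:E = 1)%E.
move=> s0.
have E : (\sum_(0 <= k < n) (poi k s)%:E)%E @[n --> \oo] --> (1%:E : \bar R).
 have -> : (fun n => (\sum_(0 <= k < n) (poi k s)%:E)%E) =
      (fun n => (expR (- s) * series (exp_coeff s) n)%:E).
  apply/funext => n; rewrite sumEFin; congr EFin.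
  rewrite /series /= mulr_sumr; apply: eq_bigr => i _.
  by rewrite /poi /exp_coeff /=; ring.
 apply/fine_cvgP; split; first by near=> n.
 rewrite /comp /=.
 have -> : (1 : R) = expR (- s) * expR s by rewrite -expRD addNr expR0.
 by apply: cvgM; [exact: cvg_cst|exact: is_cvg_series_exp_coeff].
exact: cvg_lim E.
Unshelve. all: by end_near.
Qed.

Lemma In_triv t : trivIset setT (In ^~ t).
apply/ltn_trivIset => m n mn; rewrite -subset0 => w [[Nw /andP[h1 h2]] [_ /andP[h3 h4]]].
have : T_ n.+1 w <= t by apply: le_trans (T_le Nw mn) h3.
by rewrite leNgt h2.
Qed.

Lemma knows_past n : knows (past n) n.
by split => j //= h; apply/negP; rewrite -leqNgt. Qed.

Lemma In_cover t A : 0 <= t -> measurable A ->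
 P A = (\sum_(0 <= n <oo) P (A `&` In n t))%E.
move=> t0 mA.
have k0 : knows (past 0) 0 := knows_past 0.
have h0 : hist (past 0) setT by exact: (@measurableT _ (Om (past 0))).
have T00 w : T_ 0 w = 0 by rewrite /T_ big_ord0.
have PI n : P (In n t) = (poi n t)%:E.
 have := prob_In2 n 0 k0 h0 t0; rewrite add0r add0n setTI.
 have -> : P (In 0 0) = 1%E.
  rewrite -PN0; apply: (ae_eq_measure measurable_N0 PN0); [exact: measurable_In|exact: measurable_N0|].
  apply/seteqP; split => w; first by move=> [[]].
  by move=> [Nw _]; split => //; split => //=; rewrite T_S !T00 lexx add0r; exact: Nw.
 rewrite mule1 => <-.
 apply: (ae_eq_measure measurable_N0 PN0) => //; [exact: measurable_In| |].
  by apply: measurableI; exact: measurable_In.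
 apply/seteqP; split => w; last by move=> [[_ ?] ?].
 move=> [h Nw]; split => //; split => //; split => //=.
 by rewrite T_S !T00 lexx add0r; exact: Nw.
have PU : P (\bigcup_n In n t) = 1%E.
 rewrite measure_bigcup//; last 2 first.
 - by move=> n _; exact: measurable_In.
 - exact: In_triv.
 rewrite -(poi_sum t0).
 rewrite (eq_eseriesl (Q := xpredT)); last by move=> n; rewrite in_setT.
 by apply: eq_eseriesr => n _; exact: PI.
have -> : P A = P (\bigcup_n (A `&` In n t)).
 apply: (ae_eq_measure _ PU) => //.
 - by apply: bigcup_measurable => n _; exact: measurable_In.
 - by apply: bigcup_measurable => n _; apply: measurableI => //; exact: measurable_In.
 rewrite -setI_bigcupr -setIA setIid//.
rewrite measure_bigcup//; last 2 first.
- by move=> n _; apply: measurableI => //; exact: measurable_In.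
- by apply: trivIset_setIl; exact: In_triv.
by apply: eq_eseriesl => n; rewrite in_setT.
Qed.

Definition pt (s : R) (x : int) : \bar R :=
 (\sum_(0 <= k <oo) (poi k s)%:E * Jpow k x)%E.

Variable W : R -> O -> int.
Hypothesis hW : forall (t : R) (w : O), 0 <= t ->
 W t w = \sum_(k \in [set k | jump_time tau k w <= t]) xi k w.

Lemma W_In n t w : 0 <= t -> In n t w -> W t w = Xi 0 n w.
move=> t0 [Nw /andP[h1 h2]]; rewrite hW//.
have -> : [set k | jump_time tau k w <= t] = `I_n.
 apply/seteqP; split => k /=; rewrite -/(T_ k.+1 w).
 - move=> h; rewrite ltnNge; apply/negP => nk.
  have : T_ n.+1 w <= T_ k.+1 w by apply: T_le.
  by rewrite leNgt (le_lt_trans h h2).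
 - by move=> kn; apply: le_trans h1; exact: T_le.
rewrite -fsbig_ord /Xi; apply: eq_bigr => i _.
by rewrite add0n.
Qed.

Lemma Xi_cat n k w : Xi 0 (n + k) w = Xi 0 n w + Xi n k w.
rewrite /Xi big_split_ord /=; congr (_ + _).
Qed.

(** The events known at time [t], described separately on each event that [n]
    jumps have occurred; this replaces the sigma-algebra of a stopping index.
    *)
Definition past_event (t : R) (A : set O) :=
 measurable A /\ forall n, exists2 B, hist (past n) B & A `&` In n t = B `&` In n t.

Lemma measurable_Xi m k x : measurable (Xi m k @^-1` [set x]).
by apply: (@hist_mem setT); apply: Xi_hist. Qed.

(** Joint measurability in time and chance, needed for the occupation time: [W]
    is a limit of the partial sums of the increments whose jump time has
    passed, eventually constant off an event on which the sum is [0]. *)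
Lemma W_measurable {d' : measure_display} {T' : measurableType d'}
  (f : T' -> R) (g : T' -> O) x :
 measurable_fun setT f -> measurable_fun setT g -> (forall z, 0 <= f z) ->
 measurable [set z | W (f z) (g z) = x].
move=> mf mg f0.
pose a k z : int := if T_ k.+1 (g z) <= f z then xi k (g z) else 0.
pose V n z : int := \sum_(k < n) a k z.
have ma k y : measurable [set z | a k z = y].
 have mT : measurable [set z | T_ k.+1 (g z) <= f z].
  have mTk : measurable_fun setT (fun z => T_ k.+1 (g z)).
   apply: measurableT_comp mg; rewrite /T_.
   by apply: measurable_sum => i; exact: measurable_tau.
  have := measurable_fun_ler mTk mf measurableT (Y := [set true]) Logic.I.
  by rewrite setTI; congr measurable; apply/seteqP; split.
 rewrite (_ : [set z | _] = ([set z | T_ k.+1 (g z) <= f z] `&` g @^-1` (xi k @^-1` [set y]))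
   `|` (~` [set z | T_ k.+1 (g z) <= f z] `&` [set z | y = 0])).
  apply: measurableU.
  - by apply: measurableI => //; rewrite -[X in measurable X]setTI; exact: mg.
  - by apply: measurableI; [exact: measurableC|exact: measurable_prop].
 apply/seteqP; split => z /=; rewrite /a.
 - by case: ifPn => [h ->|/negP h <-]; [left|right].
 - by case: ifPn => [h [[_ ->//]|[]//]|/negP h [[//]|[_ ->]]].
have mV n y : measurable [set z | V n z = y].
 elim: n y => [|n IH] y.
  by rewrite /V; under eq_set do rewrite big_ord0; exact: measurable_prop.
 rewrite (_ : [set z | _] = \bigcup_(u : int) ([set z | V n z = y - u] `&` [set z | a n z = u])).
  by apply: countable_bigcupT_measurable => // u; exact: measurableI.
 have VS z : V n.+1 z = V n z + a n z by rewrite /V big_ord_recr.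
 apply/seteqP; split => z /=; rewrite VS.
 - by move=> <-; exists (a n z) => //; split => //=; rewrite addrK.
 - by move=> [u _ [/= h1 h2]]; rewrite h1 h2 subrK.
have Wa z : W (f z) (g z) = \sum_(k \in [set: nat]) a k z.
 rewrite hW// fsbig_mkcond; apply: eq_fsbigr => k _.
 rewrite /patch /a; case: (boolP (k \in _)); rewrite ?inE ?notin_setE /= => h.
  by rewrite ifT.
 by rewrite ifF//; apply/negP.
pose E n := \bigcap_(k in [set k | (n <= k)%N]) [set z | a k z = 0].
have mE n : measurable (E n) by apply: bigcap_measurable => //; exists n => /=.
rewrite (_ : [set z | _] = \bigcup_n (E n `&` [set z | V n z = x])
  `|` (~` (\bigcup_n E n) `&` [set z | x = 0])).
 apply: measurableU.
  by apply: bigcup_measurable => n _; exact: measurableI.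
 apply: measurableI; last exact: measurable_prop.
 by apply: measurableC; exact: bigcup_measurable.
have WV n z : E n z -> W (f z) (g z) = V n z.
 move=> En; rewrite Wa /V (fsbig_ord _ _ (a ^~ z)).
 apply/esym; apply: fsbig_widen => // k [_ /= /negP]; rewrite -leqNgt => nk.
 exact: En.
have Wn z : ~ (\bigcup_n E n) z -> W (f z) (g z) = 0.
 move=> h; rewrite Wa; apply: fsbig_dflt => /finite_fsetP[F hF]; apply: h.
 exists (\max_(k <- F) k).+1 => // k /= kF; apply/eqP/negP => /negP ak.
 have : (k \in F) by have : [set` F] k by rewrite -hF; split => //; exact/eqP.
 by move=> /(leq_bigmax_seq (F := id)) /= /(_ xpredT isT); rewrite leqNgt kF.
apply/seteqP; split => z /=.
- move=> Wx; have [[n _ En]|h] := pselect ((\bigcup_n E n) z).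
  by left; exists n => //; split => //=; rewrite -WV.
 by right; split => //; rewrite -Wx Wn.
- move=> [[n _ [En <-]]|[h ->]]; first exact: WV.
 exact: Wn.
Qed.

Lemma W_measurable0 t x : 0 <= t -> measurable (W t @^-1` [set x]).
by move=> t0; apply: (W_measurable x (measurable_cst t) (@measurable_id _ _ setT)). Qed.

Lemma pt_ge0 s x : 0 <= s -> (0 <= pt s x)%E.
by move=> s0; apply: nneseries_ge0 => k _ _; rewrite mule_ge0 ?Jpow_ge0// lee_fin poi_ge0.
Qed.

Lemma Jpow_le1 k x : (Jpow k x <= 1)%E.
have h : hist (hD 0) setT by exact: (@measurableT _ (Om (hD 0))).
have := Xi_indep k x h; rewrite setTI probability_setT mul1e => <-.
by apply: probability_le1; exact: measurable_Xi.
Qed.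

Lemma pt_le1 s x : 0 <= s -> (pt s x <= 1)%E.
move=> s0; rewrite -(poi_sum s0); apply: lee_nneseries => k _.
 by rewrite mule_ge0 ?Jpow_ge0// lee_fin poi_ge0.
by rewrite -[leRHS]mule1 lee_wpmul2l ?Jpow_le1// lee_fin poi_ge0.
Qed.

Lemma pt_fin s x : 0 <= s -> pt s x \is a fin_num.
move=> s0; rewrite ge0_fin_numE ?pt_ge0//.
by apply: le_lt_trans (pt_le1 x s0) _; rewrite ltry.
Qed.

(** Decompose over the numbers of jumps before [t] and during the span [s]; the
    former selects an event of the past, the latter is Poisson by [prob_In2],
    and the increments are those of fresh indices. *)
Lemma markov_step t s A x : 0 <= t -> 0 <= s -> past_event t A ->
 P (A `&` [set w | W (t + s) w - W t w = x]) = (P A * pt s x)%E.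
move=> t0 s0 [mA pA].
have ts0 : 0 <= t + s by rewrite addr_ge0.
set E := [set w | _].
have mE : measurable E by apply: measurable_diff => y; exact: W_measurable0.
rewrite (In_cover t0 (measurableI _ _ mA mE)).
transitivity (\sum_(0 <= n <oo) P (A `&` In n t) * pt s x)%E; last first.
 rewrite [in RHS](In_cover t0 mA).
 rewrite muleC -(fineK (pt_fin x s0)) -nneseriesZl; last by move=> *; exact: measure_ge0.
 by apply: eq_eseriesr => n _; rewrite muleC.
apply: eq_eseriesr => n _.
have [B hB AB] := pA n.
have mB := hist_mem hB.
rewrite setIAC.
rewrite (In_cover ts0); last by apply: measurableI => //; apply: measurableI => //; exact: measurable_In.
have small m : (m < n)%N -> P (A `&` In n t `&` E `&` In m (t + s)) = 0%E.
 move=> mn; rewrite (_ : _ `&` _ = set0) ?measure0//.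
 rewrite -subset0 => w [[[_ [Nw /andP[h1 h2]]] _] [_ /andP[h3 h4]]].
 have : T_ m.+1 w <= T_ n w by apply: T_le.
 by apply/negP; rewrite -ltNge; apply: le_lt_trans h4; rewrite (le_trans h1)// lerDl.
have big k : P (A `&` In n t `&` E `&` In (n + k) (t + s)) =
  (P (A `&` In n t) * ((poi k s)%:E * Jpow k x))%E.
 transitivity (P (B `&` In n t `&` In (n + k) (t + s) `&` Xi n k @^-1` [set x])).
  congr (P _); rewrite AB eqEsubset; split => w.
  - move=> [[[Bw h1] h2] h3]; split => //.
   move: h2; rewrite /E /= (W_In t0 h1) (W_In ts0 h3) Xi_cat.
   by rewrite addrAC subrr add0r.
  - move=> [[[Bw h1] h3] h2]; split; last by [].
   split; first by [].
   rewrite /E /= (W_In t0 h1) (W_In ts0 h3) Xi_cat.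
   by rewrite addrAC subrr add0r.
 rewrite (Xi_indep (m := n)); last first.
  apply: hist_I; last exact: In_hist.
  apply: hist_I; last exact: In_hist.
  by apply: hist_sub hB => -[].
 by rewrite (prob_In2 k t (knows_past n) hB s0) -AB; rewrite muleAC muleA muleC muleA.
rewrite (nneseries_split 0 n)//= add0n big1_seq ?add0e; last first.
 by move=> m /=; rewrite mem_index_iota => /andP[_ mn]; exact: small.
rewrite -nneseries_addn; last by move=> i; exact: measure_ge0.
rewrite /pt -(fineK (fin_num_measure P _ (measurableI _ _ mA (measurable_In n t)))).
rewrite -nneseriesZl; last first.
 by move=> k _; rewrite mule_ge0 ?Jpow_ge0// lee_fin poi_ge0.
apply: eq_eseriesr => k _.
by rewrite addnC big fineK// fin_num_measure//; apply: measurableI => //; exact: measurable_In.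
Qed.

(** Given [n] jumps before [t], the number of jumps before [u <= t] is read off
    the first [n] jump times. *)
Lemma past_event_mono t u A : 0 <= u -> u <= t -> past_event u A -> past_event t A.
move=> u0 ut [mA pA]; split => // n.
have h m : exists B, hist (past m) B /\ A `&` In m u = B `&` In m u.
 by have [B ? ?] := pA m; exists B.
have [B hB] := choice h.
pose C m := if (m < n)%N then T_ m @^-1` `]-oo, u]%classic `&` T_ m.+1 @^-1` `]u, +oo[%classic
  else T_ m @^-1` `]-oo, u]%classic.
exists (\bigcup_(m in [set m | (m <= n)%N]) (C m `&` B m)).
 apply: (@bigcup_measurable _ (Om (past n))) => m /= mn.
 apply: hist_I; last first.
  by apply: hist_sub (hB m).1 => -[j|j] /= jm; exact: leq_trans mn.
 rewrite /C; case: ifPn => mn'.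
  by apply: hist_I; apply: (knows_T (knows_past n)) => //; exact: measurable_itv.
 by apply: (knows_T (knows_past n)) => //; exact: measurable_itv.
have key w m : In n t w -> (m <= n)%N -> C m w -> In m u w.
 move=> [Nw /andP[h1 h2]] mn; rewrite /C; case: ifPn => mn' /=; rewrite !in_itv/= ?andbT.
  by move=> [h3 h4]; split => //=; rewrite h3.
 move=> h3; have mnE : m = n by apply/eqP; rewrite eqn_leq mn leqNgt.
 split => //=; rewrite h3 /= mnE; exact: le_lt_trans h2.
apply/seteqP; split => w.
- move=> [/= Aw hn]; split => //.
 have [m mn Cm] : exists2 m, (m <= n)%N & C m w.
  have [Nw /andP[h1 h2]] := hn.
  have ex : exists m, (u < T_ m.+1 w) by exists n; exact: le_lt_trans ut h2.
  have [m hm mmin] := ex_minnP ex.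
  have mn : (m <= n)%N by apply: mmin; exact: le_lt_trans ut h2.
  have Tm : T_ m w <= u.
   case: m hm mmin mn => [|m] hm mmin mn; first by rewrite /T_ big_ord0.
   by rewrite leNgt; apply/negP => /mmin; rewrite ltnn.
  exists m => //; rewrite /C; case: ifPn => _ /=; rewrite !in_itv/= ?andbT//.
 exists m => //; split => //=.
 have : (A `&` In m u) w by split => //; exact: key mn Cm.
 by rewrite (hB m).2 => -[].
- move=> [[m /= mn [Cm Bm]] hn]; split => //=.
 have : (B m `&` In m u) w by split => //; exact: key mn Cm.
 by rewrite -(hB m).2 => -[].
Qed.

Lemma past_event_W t u x : 0 <= u -> u <= t -> past_event t (W u @^-1` [set x]).
move=> u0 ut; apply: (past_event_mono u0 ut); split; first exact: W_measurable0.
move=> n; exists (Xi 0 n @^-1` [set x]); first by apply: Xi_hist.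
apply/seteqP; split => w /= [h1 h2]; split => //; move: h1; rewrite /= (W_In u0 h2)//.
Qed.

Lemma past_eventI t A B : past_event t A -> past_event t B -> past_event t (A `&` B).
move=> [mA hA] [mB hB]; split; first exact: measurableI.
move=> n; have [A' ? EA] := hA n; have [B' ? EB] := hB n.
exists (A' `&` B'); first exact: hist_I.
apply/seteqP; split => w [[Aw Bw] Iw].
- have [A'w _] : (A' `&` In n t) w by rewrite -EA.
 by have [B'w _] : (B' `&` In n t) w by rewrite -EB.
- have [A'w _] : (A `&` In n t) w by rewrite EA.
 by have [B'w _] : (B `&` In n t) w by rewrite EB.
Qed.

Lemma past_event_bigcup t (A : nat -> set O) :
 (forall k, past_event t (A k)) -> past_event t (\bigcup_k A k).
move=> pA; split; first by apply: bigcup_measurable => k _; have [] := pA k.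
move=> n; have h k : exists B, hist (past n) B /\ A k `&` In n t = B `&` In n t.
 by have [_ /(_ n)[B ? ?]] := pA k; exists B.
have [B hB] := choice h.
exists (\bigcup_k B k).
 by apply: (@bigcup_measurable _ (Om (past n))) => k _; have [] := hB k.
by rewrite !setI_bigcupl; apply: eq_bigcupr => k _; have [] := hB k.
Qed.

Lemma past_eventT t : past_event t setT.
by split => // n; exists setT => //; exact: (@measurableT _ (Om (past n))).
Qed.
Lemma quiet_prob t s : 0 <= t -> 0 <= s ->
 P (\bigcup_n (In n t `&` In n (t + s))) = (expR (- s))%:E.
move=> t0 s0.
have h0 n : hist (past n) setT by exact: (@measurableT _ (Om (past n))).
rewrite measure_bigcup//; last 2 first.
- by move=> n _; apply: measurableI; exact: measurable_In.
- by apply: trivIset_setIr; exact: In_triv.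
rewrite (eq_eseriesl (Q := xpredT)); last by move=> n; rewrite in_setT.
rewrite (eq_eseriesr (g := fun n => ((expR (- s))%:E * P (setT `&` In n t))%E)); last first.
 move=> n _; have E := prob_In2 0 t (knows_past n) (h0 n) s0.
 by rewrite addn0 !setTI in E; rewrite setTI; apply: (etrans E); rewrite /poi expr0 fact0 mulr1 divr1.
rewrite nneseriesZl ?expR_ge0//.
by rewrite -In_cover// probability_setT mule1.
Qed.

Lemma quiet_const t s u w : 0 <= t -> t <= u -> u <= t + s ->
 (\bigcup_n (In n t `&` In n (t + s))) w -> W u w = W t w.
move=> t0 tu us [n _ [hn hs]].
have hu : In n u w.
 case: hn hs => Nw /andP[h1 h2] [_ /andP[h3 h4]]; split => //=.
 by rewrite (le_trans h1 tu) (le_lt_trans us h4).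
by rewrite (W_In t0 hn) (W_In (le_trans t0 tu) hu).
Qed.

End ctrw_law.

Section grid.
Context {d : measure_display} {O : measurableType d} {R : realType}.
Variable P : probability O R.

(** The Markov property freed from the holding times: [pe t] stands for the
    events known at time [t]. *)
Lemma ctrw_markov (J : int -> R) (W : R -> O -> int) : ctrw P J W ->
 exists pe : R -> set (set O),
 [/\ (forall t A, pe t A -> measurable A) /\
    (forall (d' : measure_display) (T' : measurableType d') (f : T' -> R)
     (g : T' -> O) (x : int),
     measurable_fun setT f -> measurable_fun setT g -> (forall z, 0 <= f z) ->
     measurable [set z | W (f z) (g z) = x]),
   (forall t A B, pe t A -> pe t B -> pe t (A `&` B)) /\
   (forall t u A, 0 <= u -> u <= t -> pe u A -> pe t A),
   forall t (A : nat -> set O), (forall k, pe t (A k)) -> pe t (\bigcup_k A k),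
   (forall t, pe t setT) /\
   (forall t u x, 0 <= u -> u <= t -> pe t (W u @^-1` [set x]))
  & forall t s A x, 0 <= t -> 0 <= s -> pe t A ->
    P (A `&` [set w | W (t + s) w - W t w = x]) = (P A * pt J s x)%E].
move=> [tau [xi [mxi dtau pxi ind hW]]].
exists (past_event tau xi); split.
- split; first by move=> t A [].
 by move=> d' T' f g x mf mg f0; exact: (W_measurable mxi hW).
- by split; [exact: past_eventI|exact: past_event_mono].
- exact: past_event_bigcup.
- by split; [exact: past_eventT|move=> t u x u0 ut; exact: (past_event_W mxi hW)].
- by move=> t s A x t0 s0 pA; exact: (markov_step mxi dtau pxi ind hW).
Qed.

(** A span of length [s] contains no jump with probability [expR (- s)]. *)
Lemma ctrw_quiet (J : int -> R) (W : R -> O -> int) (t s : R) :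
 ctrw P J W -> 0 <= t -> 0 <= s ->
 exists Q : set O, [/\ measurable Q, ((1 - s)%:E <= P Q)%E
  & forall w (u : R), Q w -> t <= u <= t + s -> W u w = W t w].
move=> [tau [xi [mxi dtau pxi ind hW]]] t0 s0.
exists (\bigcup_n (In tau n t `&` In tau n (t + s))); split.
- by apply: bigcup_measurable => n _; apply: measurableI; exact: measurable_In.
- by rewrite (quiet_prob mxi dtau ind t0 s0) lee_fin expR_ge1Dx.
- by move=> w u Qw /andP[tu us]; exact: (quiet_const hW t0 tu us Qw).
Qed.
End grid.

(** * Increments of the walk along a grid *)

Section increments.
Context {R : realType}.
Implicit Types (e : nat -> int) (F G : (nat -> int) -> R).

Definition cyl n F := forall e e', (forall l, (l < n)%N -> e l = e' l) -> F e = F e'.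
Definition bdd F := exists M : R, forall e, `|F e| <= M.
Definition shift j e : nat -> int := fun l => e (j + l)%N.
Definition incr i j e : int := \sum_(i <= l < j) e l.

Definition Et (J : int -> R) (s : R) (g : int -> R) : R :=
 fine (\esum_y ((g y)%:E * pt J s y))%E.

(** The expectation of functionals of finitely many independent increments of a
    walk observed every [delta]. All the later arguments about the environment
    go through this interface. *)
Record walk_law (J : int -> R) (delta : R) (E : ((nat -> int) -> R) -> R) : Prop := {
 E_cst : forall c, E (fun=> c) = c;
 E_lin : forall n F G a, cyl n F -> bdd F -> cyl n G -> bdd G ->
  E (fun e => a * F e + G e) = a * E F + E G;
 E_mono : forall n F G, cyl n F -> bdd F -> cyl n G -> bdd G ->
  (forall e, F e <= G e) -> E F <= E G;
 E_mul : forall j n F G, cyl j F -> bdd F -> cyl n G -> bdd G ->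
  E (fun e => F e * G (shift j e)) = E F * E G;
 E_inc : forall n (g : int -> R), (exists M, forall y, 0 <= g y <= M) ->
  E (fun e => g (incr 0 n e)) = Et J (delta * n%:R) g }.
End increments.

Section grid_walk.
Context {d : measure_display} {O : measurableType d} {R : realType}.
Variable P : probability O R.
Variables (J : int -> R) (W : R -> O -> int) (delta : R).
Hypotheses (hW : ctrw P J W) (delta0 : 0 <= delta).

Definition eps (w : O) (l : nat) : int := W (delta * l.+1%:R) w - W (delta * l%:R) w.

Definition Ex (F : (nat -> int) -> R) : R := \int[P]_w F (eps w).

Definition blk i n (w : O) : seq int := mkseq (fun l => eps w (i + l)%N) n.

Definition weight (s : seq int) : \bar R := (\prod_(x <- s) pt J delta x)%E.

Let tm n : 0 <= delta * n%:R. by rewrite mulr_ge0. Qed.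

(** Induction on the block length, one application of the Markov property per
    step. *)
Lemma blk_law : exists pe : nat -> set (set O),
 [/\ forall n A, pe n A -> measurable A,
   pe 0%N setT,
   forall n A B, pe n A -> pe n B -> pe n (A `&` B),
   forall i n s, pe (i + n)%N (blk i n @^-1` [set s])
  & forall i n s A, pe i A -> P (A `&` blk i n @^-1` [set s]) =
    (P A * if size s == n then weight s else 0)%E].
have [pe [[pem _] [peI peM] peU [peT peW] mk]] := ctrw_markov hW.
have tmD i : delta * i.+1%:R = delta * i%:R + delta.
 by rewrite -addn1 natrD mulrDr mulr1.
have pe_eps i n x : (n < i)%N -> pe (delta * i%:R) [set w | eps w n = x].
 move=> ni; rewrite (_ : [set w | _] = \bigcup_k
   (if pickle_inv k is Some y then W (delta * n%:R) @^-1` [set y : int] `&`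
    W (delta * n.+1%:R) @^-1` [set x + y] else W (delta * n%:R) @^-1` [set 0] `&` W (delta * n.+1%:R) @^-1` [set x])).
  apply: peU => k; case: pickle_inv => [y|]; apply: peI; apply: peW => //;
   by rewrite ler_wpM2l// ler_nat// ltnW.
 apply/seteqP; split => w /=; rewrite /eps.
 - move=> <-; exists (choice.pickle (W (delta * n%:R) w)); first by [].
  by rewrite pickleK_inv; split => //=; rewrite subrK.
 - move=> [k _]; case: pickle_inv => [y|] [/= h1 h2]; rewrite h1 h2 ?subr0//.
  by rewrite addrK.
have blkS i n w : blk i n.+1 w = rcons (blk i n w) (eps w (i + n)) by rewrite /blk mkseqS.
have pe_0 j : pe (delta * j%:R) set0.
 rewrite (_ : set0 = W (delta * j%:R) @^-1` [set 0] `&` W (delta * j%:R) @^-1` [set 1]).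
  by apply: peI; exact: peW.
 by apply/esym; rewrite -subset0 => w [/= ->].
have pe_blk i n s j : (i + n <= j)%N -> pe (delta * j%:R) (blk i n @^-1` [set s]).
 elim: n s => [|n IH] s ij.
  have [->|s0] := eqVneq s [::].
   rewrite (_ : _ @^-1` _ = setT); first exact: peT.
   by apply/seteqP; split.
  rewrite (_ : _ @^-1` _ = set0); first exact: pe_0.
  by rewrite -subset0 => w /= /eqP; rewrite eq_sym (negbTE s0).
 case/lastP: s => [|s x].
  rewrite (_ : _ @^-1` _ = set0); first exact: pe_0.
  by rewrite -subset0 => w /=; rewrite blkS => /(congr1 size); rewrite size_rcons.
 rewrite (_ : _ @^-1` _ = blk i n @^-1` [set s] `&` [set w | eps w (i + n) = x]).
  apply: peI; first by apply: IH; rewrite (leq_trans _ ij)// addnS.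
  by apply: pe_eps; rewrite (leq_trans _ ij)// addnS.
 apply/seteqP; split => w /=; rewrite blkS.
 - by move=> /rcons_inj[].
 - by move=> [-> ->].
exists (fun n => pe (delta * n%:R)); split.
- by move=> n A; exact: pem.
- exact: peT.
- by move=> n A B; exact: peI.
- by move=> i n s; exact: pe_blk.
move=> i n s A pA; elim: n s => [|n IH] s.
 have [->|s0] := eqVneq s [::].
  rewrite (_ : _ @^-1` _ = setT); last by apply/seteqP; split.
  by rewrite setIT /weight big_nil mule1.
 rewrite (_ : _ @^-1` _ = set0).
  by rewrite setI0 measure0 size_eq0 (negbTE s0) mule0.
 by rewrite -subset0 => w /= /eqP; rewrite eq_sym (negbTE s0).
case/lastP: s => [|s x].
 rewrite (_ : _ @^-1` _ = set0) ?setI0 ?measure0 ?mule0//.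
 by rewrite -subset0 => w /=; rewrite blkS => /(congr1 size); rewrite size_rcons.
rewrite size_rcons eqSS.
have -> : A `&` blk i n.+1 @^-1` [set rcons s x] =
  (A `&` blk i n @^-1` [set s]) `&`
  [set w | W (delta * (i + n)%:R + delta) w - W (delta * (i + n)%:R) w = x].
 rewrite -tmD eqEsubset; split => w /=; rewrite blkS.
 - by move=> [Aw /rcons_inj[]].
 - by move=> [[Aw ->] <-].
rewrite mk//; last first.
 apply: peI; last exact: pe_blk.
 by apply: peM pA => //; rewrite ler_wpM2l// ler_nat leq_addr.
rewrite IH -muleA; congr (_ * _)%E.
case: ifP => _; last by rewrite mul0e.
by rewrite /weight -cats1 big_cat big_seq1.
Qed.

Lemma pt_ge0' x : (0 <= pt J delta x)%E.
have [tau [xi [mxi dtau pxi ind hW']]] := hW.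
exact: (pt_ge0 pxi).
Qed.

Lemma weight_ge0 s : (0 <= weight s)%E.
by apply: prode_ge0 => x _; exact: pt_ge0'. Qed.

Lemma measurable_blk i n s : measurable (blk i n @^-1` [set s]).
by have [pe [pem _ _ peb _]] := blk_law; apply: pem (peb i n s). Qed.

Definition of_seq (s : seq int) : nat -> int := nth 0 s.

Implicit Types F G : (nat -> int) -> R.

Lemma cyl_blk n F (e : nat -> int) : cyl n F -> F (of_seq (mkseq e n)) = F e.
by move=> cF; apply: cF => l ln; rewrite /of_seq nth_mkseq. Qed.

Lemma measurable_cyl n F : cyl n F -> measurable_fun setT (fun w => F (eps w)).
move=> cF; have -> : (fun w => F (eps w)) = (fun w => F (of_seq (blk 0 n w))).
 by apply/funext => w; rewrite -(cyl_blk (eps w) cF).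
apply: (@measurable_countable _ O _ R _ (blk 0 n) (fun s => F (of_seq s))).
by move=> c; exact: measurable_blk.
Qed.

Lemma integrable_cyl n F : cyl n F -> bdd F ->
 P.-integrable setT (EFin \o (fun w => F (eps w))).
move=> cF [M FM]; apply: measurable_bounded_integrable => //.
- by rewrite [X in (X < _)%E]probability_setT ltry.
- exact: measurable_cyl cF.
- by exists M; split; [exact: num_real|move=> x Mx w _; exact: le_trans (FM _) (ltW Mx)].
Qed.

Lemma Ex_mul_ge0 j n F G : cyl j F -> cyl n G -> bdd G -> (forall e, 0 <= F e) ->
 (forall e, 0 <= G e) ->
 (\int[P]_w (F (eps w) * G (shift j (eps w)))%:E =
  \int[P]_w (F (eps w))%:E * \int[P]_w (G (eps w))%:E)%E.
move=> cF cG bG F0 G0.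
have [pe [pem peT peI peb pew]] := blk_law.
have pT i s : pe i (blk 0 i @^-1` [set s]) by have := peb 0%N i s; rewrite add0n.
have intG : (\int[P]_w (G (eps w))%:E =
  \esum_(s in [set: seq int]) ((G (of_seq s))%:E * (if size s == n then weight s else 0)))%E.
 transitivity (\int[P]_w (G (of_seq (blk 0 n w)))%:E)%E.
  by apply: eq_integral => w _; rewrite -(cyl_blk (eps w) cG).
 rewrite (@integral_countable _ _ _ P _ (blk 0 n) (fun s => G (of_seq s)) setT)//;
  last by move=> c; exact: measurable_blk.
 by apply: eq_esum => s _; rewrite pew// probability_setT mul1e.
have intA A : pe j A -> (\int[P]_(w in A) (G (shift j (eps w)))%:E =
  P A * \int[P]_w (G (eps w))%:E)%E.
 move=> pA; have mA := pem _ _ pA.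
 transitivity (\int[P]_(w in A) (G (of_seq (blk j n w)))%:E)%E.
  by apply: eq_integral => w _; rewrite -(cyl_blk (shift j (eps w)) cG).
 rewrite (@integral_countable _ _ _ P _ (blk j n) (fun s => G (of_seq s)) A)//;
  last by move=> c; exact: measurable_blk.
 rewrite intG -(@fineK _ (P A)) ?fin_num_measure// -esumZl ?fine_ge0 ?measure_ge0//; last first.
  by move=> s; rewrite mule_ge0 ?lee_fin//; case: ifP => // _; exact: weight_ge0.
 apply: eq_esum => s _; rewrite fineK ?fin_num_measure// pew//.
 by rewrite muleCA.
have FGE w : F (eps w) * G (shift j (eps w)) = F (of_seq (blk 0 j w)) * G (shift j (eps w)).
 by rewrite -(cyl_blk (eps w) cF).
have mG : measurable_fun setT (fun w => G (shift j (eps w))).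
 have -> : (fun w => G (shift j (eps w))) = (fun w => G (of_seq (blk j n w))).
  by apply/funext => w; rewrite -(cyl_blk (shift j (eps w)) cG).
 apply: (@measurable_countable _ O _ R _ (blk j n) (fun s => G (of_seq s))).
 by move=> c; exact: measurable_blk.
under eq_integral do rewrite FGE.
rewrite (@integral_countable_mul _ _ _ P _ (blk 0 j) (fun s => F (of_seq s))
 (fun w => G (shift j (eps w))))//; last by move=> c; exact: measurable_blk.
have -> : (\int[P]_w (F (eps w))%:E = \int[P]_w (F (of_seq (blk 0 j w)))%:E)%E.
 by apply: eq_integral => w _; rewrite -(cyl_blk (eps w) cF).
rewrite (@integral_countable _ _ _ P _ (blk 0 j) (fun s => F (of_seq s)) setT)//;
 last by move=> c; exact: measurable_blk.

set IG := (\int[P]_w (G (eps w))%:E)%E.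
have IGfin : IG \is a fin_num.
 exact: (integrable_fin_num measurableT (integrable_cyl cG bG)).
have IG0 : (0 <= IG)%E by apply: integral_ge0 => w _; rewrite lee_fin.
rewrite -(fineK IGfin) muleC -esumZl ?fine_ge0//; last first.
 by move=> s; rewrite mule_ge0 ?lee_fin.
apply: eq_esum => s _; rewrite fineK// !setTI intA//.
by rewrite -/IG muleA muleC.
Qed.

Lemma Ex_fin n F : cyl n F -> bdd F -> (\int[P]_w (F (eps w))%:E = (Ex F)%:E)%E.
move=> cF bF; rewrite /Ex /Rintegral fineK//.
exact: (integrable_fin_num measurableT (integrable_cyl cF bF)).
Qed.

Lemma Ex_cst c : Ex (fun=> c) = c.
by rewrite /Ex Rintegral_cst//= probability_setT mulr1. Qed.

Lemma Ex_lin n F G a : cyl n F -> bdd F -> cyl n G -> bdd G ->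
 Ex (fun e => a * F e + G e) = a * Ex F + Ex G.
move=> cF bF cG bG; have iF := integrable_cyl cF bF; have iG := integrable_cyl cG bG.
rewrite /Ex RintegralD//; first by rewrite RintegralZl.
by apply: eq_integrable (integrableZl measurableT a iF).
Qed.

Lemma Ex_mono n F G : cyl n F -> bdd F -> cyl n G -> bdd G ->
 (forall e, F e <= G e) -> Ex F <= Ex G.
move=> cF bF cG bG FG; rewrite -lee_fin -!(Ex_fin (n := n))//.
by apply: le_integral => //; [exact: (integrable_cyl cF bF)|exact: (integrable_cyl cG bG)|move=> w _; rewrite lee_fin].
Qed.

Lemma cyl_shift j n F G : cyl j F -> cyl n G -> cyl (j + n) (fun e => F e * G (shift j e)).
move=> cF cG e e' ee'; rewrite (cF e e') ?(cG (shift j e) (shift j e'))//.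
- by move=> l ln; rewrite /shift ee'// ltn_add2l.
- by move=> l lj; apply: ee'; rewrite ltn_addr.
Qed.

Lemma bdd_mul j F G : bdd F -> bdd G -> bdd (fun e => F e * G (shift j e)).
move=> [M FM] [K GK]; exists (M * K) => e; rewrite normrM ler_pM//.
Qed.

Lemma cyl_addn n (k : nat) F : cyl n F -> cyl (n + k) F.
by move=> cF e e' ee'; apply: cF => l ln; apply: ee'; rewrite ltn_addr. Qed.

Lemma Ex_mul j n F G : cyl j F -> bdd F -> cyl n G -> bdd G ->
 Ex (fun e => F e * G (shift j e)) = Ex F * Ex G.
move=> cF bF cG bG; have [M FM] := bF; have [K GK] := bG.
have shiftb m (H : (nat -> int) -> R) (c : R) : cyl m H -> bdd H ->
  [/\ cyl m (fun e => H e + c), bdd (fun e => H e + c) & Ex (fun e => H e + c) = Ex H + c].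
 move=> cH bH; split; first by move=> e e' ee'; rewrite (cH e e').
  by have [L HL] := bH; exists (L + `|c|) => e; apply: le_trans (ler_normD _ _) _; rewrite lerD.
 have cc : cyl m (fun=> c) by []. have bc : bdd (fun=> c) by exists `|c|.
 by have := Ex_lin 1 cH bH cc bc; under [X in Ex X]funext do rewrite mul1r; rewrite mul1r Ex_cst.
have lb (H : (nat -> int) -> R) L : (forall e, `|H e| <= L) -> forall e, 0 <= H e + L.
 by move=> HL e; rewrite -lerBlDr sub0r; have := HL e; rewrite ler_norml => /andP[].
have posF F' : cyl j F' -> bdd F' -> (forall e, 0 <= F' e) ->
  Ex (fun e => F' e * G (shift j e)) = Ex F' * Ex G.
 move=> cF' bF' F0; have [cK bK EK] := shiftb n G K cG bG.
 have pos : Ex (fun e => F' e * (G (shift j e) + K)) = Ex F' * (Ex G + K).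
  apply/EFin_inj; rewrite EFinM -EK -(Ex_fin cF' bF') -(Ex_fin cK bK).
  rewrite -(Ex_fin (cyl_shift cF' cK) (bdd_mul j bF' bK)).
  by apply: (Ex_mul_ge0 cF' cK bK F0); exact: lb.
 have := Ex_lin K (cyl_addn (k := n) cF') bF' (cyl_shift cF' cG) (bdd_mul j bF' bG).
 rewrite (_ : (fun e => _ + _) = fun e => F' e * (G (shift j e) + K)); last by apply/funext => e; ring.
 by rewrite pos => E; apply: (@addrI _ (K * Ex F')); rewrite -E; ring.
have c1 : cyl j (fun=> 1 : R) by [].
have b1 : bdd (fun=> 1 : R) by exists `|1|.
have E1 := posF _ c1 b1 (fun=> ler01).
have [cM bM EM] := shiftb j F M cF bF.
have := Ex_lin M (cyl_shift c1 cG) (bdd_mul j b1 bG) (cyl_shift cF cG) (bdd_mul j bF bG).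
rewrite (_ : (fun e => _ + _) = fun e => (F e + M) * G (shift j e)); last by apply/funext => e; ring.
rewrite (posF _ cM bM (lb _ _ FM)) EM E1 Ex_cst mul1r => E.
by apply: (@addrI _ (M * Ex G)); rewrite -E; ring.
Qed.

Lemma Ex_inc n (g : int -> R) : (exists M, forall y, 0 <= g y <= M) ->
 Ex (fun e => g (incr 0 n e)) = Et J (delta * n%:R) g.
move=> [M gM].
have incrE w : incr 0 n (eps w) = W (delta * n%:R) w - W 0 w.
 rewrite /incr /eps; elim: n => [|m IH]; first by rewrite big_nil mulr0 subrr.
 by rewrite big_nat_recr//= IH; ring.
have [pe [[pem _] [peI peM] peU [peT peW] mk]] := ctrw_markov hW.
have cg : cyl n (fun e => g (incr 0 n e)).
 by move=> e e' ee'; congr g; rewrite /incr !big_mkord; apply: eq_bigr => i _; exact: ee'.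
have bg : bdd (fun e => g (incr 0 n e)).
 by exists M => e; have /andP[h0 h1] := gM (incr 0 n e); rewrite ger0_norm.
rewrite /Et; apply/EFin_inj; rewrite -(Ex_fin cg bg).
pose V w := W (delta * n%:R) w - W 0 w.
have mV c : measurable (V @^-1` [set c]).
 by apply: measurable_diff => y; apply: (pem (delta * n%:R)); apply: peW.
have E : (\int[P]_w (g (incr 0 n (eps w)))%:E =
  \esum_y ((g y)%:E * pt J (delta * n%:R) y))%E.
 under eq_integral do rewrite incrE.
 rewrite (@integral_countable _ _ _ P _ V g setT)//; last by move=> c; have /andP[] := gM c.
 apply: eq_esum => y _; congr (_ * _)%E.
 have := mk 0 (delta * n%:R) setT y (lexx _) (tm n) (peT 0).
 by rewrite probability_setT mul1e add0r.
rewrite E fineK// -E (Ex_fin cg bg)//.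
Qed.

Lemma grid_walk_law : walk_law J delta Ex.
split; [exact: Ex_cst|exact: Ex_lin|exact: Ex_mono|exact: Ex_mul|exact: Ex_inc].
Qed.
End grid_walk.

(** * Transition probabilities *)

Section esum_calculus.
Context {R : realType}.

Lemma esum_exchange (S T : choiceType) (a : S -> T -> \bar R) :
 (forall i j, 0 <= a i j)%E ->
 (\esum_i \esum_j a i j =
  \esum_j \esum_i a i j)%E.
move=> a0; rewrite !esum_esum//.
rewrite (reindex_esum ([set: T] `*`` (fun=> [set: S])) _ (fun z => (z.2, z.1)))//.
split => //=; first by move=> [x y] [z1 z2] _ _ [-> ->].
by move=> [x y] _; exists (y, x).
Qed.

Lemma esum_bij (S T : choiceType) (f : S -> T) (g : T -> S) (a : T -> \bar R) :
 cancel f g -> cancel g f ->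
 (\esum_j a j = \esum_i a (f i))%E.
move=> fg gf; apply: reindex_esum; split => //=.
 by move=> x y _ _; apply: can_inj fg _ _.
by move=> y _; exists (g y).
Qed.

Lemma esum_seq_le (S : choiceType) (s : seq S) (a : S -> \bar R) :
 uniq s -> (forall i, 0 <= a i)%E -> (\sum_(i <- s) a i <= \esum_i a i)%E.
move=> us a0; apply: esum_ge; exists [set` s]; first by split.
by rewrite fsbig_seq.
Qed.

Lemma esum_ge1 (S : choiceType) (a : S -> \bar R) i :
 (forall i, 0 <= a i)%E -> (a i <= \esum_i a i)%E.
by move=> a0; have := esum_seq_le (s := [:: i]) isT a0; rewrite big_seq1. Qed.

Lemma esum_delta (S : choiceType) (a : S -> \bar R) i :
 (forall j, 0 <= a j)%E -> (forall j, j != i -> a j = 0)%E ->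
 (\esum_i a i = a i)%E.
move=> a0 aj; rewrite -(esum_set1 (a0 i)) [in RHS]esum_mkcond; apply: eq_esum => j _.
case: ifPn => //; rewrite notin_setE /= => /eqP; exact: aj.
Qed.
End esum_calculus.

(** The properties of the transition probabilities on which all estimates rest.
    [heat_jump] is the event of a single jump; [heat_sub] bounds the mean of a
    subadditive function of the position by the mean number of jumps times its
    mean over one jump. *)
Record heat {R : realType} (J : int -> R) (p : R -> int -> R) : Prop := {
 heat_pt : forall t x, 0 <= t -> pt J t x = (p t x)%:E;
 heat_ge0 : forall t x, 0 <= t -> 0 <= p t x;
 heat_init : forall x, p 0 x = (x == 0)%:R;
 heat_sum : forall t, 0 <= t -> (\esum_x (p t x)%:E = 1)%E;
 heat_sym : forall t x, 0 <= t -> p t (- x) = p t x;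
 heat_CK : forall s t x, 0 <= s -> 0 <= t ->
  ((p (s + t) x)%:E = \esum_y (p s y * p t (x - y))%:E)%E;
 heat_diag : forall t, 0 <= t -> expR (- t) <= p t 0;
 heat_jump : forall t x, 0 <= t -> t * expR (- t) * J x <= p t x;
 heat_sub : forall (g : int -> R) t, 0 <= t -> g 0 = 0 -> (forall x, 0 <= g x) ->
  (forall x y, g (x + y) <= g x + g y) ->
  (\esum_x (g x * p t x)%:E <=
   t%:E * \esum_x (g x * J x)%:E)%E }.

(** The exponent [- 2] is weaker than the true decay [- (1 + gamma)]; any power
    will do, since only its logarithm matters. *)
Definition link_bound {R : realType} (p : R -> int -> R) (a c : R) := forall t x, 2 <= t ->
 c * t `^ (- a) * (1 + (absz x)%:R * t `^ (- a)) `^ (- 2) <= p t x.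

Section heat_of_walk.
Context {d : measure_display} {O : measurableType d} {R : realType}.
Variable P : probability O R.
Variables (J : int -> R) (W : R -> O -> int).
Hypothesis hW : ctrw P J W.

Definition hp (t : R) (x : int) : R := fine (pt J t x).

Lemma ctrw_J_ge0 x : 0 <= J x.
by have [tau [xi [mxi dtau pxi ind h]]] := hW; exact: (J_ge0 pxi). Qed.

Lemma ptE t x : 0 <= t -> pt J t x = (hp t x)%:E.
by move=> t0; have [tau [xi [mxi dtau pxi ind h]]] := hW; rewrite fineK// (pt_fin mxi pxi ind).
Qed.

Lemma ctrw_W0 : exists N : set O, [/\ measurable N, P N = 1%E & forall w, N w -> W 0 w = 0].
have [tau [xi [mxi dtau pxi ind h]]] := hW.
exists (N0 tau); split; [exact: (@measurable_N0 _ _ _ P tau xi mxi)|exact: (PN0 dtau)|] => w Nw.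
rewrite (W_In h (n := 0)) ?/Xi ?big_ord0//.
split => //=; rewrite /T_ big_ord0 lexx/= big_ord_recr big_ord0/= add0r; exact: Nw.
Qed.

Lemma W_law t x : 0 <= t -> P (W t @^-1` [set x]) = (hp t x)%:E.
move=> t0; have [pe [[pem _] [peI peM] peU [peT peW] mk]] := ctrw_markov hW.
have [N [mN PN hN]] := ctrw_W0.
have := mk 0 t setT x (lexx _) t0 (peT 0).
rewrite probability_setT mul1e setTI add0r -(ptE _ t0) => <-.
have mE u y : 0 <= u -> measurable (W u @^-1` [set y]).
 by move=> u0; apply: (pem u); apply: peW.
apply: (ae_eq_measure mN PN); first exact: mE.
 by apply: measurable_diff => y; exact: mE.
by apply/seteqP; split => w [/= h Nw]; split => //=; move: h; rewrite hN// subr0.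
Qed.

Lemma hp_ge0 t x : 0 <= t -> 0 <= hp t x.
by move=> t0; rewrite -lee_fin -W_law. Qed.

Lemma hp_sum t : 0 <= t -> (\esum_x (hp t x)%:E = 1)%E.
move=> t0; have [pe [[pem _] [peI peM] peU [peT peW] mk]] := ctrw_markov hW.
have mE y : measurable (W t @^-1` [set y]) by apply: (pem t); apply: peW.
rewrite -(@probability_setT _ _ _ P) (measure_countable_partition P mE measurableT).
by apply: eq_esum => x _; rewrite setTI W_law.
Qed.

Lemma hp_CK s t x : 0 <= s -> 0 <= t ->
 ((hp (s + t) x)%:E = \esum_y (hp s y * hp t (x - y))%:E)%E.
move=> s0 t0; have [pe [[pem _] [peI peM] peU [peT peW] mk]] := ctrw_markov hW.
have st0 : 0 <= s + t by rewrite addr_ge0.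
have mE u y : 0 <= u -> measurable (W u @^-1` [set y]) by move=> u0; apply: (pem u); apply: peW.
rewrite -W_law// (measure_countable_partition P (fun y => mE s y s0) (mE _ _ st0)).
apply: eq_esum => y _; rewrite EFinM -!W_law//.
transitivity (P (W s @^-1` [set y] `&` [set w | W (s + t) w - W s w = x - y])).
 congr (P _); apply/seteqP; split => w /= [].
 - by move=> -> ->.
 - by move=> h1 h2; split => //; move: h2; rewrite h1 => /addIr.
by rewrite (mk s t _ _ s0 t0 (peW _ _ _ s0 (lexx s))) ptE// -W_law.
Qed.

Lemma hp_ge_term (k : nat) t x : 0 <= t -> (\sum_(0 <= i < k) (poi i t)%:E * Jpow J i x <= (hp t x)%:E)%E.
move=> t0; have [tau [xi [mxi dtau pxi ind h]]] := hW.
rewrite -ptE// /pt; apply: nneseries_lim_ge => i _ _.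
by rewrite mule_ge0 ?(Jpow_ge0 pxi)// lee_fin poi_ge0.
Qed.

Lemma hp_diag t : 0 <= t -> expR (- t) <= hp t 0.
move=> t0; rewrite -lee_fin; apply: le_trans (hp_ge_term 1 0 t0).
by rewrite big_nat1 /poi fact0 expr0 divr1 mulr1 /= mule1.
Qed.

Lemma Jpow_ge0' k x : (0 <= Jpow J k x)%E.
by have [tau [xi [mxi dtau pxi ind h]]] := hW; exact: (Jpow_ge0 pxi). Qed.

Lemma hp_jump t x : 0 <= t -> t * expR (- t) * J x <= hp t x.
move=> t0; rewrite -lee_fin; apply: le_trans (hp_ge_term 2 x t0).
rewrite big_nat_recr//= big_nat1; apply: le_trans (leeDr _ _); last first.
 by rewrite mule_ge0 ?Jpow_ge0' ?lee_fin ?poi_ge0//; case: (x == 0).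
rewrite /poi factS fact0 expr1 divr1 [expR _ * t]mulrC EFinM; apply: lee_wpmul2l.
 by rewrite lee_fin mulr_ge0 ?expR_ge0.
apply: le_trans (esum_ge1 x _) => //.
 by rewrite subrr eqxx mul1e.
by move=> y; rewrite mule_ge0 ?lee_fin ?ctrw_J_ge0//; case: (_ == _).
Qed.

Lemma hp_init x : hp 0 x = (x == 0)%:R.
have [N [mN PN hN]] := ctrw_W0; apply/EFin_inj; rewrite -W_law//.
have [pe [[pem _] [peI peM] peU [peT peW] mk]] := ctrw_markov hW.
have mE y : measurable (W 0 @^-1` [set y]) by apply: (pem 0); apply: peW.
case: eqVneq => [->|x0].
 rewrite -(@probability_setT _ _ _ P).
 apply: (ae_eq_measure mN PN) => //.
 by apply/seteqP; split => w [/= h Nw]; split => //=; exact: hN.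
transitivity (P set0); last by rewrite measure0.
apply: (ae_eq_measure mN PN) => //.
apply/seteqP; split => w [/= h Nw]//; exfalso; move/eqP: x0; apply.
by rewrite -h hN.
Qed.

Hypothesis Jsym : forall x, J (- x) = J x.

Hypothesis J1 : (\esum_x (J x)%:E = 1)%E.

Lemma oppz_cancel : cancel (fun x : int => - x) (fun x => - x).
exact: opprK. Qed.

Lemma hp_sym t x : 0 <= t -> hp t (- x) = hp t x.
move=> t0; rewrite /hp /pt; congr fine; apply: eq_eseriesr => k _; congr (_ * _)%E.
elim: k x => [|k IH] x /=; first by rewrite oppr_eq0.
rewrite (esum_bij _ oppz_cancel oppz_cancel); apply: eq_esum => y _.
by rewrite Jsym -IH; congr (Jpow _ _ _ * _)%E; ring.
Qed.

Lemma Jpow_sum k : (\esum_x Jpow J k x = 1)%E.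
elim: k => [|k IH] /=.
 rewrite (esum_delta (i := 0)) ?eqxx//.
 by move=> x /negPf ->.
rewrite esum_exchange; last by move=> *; rewrite mule_ge0 ?Jpow_ge0' ?lee_fin ?ctrw_J_ge0.
rewrite -J1; apply: eq_esum => y _.
rewrite (esum_bij (f := fun x => x + y) (g := fun x => x - y)); last 2 first.
- by move=> x; rewrite addrK.
- by move=> x; rewrite subrK.
under eq_esum do rewrite addrK muleC.
by rewrite esumZl ?ctrw_J_ge0// ?IH ?mule1//; move=> i; exact: Jpow_ge0'.
Qed.

Lemma Jpow_sub k (g : int -> R) : g 0 = 0 -> (forall x, 0 <= g x) -> (forall x y, g (x + y) <= g x + g y) ->
 (\esum_x ((g x)%:E * Jpow J k x) <=
  k%:R%:E * \esum_x (g x * J x)%:E)%E.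
move=> g00 g0 gs; have gJ x : (0 <= (g x * J x)%:E)%E by rewrite lee_fin mulr_ge0 ?ctrw_J_ge0.
have gp j x : (0 <= (g x)%:E * Jpow J j x)%E by rewrite mule_ge0 ?lee_fin ?Jpow_ge0'.
have SJ : (0 <= \esum_x (g x * J x)%:E)%E by apply: esum_ge0.
elim: k => [|k IH].
 rewrite mul0e (esum_delta (i := 0))//=.
 - by rewrite g00 mul0e.
 - by move=> x; exact: (gp 0%N).
 - by move=> x /negPf /= ->; rewrite mule0.
have -> : (\esum_x ((g x)%:E * Jpow J k.+1 x) =
 \esum_y \esum_x ((g (x + y)%R)%:E * (Jpow J k x * (J y)%:E)))%E.
 transitivity (\esum_x \esum_y ((g x)%:E * (Jpow J k (x - y) * (J y)%:E)))%E.
  by apply: eq_esum => x _ /=; rewrite esumZl// => y; rewrite mule_ge0 ?Jpow_ge0' ?lee_fin ?ctrw_J_ge0.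
 rewrite esum_exchange; last by move=> x y; rewrite !mule_ge0 ?Jpow_ge0' ?lee_fin ?ctrw_J_ge0.
 apply: eq_esum => y _.
 rewrite (esum_bij (f := fun x => x + y) (g := fun x => x - y)).
 - by apply: eq_esum => x _; rewrite addrK.
 - by move=> x; rewrite addrK.
 - by move=> x; rewrite subrK.
apply: (via (\esum_y ((J y)%:E * (\esum_x ((g x)%:E * Jpow J k x))
  + (g y * J y)%:E))%E).
 apply: le_esum => y _.
 have -> : ((g y * J y)%:E = (g y * J y)%:E * \esum_x Jpow J k x)%E.
  by rewrite Jpow_sum// mule1.
 rewrite -!esumZl ?mulr_ge0 ?ctrw_J_ge0//; last by move=> x; exact: Jpow_ge0'.
 rewrite -esumD; last 2 first.
 - by move=> x _; rewrite mule_ge0 ?lee_fin ?ctrw_J_ge0.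
 - by move=> x _; rewrite mule_ge0 ?lee_fin ?mulr_ge0 ?ctrw_J_ge0 ?Jpow_ge0'.
 apply: le_esum => x _.
 apply: (via ((g x + g y)%:E * (Jpow J k x * (J y)%:E))%E).
  by rewrite lee_wpmul2r ?lee_fin// mule_ge0 ?Jpow_ge0' ?lee_fin ?ctrw_J_ge0.
 rewrite EFinD ge0_muleDl ?lee_fin//.
 by rewrite EFinM !muleA [((J y)%:E * _)%E]muleC -!muleA [((J y)%:E * _)%E]muleC.
rewrite esumD; last 2 first.
- by move=> y _; rewrite mule_ge0 ?lee_fin ?ctrw_J_ge0// esum_ge0.
- by move=> y _; exact: gJ.
case: (eqVneq (\esum_x (g x * J x)%:E)%E +oo%E) => [->|SJoo].
 by rewrite gt0_muley ?leey// lte_fin ltr0n.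
have SJf : (\esum_x (g x * J x)%:E)%E \is a fin_num.
 by rewrite ge0_fin_numE// ltey.
move: IH SJ; rewrite -(fineK SJf) -!EFinM; set S := fine _ => IH SJ.
have B0 : 0 <= k%:R * S by rewrite mulr_ge0// -lee_fin.
apply: (via (\esum_y ((k%:R * S)%:E * (J y)%:E) + S%:E)%E).
 rewrite leeD2r//; apply: le_esum => y _; rewrite muleC.
 by rewrite lee_wpmul2r ?lee_fin ?ctrw_J_ge0.
rewrite esumZl//; last by move=> y; rewrite lee_fin ctrw_J_ge0.
by rewrite J1 mule1 -EFinD lee_fin -[k.+1]addn1 natrD mulrDl mul1r.
Qed.

Lemma poi_mean (t : R) : 0 <= t -> (\sum_(0 <= k <oo) (poi k t * k%:R)%:E = t%:E)%E.
move=> t0; rewrite (nneseries_split 0 1)//=; last by move=> k _; rewrite lee_fin mulr_ge0// poi_ge0.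
rewrite add0n big_nat1 mulr0 add0e -nneseries_addn; last first.
 by move=> k; rewrite lee_fin mulr_ge0// poi_ge0.
rewrite -[RHS]mule1 -(poi_sum t0) -nneseriesZl; last by move=> *; rewrite lee_fin poi_ge0.
apply: eq_eseriesr => k _; rewrite -EFinM addn1 /poi; congr EFin.
rewrite factS natrM exprS; field.
by rewrite addrC natr1 !pnatr_eq0 -lt0n fact_gt0.
Qed.

Lemma hp_sub (g : int -> R) t : 0 <= t -> g 0 = 0 -> (forall x, 0 <= g x) ->
 (forall x y, g (x + y) <= g x + g y) ->
 (\esum_x (g x * hp t x)%:E <=
  t%:E * \esum_x (g x * J x)%:E)%E.
move=> t0 g00 g0 gs.
have gJ x : (0 <= (g x * J x)%:E)%E by rewrite lee_fin mulr_ge0 ?ctrw_J_ge0.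
have p0 k : 0 <= poi k t by rewrite poi_ge0.
have -> : (\esum_x (g x * hp t x)%:E =
  \esum_k ((poi k t)%:E * \esum_x ((g x)%:E * Jpow J k x)))%E.
 transitivity (\esum_x \esum_k ((poi k t)%:E * ((g x)%:E * Jpow J k x)))%E.
  apply: eq_esum => x _; rewrite EFinM -ptE// /pt nneseries_esumT; last first.
   by move=> k; rewrite mule_ge0 ?Jpow_ge0' ?lee_fin.
  rewrite -esumZl//; last by move=> k; rewrite mule_ge0 ?Jpow_ge0' ?lee_fin.
  by apply: eq_esum => k _; rewrite muleCA.
 rewrite esum_exchange; last by move=> x k; rewrite !mule_ge0 ?Jpow_ge0' ?lee_fin.
 by apply: eq_esum => k _; rewrite esumZl// => x; rewrite mule_ge0 ?Jpow_ge0' ?lee_fin.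
set S := (\esum_(x in _) (g x * J x)%:E)%E.
have S0 : (0 <= S)%E by exact: esum_ge0.
apply: (via (\esum_k ((poi k t * k%:R)%:E * S))%E).
 apply: le_esum => k _; rewrite [(poi k t * k%:R)%:E]EFinM -muleA; apply: lee_wpmul2l; first by rewrite lee_fin.
 exact: Jpow_sub.
have [Soo|Soo] := eqVneq S +oo%E.
 have [->|tn0] := eqVneq t 0.
  rewrite mul0e esum1// => k _; rewrite /poi.
  by case: k => [|k]; rewrite ?mulr0 ?mul0e// exprS !(mul0r, mulr0) mul0e.
 by rewrite Soo gt0_muley ?leey// lte_fin lt_def tn0.
have Sf : S \is a fin_num by rewrite ge0_fin_numE// ltey.
rewrite -(fineK Sf); under eq_esum do rewrite muleC.
rewrite esumZl ?fine_ge0//; last by move=> k; rewrite lee_fin mulr_ge0.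
have pk k : (0 <= (poi k t * k%:R)%:E)%E by rewrite lee_fin mulr_ge0.
by rewrite -(nneseries_esumT pk) poi_mean// muleC.
Qed.

Lemma walk_heat : heat J hp.
split; [by move=> *; exact: ptE|exact: hp_ge0|exact: hp_init|exact: hp_sum|by move=> *; exact: hp_sym|
 exact: hp_CK|exact: hp_diag|exact: hp_jump|by move=> *; exact: hp_sub].
Qed.
End heat_of_walk.

(** * Power sums and discrete convolutions *)

Section power_sums.
Context {R : realType}.
Implicit Types (a b c h x y u : R).

Lemma powD x a b : 0 < x -> x `^ (a + b) = x `^ a * x `^ b.
by move=> x0; rewrite powRD//; apply/implyP => _; rewrite gt_eqF. Qed.

Lemma pow_le x y b : 0 <= x -> x <= y -> 0 <= b -> x `^ b <= y `^ b.
by move=> x0 xy b0; apply: ge0_ler_powR => //; rewrite nnegrE// (le_trans x0).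
Qed.

Lemma pow_leN x y b : 0 < x -> x <= y -> 0 <= b -> y `^ (- b) <= x `^ (- b).
move=> x0 xy b0; rewrite !powRN lef_pV2 ?posrE ?powR_gt0//; first exact: pow_le (ltW x0) _ _.
exact: lt_le_trans xy.
Qed.

Lemma pow_scale c x y b : 0 < x -> 0 < c -> 0 <= b -> x <= c * y ->
 y `^ (- b) <= c `^ b * x `^ (- b).
move=> x0 c0 b0 xy; have y0 : 0 < y by rewrite -(pmulr_rgt0 _ c0) (lt_le_trans x0).
apply: (via (c `^ b * (c * y) `^ (- b))); last first.
 by rewrite ler_wpM2l ?powR_ge0// pow_leN.
by rewrite (powRM _ (ltW c0) (ltW y0)) mulrA -powD// subrr powRr0 mul1r.
Qed.

Lemma bernoulli_neg c u : 0 <= c -> 0 <= u < 1 -> 1 + c * u <= (1 - u) `^ (- c).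
move=> c0 /andP[u0 u1]; rewrite powRN /powR subr_eq0 gt_eqF// -expRN.
apply: le_trans (expR_ge1Dx _); rewrite lerD2l -mulrN ler_wpM2l//.
by rewrite lerNr; apply: le_ln1Dx; rewrite ltrN2.
Qed.

Lemma bernoulli_pos c u : 0 <= c -> 0 <= u -> 1 + c * (u / (1 + u)) <= (1 + u) `^ c.
move=> c0 u0; have u1 : 0 < 1 + u by rewrite ltr_wpDr.
rewrite /powR gt_eqF//.
apply: le_trans (expR_ge1Dx _); rewrite lerD2l ler_wpM2l//.
have -> : u / (1 + u) = - (- u / (1 + u)) by rewrite mulNr opprK.
rewrite lerNl -lnV ?posrE//.
have u2 : -1 < - u / (1 + u) by rewrite mulNr ltrN2 ltr_pdivrMr// mul1r ltrDr.
by have := le_ln1Dx u2; rewrite (_ : 1 + - u / (1 + u) = (1 + u)^-1)//; field; rewrite gt_eqF.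
Qed.

Variable h : R.
Hypothesis h01 : 0 < h <= 1.

Definition X (n : nat) : R := 1 + n%:R * h.

Let h0 : 0 < h. by case/andP: h01. Qed.
Let h1 : h <= 1. by case/andP: h01. Qed.

Lemma X_ge1 n : 1 <= X n.
by rewrite lerDl mulr_ge0// ltW. Qed.

Lemma X_gt0 n : 0 < X n.
exact: lt_le_trans (X_ge1 n). Qed.
Hint Resolve X_gt0 : core.

Lemma X_ge0 n : 0 <= X n.
exact: ltW. Qed.
Hint Resolve X_ge0 : core.

Lemma X_le m n : (m <= n)%N -> X m <= X n.
by move=> mn; rewrite lerD2l ler_wpM2r ?ler_nat// ltW. Qed.

Lemma XS n : X n.+1 = X n + h.
by rewrite /X -natr1 mulrDl mul1r addrA. Qed.

Lemma XS_le n : X n.+1 <= 2 * X n.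
by rewrite XS mulr2n mulrDl mul1r lerD2l (le_trans h1)// X_ge1. Qed.

Lemma X_double n : X (2 * n) <= 2 * X n.
by rewrite /X natrM; lra. Qed.

Lemma pow_sum_low c n : 0 < c ->
 \sum_(0 <= i < n) h * X i `^ (- (1 - c)) <= 2 / c * X n `^ c.
move=> c0.
have step i : c / 2 * (h * X i `^ (- (1 - c))) <= X i.+1 `^ c - X i `^ c.
 have -> : - (1 - c) = c - 1 by ring.
 rewrite powD// powR_inv1//.
 have -> : X i.+1 = X i * (1 + h / X i).
  by rewrite XS mulrDr mulr1 mulrCA divff ?mulr1// gt_eqF.
 have u0 : 0 <= h / X i by rewrite divr_ge0// ltW.
 have u1 : h / X i <= 1.
  by rewrite ler_pdivrMr// mul1r (le_trans h1)// X_ge1.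
 rewrite (powRM _ (X_ge0 i) (addr_ge0 ler01 u0)).
 have := bernoulli_pos (ltW c0) u0.
 rewrite -subr_ge0 => H; rewrite -[X in _ - X]mulr1 -mulrBr.
 apply: (via (X i `^ c * (c * (h / X i / (1 + h / X i))))); last first.
  by rewrite ler_wpM2l ?powR_ge0// -subr_ge0; apply: le_trans H _; apply: eq_ler; ring.
 have -> : c / 2 * (h * (X i `^ c * (X i)^-1)) = X i `^ c * (c * (h / X i * 2^-1)) by ring.
 rewrite ler_wpM2l ?powR_ge0// (ler_wpM2l (ltW c0))// ler_wpM2l//.
 by rewrite lef_pV2 ?posrE//; lra.
have c2 : 0 < c / 2 by rewrite divr_gt0.
rewrite -(ler_pM2l c2) mulr_sumr mulrA.
have -> : c / 2 * (2 / c) = 1 by field; rewrite gt_eqF.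
rewrite mul1r; apply: (via (X n `^ c - X 0 `^ c)).
 by rewrite -(telescope_sumr (fun i => X i `^ c))// ler_sum.
by rewrite lerBlDr lerDl powR_ge0.
Qed.

Lemma pow_sum_high c m n : 0 < c -> (m <= n)%N ->
 \sum_(m <= i < n) h * X i `^ (- (1 + c)) <= 2 `^ (1 + c) / c * X m `^ (- c).
move=> c0 mn.
have C0 : 0 < 2 `^ (1 + c) / c by rewrite divr_gt0// powR_gt0.
have step i : h * X i `^ (- (1 + c)) <= 2 `^ (1 + c) / c * (X i `^ (- c) - X i.+1 `^ (- c)).
 have c1 : 0 <= 1 + c by rewrite addr_ge0// ltW.
 have := @pow_scale 2 (X i.+1) (X i) (1 + c) (X_gt0 _) (ltr0n _ _) c1 (XS_le i).
 move=> H; apply: (le_trans (ler_wpM2l (ltW h0) H)).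
 rewrite mulrCA -mulrA ler_wpM2l ?powR_ge0//.
 rewrite ler_pdivlMl//.
 have -> : X i = X i.+1 * (1 - h / X i.+1).
  by rewrite mulrBr mulr1 mulrCA divff ?mulr1 ?gt_eqF// XS addrK.
 have u0 : 0 <= h / X i.+1 by rewrite divr_ge0// ltW.
 have u1 : h / X i.+1 < 1.
  by rewrite ltr_pdivrMr// mul1r XS ltrDr X_gt0.
 have u2 : 0 <= 1 - h / X i.+1 by rewrite subr_ge0 ltW.
 rewrite (powRM _ (X_ge0 i.+1) u2).
 have := bernoulli_neg (ltW c0) (introT andP (conj u0 u1)) => B.
 rewrite opprD powD// powR_inv1// -[X in _ - X]mulr1 -mulrBr.
 have -> : c * (h * ((X i.+1)^-1 * X i.+1 `^ (- c))) = X i.+1 `^ (- c) * (c * (h / X i.+1)) by ring.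
 by rewrite ler_wpM2l ?powR_ge0// lerBrDl.
apply: (via (2 `^ (1 + c) / c * (X m `^ (- c) - X n `^ (- c)))).
 rewrite -opprB -(telescope_sumr (fun i => X i `^ (- c)))// -sumrN mulr_sumr.
 by apply: ler_sum => i _; rewrite opprB.
by rewrite (ler_wpM2l (ltW C0))// lerBlDr lerDl powR_ge0.
Qed.

Definition conv_const b c : R := 2 / (1 - b) + 2 `^ (1 + c) / c.

Lemma conv_const_gt0 b c : b < 1 -> 0 < c -> 0 < conv_const b c.
by move=> b1 c0; rewrite addr_gt0// divr_gt0 ?subr_gt0 ?powR_gt0.
Qed.

Lemma conv_one_sided b1 b2 c g M : b2 < 1 -> 0 < c -> c = b1 + b2 - 1 -> (0 <= b1) ->
 \sum_(0 <= m < M) h * (X (maxn g m) `^ (- b1) * X m `^ (- b2)) <=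
  conv_const b2 c * X g `^ (- c).
move=> b21 c0 cE b10.
have T0 m : 0 <= h * (X (maxn g m) `^ (- b1) * X m `^ (- b2)).
 by rewrite mulr_ge0 ?mulr_ge0 ?powR_ge0// ltW.
apply: (via (\sum_(0 <= m < g + M) h * (X (maxn g m) `^ (- b1) * X m `^ (- b2)))).
 by rewrite [leRHS](cat_nat M) ?leq_addl//= lerDl sumr_ge0.
rewrite (cat_nat g) ?leq_addr//= /conv_const mulrDl; apply: lerD.
 have a0 : 0 < 1 - b2 by rewrite subr_gt0.
 have := pow_sum_low g a0.
 rewrite (_ : - (1 - (1 - b2)) = - b2); last by ring.
 move=> H; rewrite (_ : X g `^ (- c) = X g `^ (- b1) * X g `^ (1 - b2)); last first.
  by rewrite -powD//; congr powR; rewrite cE; ring.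
 rewrite mulrCA; apply: le_trans (ler_wpM2l (powR_ge0 _ _) H).
 rewrite mulr_sumr; apply: ler_sum_nat => m /andP[_ mg].
 by rewrite (maxn_idPl (ltnW mg)) mulrCA.
apply: le_trans (pow_sum_high c0 (leq_addr M g)).
apply: ler_sum_nat => m /andP[gm _].
by rewrite (maxn_idPr gm) -powD// cE (_ : - b1 - b2 = - (1 + (b1 + b2 - 1)))//; ring.
Qed.

Definition dist (m n : nat) : nat := (m - n) + (n - m).

Lemma sum_dist_le (f : nat -> R) N (b : nat) : (forall m, 0 <= f m) ->
 \sum_(0 <= z < N) f (dist z b) <= 2 * \sum_(0 <= m < N + b.+1) f m.
move=> f0; rewrite mulr2n mulrDl mul1r.
apply: (via (\sum_(0 <= z < N + b.+1) f (dist z b))).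
 by rewrite [leRHS](cat_nat N) ?leq_addr//= lerDl sumr_ge0.
rewrite (cat_nat b.+1) ?leq_addl//=; apply: lerD.
 rewrite big_nat_rev/= add0n.
 apply: (via (\sum_(0 <= m < b.+1) f m)); last first.
  by rewrite [leRHS](cat_nat b.+1) ?leq_addl//= lerDl sumr_ge0.
 apply: ler_sum_nat => m /andP[_ mb].
 by rewrite (_ : dist _ _ = m)// /dist; lia.
rewrite -{1}[b.+1]add0n big_addn addnK.
apply: (via (\sum_(0 <= m < N) f m.+1)).
 by apply: ler_sum => m _; rewrite (_ : dist _ _ = m.+1)// /dist; lia.
rewrite addnS [leRHS]big_nat_recl//; apply: ler_wpDl => //.
by rewrite [leRHS](cat_nat N) ?leq_addr//= lerDl sumr_ge0.
Qed.

(** Whichever of the two points is nearer to [z], the other one is at distance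
    at least half of [dist x y]; this reduces to [conv_one_sided]. *)
Lemma conv_two_sided b1 b2 c N (x y : nat) : 0 <= b1 < 1 -> 0 <= b2 < 1 -> 0 < c -> c = b1 + b2 - 1 ->
 \sum_(0 <= z < N) h * (X (dist z x) `^ (- b1) * X (dist z y) `^ (- b2)) <=
  4 * (conv_const b1 c + conv_const b2 c) * X (dist x y) `^ (- c).
move=> /andP[b10 b11] /andP[b20 b21] c0 cE.
set g := dist x y.
pose f1 m := h * (X (maxn g m) `^ (- b1) * X m `^ (- b2)).
pose f2 m := h * (X (maxn g m) `^ (- b2) * X m `^ (- b1)).
have f10 m : 0 <= f1 m by rewrite mulr_ge0 ?mulr_ge0 ?powR_ge0// ltW.
have f20 m : 0 <= f2 m by rewrite mulr_ge0 ?mulr_ge0 ?powR_ge0// ltW.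
have key (u v : nat) b : 0 <= b -> b < 1 -> (v <= u)%N -> (g <= u + v)%N ->
  X u `^ (- b) <= 2 * X (maxn g v) `^ (- b).
 move=> b0 b1' vu guv.
 have H : X (maxn g v) <= 2 * X u.
  by apply: le_trans (X_double u); apply: X_le; lia.
 apply: (le_trans (pow_scale (X_gt0 _) (ltr0n _ 2) b0 H)).
 by rewrite ler_wpM2r ?powR_ge0// -[leRHS]powRr1// ler_powR ?ler1n// ltW.
apply: (via (\sum_(0 <= z < N) (2 * f1 (dist z y) + 2 * f2 (dist z x)))).
 apply: ler_sum => z _; case: (leqP (dist z y) (dist z x)) => zz.
  apply: ler_wpDr; first by rewrite mulr_ge0.
  rewrite /f1 [leRHS]mulrCA; apply: ler_wpM2l; first exact: ltW.
  rewrite [leRHS]mulrA; apply: ler_wpM2r; first exact: powR_ge0.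
  by apply: key => //; rewrite /g /dist; lia.
 apply: ler_wpDl; first by rewrite mulr_ge0.
 rewrite /f2 [leRHS]mulrCA; apply: ler_wpM2l; first exact: ltW.
 rewrite [leLHS]mulrC [leRHS]mulrA; apply: ler_wpM2r; first exact: powR_ge0.
 by apply: key => //; [exact: ltnW|rewrite /g /dist; lia].
rewrite big_split/=.
have -> : \sum_(0 <= i < N) 2 * f1 (dist i y) = 2 * \sum_(0 <= i < N) f1 (dist i y) by rewrite mulr_sumr.
have -> : \sum_(0 <= i < N) 2 * f2 (dist i x) = 2 * \sum_(0 <= i < N) f2 (dist i x) by rewrite mulr_sumr.
have H1 := sum_dist_le N y f10; have H2 := sum_dist_le N x f20.
have C1 := conv_one_sided g (N + y.+1) b21 c0 cE b10.
have cE' : c = b2 + b1 - 1 by rewrite cE; ring.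
have C2 := conv_one_sided g (N + x.+1) b11 c0 cE' b20.
rewrite -/(f1 _) in C1.
have {}C1 : \sum_(0 <= m < N + y.+1) f1 m <= conv_const b2 c * X g `^ (- c) by [].
have {}C2 : \sum_(0 <= m < N + x.+1) f2 m <= conv_const b1 c * X g `^ (- c) by [].
rewrite -mulrA mulrDl; lra.
Qed.
End power_sums.

(** * Logarithmic distances *)

Section log_distance.
Context {R : realType}.
Implicit Types (l : R) (x : int).

(** The cost of a displacement [x] in units of length [l]; subadditive, so that
    it can be charged to the single increments. *)
Definition glog (l : R) (x : int) : R := ln (1 + (absz x)%:R / l).

Lemma glog_ge0 l x : 0 < l -> 0 <= glog l x.
by move=> l0; rewrite ln_ge0// lerDl divr_ge0// ltW. Qed.

Lemma glog0 l : glog l 0 = 0.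
by rewrite /glog absz0 mul0r addr0 ln1. Qed.

Lemma glog_sub l x y : 0 < l -> glog l (x + y) <= glog l x + glog l y.
move=> l0; have q z : 0 < 1 + (absz z)%:R / l by rewrite ltr_wpDr// divr_ge0// ltW.
rewrite /glog -lnM ?posrE// ler_ln ?posrE ?mulr_gt0//.
have : ((absz (x + y))%:R : R) <= (absz x)%:R + (absz y)%:R.
 by rewrite -natrD ler_nat; lia.
rewrite -(ler_pM2r (x := l^-1)) ?invr_gt0// mulrDl => h.
rewrite mulrDl mul1r mulrDr mulr1 -!addrA lerD2l.
have : 0 <= (absz x)%:R / l * ((absz y)%:R / l) by rewrite mulr_ge0// divr_ge0// ltW.
by lra.
Qed.

End log_distance.

(** * Estimates on the transition probabilities *)

Lemma absz_sub_nat (y k i : nat) : absz (y%:Z - (y + k + i)%N%:Z) = (k + i)%N.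
lia. Qed.

Lemma absz_sub_le (x y : int) (r : nat) : (absz y <= r)%N -> (r <= absz x)%N -> (absz (x - y) <= 2 * absz x)%N.
lia. Qed.

Section heat_basic.
Context {R : realType}.
Variables (J : int -> R) (p : R -> int -> R).
Hypothesis H : heat J p.
Implicit Types (s t : R) (x y z : int).

Let p0 t x : 0 <= t -> 0 <= p t x. exact: (heat_ge0 H). Qed.

Lemma esum_add_seq (S : choiceType) (a b c : S -> R) (s : seq S) : uniq s ->
 (forall x : S, 0 <= a x) -> (forall x : S, x \in s -> 0 <= b x) ->
 (forall x : S, x \in s -> a x + b x <= c x) -> (forall x : S, a x <= c x) ->
 (\esum_x (a x)%:E + (\sum_(x <- s) b x)%:E <= \esum_x (c x)%:E)%E.
move=> us a0 b0 abc ac.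
pose b' (x : S) := if x \in s then b x else 0.
have b'0 (x : S) : 0 <= b' x by rewrite /b'; case: ifPn => // /b0.
have -> : \sum_(x <- s) b x = \sum_(x <- s) b' x.
 by rewrite big_seq [RHS]big_seq; apply: eq_bigr => x xs; rewrite /b' xs.
apply: (via (\esum_x (a x)%:E + \esum_x (b' x)%:E)%E).
 by rewrite leeD2l// -sumEFin; apply: esum_seq_le => // x; rewrite lee_fin.
rewrite -esumD; try by move=> x _; rewrite lee_fin.
apply: le_esum => x _; rewrite -EFinD lee_fin /b'; case: ifPn => [/abc//|_].
by rewrite addr0.
Qed.

Lemma esum_le_add_seq (S : choiceType) (a b c : S -> R) (s : seq S) : uniq s ->
 (forall x : S, 0 <= a x) -> (forall x : S, x \in s -> 0 <= b x) ->
 (forall x : S, x \in s -> c x <= a x + b x) -> (forall x : S, x \notin s -> c x <= a x) ->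
 (\esum_x (c x)%:E <= \esum_x (a x)%:E + (\sum_(x <- s) b x)%:E)%E.
move=> us a0 b0 abc ac.
pose b' (x : S) := if x \in s then b x else 0.
have b'0 (x : S) : 0 <= b' x by rewrite /b'; case: ifPn => // /b0.
have -> : ((\sum_(x <- s) b x)%:E = \esum_x (b' x)%:E)%E.
 transitivity (\sum_(x <- s) (b' x)%:E)%E.
  by rewrite sumEFin; congr EFin; rewrite big_seq [RHS]big_seq; apply: eq_bigr => x xs; rewrite /b' xs.
 rewrite (fsbig_seq _ _ us) -(esum_fset (F := [set` s])); last 2 first.
 - exact: finite_seq.
 - by move=> x _; rewrite lee_fin.
 rewrite esum_mkcond; apply: eq_esum => x _; rewrite /b'.
 by case: ifPn; rewrite ?inE ?notin_setE /= => // xs; rewrite ifF//; exact/negP.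
rewrite -esumD; try by move=> x _; rewrite lee_fin.
apply: le_esum => x _; rewrite -EFinD lee_fin /b'; case: ifPn => [/abc//|/ac].
by rewrite addr0.
Qed.

Lemma esumZlE (S : choiceType) (a : S -> R) (c : R) : 0 <= c -> (forall i, 0 <= a i) ->
 (\esum_i (c * a i)%:E = c%:E * \esum_i (a i)%:E)%E.
move=> c0 a0; rewrite -esumZl//.
Qed.

Lemma heat_psum t (s : seq int) : 0 <= t -> uniq s -> \sum_(x <- s) p t x <= 1.
move=> t0 us; rewrite -lee_fin -(heat_sum H t0) -sumEFin.
by apply: esum_seq_le => // x; rewrite lee_fin p0.
Qed.

Lemma heat_CK_le s t x (l : seq int) : 0 <= s -> 0 <= t -> uniq l ->
 \sum_(y <- l) p s y * p t (x - y) <= p (s + t) x.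
move=> s0 t0 ul; rewrite -lee_fin (heat_CK H)// -sumEFin.
by apply: esum_seq_le => // y; rewrite lee_fin mulr_ge0 ?p0.
Qed.

Lemma heat_square s x : 0 <= s ->
 (\esum_z (p s (x - z) ^+ 2)%:E = (p (s + s) 0)%:E)%E.
move=> s0; rewrite (heat_CK H)//.
rewrite (esum_bij (f := fun z => x - z) (g := fun z => x - z)).
- by apply: eq_esum => z _; rewrite sub0r (heat_sym H)// subKr expr2.
- by move=> z; rewrite subKr.
- by move=> z; rewrite subKr.
Qed.

Lemma heat_amgm s t x (l : R) : 0 <= s -> 0 <= t -> 0 < l ->
 2 * p (s + t) x <= l * p (s + s) 0 + l^-1 * p (t + t) 0.
move=> s0 t0 l0; have l0' := ltW l0; have li0 : 0 <= l^-1 by rewrite invr_ge0.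
rewrite -lee_fin EFinM (heat_CK H)// -esumZlE//; last by move=> y; rewrite mulr_ge0 ?p0.
rewrite EFinD 2!EFinM -(heat_square 0 s0) -(heat_square x t0).
rewrite -!esumZlE//; try by move=> y; rewrite sqr_ge0.
rewrite -esumD; try by move=> y _; rewrite lee_fin mulr_ge0// sqr_ge0.
apply: le_esum => y _; rewrite -EFinD lee_fin sub0r (heat_sym H)//.
have := sqr_ge0 (l * p s y - p t (x - y)) => h.
rewrite -(ler_pM2l l0).
have -> : l * (l * p s y ^+ 2 + l^-1 * p t (x - y) ^+ 2) = l ^+ 2 * p s y ^+ 2 + p t (x - y) ^+ 2.
 by field; rewrite gt_eqF.
rewrite -subr_ge0; move: h; congr (0 <= _); ring.
Qed.

Lemma heat_le_diag t x : 0 <= t -> p t x <= p t 0.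
move=> t0; have t2 : 0 <= t / 2 by rewrite divr_ge0.
have := heat_amgm x t2 t2 ltr01; rewrite -splitr invr1 !mul1r; lra.
Qed.

Lemma heat_midpoint s t : 0 <= s -> 0 <= t -> 2 * p (s + t) 0 <= p (s + s) 0 + p (t + t) 0.
by move=> s0 t0; have := heat_amgm 0 s0 t0 ltr01; rewrite invr1 !mul1r. Qed.

Lemma heat_diag_gt0 t : 0 <= t -> 0 < p t 0.
by move=> t0; apply: lt_le_trans (expR_gt0 _) (heat_diag H t0). Qed.

(** The inequality of Cauchy and Schwarz applied to the semigroup equation. *)
Lemma heat_logconv s t : 0 <= s -> 0 <= t -> p (s + t) 0 ^+ 2 <= p (s + s) 0 * p (t + t) 0.
move=> s0 t0; have a0 : 0 < p (s + s) 0 by rewrite heat_diag_gt0// addr_ge0.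
have m0 : 0 < p (s + t) 0 by rewrite heat_diag_gt0// addr_ge0.
have l0 : 0 < p (s + t) 0 / p (s + s) 0 by rewrite divr_gt0.
have := heat_amgm 0 s0 t0 l0; rewrite divfK ?gt_eqF// invf_div mulrDl mul1r => h.
have {}h : p (s + t) 0 <= p (s + s) 0 / p (s + t) 0 * p (t + t) 0 by lra.
by rewrite -(ler_pM2l m0) in h; rewrite expr2; apply: le_trans h _; rewrite mulrA mulrCA divff ?mulr1 ?gt_eqF.
Qed.

Lemma heat_decr s t : 0 <= s -> s <= t -> p t 0 <= p s 0.
move=> s0 st; have ts : 0 <= t - s by rewrite subr_ge0.
rewrite -lee_fin -{1}(subrK s t) (heat_CK H)//.
rewrite -[leRHS]mule1 -(heat_sum H ts) -esumZlE ?p0//; last by move=> x; rewrite p0.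
by apply: le_esum => y _; rewrite lee_fin mulrC ler_wpM2r ?p0// heat_le_diag.
Qed.

Lemma heat_step_le s t x : 0 <= s -> 0 <= t -> expR (- s) * p t x <= p (s + t) x.
move=> s0 t0; have := heat_CK_le x s0 t0 (l := [:: 0]) isT.
rewrite big_seq1 subr0; apply: le_trans; rewrite ler_wpM2r ?p0//; exact: (heat_diag H).
Qed.

Lemma heat_decrement t (v m : R) (l : seq int) : 0 <= t -> v = p t 0 -> uniq l -> 0 <= m ->
 (forall z, z \in l -> m <= p 1 z) ->
 m * \sum_(z <- l) (v - p t z) <= v - p (1 + t) 0.
move=> t0 vE ul m0 ml.
have v0 : 0 <= v by rewrite vE p0.
rewrite lerBrDl -lee_fin EFinD (heat_CK H)// mulr_sumr.
have -> : (v%:E = \esum_z (v * p 1 z)%:E)%E.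
 by rewrite esumZlE ?(heat_sum H) ?mule1// => z; rewrite p0.
apply: esum_add_seq => //.
- by move=> z; rewrite mulr_ge0 ?p0.
- by move=> z zl; rewrite mulr_ge0// subr_ge0 vE heat_le_diag.
- move=> z /ml mz; rewrite sub0r (heat_sym H)// [v * _]mulrC -lerBrDl -mulrBr.
 by rewrite ler_wpM2r// subr_ge0 vE heat_le_diag.
- by move=> z; rewrite sub0r (heat_sym H)// mulrC ler_wpM2r ?p0// vE heat_le_diag.
Qed.

Definition rng (r : nat) : seq int := [seq i%:Z - r%:Z | i <- iota 0 (2 * r).+1].

Lemma rng_uniq r : uniq (rng r).
by rewrite map_inj_uniq ?iota_uniq// => i j /addIr []. Qed.

Lemma rng_size r : size (rng r) = (2 * r).+1.
by rewrite size_map size_iota. Qed.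

Lemma mem_rng r x : (x \in rng r) = (absz x <= r)%N.
apply/mapP/idP => [[i]|xr]; first by rewrite mem_iota => ir ->; lia.
exists (absz (x + r%:Z)); last lia.
by rewrite mem_iota; lia.
Qed.

Lemma nat_esum_le (f : nat -> R) M : (forall n, 0 <= f n) -> (forall N, \sum_(0 <= n < N) f n <= M) ->
 (\esum_n (f n)%:E <= M%:E)%E.
move=> f0 fM; rewrite -nneseries_esumT; last by move=> n; rewrite lee_fin.
apply: lime_le; first by apply: is_cvg_nneseries => n _ _; rewrite lee_fin.
by apply: nearW => N; rewrite sumEFin lee_fin.
Qed.

Lemma int_esum_le (f : nat -> R) M : (forall n, 0 <= f n) -> (forall N, \sum_(0 <= n < N) f n <= M) ->
 (\esum_x (f (absz x))%:E <= (2 * M)%:E)%E.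
move=> f0 fM; rewrite (esumID [set x : int | (0 <= x)%R]); last by move=> x _; rewrite lee_fin.
rewrite !setTI mulr2n mulrDl mul1r EFinD; apply: leeD.
- rewrite (reindex_esum [set: nat] _ Posz); first exact: nat_esum_le.
 split => //=; first by move=> m n _ _ [].
 by move=> [n|n] //= _; exists n.
- rewrite (reindex_esum [set: nat] _ Negz); last first.
  split => //=; first by move=> m n _ _ [].
  by move=> [n|n] //= h; exists n.
 apply: nat_esum_le => // N; apply: le_trans (fM N.+1).
 by rewrite big_nat_recl//= lerDr.
Qed.
End heat_basic.

Section heat_bounds.
Context {R : realType}.
Variables (J : int -> R) (p : R -> int -> R) (gamma cJ CJ : R).
Hypotheses (H : heat J p) (g01 : 0 < gamma < 1) (cJ0 : 0 < cJ) (J0 : forall x, 0 <= J x)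
 (Jlo : forall x : int, cJ * (1 + (absz x)%:R) `^ (- (1 + gamma)) <= J x)
 (Jhi : forall x : int, J x <= CJ * (1 + (absz x)%:R) `^ (- (1 + gamma))).

Let a : R := gamma^-1.
Let g0 : 0 < gamma. by case/andP: g01. Qed.
Let g1 : gamma < 1. by case/andP: g01. Qed.
Let a0 : 0 < a. by rewrite invr_gt0. Qed.
Let ag : a * gamma = 1. by rewrite mulVf// gt_eqF. Qed.
Let ga : gamma * a = 1. by rewrite mulrC. Qed.
Let a1 : 1 < a. by rewrite invf_gt1. Qed.
Let p0 t x : 0 <= t -> 0 <= p t x. exact: (heat_ge0 H). Qed.

Let one1 : 0 < (1 : R) <= 1. by rewrite ltr01 lexx. Qed.

Lemma XE n : X (1 : R) n = 1 + n%:R. by rewrite /X mulr1. Qed.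

Lemma heat1_lo x : expR (-1) * cJ * (1 + (absz x)%:R) `^ (- (1 + gamma)) <= p 1 x.
apply: le_trans (heat_jump H x ler01); rewrite mul1r -mulrA ler_wpM2l ?expR_ge0//.
Qed.

Lemma heat1_lo_ball r x : (absz x <= r)%N ->
 expR (-1) * cJ * (1 + r%:R) `^ (- (1 + gamma)) <= p 1 x.
move=> xr; apply: le_trans (heat1_lo x); rewrite ler_wpM2l ?mulr_ge0 ?expR_ge0 ?(ltW cJ0)//.
apply: pow_leN; [by rewrite ltr_wpDr|by rewrite lerD2l ler_nat|].
by rewrite addr_ge0// ltW.
Qed.

(** The decrease of [p k 0] in one step is the mean over one jump of [p k 0 - p
    k z]. As the total mass is [1], many sites at distance of order [(p k
    0)^-1] have [p k z] well below [p k 0], and one jump reaches them with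
    probability of order [(p k 0) `^ gamma]. *)
Lemma heat_recursion (k : nat) : let v := p k%:R 0 in
 expR (-1) * cJ * 4 `^ (- (1 + gamma)) * v `^ (1 + gamma) <= v - p k.+1%:R 0.
rewrite /=; set v := p k%:R 0; have v0 : 0 < v by exact: (heat_diag_gt0 H).
have v1 : v <= 1.
 by have := heat_psum H (ler0n _ k) (s := [:: 0]) isT; rewrite big_seq1.
pose r := (Num.truncn v^-1).+1.
have rlo : v^-1 <= r%:R by rewrite ltW// truncnS_gt.
have rhi : 1 + r%:R <= 4 * v^-1.
 have : (Num.truncn v^-1)%:R <= v^-1 by rewrite truncn_le ?invr_ge0 ?ltW.
 have : 1 <= v^-1 by rewrite invf_ge1.
 by rewrite /r -natr1; lra.
clearbody r.
have m0 : 0 <= expR (-1) * cJ * (1 + r%:R) `^ (- (1 + gamma)).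
 by rewrite !mulr_ge0 ?expR_ge0 ?powR_ge0// ltW.
have := heat_decrement H (ler0n _ k) (erefl v) (rng_uniq r) m0.
rewrite -[1 + k%:R]/(1%:R + k%:R) -natrD add1n => dec; apply: le_trans (dec _); last first.
 by move=> z; rewrite mem_rng => zr; exact: heat1_lo_ball.
rewrite -!mulrA !ler_wpM2l ?expR_ge0 ?(ltW cJ0)//.
have g10 : 0 <= 1 + gamma by rewrite addr_ge0// ltW.
have r0 : (0 : R) < 1 + r%:R by rewrite ltr_wpDr.
apply: (via ((1 + r%:R) `^ (- (1 + gamma)))).
 apply: (via ((4 * v^-1) `^ (- (1 + gamma)))); last exact: pow_leN.
 rewrite powRM ?invr_ge0 ?(ltW v0)// ler_wpM2l ?powR_ge0//.
 by rewrite -[v^-1]powR_inv1 ?(ltW v0)// -powRrM mulN1r opprK.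
rewrite ler_peMr ?powR_ge0// big_split/= big_const_seq count_predT rng_size iter_addr addr0 sumrN.
have := heat_psum H (ler0n _ k) (rng_uniq r) => S1.
have : 1 <= v * r%:R by rewrite -ler_pdivrMl// mulr1.
have E2 : (2 * r).+1%:R = 2 * r%:R + 1 :> R by rewrite -natr1 natrM.
have E : v *+ (2 * r).+1 = v + 2 * (v * r%:R) by rewrite -[LHS]mulr_natr E2; ring.
by rewrite E; lra.
Qed.

(** The recursion makes [(p k 0) `^ (- gamma)] grow at least linearly. *)
Lemma heat_upper : exists2 C, 0 < C & forall t, 0 <= t -> p t 0 <= C * (1 + t) `^ (- a).
pose c := expR (-1) * cJ * 4 `^ (- (1 + gamma)).
have c0 : 0 < c by rewrite !mulr_gt0 ?expR_gt0 ?powR_gt0.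
pose e := Num.min 1 (c * gamma).
have e0 : 0 < e by rewrite lt_min ltr01 mulr_gt0.
have main (k : nat) : e * (1 + k%:R) <= (p k%:R 0) `^ (- gamma).
 elim: k => [|k IH].
  rewrite (heat_init H) eqxx addr0 mulr1 powR1.
  by rewrite ge_min lexx.
 set v := p k%:R 0 in IH *; have v0 : 0 < v by exact: (heat_diag_gt0 H).
 have w0 : 0 < p k.+1%:R 0 by exact: (heat_diag_gt0 H).
 have rec := heat_recursion k; rewrite /= -/v -/c in rec.
 have vg : 0 < v `^ gamma by rewrite powR_gt0.
 have wv : p k.+1%:R 0 <= v * (1 - c * v `^ gamma).
  move: rec; rewrite (powD _ _ v0) powRr1 ?(ltW v0)//; lra.
 have u1 : 0 <= c * v `^ gamma < 1.
  rewrite mulr_ge0 ?powR_ge0 ?(ltW c0)//= -subr_gt0.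
  by rewrite -(pmulr_rgt0 _ v0) (lt_le_trans w0).
 apply: (via ((v * (1 - c * v `^ gamma)) `^ (- gamma))); last first.
  by apply: pow_leN => //; exact: ltW.
 have u2 : 0 <= 1 - c * v `^ gamma by case/andP: u1 => _ /ltW; rewrite subr_ge0.
 rewrite (powRM _ (ltW v0) u2).
 apply: (via (v `^ (- gamma) * (1 + gamma * (c * v `^ gamma)))); last first.
  by rewrite ler_wpM2l ?powR_ge0// bernoulli_neg// ltW.
 have -> : v `^ (- gamma) * (1 + gamma * (c * v `^ gamma)) = v `^ (- gamma) + c * gamma.
  rewrite mulrDr mulr1; congr (_ + _).
  have -> : v `^ (- gamma) * (gamma * (c * v `^ gamma)) = c * gamma * (v `^ (- gamma) * v `^ gamma) by ring.
  by rewrite -powD// addNr powRr0 mulr1.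
 have : e <= c * gamma by rewrite ge_min lexx orbT.
 by rewrite -natr1; lra.
exists (2 `^ a * e `^ (- a)); first by rewrite mulr_gt0// powR_gt0.
move=> t t0; set k := Num.truncn t.
have kt : k%:R <= t by rewrite truncn_le.
have tk : 1 + t <= 2 * (1 + k%:R).
 by have := truncnS_gt t; rewrite -/k -natr1 => h; have := ler0n R k; lra.
apply: le_trans (heat_decr H (ler0n _ k) kt) _.
have v0 : 0 < p k%:R 0 by exact: (heat_diag_gt0 H).
have k0 : (0 : R) < 1 + k%:R by rewrite ltr_wpDr.
have -> : p k%:R 0 = (p k%:R 0 `^ (- gamma)) `^ (- a).
 by rewrite -powRrM mulrNN ga powRr1// ltW.
apply: (via ((e * (1 + k%:R)) `^ (- a))).
 by apply: pow_leN => //; [rewrite mulr_gt0|exact: ltW].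
rewrite (powRM _ (ltW e0) (ltW k0)) -mulrA [leRHS]mulrCA ler_wpM2l ?powR_ge0//.
by apply: pow_scale => //; [rewrite ltr_wpDr|exact: ltW].
Qed.

Lemma ln_le_pow s (x : R) : 0 < s -> 0 < x -> ln x <= s^-1 * x `^ s.
move=> s0 x0; rewrite ler_pdivlMl// -ln_powR ltW// ln_sublinear// powR_gt0//.
Qed.

Let CJ0 : 0 < CJ.
have := le_trans (Jlo 0) (Jhi 0); rewrite absz0 addr0 powR1 !mulr1.
exact: lt_le_trans.
Qed.

(** The sum of [J] beyond [l] is of order [l `^ (- gamma)]; below [l] one uses
    [ln (1 + u) <= u]. *)
Lemma glog_J : exists2 C, 0 < C & forall l, 1 <= l ->
 (\esum_x (glog l x * J x)%:E <= (C * l `^ (- gamma))%:E)%E.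
pose s := gamma / 2.
have s0 : 0 < s by rewrite divr_gt0.
have gs : 0 < gamma - s by rewrite subr_gt0 /s gtr_pMr// invf_lt1 ?ltr1n.
pose C1 := 2 / (1 - gamma) * 3 `^ (1 - gamma).
pose C2 := s^-1 * 2 `^ s * (2 `^ (1 + (gamma - s)) / (gamma - s)).
have C10 : 0 < C1 by rewrite mulr_gt0 ?powR_gt0// divr_gt0// subr_gt0.
have C20 : 0 < C2 by rewrite !mulr_gt0 ?powR_gt0 ?invr_gt0.
exists (2 * (CJ * (C1 + C2))); first by rewrite !mulr_gt0// addr_gt0.
move=> l l1; have l0 : 0 < l by exact: lt_le_trans l1.
pose w (n : nat) : R := (1 + n%:R) `^ (- (1 + gamma)).
pose f (n : nat) := ln (1 + n%:R / l) * (CJ * w n).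
have f0 n : 0 <= f n.
 rewrite mulr_ge0 ?mulr_ge0 ?powR_ge0 ?(ltW CJ0)//.
 by rewrite ln_ge0// lerDl divr_ge0// ltW.
apply: (via (\esum_x (f (absz x))%:E)%E).
 by apply: le_esum => x _; rewrite lee_fin ler_wpM2l ?glog_ge0//; exact: Jhi.
rewrite -mulrA; apply: int_esum_le => // N.
set m := (Num.truncn l).+1.
have lm : l <= m%:R by rewrite ltW// truncnS_gt.
have ml : 1 + m%:R <= 3 * l.
 have : (Num.truncn l)%:R <= l by rewrite truncn_le// ltW.
 by rewrite /m -natr1; lra.
apply: (via (\sum_(0 <= n < m + N) f n)).
 by rewrite [leRHS](cat_nat N) ?leq_addl//= lerDl sumr_ge0.
rewrite (cat_nat m) ?leq_addr//= mulrDr mulrDl; apply: lerD.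
 have gl : 0 < 1 - gamma by rewrite subr_gt0.
 have := pow_sum_low one1 m gl => S1.
 apply: (via (CJ / l * \sum_(0 <= i < m) 1 * X 1 i `^ (- (1 - (1 - gamma))))).
  rewrite mulr_sumr; apply: ler_sum => n _; rewrite mul1r XE subKr /f /w.
  have n0 : (0 : R) < 1 + n%:R by rewrite ltr_wpDr.
  have -> : (1 + n%:R : R) `^ (- gamma) = (1 + n%:R) * (1 + n%:R) `^ (- (1 + gamma)).
   rewrite -{2}[1 + n%:R](@powRr1 _ (1 + n%:R)) ?(ltW n0)// -powD//; congr powR; ring.
  have -> : CJ / l * ((1 + n%:R) * (1 + n%:R) `^ (- (1 + gamma))) =
   ((1 + n%:R) / l) * (CJ * (1 + n%:R) `^ (- (1 + gamma))) by ring.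
  rewrite ler_wpM2r ?mulr_ge0 ?powR_ge0 ?(ltW CJ0)//.
  have u0 : 0 <= n%:R / l by rewrite divr_ge0// ltW.
  apply: le_trans (le_ln1Dx _) _; first by rewrite (lt_le_trans _ u0)// oppr_lt0.
  by rewrite ler_wpM2r ?invr_ge0 ?(ltW l0)// lerDr.
 apply: (le_trans (ler_wpM2l _ S1)); first by rewrite divr_ge0// ltW.
 rewrite -!mulrA ler_wpM2l ?(ltW CJ0)// XE /C1 -?mulrA.
 have -> : l `^ (- gamma) = l^-1 * l `^ (1 - gamma).
  rewrite -powR_inv1 ?(ltW l0)// -powD//; congr powR; ring.
 have -> : 2 * ((1 - gamma)^-1 * (3 `^ (1 - gamma) * (l^-1 * l `^ (1 - gamma)))) =
   l^-1 * (2 * ((1 - gamma)^-1 * (3 * l) `^ (1 - gamma))).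
  rewrite powRM ?(ltW l0)//; ring.
 rewrite ler_wpM2l ?invr_ge0 ?(ltW l0)// ler_wpM2l// ler_wpM2l ?invr_ge0 ?(ltW gl)//.
 by apply: pow_le => //; exact: ltW.
have := pow_sum_high one1 gs (leq_addr N m) => S2.
apply: (via (CJ * (s^-1 * 2 `^ s * l `^ (- s)) * \sum_(m <= i < m + N) 1 * X 1 i `^ (- (1 + (gamma - s))))).
 rewrite mulr_sumr; apply: ler_sum_nat => n /andP[mn _].
 rewrite mul1r XE /f /w mulrCA -!mulrA ler_wpM2l ?(ltW CJ0)//.
 have n0 : (0 : R) < 1 + n%:R by rewrite ltr_wpDr.
 have -> : (1 + n%:R) `^ (- (1 + (gamma - s))) = (1 + n%:R) `^ s * (1 + n%:R) `^ (- (1 + gamma)).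
  by rewrite -powD//; congr powR; ring.
 have -> : s^-1 * (2 `^ s * (l `^ (- s) * ((1 + n%:R) `^ s * (1 + n%:R) `^ (- (1 + gamma))))) =
  s^-1 * (2 * (l^-1 * (1 + n%:R))) `^ s * (1 + n%:R) `^ (- (1 + gamma)).
  rewrite powRM ?mulr_ge0 ?invr_ge0 ?(ltW l0) ?(ltW n0)// powRM ?invr_ge0 ?(ltW l0) ?(ltW n0)//.
  by rewrite -[l^-1]powR_inv1 ?(ltW l0)// -powRrM mulN1r; ring.
 rewrite ler_wpM2r ?powR_ge0//.
 have u0 : 0 < 1 + n%:R / l by rewrite ltr_wpDr// divr_ge0// ltW.
 apply: (le_trans (ln_le_pow s0 u0)); rewrite ler_wpM2l ?invr_ge0 ?(ltW s0)//.
 apply: pow_le; [exact: ltW| |exact: ltW].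
 have : 1 <= n%:R / l by rewrite ler_pdivlMr// mul1r (le_trans lm)// ler_nat.
 have : 0 < l^-1 by rewrite invr_gt0.
 by rewrite mulrDr mulr1 [l^-1 * _]mulrC; lra.
apply: (le_trans (ler_wpM2l _ S2)).
 by rewrite !mulr_ge0 ?powR_ge0 ?invr_ge0 ?(ltW CJ0) ?(ltW s0).
rewrite XE /C2 -!mulrA ler_wpM2l ?(ltW CJ0)// ler_wpM2l ?invr_ge0 ?(ltW s0)// ler_wpM2l ?powR_ge0//.
rewrite mulrCA ler_wpM2l ?powR_ge0//.
have -> : l `^ (- gamma) = l `^ (- s) * l `^ (- (gamma - s)).
 by rewrite -powD//; congr powR; ring.
rewrite mulrCA ler_wpM2l ?invr_ge0 ?(ltW gs)// ler_wpM2l ?powR_ge0//.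
apply: pow_leN => //; last exact: ltW.
by rewrite (le_trans lm)// lerDr.
Qed.

(** The mean of [glog l] at time [t] is at most [t * C * l `^ (- gamma)] by
    subadditivity, and Markov turns this into tightness at scale [t `^ a]. *)
Lemma heat_concentration : exists2 A, 1 <= A & forall t r, 0 <= t ->
 A * (1 + t) `^ a <= r%:R -> 1 / 2 <= \sum_(x <- rng r) p t x.
have [C C0 HC] := glog_J.
exists (expR (2 * C)); first by rewrite -expR0 ler_expR mulr_ge0// ltW.
move=> t r t0 rA.
have t1 : 0 < 1 + t by rewrite ltr_wpDr.
set l := (1 + t) `^ a in rA *; have l0 : 0 < l by rewrite powR_gt0.
have l1 : 1 <= l by rewrite -[leLHS](@powRr0 _ (1 + t)) ler_powR ?lerDl// ltW.
pose g := glog l; have gr : 2 * C <= ln (1 + r%:R / l).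
 rewrite -ler_expR lnK ?posrE ?ltr_wpDr// ?divr_ge0 ?(ltW l0)//.
 by apply: le_trans (_ : r%:R / l <= _); [rewrite ler_pdivlMr|rewrite lerDr].
set L := ln (1 + r%:R / l) in gr *; have L0 : 0 < L by apply: lt_le_trans gr; rewrite mulr_gt0.
have g0' x : 0 <= g x by exact: glog_ge0.
have M : (\esum_x (g x * p t x)%:E <= C%:E)%E.
 apply: le_trans (heat_sub H t0 (glog0 l) g0' (fun x y => glog_sub x y l0)) _.
 apply: (le_trans (lee_wpmul2l _ (HC l l1))); first by rewrite lee_fin.
 rewrite lee_fin mulrCA ler_piMr ?(ltW C0)//.
 by rewrite /l -powRrM mulrN ag powR_inv1 ?(ltW t1)// ler_pdivrMr// mul1r lerDr.
have : (\esum_x (L * p t x)%:E <= \esum_x (g x * p t x)%:E +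
  (\sum_(x <- rng r) L * p t x)%:E)%E.
 apply: esum_le_add_seq.
 - exact: rng_uniq.
 - by move=> x; rewrite mulr_ge0 ?p0.
 - by move=> x _; rewrite mulr_ge0 ?p0 ?(ltW L0).
 - by move=> x _; rewrite lerDr mulr_ge0 ?p0.
 - move=> x; rewrite mem_rng -ltnNge => rx; rewrite ler_wpM2r ?p0//.
  have q z : 0 < 1 + (z%:R : R) / l by rewrite ltr_wpDr// divr_ge0// ltW.
  rewrite /L /g /glog ler_ln ?posrE ?q// lerD2l ler_wpM2r ?invr_ge0 ?(ltW l0)//.
  by rewrite ler_nat ltnW.
rewrite esumZlE ?(ltW L0)//; last by move=> x; rewrite p0.
rewrite (heat_sum H)// mule1 => /le_trans/(_ (leeD2r _ M)); rewrite -EFinD lee_fin -mulr_sumr => h.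
rewrite -(ler_pM2l L0); lra.
Qed.

(** Half of the mass sits on [O(t `^ a)] sites, none of which carries more than
    [p t 0]. *)
Lemma heat_lower : exists2 c, 0 < c & forall t, 0 <= t -> c * (1 + t) `^ (- a) <= p t 0.
have [A A1 HA] := heat_concentration.
have A0 : 0 < A by exact: lt_le_trans A1.
exists (10 * A)^-1; first by rewrite invr_gt0 mulr_gt0.
move=> t t0; have t1 : 1 <= 1 + t by rewrite lerDl.
have t10 : 0 < 1 + t by exact: lt_le_trans t1.
set l := (1 + t) `^ a; have l0 : 0 < l by rewrite powR_gt0.
have l1 : 1 <= l by rewrite -[leLHS](@powRr0 _ (1 + t)) ler_powR// ltW.
have Al : 1 <= A * l by rewrite -[1]mulr1 ler_pM.
pose r := (Num.truncn (A * l)).+1.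
have rlo : A * l <= r%:R by rewrite ltW// truncnS_gt.
have rhi : r%:R <= 2 * (A * l).
 have : (Num.truncn (A * l))%:R <= A * l by rewrite truncn_le// mulr_ge0 ?(ltW A0) ?(ltW l0).
 by rewrite /r -natr1; lra.
have h1 := HA t r t0 rlo.
have : \sum_(x <- rng r) p t x <= (2 * r).+1%:R * p t 0.
 apply: (via (\sum_(x <- rng r) p t 0)).
  by apply: ler_sum => x _; exact: (heat_le_diag H).
 by rewrite big_const_seq count_predT rng_size iter_addr addr0 mulr_natl.
rewrite -natr1 natrM => h2.
have pp : 0 <= p t 0 by rewrite p0.
have h3 : 2 * r%:R + 1 <= 5 * (A * l) by lra.
have h4 := ler_wpM2r pp h3.
rewrite powRN -/l -invfM -[leLHS]mulr1 ler_pdivrMl ?mulr_gt0//.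
by lra.
Qed.

(** Inclusion and exclusion to second order over the step at which a jump into
    [w] occurs: the first-order term minus the expected number of pairs of such
    jumps. *)
Lemma heat_one_jump (n : nat) (x : int) (m : R) (w : seq int) : uniq w -> 0 <= m ->
 (forall z, z \in w -> m <= p 1 z) ->
 n%:R * \sum_(z <- w) m * p n.-1%:R (x - z) <= p n%:R x + n%:R ^+ 2 * (m * (m *+ size w)).
move=> uw m0 mw; set G := m *+ size w; have G0 : 0 <= G by rewrite mulrn_wge0.
have mG : 0 <= m * G by rewrite mulr_ge0.
elim: n x => [|n IH] x.
 by rewrite mul0r addr_ge0 ?p0// mulr_ge0// sqr_ge0.
case: n IH => [|n] IH.
 rewrite mul1r expr1n mul1r /=.
 apply: (via (p 1 x)); last by rewrite lerDl.
 apply: (via (\sum_(z <- w) p 1 z * p 0 (x - z))).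
  by rewrite big_seq [leRHS]big_seq; apply: ler_sum => z zw; rewrite ler_wpM2r ?p0// mw.
 by apply: le_trans (heat_CK_le H x ler01 (lexx 0) uw) _; rewrite addr0.
rewrite [n.+2.-1]/=; rewrite [n.+1.-1]/= in IH.
pose N : R := n.+1%:R; have N0 : 0 <= N by [].
set T := \sum_(z <- w) m * p N (x - z).
pose U y := \sum_(z <- w) m * p n%:R (x - y - z).
have U0 y : 0 <= U y by apply: sumr_ge0 => z _; rewrite mulr_ge0 ?p0.
pose c y := p 1 y * (p N (x - y) + N ^+ 2 * (m * G)).
pose b y := m * (p N (x - y) + N ^+ 2 * (m * G) - N * U y).
have D0 y : 0 <= p N (x - y) + N ^+ 2 * (m * G) - N * U y by rewrite subr_ge0 IH.
have key : (\esum_y (p 1 y * (N * U y))%:E + (\sum_(y <- w) b y)%:E <=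
  \esum_y (c y)%:E)%E.
 apply: esum_add_seq => //.
 - by move=> y; rewrite mulr_ge0 ?p0// mulr_ge0.
 - by move=> y _; rewrite mulr_ge0.
 - move=> y /mw my; rewrite /b /c -lerBrDl -mulrBr ler_wpM2r//.
 - by move=> y; rewrite ler_wpM2l ?p0// IH.
have E1 : (\esum_y (p 1 y * (N * U y))%:E = (N * T)%:E)%E.
 transitivity (\esum_y (\sum_(z <- w) (N * m * (p 1 y * p n%:R (x - z - y)))%:E))%E.
  apply: eq_esum => y _; rewrite sumEFin /U !mulr_sumr; congr EFin.
  by apply: eq_bigr => z _; rewrite (_ : x - z - y = x - y - z); ring.
 rewrite esum_sum; last by move=> y z _ _; rewrite lee_fin !mulr_ge0 ?p0.
 rewrite /T mulr_sumr -sumEFin; apply: eq_bigr => z _.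
 rewrite esumZlE ?mulr_ge0//; last by move=> y; rewrite mulr_ge0 ?p0.
 rewrite -(heat_CK H)// -EFinM mulrA; congr (_ * p _ _)%:E.
 by rewrite /N -natr1 addrC.
have E2 : (\esum_y (c y)%:E = (p n.+2%:R x + N ^+ 2 * (m * G))%:E)%E.
 transitivity (\esum_y ((p 1 y * p N (x - y))%:E + (N ^+ 2 * (m * G) * p 1 y)%:E))%E.
  by apply: eq_esum => y _; rewrite -EFinD /c mulrDr [_ * (m * G) * _]mulrC.
 rewrite esumD; try by move=> y _; rewrite lee_fin !mulr_ge0 ?p0 ?sqr_ge0.
 rewrite -(heat_CK H)// esumZlE ?mulr_ge0 ?sqr_ge0//; last by move=> y; rewrite p0.
 by rewrite (heat_sum H)// mule1 -EFinD; congr (p _ _ + _)%:E; rewrite /N -[n.+2]add1n natrD.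
move: key; rewrite E1 E2 -EFinD lee_fin => key.
have B : T + G * (N ^+ 2 * (m * G)) - N * (m * G) <= \sum_(y <- w) b y.
 have -> : \sum_(y <- w) b y = m * (\sum_(y <- w) p N (x - y) +
   N ^+ 2 * (m * G) *+ size w - N * \sum_(y <- w) U y).
  rewrite /b -mulr_sumr !big_split/= sumrN [N * \sum_(_ <- _) _]mulr_sumr.
  by rewrite big_const_seq count_predT iter_addr addr0.
 have UG : \sum_(y <- w) U y <= G.
  rewrite /G; apply: (via (\sum_(y <- w) m)).
   apply: ler_sum => y _; rewrite /U -mulr_sumr ler_piMr//.
   rewrite -(big_map (fun z => x - y - z) xpredT (fun z => p n%:R z)).
   apply: (heat_psum H) => //; rewrite map_inj_uniq// => z z' /addrI /oppr_inj //.
  by rewrite big_const_seq count_predT iter_addr addr0.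
 have -> : T = m * \sum_(y <- w) p N (x - y) by rewrite mulr_sumr.
 rewrite mulrDr mulrDr.
 have -> : m * (N ^+ 2 * (m * G) *+ size w) = G * (N ^+ 2 * (m * G)).
  by rewrite /G -mulr_natr -[m *+ _]mulr_natr; ring.
 by rewrite lerD2l mulrN lerN2 mulrCA ler_wpM2l// ler_wpM2l.
have GG : 0 <= G * (N ^+ 2 * (m * G)) by rewrite !mulr_ge0 ?sqr_ge0.
have N2 : n.+2%:R = N + 1 :> R by rewrite /N natr1.
rewrite -/T N2.
have : (N + 1) ^+ 2 * (m * G) = N ^+ 2 * (m * G) + 2 * (N * (m * G)) + m * G by ring.
move=> ->; have : 0 <= N * (m * G) by rewrite mulr_ge0.
rewrite N2 in key; lra.
Qed.

Let far_power n (u : R) : 0 < n -> (u * n `^ a) `^ (- (1 + gamma)) = (u `^ (- (1 + gamma))) * n `^ (- a) / n \/ u < 0.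
move=> n0; case: (ltP u 0) => u0; [by right|left].
have E : (n `^ a) `^ (- (1 + gamma)) = n `^ (- a) / n.
 rewrite -powRrM mulrN mulrDr mulr1 ag opprD (powD _ _ n0); congr (_ * _).
 by rewrite powR_inv1 ?(ltW n0).
by rewrite powRM ?powR_ge0// E mulrA.
Qed.

(** One jump of size about [x], while the remaining steps stay near [0]. For
    [K] large the expected number of such jumps is at most [1 / 4], so that the
    correction in [heat_one_jump] loses at most half. *)
Lemma heat_far : exists c K, [/\ 0 < c, 1 <= K & forall (n : nat) x, (0 < n)%N ->
 K * n%:R `^ a <= (absz x)%:R -> c * n%:R * (absz x)%:R `^ (- (1 + gamma)) <= p n%:R x].
have [A A1 HA] := heat_concentration.
have A0 : 0 < A by exact: lt_le_trans A1.
pose K := 2 * A + 24 * A * cJ.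
have AcJ : 0 < A * cJ by rewrite mulr_gt0.
have K1 : 1 <= K by rewrite /K; lra.
have K0 : 0 < K by exact: lt_le_trans K1.
have g10 : 0 <= 1 + gamma by rewrite addr_ge0// ltW.
exists (expR (-1) * cJ * 3 `^ (- (1 + gamma)) / 4), K; split => //.
 by rewrite divr_gt0// !mulr_gt0 ?expR_gt0 ?powR_gt0.
move=> n x n0 nx.
have nR : 1 <= n%:R :> R by rewrite ler1n.
have nR0 : 0 < n%:R :> R by exact: lt_le_trans nR.
set l := n%:R `^ a in nx *; have l0 : 0 < l by rewrite powR_gt0.
have l1 : 1 <= l by rewrite -[leLHS](@powRr0 _ n%:R) ler_powR// ltW.
set X := (absz x)%:R : R; have X0 : 0 < X by rewrite (lt_le_trans _ nx)// mulr_gt0.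
have Al : 1 <= A * l by rewrite -[1]mulr1 ler_pM.
have [r rlo rhi] : exists2 r : nat, A * l <= r%:R & r%:R <= 2 * (A * l).
 exists (Num.truncn (A * l)).+1; first by rewrite ltW// truncnS_gt.
 have : (Num.truncn (A * l))%:R <= A * l by rewrite truncn_le// mulr_ge0 ?(ltW A0) ?(ltW l0).
 by rewrite -natr1; lra.
have rX : r%:R <= X.
 apply: (le_trans rhi); apply: le_trans nx; rewrite /K mulrDl.
 by have := mulr_gt0 AcJ l0; rewrite -!mulrA; lra.
have rXn : (r <= absz x)%N by rewrite -(ler_nat R).
have X1 : 1 <= X by rewrite (le_trans _ rX)// (le_trans _ rlo).
pose w := [seq x - y | y <- rng r].
have uw : uniq w by rewrite map_inj_uniq ?rng_uniq// => z z' /addrI /oppr_inj.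
pose m := expR (-1) * cJ * (1 + (2 * absz x)%:R) `^ (- (1 + gamma)).
have m0 : 0 <= m by rewrite !mulr_ge0 ?expR_ge0 ?powR_ge0// ltW.
have mw z : z \in w -> m <= p 1 z.
 move=> /mapP[y yr ->]; apply: heat1_lo_ball; apply: absz_sub_le rXn.
 by rewrite -mem_rng.
have := heat_one_jump n x uw m0 mw.
have -> : \sum_(z <- w) m * p n.-1%:R (x - z) = m * \sum_(y <- rng r) p n.-1%:R y.
 by rewrite big_map -mulr_sumr; congr (_ * _); apply: eq_bigr => y _; rewrite subKr.
have n1 : 1 + n.-1%:R = n%:R :> R by rewrite nat1r prednK.
have := HA n.-1%:R r (ler0n _ _); rewrite n1 => /(_ rlo) h1.
rewrite size_map rng_size => h2.
have mlo : expR (-1) * cJ * 3 `^ (- (1 + gamma)) * X `^ (- (1 + gamma)) <= m.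
 rewrite /m -!mulrA ler_wpM2l ?expR_ge0// ler_wpM2l ?(ltW cJ0)//.
 rewrite -powRM ?(ltW X0)//; apply: pow_leN => //.
 by rewrite natrM -/X; lra.
have mhi : m * n%:R * (2 * r).+1%:R <= 1 / 4.
 have h3 : (2 * r).+1%:R <= 6 * (A * l) by rewrite -natr1 natrM; lra.
 have h4 : m <= cJ * (K^-1 * n%:R `^ (- a) / n%:R).
  rewrite /m -[leRHS]mul1r -mulrA ler_pM ?expR_ge0//.
   by rewrite mulr_ge0 ?powR_ge0 ?(ltW cJ0).
  rewrite ler_wpM2l ?(ltW cJ0)//.
  apply: (via ((K * l) `^ (- (1 + gamma)))).
   apply: pow_leN => //; first by rewrite mulr_gt0.
   by apply: (le_trans nx); rewrite natrM -/X; lra.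
  case: (far_power K nR0) => [->|]; last by rewrite ltNge (ltW K0).
  rewrite ler_wpM2r ?invr_ge0 ?(ltW nR0)// ler_wpM2r ?powR_ge0//.
  rewrite opprD powD// powR_inv1 ?(ltW K0)// ler_piMr ?invr_ge0 ?(ltW K0)//.
  by rewrite powRN invf_le1 ?powR_gt0// -[leLHS](@powRr0 _ K) ler_powR// ltW.
 have h5 : m * n%:R * (2 * r).+1%:R <= cJ * (K^-1 * n%:R `^ (- a) / n%:R) * n%:R * (6 * (A * l)).
  by apply: ler_pM => //; [rewrite mulr_ge0|apply: ler_wpM2r].
 apply: (le_trans h5).
 have -> : cJ * (K^-1 * n%:R `^ (- a) / n%:R) * n%:R * (6 * (A * l)) =
   6 * (A * cJ) / K * (n%:R `^ (- a) * l) * (n%:R^-1 * n%:R) by ring.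
 rewrite mulVf ?gt_eqF// mulr1 /l -powD// addNr powRr0 mulr1.
 rewrite ler_pdivrMr// /K; lra.
have h6 : n%:R * m / 2 <= n%:R * (m * \sum_(y <- rng r) p n.-1%:R y).
 by rewrite -mulrA ler_wpM2l// ler_wpM2l//; lra.
have h7 : n%:R ^+ 2 * (m * (m *+ (2 * r).+1)) <= n%:R * m / 4.
 have -> : n%:R ^+ 2 * (m * (m *+ (2 * r).+1)) = n%:R * m * (m * n%:R * (2 * r).+1%:R).
  by rewrite -[m *+ _]mulr_natr; ring.
 have -> : n%:R * m / 4 = n%:R * m * (1 / 4) by rewrite mul1r.
 by rewrite ler_wpM2l// mulr_ge0.
have h8 := ler_wpM2l (ler0n R n) mlo.
move: h8; set q := expR (-1) * cJ * _; move=> h8.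
have -> : q / 4 * n%:R * X `^ (- (1 + gamma)) = n%:R * (q * X `^ (- (1 + gamma))) / 4 by ring.
lra.
Qed.

(** Far away this is [heat_far]. Near the diagonal the walk is sent, in time
    [n], to a distance of order [n `^ a] and back, where [heat_far] applies to
    both halves. *)
Lemma heat_link_even : exists2 c, 0 < c & forall (n : nat) x, (0 < n)%N ->
 c * (2 * n)%:R `^ (- a) * (1 + (absz x)%:R * (2 * n)%:R `^ (- a)) `^ (- 2) <= p (2 * n)%:R x.
have [c [K [c0 K1 far]]] := heat_far.
have K0 : 0 < K by exact: lt_le_trans K1.
have g10 : 0 <= 1 + gamma by rewrite addr_ge0// ltW.
pose D := K * 2 `^ a + 4 * K.
have D0 : 0 < D by rewrite addr_gt0// mulr_gt0 ?powR_gt0.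
pose c2 := K * (c * D `^ (- (1 + gamma))) ^+ 2.
have c20 : 0 < c2 by rewrite mulr_gt0// exprn_gt0// mulr_gt0// powR_gt0.
exists (Num.min c c2); first by rewrite lt_min c0.
move=> n x n0.
have nR : 1 <= n%:R :> R by rewrite ler1n.
have nR0 : 0 < n%:R :> R by exact: lt_le_trans nR.
have tn0 : (0 < 2 * n)%N by rewrite muln_gt0.
have tR : 1 <= (2 * n)%:R :> R by rewrite ler1n.
have tR0 : 0 < (2 * n)%:R :> R by exact: lt_le_trans tR.
case: (leP (K * (2 * n)%:R `^ a) (absz x)%:R) => [xfar|xnear].
 apply: le_trans (far _ _ tn0 xfar).
 set u := (absz x)%:R * (2 * n)%:R `^ (- a).
 have uK : K <= u by rewrite /u powRN ler_pdivlMr// powR_gt0.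
 have u1 : 1 <= u by exact: le_trans uK.
 have u0 : 0 < u by exact: lt_le_trans u1.
 have Xu : (absz x)%:R = u * (2 * n)%:R `^ a.
  by rewrite /u -mulrA -powD// addNr powRr0 mulr1.
 rewrite Xu; case: (far_power u tR0) => [->|]; last by rewrite ltNge (ltW u0).
 have -> : c * (2 * n)%:R * (u `^ (- (1 + gamma)) * (2 * n)%:R `^ (- a) / (2 * n)%:R) =
   c * (2 * n)%:R `^ (- a) * u `^ (- (1 + gamma)).
  by field; rewrite gt_eqF.
 rewrite -!mulrA ler_pM ?mulr_ge0 ?powR_ge0//.
 - by rewrite le_min (ltW c0) (ltW c20).
 - by rewrite ge_min lexx.
 rewrite ler_wpM2l ?powR_ge0//.
 apply: (via (u `^ (- 2))).
  by apply: pow_leN => //; rewrite lerDr.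
 apply: ler_powR => //; rewrite lerN2; have := g1; lra.
set l := n%:R `^ a; have l0 : 0 < l by rewrite powR_gt0.
have l1 : 1 <= l by rewrite -[leLHS](@powRr0 _ n%:R) ler_powR// ltW.
have Kl : 1 <= K * l by rewrite -[1]mulr1 ler_pM.
have [k klo khi] : exists2 r : nat, K * l <= r%:R & r%:R <= 2 * (K * l).
 exists (Num.truncn (K * l)).+1; first by rewrite ltW// truncnS_gt.
 have : (Num.truncn (K * l))%:R <= K * l by rewrite truncn_le// mulr_ge0 ?(ltW K0) ?(ltW l0).
 by rewrite -natr1; lra.
have near (y : nat) : K * (2 * n)%:R `^ a > y%:R -> c2 * n%:R `^ (- a) <= p (2 * n)%:R y%:Z.
 move=> ynear.
 pose ys := [seq (y + k + i)%N%:Z | i <- iota 0 k].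
 have uys : uniq ys by rewrite map_inj_uniq ?iota_uniq// => i j [] /addnI.
 rewrite natrM mulr_natl mulr2n.
 apply: le_trans (heat_CK_le H y%:Z (ler0n _ n) (ler0n _ n) uys).
 pose b := c * D `^ (- (1 + gamma)) * n%:R `^ (- a).
 have b0 : 0 <= b by rewrite !mulr_ge0 ?powR_ge0// ltW.
 have pb (z : int) : K * l <= (absz z)%:R -> (absz z)%:R <= D * l -> b <= p n%:R z.
  move=> z1 z2; apply: le_trans (far _ _ n0 z1).
  have z0 : 0 < (absz z)%:R :> R by rewrite (lt_le_trans _ z1)// mulr_gt0.
  apply: (via (c * n%:R * (D * l) `^ (- (1 + gamma)))); last first.
   by rewrite ler_wpM2l ?mulr_ge0 ?(ltW c0)// pow_leN.
  case: (far_power D nR0) => [->|]; last by rewrite ltNge (ltW D0).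
  by rewrite le_eqVlt /b; apply/orP; left; apply/eqP; field; rewrite gt_eqF.
 have l2 : (2 * n)%:R `^ a = 2 `^ a * l by rewrite natrM powRM.
 apply: (via (\sum_(z <- ys) b ^+ 2)).
  rewrite big_const_seq count_predT iter_addr addr0 size_map size_iota -[_ *+ k]mulr_natr /c2.
  have -> : K * (c * D `^ (- (1 + gamma))) ^+ 2 * n%:R `^ (- a) = b ^+ 2 * (K * l).
   rewrite /b /l; have : n%:R `^ (- a) * n%:R `^ a = 1 :> R by rewrite -powD// addNr powRr0.
   set P := n%:R `^ (- a); set Q := n%:R `^ a => PQ.
   rewrite -[P in LHS]mulr1 -PQ; ring.
  by rewrite ler_wpM2l ?sqr_ge0.
 rewrite big_seq [leRHS]big_seq; apply: ler_sum => z /mapP[i]; rewrite mem_iota add0n => /andP[_ ik] ->.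
 have ikR : i%:R <= k%:R :> R by rewrite ler_nat ltnW.
 have DE : D * l = K * (2 `^ a * l) + 4 * (K * l) by rewrite /D; ring.
 rewrite l2 in ynear.
 rewrite expr2 ler_pM//; apply: pb.
 - by rewrite (le_trans klo)// ler_nat ?absz_sub_nat ?absz_nat ?leq_addr// -addnA addnCA leq_addr.
 - rewrite absz_nat !natrD DE; lra.
 - by rewrite (le_trans klo)// ler_nat ?absz_sub_nat ?absz_nat ?leq_addr// -addnA addnCA leq_addr.
 - rewrite absz_sub_nat.
  have : 0 <= K * (2 `^ a * l) by rewrite !mulr_ge0 ?powR_ge0 ?(ltW K0) ?(ltW l0).
  by rewrite natrD DE; lra.
have -> : p (2 * n)%:R x = p (2 * n)%:R (absz x)%:Z.
 case: (leP 0 x) => x0; first by rewrite gez0_abs.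
 by rewrite (ltz0_abs x0) (heat_sym H).
apply: le_trans (near _ xnear).
rewrite -mulrA ler_pM ?mulr_ge0 ?powR_ge0//.
- by rewrite le_min (ltW c0) (ltW c20).
- by rewrite ge_min lexx orbT.
rewrite -[leRHS]mulr1 ler_pM ?powR_ge0//.
- by apply: pow_leN => //; [rewrite ler_nat leq_pmull|exact: ltW].
- rewrite [_ `^ (- 2)]powRN invf_le1 ?powR_gt0 ?ltr_wpDr ?mulr_ge0 ?powR_ge0//.
 have q : 1 <= 1 + (absz x)%:R * (2 * n)%:R `^ (- a) by rewrite lerDl mulr_ge0 ?powR_ge0.
 by rewrite -[leLHS](@powRr0 _ (1 + (absz x)%:R * (2 * n)%:R `^ (- a))) ler_powR.
Qed.

Lemma heat_link : exists2 c, 0 < c & link_bound p a c.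
have [c c0 Hc] := heat_link_even.
pose B := (2 `^ a) `^ 2 : R.
have B0 : 0 < B by rewrite powR_gt0// powR_gt0.
exists (expR (- 2) * c / B); first by rewrite divr_gt0// mulr_gt0 ?expR_gt0.
move=> t x t2; set n := Num.truncn (t / 2).
have t0 : 0 < t by exact: lt_le_trans t2.
have n0 : (0 < n)%N by rewrite truncn_gt0 ler_pdivlMr// mul1r.
have n1 : 1 <= n%:R :> R by rewrite ler1n.
have nt : (2 * n)%:R <= t.
 have : n%:R <= t / 2 by rewrite truncn_le// divr_ge0// ltW.
 by rewrite natrM; lra.
have tn : t <= (2 * n)%:R + 2.
 have := truncnS_gt (t / 2); rewrite -/n (_ : n.+1%:R = n%:R + 1 :> R) ?natr1// natrM.
 by lra.
have tt : t <= 2 * (2 * n)%:R by rewrite natrM in tn *; lra.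
have s0 : 0 <= t - (2 * n)%:R by rewrite subr_ge0.
rewrite -[t in leRHS](subrK (2 * n)%:R).
apply: le_trans (heat_step_le H x s0 (ler0n _ _)).
have nn0 : 0 < (2 * n)%:R :> R by rewrite ltr0n muln_gt0.
have ee : expR (- 2) <= expR (- (t - (2 * n)%:R)) :> R by rewrite ler_expR lerN2; lra.
apply: (via (expR (- 2) * (c * (2 * n)%:R `^ (- a) * (1 + (absz x)%:R * (2 * n)%:R `^ (- a)) `^ (- 2)))); last first.
 by rewrite ler_pM ?expR_ge0 ?mulr_ge0 ?powR_ge0 ?(ltW c0) ?Hc.
rewrite -!mulrA ler_wpM2l ?expR_ge0// ler_wpM2l ?(ltW c0)//.
rewrite mulrCA ler_pM ?mulr_ge0 ?powR_ge0 ?invr_ge0 ?(ltW B0)//.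
 by apply: pow_leN => //; exact: ltW.
rewrite ler_pdivrMl//.
apply: pow_scale => //; try by rewrite ?powR_gt0// ltr_wpDr// mulr_ge0// powR_ge0.
have h : (2 * n)%:R `^ (- a) <= 2 `^ a * t `^ (- a) by apply: pow_scale => //; exact: ltW.
rewrite mulrDr mulr1; apply: lerD.
 by rewrite -[leLHS](@powRr0 _ (2 : R)) ler_powR ?ler1n// ltW.
by rewrite mulrCA ler_wpM2l.
Qed.

(** The function [p t 0] of [t] is convex ([heat_midpoint]). Its decrease
    during the last fraction [rho] of the time [t] is therefore at most [8 *
    rho] times its total decrease from a comparable earlier time, at which it
    is at most [B * p t 0] by the two-sided bounds. *)
Lemma heat_slow : exists2 C, 0 < C & forall t rho, 0 <= t -> 0 <= rho <= 1 / 4 ->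
 p ((1 - rho) * t) 0 <= (1 + C * rho) * p t 0.
have [C1 C10 up] := heat_upper; have [c1 c10 lo] := heat_lower.
pose B := C1 * (4 `^ a) / c1.
have B0 : 0 < B by rewrite divr_gt0// mulr_gt0// powR_gt0.
exists (8 * B); first by rewrite mulr_gt0.
move=> t rho t0 /andP[r0 r4].
have quarter : p ((1 - rho) * t / 2) 0 <= B * p t 0.
 have u0 : 0 <= (1 - rho) * t / 2 by rewrite divr_ge0// mulr_ge0// subr_ge0; lra.
 apply: (le_trans (up _ u0)).
 have := ler_wpM2l (ltW B0) (lo t t0); apply: le_trans.
 rewrite /B -!mulrA ler_wpM2l ?(ltW C10)//.
 have -> : 4 `^ a * (c1^-1 * (c1 * (1 + t) `^ (- a))) = 4 `^ a * (1 + t) `^ (- a).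
  by field; rewrite gt_eqF.
 apply: pow_scale => //; [by rewrite ltr_wpDr|exact: ltW|].
 have : 0 <= (1 / 4 - rho) * t by rewrite mulr_ge0// subr_ge0.
 lra.
have [->|rn0] := eqVneq rho 0; first by rewrite subr0 mul1r mulr0 addr0 mul1r.
have rp : 0 < rho by rewrite lt_def rn0.
have [->|tn0] := eqVneq t 0.
 by rewrite mulr0 ler_peMl ?p0// lerDl mulr_ge0// mulr_ge0// ltW.
have tp : 0 < t by rewrite lt_def tn0.
pose s := (1 - rho) * t; pose d := rho * t.
have d0 : 0 < d by rewrite mulr_gt0.
have sd : s + d = t by rewrite /s /d; ring.
have s3 : 3 * d <= s.
 have : 0 <= (1 / 4 - rho) * t by rewrite mulr_ge0// subr_ge0.
 by rewrite /s /d; lra.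
(* Steps of length [d] back from [s] to a time that is at least [s / 2]. *)
pose k := Num.truncn (s / (2 * d)).
have k1 : k%:R <= s / (2 * d) by rewrite truncn_le// divr_ge0// ?mulr_ge0 ?(ltW d0)//; lra.
have k2 : s / (2 * d) < k%:R + 1 by rewrite natr1 truncnS_gt.
have {}k1 : k%:R * d <= s / 2.
 by move: k1; rewrite ler_pdivlMr ?mulr_gt0//; lra.
have {}k2 : s < (k%:R + 1) * (2 * d) by move: k2; rewrite ltr_pdivrMr ?mulr_gt0.
have kpos : 0 < k%:R :> R.
 rewrite ltr0n lt0n; apply/negP => /eqP k0; move: k2; rewrite k0 mulr0n add0r mul1r; lra.
have kr : 1 <= 8 * rho * k%:R.
 have : 0 < t * (8 * rho * k%:R - 1) + t.
  have -> : t * (8 * rho * k%:R - 1) + t = 8 * (k%:R * d) by rewrite /d; ring.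
  by rewrite mulr_gt0// mulr_gt0.
 move=> _; rewrite -(ler_pM2l tp) mulr1.
 have -> : t * (8 * rho * k%:R) = 8 * (k%:R * d) by rewrite /d; ring.
 have E : (k%:R + 1) * (2 * d) = 2 * (k%:R * d) + 2 * d by ring.
 by rewrite E in k2; lra.
pose q (j : nat) := p (s - k%:R * d + j%:R * d) 0.
have tm (j : nat) : 0 <= s - k%:R * d + j%:R * d.
 have : 0 <= j%:R * d by rewrite mulr_ge0// ltW.
 have : 0 <= s / 2 by lra.
 by lra.
have conv j : q j.+1 - q j.+2 <= q j - q j.+1.
 have h1 : 0 <= (s - k%:R * d + j%:R * d) / 2 by rewrite divr_ge0.
 have h2 : 0 <= (s - k%:R * d + j.+2%:R * d) / 2 by rewrite divr_ge0.
 have := heat_midpoint H h1 h2; rewrite -!splitr.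
 rewrite (_ : _ / 2 + _ / 2 = s - k%:R * d + j.+1%:R * d); last first.
  by rewrite -[j.+2]addn2 -[j.+1]addn1 !natrD; field.
 rewrite -/(q j) -/(q j.+1) -/(q j.+2); lra.
have conv2 i j : (i <= j)%N -> q j - q j.+1 <= q i - q i.+1.
 elim: j => [|j IH]; first by rewrite leqn0 => /eqP ->.
 rewrite leq_eqVlt => /predU1P[->//|]; rewrite ltnS => /IH; exact: le_trans.
have avg : k%:R * (q k - q k.+1) <= q 0%N - q k.
 rewrite -[leRHS]opprB -(telescope_sumr q (leq0n k)) -sumrN.
 rewrite mulr_natl (_ : _ *+ k = \sum_(0 <= i < k) (q k - q k.+1)); last by rewrite sumr_const_nat subn0.
 apply: ler_sum_nat => i /andP[_ ik].
 by rewrite opprB; apply: conv2; exact: ltnW.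
have qk : q k = p s 0 by rewrite /q subrK.
have qk1 : q k.+1 = p t 0.
 by rewrite /q -natr1 mulrDl mul1r addrA subrK sd.
have q0 : q 0%N <= B * p t 0.
 apply: le_trans quarter; rewrite /q mul0r addr0; apply: (heat_decr H).
  by rewrite -/s; lra.
 by rewrite -/s; lra.
have qkp : 0 <= q k by rewrite /q p0.
rewrite -/s -qk -qk1.
have h3 : k%:R * (q k - q k.+1) <= B * q k.+1 by rewrite -qk1 in q0; lra.
have h4 : q k - q k.+1 <= 8 * rho * (k%:R * (q k - q k.+1)).
 rewrite mulrA ler_peMl// subr_ge0 qk qk1; apply: (heat_decr H); rewrite -?sd; lra.
have h5 : 8 * rho * (k%:R * (q k - q k.+1)) <= 8 * rho * (B * q k.+1).
 by rewrite ler_wpM2l// mulr_ge0// ltW.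
have -> : (1 + 8 * B * rho) * q k.+1 = q k.+1 + 8 * rho * (B * q k.+1) by ring.
lra.
Qed.
End heat_bounds.

(** * Renewal sequences of log-convex kernels *)

Lemma leq_add_subr (n g i : nat) : (i < n)%N -> (g <= n + g - i)%N.
lia. Qed.

Lemma addSn_subn (n g i : nat) : (i < n.+1)%N -> (n.+1 + g - i = (n - i).+1 + g)%N.
lia. Qed.

Lemma addn_subn_rev (n g i : nat) : (n + g - (i + n) = g.+1 - i.+1)%N.
lia. Qed.

Lemma subn_leq_sub (m n g : nat) : (m + g <= n)%N -> (m <= n - g)%N.
lia. Qed.

Lemma solve_u {R : realFieldType} (h x B D Y : R) : 0 < h -> 0 < B -> 0 < D -> 0 < Y ->
 1 / 2 <= x * (B * (h^-1 * (D * Y))) -> (2 * (B * D))^-1 * (h * Y^-1) <= x.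
move=> h0 B0 D0 Y0 H; have P0 : 0 < 2 * (B * D) * Y / h by rewrite divr_gt0// !mulr_gt0.
rewrite -(ler_pM2l P0).
have -> : 2 * (B * D) * Y / h * ((2 * (B * D))^-1 * (h * Y^-1)) = 1 by field; rewrite !gt_eqF.
have -> : 2 * (B * D) * Y / h * x = 2 * (x * (B * (h^-1 * (D * Y)))) by ring.
lra.
Qed.

Section renewal.
Context {R : realType}.

(** A probability on the positive integers, log-convex, of polynomial order
    up to the exponential factor [expR (- phi * j * h)]. *)
Record rkernel (al C c h phi : R) (k : nat -> R) : Prop := {
 rk_hi : forall j, k j.+1 <= C * (h * X h j.+1 `^ (- (1 + al)));
 rk_lo : forall j, c * (h * X h j.+1 `^ (- (1 + al)) * expR (- (phi * (j.+1%:R * h)))) <= k j.+1;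
 rk_logconvex : forall j, k j.+2 ^+ 2 <= k j.+1 * k j.+3;
 rk_le1 : forall N, \sum_(0 <= j < N) k j.+1 <= 1;
 rk_sup : forall e, 0 < e -> exists N, 1 - e <= \sum_(0 <= j < N) k j.+1;
 rk_decay : forall j g, k (j + g).+1 <= expR (- (phi * (g%:R * h))) * k j.+1 }.

Variables (al C c h phi : R) (k : nat -> R).
Hypotheses (al01 : 0 < al < 1) (C0 : 0 < C) (c0 : 0 < c) (h01 : 0 < h <= 1)
 (phi01 : 0 < phi <= 1) (K : rkernel al C c h phi k).

Let h0 : 0 < h. by case/andP: h01. Qed.
Let h1 : h <= 1. by case/andP: h01. Qed.
Let p0 : 0 < phi. by case/andP: phi01. Qed.
Let p1 : phi <= 1. by case/andP: phi01. Qed.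
Let a0 : 0 < al. by case/andP: al01. Qed.
Let a1 : al < 1. by case/andP: al01. Qed.
Let X0 n : 0 < X h n. exact: X_gt0. Qed.
Let X1 n : 1 <= X h n. exact: X_ge1. Qed.

Lemma k_gt0 j : 0 < k j.+1.
by apply: lt_le_trans (rk_lo K j); rewrite !mulr_gt0 ?powR_gt0 ?expR_gt0.
Qed.

Definition Kbar (n : nat) : R := 1 - \sum_(0 <= j < n) k j.+1.

Lemma Kbar0 : Kbar 0 = 1.
by rewrite /Kbar big_geq// subr0. Qed.

Lemma KbarS n : Kbar n.+1 = Kbar n - k n.+1.
by rewrite /Kbar big_nat_recr//= opprD addrA. Qed.

Lemma Kbar_tail m n : (m <= n)%N -> \sum_(m <= j < n) k j.+1 <= Kbar m.
move=> mn; rewrite /Kbar lerBrDl -(cat_nat m)//; exact: (rk_le1 K).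
Qed.

Lemma Kbar_ge0 n : 0 <= Kbar n.
by have := Kbar_tail (leqnn n); rewrite big_geq. Qed.

Lemma Kbar_le m b : (forall n, (m <= n)%N -> \sum_(m <= j < n) k j.+1 <= b) -> Kbar m <= b.
move=> H; rewrite leNgt; apply/negP => bK.
have e0 : 0 < (Kbar m - b) / 2 by rewrite divr_gt0// subr_gt0.
have [N HN] := rk_sup K e0.
have : \sum_(0 <= j < N) k j.+1 <= \sum_(0 <= j < m + N) k j.+1.
 rewrite [leRHS](cat_nat N) ?leq_addl//= lerDl sumr_ge0// => i _.
 exact: ltW (k_gt0 _).
have := H (m + N)%N (leq_addr _ _).
have -> : \sum_(0 <= j < m + N) k j.+1 = \sum_(0 <= j < m) k j.+1 + \sum_(m <= j < m + N) k j.+1.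
 by rewrite [LHS](cat_nat m) ?leq_addr.
move: HN; rewrite /Kbar in bK e0 *; lra.
Qed.

Lemma Kbar_gt0 n : 0 < Kbar n.
by apply: lt_le_trans (Kbar_tail (leqnSn n)); rewrite big_nat1 k_gt0.
Qed.

Lemma Kbar_decr m n : (m <= n)%N -> Kbar n <= Kbar m.
move=> mn; rewrite /Kbar lerD2l lerN2 [leRHS](cat_nat m)//= lerDl sumr_ge0// => i _.
exact: ltW (k_gt0 _).
Qed.

Lemma k_ratio i j : k i.+2 * k (i + j).+1 <= k i.+1 * k (i + j).+2.
elim: j => [|j IH]; first by rewrite addn0 mulrC.
rewrite addnS; have z0 := k_gt0 (i + j); have x0 := k_gt0 (i + j).+1.
rewrite -(ler_pM2l z0).
have L := ler_wpM2l (ltW (k_gt0 i)) (rk_logconvex K (i + j)).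
have M := ler_wpM2r (ltW x0) IH.
have -> : k (i + j).+1 * (k i.+1 * k (i + j).+3) = k i.+1 * (k (i + j).+1 * k (i + j).+3) by ring.
apply: le_trans L; rewrite expr2 [leRHS]mulrA; apply: le_trans M.
by apply: eq_ler; ring.
Qed.

Definition hazard (n : nat) : R := k n.+1 / Kbar n.

(** A log-convex law has a decreasing failure rate, which is what makes the
    renewal sequence monotone ([age_renewal_decr]). *)
Lemma hazard_decr n : hazard n.+1 <= hazard n.
rewrite /hazard ler_pdivrMr ?Kbar_gt0// mulrAC ler_pdivlMr ?Kbar_gt0//.
rewrite -ler_pdivlMl ?k_gt0//; apply: Kbar_le => m nm.
rewrite ler_pdivlMl ?k_gt0// mulr_sumr.
have H := Kbar_tail (m := n.+1) (n := m.+1) (leq_trans nm (leqnn _)).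
apply: le_trans (ler_wpM2l (ltW (k_gt0 n)) H).
rewrite mulr_sumr big_add1 /=; apply: ler_sum_nat => j /andP[nj _].
by have := k_ratio n (j - n); rewrite subnKC.
Qed.

Lemma hazard_ge0 n : 0 <= hazard n.
by rewrite divr_ge0 ?Kbar_ge0 ?(ltW (k_gt0 _)). Qed.

Lemma hazard_le1 n : hazard n <= 1.
rewrite ler_pdivrMr ?Kbar_gt0// mul1r.
by have := Kbar_tail (leqnSn n); rewrite big_nat1.
Qed.

Lemma hazard_Kbar n : (1 - hazard n) * Kbar n = Kbar n.+1.
by rewrite mulrBl mul1r divfK ?gt_eqF ?Kbar_gt0// KbarS. Qed.

(** The probability of a renewal at time [n] when the age at time [0] is [a];
    at age [0] this is the renewal sequence. *)
Fixpoint age_renewal (n a : nat) : R :=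
 if n is n'.+1 then hazard a * age_renewal n' 0 + (1 - hazard a) * age_renewal n' a.+1
 else (a == 0%N)%:R.

Definition u (n : nat) : R := age_renewal n 0.

Lemma age_renewal_ge0 n a : 0 <= age_renewal n a.
elim: n a => [|n IH] a /=; first by case: (a == _).
by rewrite addr_ge0// mulr_ge0 ?hazard_ge0 ?subr_ge0 ?hazard_le1.
Qed.

Lemma age_renewal_decr n a b : (a <= b)%N -> age_renewal n b <= age_renewal n a.
have step n' : forall a', age_renewal n' a'.+1 <= age_renewal n' a'.
 elim: n' => [|m IH] a'; first by rewrite /=; case: (a' == _).
 have mono b' : age_renewal m b' <= age_renewal m 0.
  by elim: b' => // b' IHb; exact: le_trans (IH _) IHb.
 rewrite /=; apply: (via (hazard a'.+1 * age_renewal m 0 + (1 - hazard a'.+1) * age_renewal m a'.+1)).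
  by rewrite lerD2l ler_wpM2l// subr_ge0 hazard_le1.
 have := hazard_decr a'; have := mono a'.+1.
 set x := age_renewal m 0; set y := age_renewal m a'.+1 => xy rr.
 have : 0 <= (hazard a' - hazard a'.+1) * (x - y) by rewrite mulr_ge0// subr_ge0.
 rewrite -subr_ge0; lra.
elim: b => [|b IH]; first by rewrite leqn0 => /eqP ->.
rewrite leq_eqVlt => /predU1P[->//|]; rewrite ltnS => /IH; apply: le_trans; exact: step.
Qed.

Lemma u0 : u 0 = 1.
by []. Qed.

Lemma u_ge0 n : 0 <= u n.
exact: age_renewal_ge0. Qed.

Lemma u_decrS n : u n.+1 <= u n.
rewrite /u /=; have := age_renewal_decr n (leq0n 1).
set x := age_renewal n 0; set y := age_renewal n 1 => yx.
have : 0 <= (1 - hazard 0) * (x - y) by rewrite mulr_ge0 ?subr_ge0// hazard_le1.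
lra.
Qed.

Lemma u_decr m n : (m <= n)%N -> u n <= u m.
elim: n => [|n IH]; first by rewrite leqn0 => /eqP ->.
rewrite leq_eqVlt => /predU1P[->//|]; rewrite ltnS => /IH; apply: le_trans; exact: u_decrS.
Qed.

Lemma age_renewalE n a : (0 < n + a)%N ->
 Kbar a * age_renewal n a = \sum_(0 <= j < n) k (a + j).+1 * u (n - j.+1).
elim: n a => [|n IH] a na.
 by rewrite big_geq// /= (_ : a == _ = false) ?mulr0// eqn0Ngt; move: na; rewrite add0n => ->.
rewrite /= mulrDr mulrA [Kbar a * _]mulrC divfK ?gt_eqF ?Kbar_gt0//.
rewrite mulrA [Kbar a * _]mulrC hazard_Kbar IH ?addnS// big_nat_recl//= addn0 subn1 /=; congr (_ + _).
by apply: eq_bigr => j _; rewrite addSnnS subSS.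
Qed.

Lemma u_rec n : u n.+1 = \sum_(0 <= j < n.+1) k j.+1 * u (n - j).
by have := age_renewalE (n := n.+1) (a := 0) isT; rewrite Kbar0 mul1r. Qed.

(** The last renewal up to time [n] happens at exactly one [i]. *)
Lemma u_Kbar n : \sum_(0 <= i < n.+1) u i * Kbar (n - i) = 1.
elim: n => [|n IH]; first by rewrite big_nat1 Kbar0 u0 mulr1.
rewrite big_nat_recr//= subnn Kbar0 mulr1 -[RHS]IH.
have -> : \sum_(0 <= i < n.+1) u i * Kbar (n.+1 - i) =
  \sum_(0 <= i < n.+1) u i * Kbar (n - i) - \sum_(0 <= i < n.+1) u i * k (n - i).+1.
 rewrite -sumrB; apply: eq_big_nat => i /andP[_ iN].
 by rewrite subSn// KbarS mulrBr.
suff -> : \sum_(0 <= i < n.+1) u i * k (n - i).+1 = u n.+1 by rewrite subrK.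
by rewrite u_rec big_nat_rev/= add0n; apply: eq_big_nat => i /andP[_ iN]; rewrite subSS subKn// mulrC.
Qed.

Lemma sum_u_le n : \sum_(0 <= i < n.+1) u i <= (Kbar n)^-1.
rewrite -[leRHS]mul1r ler_pdivlMr ?Kbar_gt0// -(u_Kbar n) mulr_suml.
by apply: ler_sum => i _; rewrite ler_wpM2l ?u_ge0// Kbar_decr// leq_subr.
Qed.

(** By monotonicity of [u] and [Kbar], the smallest term of the identity
    [u_Kbar] is the product of their last values. *)
Lemma u_le n : u n * (n.+1%:R * Kbar n) <= 1.
rewrite -[leRHS](u_Kbar n) mulrCA mulr_natl -[n.+1 in leLHS]subn0 -sumr_const_nat.
apply: ler_sum_nat => i /andP[_ iN].
by apply: ler_pM; rewrite ?u_ge0 ?Kbar_ge0 ?u_decr ?Kbar_decr ?leq_subr.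
Qed.

Definition Kup : R := C * (2 `^ (1 + al) / al * 2).

Lemma Kup_gt0 : 0 < Kup.
by rewrite !mulr_gt0 ?powR_gt0 ?invr_gt0. Qed.

Lemma Kbar_hi n : Kbar n <= Kup * X h n `^ (- al).
apply: Kbar_le => m nm.
apply: (via (C * \sum_(n.+1 <= j < m.+1) h * X h j `^ (- (1 + al)))).
 by rewrite mulr_sumr big_add1 /=; apply: ler_sum => j _; exact: (rk_hi K).
apply: (le_trans (ler_wpM2l (ltW C0) (pow_sum_high h01 a0 (m := n.+1) (n := m.+1) nm))).
rewrite /Kup -!mulrA ler_wpM2l ?(ltW C0)// !ler_wpM2l ?powR_ge0 ?invr_ge0 ?(ltW a0)//.
apply: (via (X h n `^ (- al))).
 by apply: pow_leN => //; [exact: X_le|exact: ltW].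
by rewrite ler_peMl ?powR_ge0// ler1n.
Qed.

Lemma ceil_div (b : R) : 0 <= b -> exists2 g : nat, b <= g%:R * h & g%:R * h <= b + h.
move=> b0; exists (Num.truncn (b / h)).+1.
 by rewrite -ler_pdivrMr// ltW// truncnS_gt.
have : (Num.truncn (b / h))%:R <= b / h by rewrite truncn_le// divr_ge0// ltW.
by rewrite ler_pdivlMr// -natr1 mulrDl mul1r => ?; rewrite lerD2r.
Qed.

Definition Klo (Q : R) : R := c * expR (- (2 * Q + 2)) * 4 `^ (- (1 + al)).

Lemma Klo_gt0 Q : 0 < Klo Q.
by rewrite !mulr_gt0 ?powR_gt0 ?expR_gt0. Qed.

Lemma Kbar_lo Q n : n%:R * h * phi <= Q -> Klo Q * X h n `^ (- al) <= Kbar n.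
move=> nQ; have [g g1 g2] := ceil_div (ltW (X0 n)).
have XE : X h n = 1 + n%:R * h by [].
have ng : (n <= n + g)%N by rewrite leq_addr.
apply: le_trans (Kbar_tail ng).
apply: (via (\sum_(n <= j < n + g) c * (h * ((4 * X h n) `^ (- (1 + al)) * expR (- (2 * Q + 2)))))).
 rewrite sumr_const_nat addKn -[_ *+ g]mulr_natl /Klo powRM ?(ltW (X0 _))//.
 have -> : X h n `^ (- al) = X h n * X h n `^ (- (1 + al)).
  by rewrite -[X in _ = X * _]powRr1 ?(ltW (X0 _))// -powD//; congr powR; ring.
 have -> : g%:R * (c * (h * (4 `^ (- (1 + al)) * X h n `^ (- (1 + al)) * expR (- (2 * Q + 2))))) =
  c * expR (- (2 * Q + 2)) * 4 `^ (- (1 + al)) * (g%:R * h * X h n `^ (- (1 + al))) by ring.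
 rewrite ler_wpM2l ?mulr_ge0 ?powR_ge0 ?expR_ge0 ?(ltW c0)//.
 by rewrite ler_wpM2r ?powR_ge0.
apply: ler_sum_nat => j /andP[nj jg].
apply: le_trans (rk_lo K j); rewrite ler_wpM2l ?(ltW c0)// -mulrA ler_wpM2l ?(ltW h0)//.
have jh : j.+1%:R * h <= (n + g)%:R * h by rewrite ler_wpM2r ?(ltW h0)// ler_nat.
have {}jh : j.+1%:R * h <= 2 * (n%:R * h) + 2 by move: jh; rewrite natrD mulrDl; have := h1; lra.
rewrite ler_pM ?powR_ge0 ?expR_ge0//.
 apply: pow_leN => //; last by rewrite addr_ge0// ltW.
 rewrite XE /X; have : 0 <= n%:R * h by rewrite mulr_ge0// ltW.
 lra.
rewrite ler_expR lerN2.
apply: (via (phi * (2 * (n%:R * h) + 2))); first by rewrite ler_wpM2l ?(ltW p0).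
by move: p1; lra.
Qed.

Definition u_hi_const (Q : R) : R := 2 * (C + 1) / Klo Q.

Lemma u_hi Q n : (0 < n)%N -> n%:R * h * phi <= Q ->
 u n <= u_hi_const Q * (h * X h n `^ (- (1 - al))).
move=> n0 nQ; have L := Kbar_lo nQ; have L0 := Klo_gt0 Q.
have KV : (Kbar n)^-1 <= (Klo Q)^-1 * X h n `^ al.
 rewrite -[X h n `^ al]invrK -powRN -invfM lef_pV2 ?posrE ?Kbar_gt0//.
 by apply: mulr_gt0 => //; exact: powR_gt0.
have XX : X h n `^ al = X h n * X h n `^ (- (1 - al)).
 by rewrite -[X in _ = X * _]powRr1 ?(ltW (X0 _))// -powD//; congr powR; ring.
have nR : 0 < n%:R :> R by rewrite ltr0n.
have W0 : 0 <= X h n `^ (- (1 - al)) by rewrite powR_ge0.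
rewrite /u_hi_const; case: (leP 1 (n%:R * h)) => nh.
 apply: (via (n%:R^-1 * (Kbar n)^-1)).
  rewrite -invfM -[leRHS]mul1r ler_pdivlMr ?mulr_gt0 ?Kbar_gt0//.
  apply: le_trans (u_le n); rewrite ler_wpM2l ?u_ge0// ler_wpM2r ?Kbar_ge0// ler_nat//.
 apply: (via (n%:R^-1 * ((Klo Q)^-1 * X h n `^ al))); first by rewrite ler_wpM2l ?invr_ge0.
 rewrite XX.
 have -> : n%:R^-1 * ((Klo Q)^-1 * (X h n * X h n `^ (- (1 - al)))) =
   (Klo Q)^-1 * X h n `^ (- (1 - al)) * (X h n / n%:R) by ring.
 have -> : 2 * (C + 1) / Klo Q * (h * X h n `^ (- (1 - al))) =
   (Klo Q)^-1 * X h n `^ (- (1 - al)) * (2 * (C + 1) * h) by ring.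
 rewrite ler_wpM2l ?mulr_ge0 ?invr_ge0 ?(ltW L0)// ler_pdivrMr//.
 rewrite /X; have := mulr_ge0 (ltW C0) (mulr_ge0 (ler0n R n) (ltW h0)); lra.
case: n n0 nQ L KV XX nR W0 nh => // n _ nQ L KV XX nR W0 nh.
rewrite u_rec.
apply: (via (C * h * \sum_(0 <= j < n.+1) u (n - j))).
 rewrite mulr_sumr; apply: ler_sum => j _; rewrite ler_wpM2r ?u_ge0//.
 apply: le_trans (rk_hi K j) _; rewrite ler_wpM2l ?(ltW C0)// ler_piMr ?(ltW h0)//.
 rewrite powRN invf_le1 ?powR_gt0// -[leLHS](@powRr0 _ (X h j.+1)) ler_powR// addr_ge0// (ltW a0)//.
have -> : \sum_(0 <= j < n.+1) u (n - j) = \sum_(0 <= i < n.+1) u i.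
 by rewrite [RHS]big_nat_rev/= add0n; apply: eq_bigr => i _; rewrite subSS.
have S1 : \sum_(0 <= i < n.+1) u i <= (Kbar n.+1)^-1.
 apply: le_trans (sum_u_le n.+1); rewrite [leRHS]big_nat_recr//= lerDl; exact: u_ge0.
apply: (via (C * h * ((Klo Q)^-1 * X h n.+1 `^ al))).
 by rewrite ler_wpM2l ?mulr_ge0 ?(ltW C0) ?(ltW h0)// (le_trans S1).
rewrite XX.
have -> : C * h * ((Klo Q)^-1 * (X h n.+1 * X h n.+1 `^ (- (1 - al)))) =
  (Klo Q)^-1 * X h n.+1 `^ (- (1 - al)) * h * (C * X h n.+1) by ring.
have -> : 2 * (C + 1) / Klo Q * (h * X h n.+1 `^ (- (1 - al))) =
  (Klo Q)^-1 * X h n.+1 `^ (- (1 - al)) * h * (2 * (C + 1)) by ring.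
rewrite ler_wpM2l ?mulr_ge0 ?invr_ge0 ?(ltW L0) ?(ltW h0)//.
have X2 : X h n.+1 <= 2 by rewrite /X; lra.
by have := ler_wpM2l (ltW C0) X2; lra.
Qed.

Lemma sum_Kbar_hi g : \sum_(0 <= m < g.+1) Kbar m <= Kup * (2 / (1 - al)) * (h^-1 * (2 * X h g) `^ (1 - al)).
have b0 : 0 < 1 - al by rewrite subr_gt0.
have := pow_sum_low h01 g.+1 b0; rewrite subKr -mulr_sumr => S1.
apply: (via (Kup * \sum_(0 <= m < g.+1) X h m `^ (- al))).
 by rewrite mulr_sumr; apply: ler_sum => m _; exact: Kbar_hi.
rewrite -[leRHS]mulrA ler_wpM2l ?(ltW Kup_gt0)//.
rewrite mulrCA ler_pdivlMl//; apply: (le_trans S1).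
rewrite ler_wpM2l ?divr_ge0 ?(ltW b0)//; apply: pow_le; [exact: ltW| |exact: ltW].
exact: XS_le.
Qed.

Lemma u_split n g : \sum_(0 <= i < n) u i * Kbar (n + g - i) <= 1 / 2 ->
 1 / 2 <= u n * \sum_(0 <= m < g.+1) Kbar m.
move=> H1; have := u_Kbar (n + g).
rewrite (cat_nat n)//=; last by rewrite -addnS leq_addr.
move=> E; suff : \sum_(n <= i < (n + g).+1) u i * Kbar (n + g - i) <= u n * \sum_(0 <= m < g.+1) Kbar m by lra.
rewrite mulr_sumr -{1}[n]add0n big_addn -addnS addKn [leRHS]big_nat_rev/= add0n.
apply: ler_sum_nat => i /andP[_ ig].
have -> : (n + g - (i + n) = g.+1 - i.+1)%N by exact: addn_subn_rev.
by rewrite ler_wpM2r ?Kbar_ge0// u_decr// leq_addl.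
Qed.

Definition u_lo_const (Q : R) : R :=
 let A := (2 * Kup / Klo Q) `^ (al^-1) in
 (2 * (Kup * (2 / (1 - al)) * (2 * (A + 2)) `^ (1 - al)))^-1.

Lemma u_lo_const_gt0 Q : 0 < u_lo_const Q.
rewrite invr_gt0 !mulr_gt0 ?Kup_gt0 ?invr_gt0 ?subr_gt0// powR_gt0// mulr_gt0//.
by rewrite ltr_wpDl// powR_ge0.
Qed.

(** At distance [g = A * n] the tail is so small that renewals before [n]
    contribute at most half to [u_Kbar]; the rest is bounded by [u n] times a
    sum of tails. *)
Lemma u_lo Q n : n%:R * h * phi <= Q -> u_lo_const Q * (h * X h n `^ (- (1 - al))) <= u n.
move=> nQ; have L := Kbar_lo nQ; have L0 := Klo_gt0 Q; have U0 := Kup_gt0.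
(* The tail beyond [A * X h n] is at most half of the tail at [n]. *)
pose A := (2 * Kup / Klo Q) `^ (al^-1).
have A0 : 0 < A by rewrite powR_gt0// divr_gt0// mulr_gt0.
have [g g1 g2] := ceil_div (mulr_ge0 (ltW A0) (ltW (X0 n))).
have b0 : 0 < 1 - al by rewrite subr_gt0.
have H1 : \sum_(0 <= i < n) u i * Kbar (n + g - i) <= 1 / 2.
 apply: (via ((Kbar n)^-1 * Kbar g)).
  apply: (via (\sum_(0 <= i < n.+1) u i * Kbar g)).
   apply: (via (\sum_(0 <= i < n) u i * Kbar g)); last first.
    by rewrite [leRHS]big_nat_recr//= lerDl mulr_ge0 ?u_ge0 ?Kbar_ge0.
   apply: ler_sum_nat => i /andP[_ iN].
   by rewrite ler_wpM2l ?u_ge0// Kbar_decr// leq_add_subr.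
  by rewrite -mulr_suml ler_wpM2r ?Kbar_ge0// sum_u_le.
 rewrite mulrC ler_pdivrMr ?Kbar_gt0//; apply: (le_trans (Kbar_hi g)).
 apply: (via (Kup * (A * X h n) `^ (- al))).
  rewrite ler_wpM2l ?(ltW U0)//; apply: pow_leN; [by rewrite mulr_gt0| |exact: ltW].
  by apply: (le_trans g1); rewrite lerDr.
 have -> : Kup * (A * X h n) `^ (- al) = Klo Q / 2 * X h n `^ (- al).
  rewrite powRM ?(ltW A0) ?(ltW (X0 _))// mulrA; congr (_ * _).
  have q0 : 0 < 2 * Kup / Klo Q by rewrite divr_gt0// mulr_gt0.
  rewrite /A -powRrM mulrN mulVf ?gt_eqF// powR_inv1 ?(ltW q0)//.
  by field; rewrite !gt_eqF.
 by have := ler_wpM2l (ler0n R 1) L; lra.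
have := u_split H1; have S := sum_Kbar_hi g.
move=> /le_trans/(_ (ler_wpM2l (u_ge0 n) S)) H2.
have Xg : X h g <= (A + 2) * X h n.
 rewrite {1}/X mulrDl; have := X1 n; have := h1; lra.
have BB : 0 < Kup * (2 / (1 - al)) by apply: mulr_gt0 => //; exact: divr_gt0.
have H3 : 1 / 2 <= u n * (Kup * (2 / (1 - al)) * (h^-1 * (2 * (A + 2) * X h n) `^ (1 - al))).
 apply: (le_trans H2); rewrite ler_wpM2l ?u_ge0// ler_wpM2l ?(ltW BB)//.
 rewrite ler_wpM2l ?invr_ge0 ?(ltW h0)//; apply: pow_le; [by rewrite mulr_ge0 ?(ltW (X0 _))| |exact: ltW].
 by rewrite -mulrA ler_wpM2l.
rewrite /u_lo_const -/A.
set B := Kup * (2 / (1 - al)) in BB H3 *.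
have D0 : 0 < (2 * (A + 2)) `^ (1 - al) by rewrite powR_gt0// mulr_gt0// addr_gt0.
have A2 : 0 <= 2 * (A + 2) by rewrite mulr_ge0// addr_ge0// ltW.
move: H3; rewrite (powRM _ A2 (ltW (X0 n))).
set D := (2 * (A + 2)) `^ _ in D0 *; rewrite powRN.
have Y0 : 0 < X h n `^ (1 - al) by rewrite powR_gt0.
set Y := X h n `^ _ in Y0 *; exact: solve_u.
Qed.

Definition u_all_const : R := (2 * (Kup * (2 / (1 - al)) * 6 `^ (1 - al)))^-1.

Lemma u_all_const_gt0 : 0 < u_all_const.
by rewrite invr_gt0 !mulr_gt0 ?Kup_gt0 ?invr_gt0 ?subr_gt0 ?powR_gt0.
Qed.

Lemma Kbar_half m g : 1 <= phi * (g%:R * h) -> Kbar (m + g) <= Kbar m / 2.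
move=> g1; apply: Kbar_le => n mn.
apply: (via (expR (- (phi * (g%:R * h))) * Kbar m)).
 apply: (via (expR (- (phi * (g%:R * h))) * \sum_(m <= j < n - g) k j.+1)); last first.
  by rewrite ler_wpM2l ?expR_ge0// Kbar_tail// subn_leq_sub.
 rewrite big_addn mulr_sumr; apply: ler_sum => j _; exact: (rk_decay K).
rewrite mulrC ler_wpM2l ?Kbar_ge0// expRN lef_pV2 ?posrE ?expR_gt0//.
by apply: le_trans (expR_ge1Dx _); lra.
Qed.

(** As in [u_lo], with [g] of the order of the correlation length, where the
    tail is reduced by a factor [2]: beyond this scale the density no longer
    decreases. *)
Lemma u_all n : u_all_const * (h * phi `^ (1 - al)) <= u n.
have b0 : 0 < 1 - al by rewrite subr_gt0.
have U0 := Kup_gt0.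
have pV : 0 <= phi^-1 by rewrite invr_ge0 ltW.
have [g g1 g2] := ceil_div pV.
have gp : 1 <= phi * (g%:R * h) by rewrite -ler_pdivrMl// mulr1.
have H1 : \sum_(0 <= i < n) u i * Kbar (n + g - i) <= 1 / 2.
 case: n => [|n]; first by rewrite big_geq.
 apply: (via ((\sum_(0 <= i < n.+1) u i * Kbar (n - i)) / 2)); last by rewrite u_Kbar.
 rewrite mulr_suml; apply: ler_sum_nat => i /andP[_ iN]; rewrite -mulrA ler_wpM2l ?u_ge0//.
 have -> : (n.+1 + g - i = (n - i).+1 + g)%N by exact: addSn_subn.
 by apply: le_trans (Kbar_half _ gp) _; rewrite ler_wpM2r// Kbar_decr.
have := u_split H1; have S := sum_Kbar_hi g.
move=> /le_trans/(_ (ler_wpM2l (u_ge0 n) S)) H2.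
have Xg : 2 * X h g <= 6 * phi^-1.
 have : 1 <= phi^-1 by rewrite invf_ge1.
 by rewrite /X; have := h1; lra.
have BB : 0 < Kup * (2 / (1 - al)) by apply: mulr_gt0 => //; exact: divr_gt0.
have H3 : 1 / 2 <= u n * (Kup * (2 / (1 - al)) * (h^-1 * (6 * phi^-1) `^ (1 - al))).
 apply: (le_trans H2); rewrite ler_wpM2l ?u_ge0// ler_wpM2l ?(ltW BB)//.
 by rewrite ler_wpM2l ?invr_ge0 ?(ltW h0)//; apply: pow_le => //; [rewrite mulr_ge0 ?(ltW (X0 _))|exact: ltW].
rewrite /u_all_const.
set B := Kup * (2 / (1 - al)) in BB H3 *.
move: H3; rewrite (powRM _ _ pV)//.
have -> : phi^-1 `^ (1 - al) = (phi `^ (1 - al))^-1.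
 by rewrite -[phi^-1]powR_inv1 ?(ltW p0)// -powRrM mulN1r powRN.
move=> H3; have V0 : 0 < (phi `^ (1 - al))^-1 by rewrite invr_gt0 powR_gt0.
have S0 : 0 < 6 `^ (1 - al) :> R by rewrite powR_gt0.
by have := solve_u h0 BB S0 V0 H3; rewrite invrK.
Qed.
End renewal.

(** * Volterra recursions *)

Section volterra.
Context {R : realType}.
Implicit Types (K : nat -> nat -> R) (f S : nat -> R) (d i j m : nat).

(** The solution of [V i = f i + \sum_(i < j < d) K i j * V j], computed by
    iterating the equation as often as there are indices left. *)
Fixpoint volt_iter K f d m i : R :=
 f i + if m is m'.+1 then \sum_(i.+1 <= j < d) K i j * volt_iter K f d m' j else 0.

Definition volt K f d i := volt_iter K f d (d - i) i.

Lemma volt_iter_stable K f d m m' i : (d - i <= m)%N -> (d - i <= m')%N ->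
 volt_iter K f d m i = volt_iter K f d m' i.
elim: m m' i => [|m IH] [|m'] i im im' //=; congr (_ + _).
- by rewrite big_geq// leqW// -subn_eq0 -leqn0.
- by rewrite big_geq// leqW// -subn_eq0 -leqn0.
apply: eq_big_nat => j /andP[ij jd]; congr (_ * _).
by apply: IH; rewrite -ltnS (leq_trans _ im, leq_trans _ im')// ltn_sub2l// (ltn_trans ij).
Qed.

Lemma voltE K f d i : volt K f d i = f i + \sum_(i.+1 <= j < d) K i j * volt K f d j.
rewrite {1}/volt (@volt_iter_stable K f d (d - i) (d - i).+1)//=; congr (_ + _).
apply: eq_big_nat => j /andP[ij jd].
by congr (_ * _); apply: volt_iter_stable => //; exact: leq_sub2l (ltnW ij).
Qed.

Lemma backward_ind (P : nat -> Prop) d :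
 (forall i, (forall j, (i < j < d)%N -> P j) -> P i) -> forall i, P i.
move=> H i; have [n] := ubnP (d - i); elim: n i => // n IH i; rewrite ltnS => din.
apply: H => j /andP[ij jd]; apply: IH; apply: leq_trans din.
by rewrite ltn_sub2l// (ltn_trans ij).
Qed.

Lemma volt_le K f d S : (forall i j, 0 <= K i j) ->
 (forall i, f i + \sum_(i.+1 <= j < d) K i j * S j <= S i) ->
 forall i, volt K f d i <= S i.
move=> K0 HS; apply: (@backward_ind _ d) => i IH; rewrite voltE; apply: le_trans (HS i).
rewrite lerD2l; apply: ler_sum_nat => j ij.
by rewrite ler_wpM2l// IH.
Qed.

Lemma volt_ge0 K f d : (forall i j, 0 <= K i j) -> (forall i, 0 <= f i) ->
 forall i, 0 <= volt K f d i.
move=> K0 f0; apply: (@backward_ind _ d) => i IH; rewrite voltE addr_ge0// big_nat_cond.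
by apply: sumr_ge0 => j /andP[ij _]; rewrite mulr_ge0// IH.
Qed.
End volterra.

Lemma triangle_sum {R : nmodType} (m n : nat) (F : nat -> nat -> R) :
 \sum_(m <= x < n) \sum_(m <= j < x.+1) F x j = \sum_(m <= j < n) \sum_(j <= x < n) F x j.
transitivity (\sum_(m <= x < n) \sum_(m <= j < n | (j <= x)%N) F x j).
 apply: eq_big_nat => x /andP[mx xn].
 by rewrite (big_nat_widen _ _ n).
transitivity (\sum_(m <= j < n) \sum_(m <= x < n | (j <= x)%N) F x j).
 by rewrite (exchange_big_dep xpredT).
apply: eq_big_nat => j /andP[mj jn].
by rewrite [RHS](big_nat_widenl _ m).
Qed.

(** * Green sums of two replicas *)

Lemma two_r_le (q r : nat) : (4 < q)%N -> (2 * r <= 3 * ((q - 1) * r))%N.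
nia. Qed.

Lemma window_size (q r : nat) : (4 < q)%N -> ((q - 1) * r - (q - 2) * r = r)%N.
by move=> q4; rewrite -mulnBl (_ : q - 1 - (q - 2) = 1)%N ?mul1n//; lia. Qed.

Lemma sub_dist (b j : nat) : (b < j)%N -> (j - b = (j - b) + (b - j))%N.
lia. Qed.

Lemma four_r (r a : nat) : (a < 2 * r)%N -> (2 * r + a.+1 <= 4 * r)%N.
lia. Qed.

Lemma three_le (a b D H : nat) : (b < D)%N -> (H <= D)%N -> (b + ((b - a) + H) <= 3 * D)%N.
lia. Qed.

Lemma dist_add_sub (a b n : nat) : (a <= b)%N -> dist a (n + b) = (b - a + n)%N.
rewrite /dist; lia. Qed.

Lemma shift_sub (a b n : nat) : (a <= b)%N -> (n + b.+1 - a = (b - a + n).+1)%N.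
lia. Qed.

Lemma gn_le (a b n D : nat) : (b <= D)%N -> (n < D - b.+1)%N -> ((b - a + n).+1 <= 3 * D)%N.
lia. Qed.

Lemma windows_in (q r i : nat) : (4 < q)%N -> (0 < r)%N -> (i < 2 * r)%N -> (i < (q - 2) * r)%N.
nia. Qed.

Section pair_green.
Context {R : realType}.
Variables (al Ck ck : R) (q : nat).
Hypotheses (al01 : 0 < al < 1 / 2) (Ck0 : 0 < Ck) (ck0 : 0 < ck) (q4 : (4 < q)%N).

Variables (H r : nat) (phi : R) (kap : nat -> R).
Hypothesis H0 : (0 < H)%N.
Let h : R := H%:R^-1.
Hypotheses (phi01 : 0 < phi <= 1) (Kk : rkernel al Ck ck h phi kap)
 (phil : 1 <= phi * (r%:R * h) <= 2).

Let a0 : 0 < al. by case/andP: al01. Qed.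
Let a2 : al < 1 / 2. by case/andP: al01. Qed.
Let al1 : 0 < al < 1. by rewrite a0 (lt_trans a2)// ltr_pdivrMr// mul1r ltr1n. Qed.
Let h0 : 0 < h. by rewrite invr_gt0 ltr0n. Qed.
Let h01 : 0 < h <= 1. by rewrite h0 invf_le1 ?ltr0n// ler1n. Qed.
Let Hh : H%:R * h = 1. by rewrite divff// pnatr_eq0 -lt0n. Qed.
Let p0 : 0 < phi. by case/andP: phi01. Qed.
Let p1 : phi <= 1. by case/andP: phi01. Qed.
Let X0 n : 0 < X h n. exact: X_gt0. Qed.
Let X1 n : 1 <= X h n. exact: X_ge1. Qed.

Let l1 : 1 <= r%:R * h.
case/andP: phil => + _ => L; apply: (le_trans L).
by rewrite ler_piMl// mulr_ge0// ltW.
Qed.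

Let r0 : (0 < r)%N.
by rewrite lt0n; apply/eqP => rE; move: l1; rewrite rE mul0r ler10. Qed.
Let Hr : (H <= r)%N.
by have := l1; rewrite -{1}Hh ler_pM2r// ler_nat. Qed.

Let C : nat := ((q - 2) * r)%N.
Let D : nat := ((q - 1) * r)%N.
Let D' : nat := (3 * D)%N.
Let Q : R := 6 * q%:R.

Let uu := u kap.
Definition growth (n : nat) : R := expR (phi * (n%:R * h)).
(** The kernel before tilting: [growth] undoes the factor that makes [kap] a
    probability. Up to [D] the two differ only by bounded factors. *)
Definition kk (n : nat) : R := kap n * growth n.
Definition ff (n : nat) : R := uu n * growth n.

Lemma growthD m n : growth (m + n) = growth m * growth n.
by rewrite /growth natrD mulrDl mulrDr expRD. Qed.

Lemma growth_ge1 n : 1 <= growth n.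
by rewrite -expR0 ler_expR mulr_ge0 ?(ltW p0)// mulr_ge0// ltW. Qed.

Let D'Q n : (n <= D')%N -> n%:R * h * phi <= Q.
move=> nD; have : (n%:R : R) <= 3 * q%:R * r%:R.
 by rewrite -!natrM ler_nat (leq_trans nD)// /D' /D mulnA leq_mul// leq_mul// leq_subr.
move=> /(ler_wpM2r (ltW h0))/(ler_wpM2r (ltW p0)) /le_trans; apply.
have -> : 3 * q%:R * r%:R * h * phi = 3 * q%:R * (phi * (r%:R * h)) by ring.
rewrite /Q; have -> : 6 * q%:R = 3 * q%:R * 2 :> R by ring.
by rewrite ler_wpM2l ?mulr_ge0//; case/andP: phil.
Qed.

Let gE : R := expR Q.
Let gE1 : 1 <= gE. by rewrite -expR0 ler_expR /Q mulr_ge0. Qed.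
Lemma growth_le n : (n <= D')%N -> growth n <= gE.
by move=> /D'Q; rewrite ler_expR mulrC. Qed.

Lemma kk_ge0 n : 0 <= kk n.+1.
by rewrite mulr_ge0 ?expR_ge0// ltW// (k_gt0 ck0 h01 Kk). Qed.

Lemma ff0 : ff 0 = 1.
by rewrite /ff /growth mul0r mulr0 expR0 mulr1. Qed.

Lemma ff_ge0 n : 0 <= ff n.
by rewrite mulr_ge0 ?expR_ge0// (u_ge0 ck0 h01 Kk). Qed.

Lemma ff_rec n : ff n.+1 = \sum_(0 <= j < n.+1) kk j.+1 * ff (n - j).
rewrite /ff /uu (u_rec ck0 h01 Kk) mulr_suml; apply: eq_big_nat => j /andP[_ jn].
have -> : growth n.+1 = growth j.+1 * growth (n - j) by rewrite -growthD addSn subnKC.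
by rewrite /kk; ring.
Qed.

Definition f_hi : R := u_hi_const al Ck ck Q * gE + gE.

Lemma f_hi_gt0 : 0 < f_hi.
rewrite ltr_wpDl ?expR_gt0//; apply: mulr_ge0; last exact: expR_ge0.
apply: divr_ge0; first by rewrite mulr_ge0// addr_ge0// ltW.
by apply: ltW; exact: Klo_gt0.
Qed.

Let W b n : R := X h n `^ (- b).
Let W0 b n : 0 <= W b n. exact: powR_ge0. Qed.

Lemma ff_hi n : (n <= D')%N -> ff n <= (n == 0%N)%:R + f_hi * (h * W (1 - al) n).
move=> nD; case: n nD => [|n] nD.
 by rewrite ff0 eqxx lerDl mulr_ge0 ?(ltW f_hi_gt0)// mulr_ge0// ltW.
rewrite eqn0Ngt /= add0r /ff mulrC.
have hu := u_hi al1 Ck0 ck0 h01 phi01 Kk (isT : (0 < n.+1)%N) (D'Q nD).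
have := ler_pM (expR_ge0 _) (u_ge0 ck0 h01 Kk n.+1) (growth_le nD) hu.
move=> hh; apply: (via (gE * u_hi_const al Ck ck Q * (h * W (1 - al) n.+1))).
 by rewrite -[leRHS]mulrA; exact: hh.
apply: ler_wpM2r.
 by rewrite mulr_ge0 ?powR_ge0// ltW.
by rewrite /f_hi [gE * _]mulrC lerDl; exact: expR_ge0.
Qed.

Definition f_lo : R := u_lo_const al Ck ck Q.

Lemma f_lo_gt0 : 0 < f_lo.
exact: u_lo_const_gt0. Qed.

Lemma ff_lo n : (n <= D')%N -> f_lo * (h * W (1 - al) n) <= ff n.
move=> nD; apply: le_trans (u_lo al1 Ck0 ck0 h01 phi01 Kk (D'Q nD)) _.
by rewrite ler_peMr ?growth_ge1// (u_ge0 ck0 h01 Kk).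
Qed.

Definition k_hi : R := Ck * gE.

Lemma kk_hi n : (n.+1 <= D')%N -> kk n.+1 <= k_hi * (h * W (1 + al) n.+1).
move=> nD; rewrite /kk /k_hi mulrAC.
apply: ler_pM; rewrite ?expR_ge0 ?growth_le ?(rk_hi Kk)//.
exact: ltW (k_gt0 ck0 h01 Kk _).
Qed.

(** Half of the room left by [al < 1 / 2]: the interaction must decay like [W
    (2 * al + kp)] with an exponent less than [1] to be summable twice against
    renewal densities. *)
Definition kp : R := 1 / 2 - al.

Let kp0 : 0 < kp. by rewrite subr_gt0. Qed.

(** The exponents add up to more than [1] exactly if [B > al]; each application
    of the Green sum thus lowers the exponent by [al]. *)
Lemma ff_conv b x B : (b <= D')%N -> (x <= D')%N -> al < B -> B < 1 ->
 \sum_(b <= z < D') ff (z - b) * W B (dist x z) <=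
  (1 + f_hi * (4 * (conv_const (1 - al) (B - al) + conv_const B (B - al)))) * W (B - al) (dist x b).
move=> bD xD aB B1; have F0 := f_hi_gt0.
apply: (via (\sum_(b <= z < D') ((z == b)%:R * W B (dist x z) +
  f_hi * (h * (X h (dist z b) `^ (- (1 - al)) * X h (dist z x) `^ (- B)))))).
 apply: ler_sum_nat => z /andP[bz zD].
 have zb : (z - b <= D')%N by rewrite (leq_trans (leq_subr _ _))// ltnW.
 apply: le_trans (ler_wpM2r (W0 _ _) (ff_hi zb)) _.
 rewrite mulrDl subn_eq0 eqn_leq bz andbT lerD2l.
 have -> : dist z b = (z - b)%N by rewrite /dist (eqP (_ : (b - z == 0)%N)) ?addn0// subn_eq0.
 have -> : dist z x = dist x z by rewrite /dist addnC.
 by apply: eq_ler; rewrite /W; ring.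
rewrite big_split/= mulrDl mul1r; apply: lerD.
 case: (ltnP b D') => bD'; last by rewrite big_geq.
 rewrite big_ltn// eqxx mul1r big_nat_cond big1 ?addr0.
  apply: ler_powR; [exact: X1|rewrite lerN2; have := a0; lra].
 by move=> z /andP[/andP[bz _] _]; rewrite gtn_eqF// mul0r.
rewrite -mulr_sumr -mulrA ler_wpM2l ?(ltW F0)//.
have b1 : 0 <= 1 - al < 1 by rewrite subr_ge0 ltrBlDr ltrDl a0 andbT; have := a2; lra.
have b2 : 0 <= B < 1 by rewrite B1 andbT (le_trans (ltW a0))// ltW.
have c0 : 0 < B - al by rewrite subr_gt0.
have cE : B - al = (1 - al) + B - 1 by ring.
have := conv_two_sided h01 D' b x b1 b2 c0 cE.
have -> : dist b x = dist x b by rewrite /dist addnC.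
apply: le_trans; rewrite [leRHS](cat_nat b)//= lerDr sumr_ge0// => z _.
by rewrite mulr_ge0 ?(ltW h0)// mulr_ge0 ?powR_ge0.
Qed.

Let B0 : R := 2 * al + kp.
Let B01 : B0 < 1. rewrite /B0 /kp; have := a2; lra. Qed.

(** The Green function of two independent replicas started at [a] and [b],
    applied to an interaction decaying like a power of their distance. *)
Definition pair_sum (a b : nat) : R :=
 \sum_(a <= x < D') \sum_(b <= z < D') ff (x - a) * (ff (z - b) * W B0 (dist x z)).

Definition cc1 : R := 1 + f_hi * (4 * (conv_const (1 - al) (al + kp) + conv_const B0 (al + kp))).
Definition cc2 : R := 1 + f_hi * (4 * (conv_const (1 - al) kp + conv_const (al + kp) kp)).

Lemma pair_sum_ge0 a b : 0 <= pair_sum a b.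
apply: sumr_ge0 => x _; apply: sumr_ge0 => z _.
by rewrite mulr_ge0 ?ff_ge0// mulr_ge0 ?ff_ge0//; exact: W0. Qed.

Lemma pair_sum_hi a b : (a <= D')%N -> (b <= D')%N -> pair_sum a b <= cc1 * cc2 * W kp (dist a b).
move=> aD bD.
have c10 : 0 <= cc1.
 have q1 : 0 < conv_const (1 - al) (al + kp).
  by apply: conv_const_gt0; have := a0; have := kp0; lra.
 have q2 : 0 < conv_const B0 (al + kp).
  by apply: conv_const_gt0 => //; have := a0; have := kp0; lra.
 by rewrite addr_ge0// mulr_ge0 ?(ltW f_hi_gt0)// mulr_ge0// addr_ge0// ltW.
apply: (via (\sum_(a <= x < D') ff (x - a) * (cc1 * W (al + kp) (dist b x)))).
 apply: ler_sum_nat => x /andP[ax xD].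
 rewrite -mulr_sumr ler_wpM2l ?ff_ge0//.
 have := @ff_conv b x B0 bD (ltnW xD) _ B01.
 have -> : B0 - al = al + kp by rewrite /B0; ring.
 have -> : dist b x = dist x b by rewrite /dist addnC.
 by apply; rewrite /B0; have := a0; have := kp0; lra.
have -> : \sum_(a <= x < D') ff (x - a) * (cc1 * W (al + kp) (dist b x)) =
  cc1 * \sum_(a <= x < D') ff (x - a) * W (al + kp) (dist b x).
 by rewrite mulr_sumr; apply: eq_bigr => x _; rewrite mulrCA.
rewrite -mulrA ler_wpM2l//.
have := @ff_conv a b (al + kp) aD bD.
have -> : al + kp - al = kp by ring.
have -> : dist a b = dist b a by rewrite /dist addnC.
apply; first by rewrite ltrDl.
by rewrite /kp; lra.
Qed.

Lemma pair_sum_green a b : (a < D')%N ->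
 pair_sum a b = \sum_(b <= z < D') ff (z - b) * W B0 (dist a z) +
  \sum_(a.+1 <= j < D') kk (j - a) * pair_sum j b.
move=> aD; rewrite {1}/pair_sum big_ltn//; congr (_ + _).
 by apply: eq_bigr => z _; rewrite subnn ff0 mul1r.
pose T x := \sum_(b <= z < D') ff (z - b) * W B0 (dist x z).
transitivity (\sum_(a.+1 <= x < D') \sum_(a.+1 <= j < x.+1) kk (j - a) * ff (x - j) * T x).
 apply: eq_big_nat => x /andP[ax xD].
 rewrite -mulr_sumr -mulr_suml; congr (_ * _).
 have -> : (x - a)%N = (x - a.+1).+1 by rewrite subnSK.
 rewrite ff_rec -[in RHS](add0n a.+1) big_addn subSn//; apply: eq_big_nat => j /andP[_ jx].
 by congr (kk _ * ff _); [rewrite addnS subSn ?leq_addl// addnK|rewrite addnC subnDA].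
rewrite triangle_sum; apply: eq_big_nat => j /andP[aj jD].
rewrite /pair_sum mulr_sumr; apply: eq_bigr => x _.
by rewrite -mulr_sumr mulrA.
Qed.

Definition cl : R := f_lo / 12.

(** A lower bound for the part of the Green sum in which the first replica has
    not moved; it compensates the interaction created by one step. *)
Lemma pair_sum_gain a b : (a <= b)%N -> (b < D)%N ->
 cl * W (al + kp) (b - a) <= \sum_(b <= z < D') ff (z - b) * W B0 (dist a z).
move=> ab bD; set g := (b - a)%N; pose N := (g + H)%N.
have gD : (g < D)%N by rewrite (leq_ltn_trans (leq_subr _ _)).
have rD : (r <= D)%N by rewrite /D leq_pmull// subn_gt0 (leq_trans _ q4).
have HD : (H <= D)%N by exact: leq_trans Hr rD.
have ND : (b + N <= D')%N by rewrite /N /D'; apply: three_le.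
have NX : N%:R * h = X h g by rewrite /N natrD mulrDl Hh addrC.
have F0 := f_lo_gt0.
apply: (via (\sum_(b <= z < b + N) ff (z - b) * W B0 (dist a z))); last first.
 rewrite [leRHS](cat_nat (b + N))//= ?leq_addr// lerDl sumr_ge0// => z _.
 by rewrite mulr_ge0 ?ff_ge0.
rewrite -{1}[b]add0n big_addn addKn.
have Xg := X0 g.
apply: (via (\sum_(0 <= n < N) f_lo * (h * (2 * X h g) `^ (- (1 - al))) * (3 * X h g) `^ (- B0))); last first.
 apply: ler_sum_nat => n /andP[_ nN].
 rewrite addnK.
 have nD' : (n <= D')%N by rewrite (leq_trans (ltnW nN))// (leq_trans _ ND)// leq_addl.
 have nX : n%:R * h <= X h g by rewrite -NX ler_wpM2r ?(ltW h0)// ler_nat ltnW.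
 have B00 : 0 <= B0 by rewrite /B0; have := a0; have := kp0; lra.
 apply: ler_pM.
 - by rewrite mulr_ge0 ?(ltW F0)// mulr_ge0 ?powR_ge0// ltW.
 - exact: powR_ge0.
 - apply: le_trans (ff_lo nD'); rewrite ler_wpM2l ?(ltW F0)// ler_wpM2l ?(ltW h0)//.
  apply: pow_leN => //; last by have := a0; have := a2; lra.
  by rewrite {1}/X; have := X1 g; lra.
 - apply: pow_leN => //.
  have -> : dist a (n + b) = (g + n)%N by rewrite /g; exact: dist_add_sub.
  have -> : X h (g + n) = X h g + n%:R * h by rewrite /X natrD mulrDl addrA.
  by have := X1 g; lra.
rewrite sumr_const_nat subn0 -[_ *+ N]mulr_natl.
have -> : N%:R * (f_lo * (h * (2 * X h g) `^ (- (1 - al))) * (3 * X h g) `^ (- B0)) =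
 f_lo * (N%:R * h * (2 * X h g) `^ (- (1 - al)) * (3 * X h g) `^ (- B0)) by ring.
rewrite NX /cl -mulrA ler_wpM2l ?(ltW F0)//.
rewrite (powRM _ (ler0n R 2) (ltW Xg)) (powRM _ (ler0n R 3) (ltW Xg)).
have E : W (al + kp) g = X h g * X h g `^ (- (1 - al)) * X h g `^ (- B0).
 rewrite /W -[X in _ = X * _ * _]powRr1 ?(ltW Xg)// -!powD//; congr powR.
 by rewrite /B0; ring.
have -> : X h g * (2 `^ (- (1 - al)) * X h g `^ (- (1 - al))) * (3 `^ (- B0) * X h g `^ (- B0)) =
 (2 `^ (- (1 - al)) * 3 `^ (- B0)) * W (al + kp) g by rewrite E; ring.
rewrite ler_wpM2r//.
have q2 : 2^-1 <= 2 `^ (- (1 - al)) :> R.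
 by rewrite -powR_inv1// ler_powR ?ler1n// lerN2; have := a0; lra.
have q3 : 3^-1 <= 3 `^ (- B0) :> R.
 by rewrite -powR_inv1// ler_powR ?ler1n// lerN2 ltW.
have := ler_pM _ _ q2 q3; rewrite !invr_ge0 => /(_ (ler0n _ _) (ler0n _ _)); lra.
Qed.

(** The price of one interaction: a step of the first replica over the position
    of the second. *)
Lemma kk_tail b1 a b : (a <= b)%N -> (b < D)%N -> 0 <= b1 < 1 ->
 \sum_(b.+1 <= j < D) kk (j - a) * W b1 (j - b) <= k_hi * conv_const b1 (al + b1) * W (al + b1) (b - a).
move=> ab bD /andP[b10 b11]; set g := (b - a)%N.
have k0 : 0 < k_hi by rewrite mulr_gt0// expR_gt0.
have ab0 : 0 < al + b1 by rewrite ltr_wpDr.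
have cE : al + b1 = (1 + al) + b1 - 1 by ring.
have c0 : 0 <= 1 + al by rewrite addr_ge0// ltW.
have := conv_one_sided h01 g D b11 ab0 cE c0 => /(ler_wpM2l (ltW k0)); rewrite mulrA; apply: le_trans.
rewrite mulr_sumr.
apply: (via (\sum_(0 <= n < D - b) k_hi * (h * (X h (maxn g n) `^ (- (1 + al)) * X h n `^ (- b1))))); last first.
 rewrite [leRHS](cat_nat (D - b)) ?leq_subr//= lerDl sumr_ge0// => n _.
 by rewrite mulr_ge0 ?(ltW k0)// mulr_ge0 ?(ltW h0)// mulr_ge0 ?powR_ge0.
rewrite -{1}[b.+1]add0n big_addn.
apply: (via (\sum_(0 <= n < D - b.+1) k_hi * (h * (X h (maxn g n.+1) `^ (- (1 + al)) * X h n.+1 `^ (- b1))))); last first.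
 rewrite -(subnSK bD) [leRHS]big_nat_recl//= lerDr.
 by rewrite mulr_ge0 ?(ltW k0)// mulr_ge0 ?(ltW h0)// mulr_ge0 ?powR_ge0.
apply: ler_sum_nat => n /andP[_ nD].
have -> : (n + b.+1 - b = n.+1)%N by rewrite addnS subSn ?leq_addl// addnK.
have -> : (n + b.+1 - a = (g + n).+1)%N by rewrite /g; exact: shift_sub.
have -> : k_hi * (h * (X h (maxn g n.+1) `^ (- (1 + al)) * X h n.+1 `^ (- b1))) =
 k_hi * (h * X h (maxn g n.+1) `^ (- (1 + al))) * X h n.+1 `^ (- b1) by ring.
apply: ler_wpM2r; first exact: powR_ge0.
have nD' : ((g + n).+1 <= D')%N by apply: gn_le nD; rewrite ltnW.
apply: le_trans (kk_hi nD') _; rewrite ler_wpM2l ?(ltW k0)// ler_wpM2l ?(ltW h0)//.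
apply: pow_leN => //; apply: X_le => //.
by rewrite geq_max -addnS leq_addr leq_addl.
Qed.

Lemma ff_step a x : (a < x)%N -> ff (x - a) = \sum_(a.+1 <= j < x.+1) kk (j - a) * ff (x - j).
move=> ax; have -> : (x - a)%N = (x - a.+1).+1 by rewrite subnSK.
rewrite ff_rec -[in RHS](add0n a.+1) big_addn subSn//; apply: eq_big_nat => j /andP[_ jx].
by congr (kk _ * ff _); [rewrite addnS subSn ?leq_addl// addnK|rewrite addnC subnDA].
Qed.

Definition mm (i : nat) : R := \sum_(i <= j < D) (C <= j)%:R * ff (j - i).

Lemma mm_rec i : (i < D)%N ->
 mm i = (C <= i)%:R + \sum_(i.+1 <= j < D) kk (j - i) * mm j.
move=> iD; rewrite {1}/mm big_ltn// subnn ff0 mulr1; congr (_ + _).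
transitivity (\sum_(i.+1 <= x < D) \sum_(i.+1 <= j < x.+1) (C <= x)%:R * (kk (j - i) * ff (x - j))).
 apply: eq_big_nat => x /andP[ix xD]; rewrite -mulr_sumr; congr (_ * _).
 exact: ff_step.
rewrite triangle_sum; apply: eq_big_nat => j _; rewrite /mm mulr_sumr.
by apply: eq_bigr => x _; rewrite mulrCA.
Qed.

Lemma mm_ge0 i : 0 <= mm i.
by apply: sumr_ge0 => j _; rewrite mulr_ge0 ?ff_ge0. Qed.

Let Y : R := X h D `^ al.

Definition m_hi : R := gE / Klo al ck Q.

Let DD' : (D <= D')%N. by rewrite /D' leq_pmull. Qed.

Lemma mm_hi i : mm i <= m_hi * Y.
apply: (via (gE * \sum_(0 <= n < D.+1) uu n)).
 apply: (via (\sum_(i <= j < D) ff (j - i))).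
  by apply: ler_sum => j _; rewrite ler_piMl ?ff_ge0// lern1 leq_b1.
 rewrite -{1}[i]add0n big_addn mulr_sumr.
 apply: (via (\sum_(0 <= n < D - i) gE * uu n)).
  apply: ler_sum_nat => n /andP[_ nD]; rewrite addnK /ff mulrC.
  apply: ler_wpM2r; first exact: (u_ge0 ck0 h01 Kk).
  by apply: growth_le; rewrite (leq_trans (ltnW nD))// (leq_trans (leq_subr _ _)).
 rewrite [leRHS](cat_nat (D - i)) ?leqW ?leq_subr//= lerDl sumr_ge0// => n _.
 by rewrite mulr_ge0 ?(u_ge0 ck0 h01 Kk)//; exact: expR_ge0.
rewrite /m_hi -mulrA ler_wpM2l ?expR_ge0//.
apply: (le_trans (sum_u_le ck0 h01 Kk D)).
have L := Kbar_lo al1 ck0 h01 phi01 Kk (D'Q DD').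
have L0 : 0 < Klo al ck Q by exact: Klo_gt0.
rewrite -[Y]invrK -powRN -invfM lef_pV2 ?posrE ?(Kbar_gt0 ck0 h01 Kk)//.
by apply: mulr_gt0 => //; exact: powR_gt0.
Qed.

Definition m_lo : R := f_lo / (2 * q%:R).

Lemma m_lo_gt0 : 0 < m_lo.
by rewrite divr_gt0 ?f_lo_gt0// mulr_gt0// ltr0n (ltn_trans _ q4). Qed.

Let q1 : 1 <= q%:R :> R. by rewrite ler1n (ltn_trans _ q4). Qed.

Let XD : X h D <= 2 * q%:R * (r%:R * h).
rewrite /X; have : (D%:R : R) <= q%:R * r%:R by rewrite -natrM ler_nat leq_mul// leq_subr.
move=> /(ler_wpM2r (ltW h0)) => DD.
have : 1 * 1 <= q%:R * (r%:R * h) by apply: ler_pM.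
by rewrite mulrA; lra.
Qed.

Lemma CDr : (D - C = r)%N.
exact: window_size. Qed.

Lemma mm_lo i : (i < 2 * r)%N -> m_lo * Y <= mm i.
move=> ir; have iC : (i <= C)%N by rewrite ltnW// windows_in.
have CD : (C <= D)%N by rewrite leq_mul// leq_sub2l.
apply: (via (\sum_(C <= j < D) ff (j - i))); last first.
 rewrite /mm [leRHS](cat_nat C)//=.
 rewrite -[leLHS]add0r; apply: lerD.
  by apply: sumr_ge0 => j _; rewrite mulr_ge0 ?ff_ge0.
 by apply: ler_sum_nat => j /andP[-> _]; rewrite mul1r.
apply: (via (\sum_(C <= j < D) f_lo * (h * W (1 - al) D))); last first.
 apply: ler_sum_nat => j /andP[_ jD].
 have jD' : (j - i <= D)%N by rewrite (leq_trans (leq_subr _ _))// ltnW.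
 apply: le_trans (ff_lo (leq_trans jD' DD')).
 rewrite ler_wpM2l ?(ltW f_lo_gt0)// ler_wpM2l ?(ltW h0)//; apply: pow_leN => //.
  exact: X_le.
 by rewrite subr_ge0; case/andP: al1 => _ /ltW.
rewrite sumr_const_nat CDr -[_ *+ r]mulr_natl /m_lo.
have -> : Y = X h D * W (1 - al) D.
 by rewrite /Y /W -[X in _ = X * _]powRr1 ?(ltW (X0 _))// -powD//; congr powR; ring.
have -> : r%:R * (f_lo * (h * W (1 - al) D)) = f_lo * ((r%:R * h) * W (1 - al) D) by ring.
rewrite -mulrA ler_wpM2l ?(ltW f_lo_gt0)// mulrA ler_wpM2r// mulrC.
by rewrite ler_pdivrMr ?mulr_gt0 ?(lt_le_trans _ q1)// mulrC.
Qed.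

Let T0 : R := k_hi * conv_const 0 (al + 0).
Let T1 : R := k_hi * conv_const kp (al + kp).

Let kp1 : kp < 1. rewrite /kp; have := a0; lra. Qed.
Let k_hi0 : 0 < k_hi. by rewrite mulr_gt0// expR_gt0. Qed.
Let T00 : 0 < T0. by rewrite mulr_gt0// conv_const_gt0// addr0. Qed.
Let T10 : 0 < T1. by rewrite mulr_gt0// conv_const_gt0// addr_gt0. Qed.
Let cl0 : 0 < cl. by rewrite divr_gt0 ?f_lo_gt0. Qed.
Let cc10 : 0 < cc1.
have q1' : 0 < conv_const (1 - al) (al + kp).
 by apply: conv_const_gt0; have := a0; have := kp0; lra.
have q2 : 0 < conv_const B0 (al + kp).
 by apply: conv_const_gt0 => //; have := a0; have := kp0; lra.
rewrite /cc1 ltr_pwDl// mulr_ge0 ?(ltW f_hi_gt0)// mulr_ge0// addr_ge0//; exact: ltW.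
Qed.
Let cc20 : 0 < cc2.
have q1' : 0 < conv_const (1 - al) kp by apply: conv_const_gt0 => //; have := a0; lra.
have q2 : 0 < conv_const (al + kp) kp.
 by apply: conv_const_gt0 => //; rewrite /kp; have := a0; lra.
rewrite /cc2 ltr_pwDl// mulr_ge0 ?(ltW f_hi_gt0)// mulr_ge0// addr_ge0//; exact: ltW.
Qed.

(** The interaction strength below which [Psi_super] closes. *)
Definition pair_e0 : R := cl / (2 * (cc1 * cc2 * T1)).

Lemma pair_e0_gt0 : 0 < pair_e0.
by rewrite divr_gt0// mulr_gt0// mulr_gt0// mulr_gt0. Qed.

Definition Psi0 (eps : R) : R := 2 * T0 / cl * eps * (m_hi * Y) ^+ 2 * X h D `^ kp.

Definition Psi (eps : R) (a b : nat) : R := Psi0 eps * pair_sum a b.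

Lemma Psi0_ge0 eps : 0 <= eps -> 0 <= Psi0 eps.
move=> e0; have t : 0 <= 2 * T0 / cl by rewrite divr_ge0 ?(ltW cl0)// mulr_ge0 ?(ltW T00).
by apply: mulr_ge0; [apply: mulr_ge0; [exact: mulr_ge0|exact: sqr_ge0]|exact: powR_ge0].
Qed.

Lemma pair_sum_sym a b : pair_sum a b = pair_sum b a.
rewrite /pair_sum exchange_big/=; apply: eq_bigr => z _; apply: eq_bigr => x _.
by rewrite mulrCA; congr (_ * (_ * W _ _)); rewrite /dist addnC.
Qed.

(** The product [mm * mm] contributes a source of order [eps * W al]; it is
    absorbed by the gain of [pair_sum], and so is the term [eps * Psi], for
    [eps <= pair_e0]. *)
Lemma Psi_super eps a b : 0 <= eps <= pair_e0 -> (a <= b)%N -> (b < D)%N ->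
 \sum_(a.+1 <= j < D) kk (j - a) * Psi eps j b +
 eps * (\sum_(b.+1 <= j < D) kk (j - a) * (mm j * mm b + Psi eps j b)) <= Psi eps a b.
move=> /andP[e0 e1] ab bD; have P0 := Psi0_ge0 e0.
have aD : (a < D)%N by exact: leq_ltn_trans bD.
have kkj j c : (c < j)%N -> 0 <= kk (j - c) by move=> cj; rewrite -(subnSK cj) kk_ge0.
rewrite {3}/Psi (pair_sum_green b (leq_trans aD DD')) mulrDr [leRHS]addrC; apply: lerD.
 rewrite mulr_sumr [leRHS](cat_nat D)//=.
 rewrite -[leLHS]addr0; apply: lerD.
  by apply: eq_ler; apply: eq_bigr => j _; rewrite mulrCA.
 rewrite big_nat_cond sumr_ge0// => j /andP[/andP[Dj _] _].
 rewrite mulr_ge0// mulr_ge0 ?pair_sum_ge0// kkj//; exact: leq_trans Dj.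
have G := pair_sum_gain ab bD.
apply: le_trans (ler_wpM2l P0 G).
set V := W (al + kp) (b - a).
have g1 : \sum_(b.+1 <= j < D) kk (j - a) * (mm j * mm b) <= (m_hi * Y) ^+ 2 * (T0 * (V * X h D `^ kp)).
 apply: (via ((m_hi * Y) ^+ 2 * \sum_(b.+1 <= j < D) kk (j - a) * W 0 (j - b))).
  rewrite mulr_sumr; apply: ler_sum_nat => j /andP[bj jD].
  rewrite /W oppr0 powRr0 mulr1 mulrC; apply: ler_wpM2r.
   by apply: kkj; exact: leq_ltn_trans bj.
  by rewrite expr2; apply: ler_pM; rewrite ?mm_ge0 ?mm_hi.
 rewrite ler_wpM2l ?sqr_ge0//.
 have z1 : 0 <= (0 : R) < 1 by rewrite lexx ltr01.
 apply: (le_trans (kk_tail ab bD z1)); rewrite -/T0 ler_wpM2l ?(ltW T00)//.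
 rewrite /V /W addr0 opprD powD// -mulrA ler_peMr ?powR_ge0//.
 rewrite powRN ler_pdivlMl ?powR_gt0// mulr1.
 apply: pow_le; [exact: ltW|apply: X_le => //|exact: ltW].
 by rewrite (leq_trans (leq_subr _ _))// ltnW.
have g2 : \sum_(b.+1 <= j < D) kk (j - a) * Psi eps j b <= Psi0 eps * (cc1 * cc2 * (T1 * V)).
 apply: (via (Psi0 eps * (cc1 * cc2 * \sum_(b.+1 <= j < D) kk (j - a) * W kp (j - b)))).
  rewrite mulr_sumr mulr_sumr; apply: ler_sum_nat => j /andP[bj jD].
  rewrite /Psi mulrCA; apply: ler_wpM2l => //; rewrite [leRHS]mulrCA; apply: ler_wpM2l.
   by apply: kkj; exact: leq_ltn_trans bj.
  have -> : (j - b)%N = dist j b by rewrite /dist; exact: sub_dist.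
  by apply: pair_sum_hi; rewrite (leq_trans _ DD')// ltnW.
 apply: ler_wpM2l => //; apply: ler_wpM2l; first by rewrite mulr_ge0 ?(ltW cc10) ?(ltW cc20).
 by apply: kk_tail => //; rewrite (ltW kp0).
have -> : \sum_(b.+1 <= j < D) kk (j - a) * (mm j * mm b + Psi eps j b) =
  \sum_(b.+1 <= j < D) kk (j - a) * (mm j * mm b) + \sum_(b.+1 <= j < D) kk (j - a) * Psi eps j b.
 by rewrite -big_split; apply: eq_bigr => j _; rewrite mulrDr.
have V0 : 0 <= V by exact: W0.
have h1 : eps * ((m_hi * Y) ^+ 2 * (T0 * (V * X h D `^ kp))) = Psi0 eps * (cl * V) / 2.
 by rewrite /Psi0; field; rewrite gt_eqF.
have h2 : eps * (Psi0 eps * (cc1 * cc2 * (T1 * V))) <= Psi0 eps * (cl * V) / 2.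
 have -> : eps * (Psi0 eps * (cc1 * cc2 * (T1 * V))) = Psi0 eps * V * (eps * (cc1 * cc2 * T1)) by ring.
 have -> : Psi0 eps * (cl * V) / 2 = Psi0 eps * V * (cl / 2) by ring.
 apply: ler_wpM2l; first by apply: mulr_ge0.
 have t0 : 0 < cc1 * cc2 * T1 by rewrite mulr_gt0// mulr_gt0.
 by move: e1; rewrite /pair_e0 ler_pdivlMr//; lra.
have := ler_wpM2l e0 (lerD g1 g2); rewrite mulrDr; lra.
Qed.

Definition pairA : R :=
 2 * T0 / cl * (cc1 * cc2) * (2 * (10 / (1 - kp))) * (2 * q%:R) * (m_hi / m_lo) ^+ 2.

(** On the start window, of size [r], the power of the distance is summable,
    and [mm_lo] bounds the square of the means from below. *)
Lemma Psi_sum eps : 0 <= eps ->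
 \sum_(r <= a < 2 * r) \sum_(r <= b < 2 * r) Psi eps a b <=
  pairA * eps * (\sum_(r <= a < 2 * r) mm a) ^+ 2.
move=> e0; have P0 := Psi0_ge0 e0.
pose rh := r%:R * h; have rh0 : 0 < rh by exact: lt_le_trans l1.
have kq : 0 < 1 - kp by rewrite subr_gt0.
have c12 : 0 <= cc1 * cc2 by rewrite mulr_ge0 ?(ltW cc10) ?(ltW cc20).
have rD' : (2 * r <= D')%N by exact: two_r_le.
have inner a : (a < 2 * r)%N -> \sum_(r <= b < 2 * r) W kp (dist a b) <= r%:R * (2 * (10 / (1 - kp))) * rh `^ (- kp).
 move=> ar.
 apply: (via (\sum_(0 <= b < 2 * r) W kp (dist b a))).
  rewrite [leRHS](cat_nat r) ?leq_pmull//= ler_wpDl ?sumr_ge0//.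
  by apply: ler_sum => b _; rewrite le_eqVlt /dist addnC eqxx.
 have SD := sum_dist_le h01 (2 * r) a (W0 kp).
 apply: (le_trans SD).
 apply: (via (2 * \sum_(0 <= m < 4 * r) W kp m)).
  rewrite ler_wpM2l// [leRHS](cat_nat (2 * r + a.+1)) ?four_r//= lerDl sumr_ge0//.
 have := pow_sum_low h01 (4 * r) kq; rewrite subKr -mulr_sumr => S.
 have X4 : X h (4 * r) <= 5 * rh by rewrite /X natrM -mulrA -/rh; have := l1; rewrite -/rh; lra.
 have S2 : X h (4 * r) `^ (1 - kp) <= 5 * (rh * rh `^ (- kp)).
  apply: (via ((5 * rh) `^ (1 - kp))).
   by apply: pow_le => //; exact: ltW.
  rewrite (powRM _ (ler0n _ _) (ltW rh0)) (powD _ _ rh0) powRr1 ?(ltW rh0)//.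
  apply: ler_wpM2r; first by rewrite mulr_ge0 ?powR_ge0// ltW.
  by rewrite -[leRHS]powRr1// ler_powR ?ler1n// gerBl ltW.
 rewrite -(ler_pM2l h0) mulrCA.
 apply: (le_trans (ler_wpM2l (ler0n R 2) S)).
 apply: (via (2 * (2 / (1 - kp) * (5 * (rh * rh `^ (- kp)))))).
  by rewrite ler_wpM2l// ler_wpM2l// divr_ge0// ltW.
 apply: eq_ler; rewrite /rh; ring.
apply: (via (\sum_(r <= a < 2 * r) Psi0 eps * (cc1 * cc2 * (r%:R * (2 * (10 / (1 - kp))) * rh `^ (- kp))))).
 apply: ler_sum_nat => a /andP[_ ar]; rewrite -mulr_sumr ler_wpM2l//.
 apply: (via (\sum_(r <= b < 2 * r) cc1 * cc2 * W kp (dist a b))).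
  apply: ler_sum_nat => b /andP[_ br]; apply: pair_sum_hi; exact: leq_trans (ltnW _) rD'.
 by rewrite -mulr_sumr ler_wpM2l// inner.
have rr : (2 * r - r = r)%N by rewrite mul2n -addnn addnK.
rewrite sumr_const_nat rr -[_ *+ r]mulr_natl.
have Y0 : 0 <= Y by exact: powR_ge0.
have ml : 0 < m_lo by exact: m_lo_gt0.
have Msum : r%:R * (m_lo * Y) <= \sum_(r <= a < 2 * r) mm a.
 rewrite mulr_natl -[r in leLHS]rr -sumr_const_nat.
 by apply: ler_sum_nat => a /andP[_ ar]; exact: mm_lo.
have Msq : (r%:R * (m_lo * Y)) ^+ 2 <= (\sum_(r <= a < 2 * r) mm a) ^+ 2.
 rewrite ler_sqr ?nnegrE//; first by rewrite mulr_ge0// mulr_ge0// ltW.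
 by apply: sumr_ge0 => a _; exact: mm_ge0.
have A0 : 0 <= pairA.
 rewrite /pairA; apply: mulr_ge0; last exact: sqr_ge0.
 apply: mulr_ge0; last by rewrite mulr_ge0.
 apply: mulr_ge0; last by rewrite mulr_ge0// divr_ge0// ltW.
 by apply: mulr_ge0 => //; rewrite divr_ge0 ?(ltW cl0)// mulr_ge0// ltW.
apply: le_trans (ler_wpM2l (mulr_ge0 A0 e0) Msq).
have Xk : X h D `^ kp * rh `^ (- kp) <= 2 * q%:R.
 apply: (via ((2 * q%:R * rh) `^ kp * rh `^ (- kp))).
  apply: ler_wpM2r; first exact: powR_ge0.
  by apply: pow_le; [exact: ltW|exact: XD|exact: ltW].
 rewrite (powRM _ _ (ltW rh0)) ?mulr_ge0// -mulrA -powD// subrr powRr0 mulr1.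
 rewrite -[leRHS]powRr1 ?mulr_ge0// ler_powR ?(ltW kp1)//.
 by have := q1; lra.
have -> : r%:R * (Psi0 eps * (cc1 * cc2 * (r%:R * (2 * (10 / (1 - kp))) * rh `^ (- kp)))) =
  (r%:R ^+ 2 * (m_hi * Y) ^+ 2 * (2 * T0 / cl * eps * (cc1 * cc2) * (2 * (10 / (1 - kp))))) *
  (X h D `^ kp * rh `^ (- kp)) by rewrite /Psi0; ring.
have -> : pairA * eps * (r%:R * (m_lo * Y)) ^+ 2 =
  (r%:R ^+ 2 * (m_hi * Y) ^+ 2 * (2 * T0 / cl * eps * (cc1 * cc2) * (2 * (10 / (1 - kp))))) * (2 * q%:R).
 rewrite /pairA; move: ml (cl0) kq; move: m_lo cl (1 - kp) => x y z x0 y0 z0.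
 by field; rewrite !gt_eqF.
apply: ler_wpM2l => //.
apply: mulr_ge0; first by rewrite mulr_ge0 ?sqr_ge0.
apply: mulr_ge0; last by rewrite mulr_ge0// divr_ge0// ltW.
apply: mulr_ge0 => //; apply: mulr_ge0 => //.
by rewrite divr_ge0 ?(ltW cl0)// mulr_ge0// ltW.
Qed.
End pair_green.

(** * Pinned paths and their second moment *)

Lemma ind_lt (D n a b j : nat) : (2 * D - (a + b) < n.+1)%N -> (a < j)%N -> (j < D)%N -> (b < D)%N ->
 (2 * D - (j + b) < n)%N.
lia. Qed.

Lemma two_r_le_D (q r : nat) : (4 < q)%N -> (2 * r <= (q - 1) * r)%N.
by move=> q4; apply: leq_mul => //; lia. Qed.

Section functionals.
Context {R : realType}.
Variables (J : int -> R) (delta : R) (E : ((nat -> int) -> R) -> R).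
Hypothesis WL : walk_law J delta E.
Implicit Types (e : nat -> int) (F G : (nat -> int) -> R).

(** Dependence on the increments with indices in [a, b), so that disjoint
    windows are independent. *)
Definition dep (a b : nat) F := forall e e', (forall l, (a <= l < b)%N -> e l = e' l) -> F e = F e'.
Definition nice F := (exists n, cyl n F) /\ bdd F.

Lemma nice_cst c : nice (fun=> c).
by split; [exists 0%N|exists `|c|]. Qed.

Lemma cyl_le m n F : (m <= n)%N -> cyl m F -> cyl n F.
by move=> mn cF e e' h; apply: cF => l lm; apply: h; exact: leq_trans mn. Qed.

Lemma nice2 F G : nice F -> nice G -> exists n, cyl n F /\ cyl n G.
move=> [[m cF] _] [[n cG] _]; exists (maxn m n).
by split; [apply: cyl_le cF; rewrite leq_maxl|apply: cyl_le cG; rewrite leq_maxr].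
Qed.

Lemma nice_add F G : nice F -> nice G -> nice (fun e => F e + G e).
move=> nF nG; have [n [cF cG]] := nice2 nF nG.
split; first by exists n => e e' h; rewrite (cF e e')// (cG e e').
have [_ [M FM]] := nF; have [_ [K GK]] := nG; exists (M + K) => e.
by apply: le_trans (ler_normD _ _) _; rewrite lerD.
Qed.

Lemma nice_mul F G : nice F -> nice G -> nice (fun e => F e * G e).
move=> nF nG; have [n [cF cG]] := nice2 nF nG.
split; first by exists n => e e' h; rewrite (cF e e')// (cG e e').
have [_ [M FM]] := nF; have [_ [K GK]] := nG; exists (M * K) => e.
by rewrite normrM ler_pM.
Qed.

Lemma nice_scale c F : nice F -> nice (fun e => c * F e).
exact: nice_mul (nice_cst c). Qed.

Lemma nice_opp F : nice F -> nice (fun e => - F e).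
move=> nF; have := nice_scale (-1) nF.
by under [X in nice X]funext do rewrite mulN1r.
Qed.

Lemma nice_sum (I : Type) (s : seq I) (P : pred I) (F : I -> (nat -> int) -> R) :
 (forall i, P i -> nice (F i)) -> nice (fun e => \sum_(i <- s | P i) F i e).
move=> nF; elim: s => [|i s IH].
 by under [X in nice X]funext do rewrite big_nil; exact: nice_cst.
under [X in nice X]funext do rewrite big_cons.
by case Pi : (P i) => //; apply: nice_add => //; exact: nF.
Qed.

Lemma nice_cyl n F M : cyl n F -> (forall e, 0 <= F e <= M) -> nice F.
move=> cF FM; split; first by exists n.
by exists M => e; have /andP[? ?] := FM e; rewrite ger0_norm.
Qed.

Lemma dep_cyl a b F : dep a b F -> cyl b F.
by move=> dF e e' h; apply: dF => l /andP[_]; exact: h. Qed.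

Lemma nice_dep a b F M : dep a b F -> (forall e, 0 <= F e <= M) -> nice F.
by move=> /dep_cyl; exact: nice_cyl. Qed.

Lemma EC c : E (fun=> c) = c.
exact: (E_cst WL). Qed.

Lemma EL a F G : nice F -> nice G -> E (fun e => a * F e + G e) = a * E F + E G.
move=> nF nG; have [n [cF cG]] := nice2 nF nG; case: nF nG => [_ bF] [_ bG].
exact: (E_lin WL a cF bF cG bG).
Qed.

Lemma ED F G : nice F -> nice G -> E (fun e => F e + G e) = E F + E G.
by move=> nF nG; rewrite -[E F]mul1r -(EL 1 nF nG); congr E; apply/funext => e; rewrite mul1r.
Qed.

Lemma EZ a F : nice F -> E (fun e => a * F e) = a * E F.
move=> nF; rewrite -[RHS]addr0 -[X in _ + X](EC 0) -(EL a nF (nice_cst 0)).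
by congr E; apply/funext => e; rewrite addr0.
Qed.

Lemma EN F : nice F -> E (fun e => - F e) = - E F.
by move=> nF; rewrite -mulN1r -EZ//; congr E; apply/funext => e; rewrite mulN1r.
Qed.

Lemma EB F G : nice F -> nice G -> E (fun e => F e - G e) = E F - E G.
by move=> nF nG; rewrite ED// ?EN//; exact: nice_opp. Qed.

Lemma Esum (I : Type) (s : seq I) (P : pred I) (F : I -> (nat -> int) -> R) :
 (forall i, P i -> nice (F i)) ->
 E (fun e => \sum_(i <- s | P i) F i e) = \sum_(i <- s | P i) E (F i).
move=> nF; elim: s => [|i s IH].
 by under [X in E X]funext do rewrite big_nil; rewrite big_nil EC.
under [X in E X]funext do rewrite big_cons.
rewrite big_cons; case: ifPn => // Pi; rewrite ED ?IH//; [exact: nF|exact: nice_sum].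
Qed.

Lemma Ele F G : nice F -> nice G -> (forall e, F e <= G e) -> E F <= E G.
move=> nF nG; have [n [cF cG]] := nice2 nF nG; case: nF nG => [_ bF] [_ bG].
exact: (E_mono WL cF bF cG bG).
Qed.

Lemma E_ge0 F : nice F -> (forall e, 0 <= F e) -> 0 <= E F.
by move=> nF F0; rewrite -(EC 0); apply: Ele => //; exact: nice_cst. Qed.

Lemma nice_shift j F : nice F -> nice (fun e => F (shift j e)).
move=> [[n cF] [M FM]]; split; last by exists M.
exists (j + n)%N => e e' h; apply: cF => l ln; rewrite /shift; apply: h.
by rewrite ltn_add2l.
Qed.

Lemma E_shift j F : nice F -> E (fun e => F (shift j e)) = E F.
move=> [[n cF] bF]; rewrite -[RHS]mul1r -[X in X * _](EC 1).
have b1 : bdd (fun=> 1 : R) by exists `|1|.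
rewrite -(E_mul WL (j := j) (n := n) (F := fun=> 1) _ b1 cF bF)//.
by congr E; apply/funext => e; rewrite mul1r.
Qed.

Lemma E_indep a j b F G : nice F -> nice G -> dep a j F -> dep j b G ->
 E (fun e => F e * G e) = E F * E G.
move=> [_ bF] [_ bG] /dep_cyl cF dG.
pose back e : nat -> int := fun l => if (l < j)%N then 0 else e (l - j)%N.
pose G' e := G (back e).
have GE e : G e = G' (shift j e).
 apply: dG => l /andP[jl _]; rewrite /back ltnNge jl /= /shift subnKC//.
have cG' : cyl b G'.
 move=> e e' h; apply: dG => l /andP[jl lb]; rewrite /back; case: ifP => // _.
 by apply: h; exact: leq_ltn_trans (leq_subr _ _) lb.
have bG' : bdd G' by case: bG => M GM; exists M => e; exact: GM.
have -> : E G = E G'.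
 have nG' : nice G' by split; [exists b|].
 by rewrite -(E_shift j nG'); congr E; apply/funext => e; exact: GE.
rewrite -(E_mul WL cF bF cG' bG'); congr E; apply/funext => e.
by rewrite GE.
Qed.

Lemma incr_shift i j e : (i <= j)%N -> incr i j e = incr 0 (j - i) (shift i e).
move=> ij; rewrite /incr -{1}[i]add0n big_addn; apply: eq_bigr => l _.
by rewrite /shift addnC.
Qed.

Lemma incr_dep i j (g : int -> R) : dep i j (fun e => g (incr i j e)).
move=> e e' h; congr g; rewrite /incr; apply: eq_big_nat => l; exact: h.
Qed.

Lemma E_incr i j (g : int -> R) M : (i <= j)%N -> (forall y, 0 <= g y <= M) ->
 E (fun e => g (incr i j e)) = Et J (delta * (j - i)%:R) g.
move=> ij gM; rewrite -(E_inc WL); last by exists M.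
have n0 : nice (fun e => g (incr 0 (j - i) e)).
 by apply: (nice_dep (a := 0) (b := (j - i)%N) (M := M)) => //; exact: incr_dep.
rewrite -(E_shift i n0); congr E; apply/funext => e.
by rewrite (incr_shift _ ij).
Qed.
End functionals.

Section pinned_paths.
Context {R : realType}.
Variables (J : int -> R) (p : R -> int -> R) (E : ((nat -> int) -> R) -> R) (rho h z : R).
Hypotheses (HE : heat J p) (rho01 : 0 <= rho <= 1) (h0 : 0 < h) (z0 : 0 <= z)
 (WL : walk_law J (rho * h) E).

(** The probability that [X] follows the displacement of the environment
    between the contacts [i] and [j]. *)
Definition link (i j : nat) (e : nat -> int) : R :=
 p ((1 - rho) * ((j - i)%:R * h)) (incr i j e).

Let tm i j : 0 <= (1 - rho) * ((j - i)%:R * h).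
by case/andP: rho01 => _ r1; rewrite mulr_ge0 ?subr_ge0// mulr_ge0// ltW. Qed.
Lemma heat_le1 t x : 0 <= t -> p t x <= 1.
by move=> t0; have := heat_psum HE t0 (s := [:: x]) isT; rewrite big_seq1. Qed.

Lemma link_ge0 i j e : 0 <= link i j e.
exact: (heat_ge0 HE). Qed.

Lemma link_le1 i j e : link i j e <= 1.
exact: heat_le1. Qed.

Lemma link_le i j e : link i j e <= p ((1 - rho) * ((j - i)%:R * h)) 0.
exact: (heat_le_diag HE). Qed.

Lemma link_dep i j : dep i j (link i j).
exact: (@incr_dep R i j (fun y => p ((1 - rho) * ((j - i)%:R * h)) y)). Qed.

Lemma link_nice i j : nice (link i j).
apply: (nice_dep (@link_dep i j) (M := 1)) => e; by rewrite link_ge0 link_le1.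
Qed.

(** The speeds [1 - rho] and [rho] add up: averaging over the environment
    restores the homogeneous kernel. *)
Lemma E_link i j : (i <= j)%N -> E (link i j) = p ((j - i)%:R * h) 0.
move=> ij; rewrite /link (@E_incr _ _ _ _ WL i j (fun y => p ((1 - rho) * ((j - i)%:R * h)) y) 1 ij); last first.
 by move=> y; rewrite (heat_ge0 HE)//= heat_le1.
have r0 : 0 <= rho * h * (j - i)%:R.
 by case/andP: rho01 => ? _; rewrite mulr_ge0// mulr_ge0// ltW.
rewrite /Et.
have -> : (\esum_y ((p ((1 - rho) * ((j - i)%:R * h)) y)%:E * pt J (rho * h * (j - i)%:R) y))%E =
  (p ((j - i)%:R * h) 0)%:E.
 transitivity ((p (rho * h * (j - i)%:R + (1 - rho) * ((j - i)%:R * h)) 0)%:E); last first.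
  by congr ((p _ _)%:E); ring.
 rewrite (heat_CK HE)//; apply: eq_esum => y _.
 by rewrite (heat_pt HE)// -EFinM sub0r (heat_sym HE)// mulrC.
by [].
Qed.

Definition paths (f : nat -> R) (d i : nat) (e : nat -> int) : R :=
 volt (fun i j => z * link i j e) f d i.

Lemma pathsE f d i e : paths f d i e = f i + z * \sum_(i.+1 <= j < d) link i j e * paths f d j e.
by rewrite /paths voltE mulr_sumr; congr (_ + _); apply: eq_bigr => j _; rewrite mulrA. Qed.

Variable f : nat -> R.
Hypothesis f0 : forall i, 0 <= f i.

Lemma paths_ge0 d i e : 0 <= paths f d i e.
by apply: volt_ge0 => // k j; rewrite mulr_ge0// link_ge0. Qed.

Lemma paths_dep d i : dep i d (paths f d i).
move=> e e' ee; move: i ee; apply: (@backward_ind _ d) => i IH ee; rewrite !pathsE.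
congr (_ + _ * _); apply: eq_big_nat => j /andP[ij jd]; congr (_ * _).
 by apply: link_dep => l /andP[il lj]; apply: ee; rewrite il (ltn_trans lj).
apply: IH; first by rewrite ij.
by move=> l /andP[jl ld]; apply: ee; rewrite ld andbT (leq_trans _ jl)// ltnW.
Qed.

Lemma paths_nice d i : nice (paths f d i).
apply: (nice_dep (@paths_dep d i) (M := volt (fun _ _ => z) f d i)) => e.
rewrite paths_ge0/=; apply: volt_le => [k j|k]; first by rewrite mulr_ge0// link_ge0.
rewrite [leRHS]voltE lerD2l; apply: ler_sum => j _; rewrite ler_wpM2r//.
 exact: volt_ge0.
by rewrite ler_piMr// link_le1.
Qed.

(** The environments of successive links are independent, so the mean of the
    path sum is the path sum of the means. *)
Lemma E_paths d i : E (paths f d i) = volt (fun i j => z * p ((j - i)%:R * h) 0) f d i.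
move: i; apply: (@backward_ind _ d) => i IH; rewrite voltE.
have n1 j : nice (fun e => link i j e * paths f d j e).
 by apply: nice_mul; [exact: link_nice|exact: paths_nice].
have -> : E (paths f d i) = E (fun e => f i + z * \sum_(i.+1 <= j < d) link i j e * paths f d j e).
 by congr E; apply/funext => e; rewrite pathsE.
have n2 : nice (fun e => \sum_(i.+1 <= j < d) link i j e * paths f d j e) by exact: nice_sum.
rewrite (ED WL (nice_cst _) (nice_scale z n2)) (EC WL) (EZ WL z n2) (Esum WL)//.
congr (_ + _); rewrite mulr_sumr; apply: eq_big_nat => j /andP[ij jd].
rewrite (E_indep WL (link_nice i j) (paths_nice d j) (@link_dep i j) (@paths_dep d j)).
by rewrite E_link 1?ltnW// IH ?ij// mulrA.
Qed.
End pinned_paths.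

Section second_moment.
Context {R : realType}.
Variables (J : int -> R) (p : R -> int -> R) (E : ((nat -> int) -> R) -> R) (rho z : R).
Variables (al Ck ck : R) (q H r : nat) (phi : R) (kap : nat -> R) (eps : R).
Let h : R := H%:R^-1.
Hypotheses (HE : heat J p) (rho01 : 0 <= rho <= 1) (z0 : 0 <= z) (al01 : 0 < al < 1 / 2)
 (Ck0 : 0 < Ck) (ck0 : 0 < ck) (q4 : (4 < q)%N) (H0 : (0 < H)%N) (phi01 : 0 < phi <= 1)
 (Kk : rkernel al Ck ck h phi kap) (phil : 1 <= phi * (r%:R * h) <= 2)
 (WL : walk_law J (rho * h) E) (kkE : forall n, kk H phi kap n.+1 = z * p (n.+1%:R * h) 0)
 (eps0 : 0 <= eps <= pair_e0 al Ck ck q)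
 (slow : forall n, p ((1 - rho) * (n.+1%:R * h)) 0 <= (1 + eps) * p (n.+1%:R * h) 0).

Let h0 : 0 < h. by rewrite invr_gt0 ltr0n. Qed.
Let D : nat := ((q - 1) * r)%N.
Let f (i : nat) : R := ((q - 2) * r <= i)%N%:R.
Let f0 i : 0 <= f i. by rewrite /f; case: (_ <= _)%N. Qed.

Definition Zb (i : nat) (e : nat -> int) : R := paths p rho h z f D i e.
Let m := mm q H r phi kap.
Let P := Psi al Ck ck q H r phi kap eps.

Let kk1 a j : (a < j)%N -> kk H phi kap (j - a) = z * p ((j - a)%:R * h) 0.
by move=> aj; rewrite -(subnSK aj) kkE. Qed.

Let nZ i : nice (Zb i). exact: (paths_nice HE rho01 h0 z0 f0). Qed.
Let dZ i : dep i D (Zb i). exact: paths_dep. Qed.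
Let Z0 i e : 0 <= Zb i e. exact: (paths_ge0 HE rho01 h0 z0 f0). Qed.
Lemma E_Zb i : (i < D)%N -> E (Zb i) = m i.
rewrite /Zb (E_paths HE rho01 h0 z0 WL f0).
move: i; apply: (@backward_ind _ D) => i IH iD; rewrite voltE /m (mm_rec ck0 H0 Kk iD).
congr (_ + _); apply: eq_big_nat => j /andP[ij jD].
by rewrite kk1// IH ?ij.
Qed.

(** First-step recursion for the replica that is behind. A link overtaking the
    other replica shares its environment with the latter; it is bounded by its
    maximum over displacements, which costs only the factor [1 + eps]. *)
Lemma E_ZbZb a b : (a <= b)%N -> (b < D)%N -> E (fun e => Zb a e * Zb b e) <= m a * m b + P a b.
have [n] := ubnP (2 * D - (a + b)); elim: n a b => // n IH a b abn ab bD.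
have aD : (a < D)%N by exact: leq_ltn_trans bD.
have nlz j : nice (fun e => link p rho h a j e * (Zb j e * Zb b e)).
 by apply: nice_mul; [exact: (link_nice HE rho01 h0)|exact: nice_mul].
have nsum : nice (fun e => \sum_(a.+1 <= j < D) link p rho h a j e * (Zb j e * Zb b e)) by exact: nice_sum.
have -> : E (fun e => Zb a e * Zb b e) =
  E (fun e => f a * Zb b e + z * \sum_(a.+1 <= j < D) link p rho h a j e * (Zb j e * Zb b e)).
 congr E; apply/funext => e; rewrite {1}/Zb pathsE mulrDl -mulrA mulr_suml.
 by congr (_ + _ * _); apply: eq_bigr => j _; rewrite mulrA.
rewrite (ED WL (nice_scale _ (nZ b)) (nice_scale z nsum)) (EZ WL _ (nZ b)) (EZ WL z nsum) (Esum WL)//.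
rewrite E_Zb// [z * _]mulr_sumr.
have [e0 e1] := andP eps0.
have IH' j : (a < j < D)%N -> E (fun e => Zb j e * Zb b e) <= m j * m b + P j b.
 move=> /andP[aj jD]; case: (leqP j b) => jb.
  by apply: IH => //; apply: ind_lt abn aj jD bD.
 have -> : E (fun e => Zb j e * Zb b e) = E (fun e => Zb b e * Zb j e).
  by congr E; apply/funext => e; rewrite mulrC.
 have := IH b j; rewrite mulrC /P /Psi pair_sum_sym; apply => //; last exact: ltnW.
 by rewrite addnC; apply: ind_lt abn aj jD bD.
have step j : (a < j < D)%N -> z * E (fun e => link p rho h a j e * (Zb j e * Zb b e)) <=
  kk H phi kap (j - a) * (m j * m b + P j b) +
  (if (b < j)%N then eps * (kk H phi kap (j - a) * (m j * m b + P j b)) else 0).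
 move=> /andP[aj jD]; have nzz : nice (fun e => Zb j e * Zb b e) by exact: nice_mul.
 have zz0 : 0 <= E (fun e => Zb j e * Zb b e) by apply: (E_ge0 WL nzz) => e; rewrite mulr_ge0.
 have pz : 0 <= z * p ((j - a)%:R * h) 0.
  by rewrite mulr_ge0// (heat_ge0 HE)// mulr_ge0// ltW.
 case: ifPn => [bj|]; last first.
  rewrite -leqNgt addr0 => jb; rewrite kk1//.
  have dzz : dep j D (fun e => Zb j e * Zb b e).
   move=> e e' h'; congr (_ * _); first exact: dZ.
   by apply: dZ => l /andP[bl lD]; apply: h'; rewrite lD (leq_trans jb bl).
  rewrite (E_indep WL (link_nice HE rho01 h0 a j) nzz (@link_dep _ p rho h a j) dzz).
  rewrite (E_link HE rho01 h0 WL (ltnW aj)) mulrA.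
  by apply: ler_wpM2l => //; apply: IH'; rewrite aj.
 apply: (via (z * (((1 + eps) * p ((j - a)%:R * h) 0) * E (fun e => Zb j e * Zb b e)))).
  apply: ler_wpM2l => //; rewrite -(EZ WL _ nzz); apply: (Ele WL) => //.
   exact: nice_scale.
  move=> e; apply: ler_wpM2r; first by rewrite mulr_ge0.
  apply: (le_trans (link_le HE rho01 h0 a j e)).
  by rewrite -(subnSK aj); exact: slow.
 have -> : z * ((1 + eps) * p ((j - a)%:R * h) 0 * E (fun e => Zb j e * Zb b e)) =
   (z * p ((j - a)%:R * h) 0) * ((1 + eps) * E (fun e => Zb j e * Zb b e)) by ring.
 rewrite kk1// -[X in _ <= X]/(_ + _).
 have -> : z * p ((j - a)%:R * h) 0 * (m j * m b + P j b) +
   eps * (z * p ((j - a)%:R * h) 0 * (m j * m b + P j b)) =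
   z * p ((j - a)%:R * h) 0 * ((1 + eps) * (m j * m b + P j b)) by ring.
 apply: ler_wpM2l => //; apply: ler_wpM2l; first by rewrite addr_ge0.
 by apply: IH'; rewrite aj.
apply: (via (f a * m b + \sum_(a.+1 <= j < D) (kk H phi kap (j - a) * (m j * m b + P j b) +
  (if (b < j)%N then eps * (kk H phi kap (j - a) * (m j * m b + P j b)) else 0)))).
 by rewrite lerD2l; apply: ler_sum_nat => j; exact: step.
have S := Psi_super al01 Ck0 ck0 q4 H0 phi01 Kk phil eps0 ab bD.
rewrite big_split/=.
have -> : \sum_(a.+1 <= j < D) (if (b < j)%N then eps * (kk H phi kap (j - a) * (m j * m b + P j b)) else 0) =
  eps * \sum_(b.+1 <= j < D) kk H phi kap (j - a) * (m j * m b + P j b).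
 rewrite mulr_sumr [RHS](big_nat_widenl _ a.+1)//= -big_mkcond /=.
 by apply: eq_bigl => j.
have -> : m a * m b = f a * m b + \sum_(a.+1 <= j < D) kk H phi kap (j - a) * (m j * m b).
 rewrite {1}/m (mm_rec ck0 H0 Kk aD) mulrDl mulr_suml; congr (_ + _).
 by apply: eq_bigr => j _; rewrite mulrA.
have -> : \sum_(a.+1 <= i < D) kk H phi kap (i - a) * (m i * m b + P i b) =
  \sum_(a.+1 <= j < D) kk H phi kap (j - a) * (m j * m b) + \sum_(a.+1 <= j < D) kk H phi kap (j - a) * P j b.
 by rewrite -big_split; apply: eq_bigr => j _; rewrite mulrDr.
move: S; rewrite -/D -/m -/P; lra.
Qed.

Definition Bb (e : nat -> int) : R := \sum_(r <= i < 2 * r) Zb i e.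
Definition mB : R := \sum_(r <= i < 2 * r) m i.
Definition bad (e : nat -> int) : bool := Bb e < mB / 2.

Let rD : (2 * r <= D)%N. exact: two_r_le_D. Qed.

Lemma Bb_nice : nice Bb.
by apply: nice_sum => i _; exact: nZ. Qed.

Lemma Bb_dep : dep 0 D Bb.
move=> e e' h'; apply: eq_big_nat => i /andP[ri ir].
by apply: dZ => l /andP[il lD]; apply: h'; rewrite lD.
Qed.

Lemma E_Bb : E Bb = mB.
rewrite (Esum WL) => [|i _]; last exact: nZ.
by apply: eq_big_nat => i /andP[_ ir]; rewrite E_Zb//; exact: leq_trans rD.
Qed.

Lemma bad_nice : nice (fun e => (bad e)%:R : R).
apply: (nice_dep (a := 0) (b := D) (M := 1)).
 by move=> e e' h'; rewrite /bad (Bb_dep h').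
by move=> e; case: (bad e); rewrite ?ler01 ?lexx.
Qed.

Lemma E_bad : 0 < mB -> E (fun e => (bad e)%:R) <= 4 * pairA al Ck ck q * eps.
move=> mB0.
have nB := Bb_nice.
have nBB : nice (fun e => Bb e * Bb e) by exact: nice_mul.
have S2 : E (fun e => Bb e * Bb e) <= mB ^+ 2 + pairA al Ck ck q * eps * mB ^+ 2.
 have [e0 e1] := andP eps0.
 apply: (via (\sum_(r <= a < 2 * r) \sum_(r <= b < 2 * r) (m a * m b + P a b))).
  have -> : E (fun e => Bb e * Bb e) = E (fun e => \sum_(r <= a < 2 * r) \sum_(r <= b < 2 * r) Zb a e * Zb b e).
   by congr E; apply/funext => e; rewrite /Bb mulr_suml; apply: eq_bigr => a _; rewrite mulr_sumr.
  rewrite (Esum WL) => [|a _]; last by apply: nice_sum => b _; exact: nice_mul.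
  apply: ler_sum_nat => a /andP[_ ar]; rewrite (Esum WL) => [|b _]; last exact: nice_mul.
  apply: ler_sum_nat => b /andP[_ br]; case: (leqP a b) => ab.
   by apply: E_ZbZb => //; exact: leq_trans rD.
  have -> : E (fun e => Zb a e * Zb b e) = E (fun e => Zb b e * Zb a e).
   by congr E; apply/funext => e; rewrite mulrC.
  have := @E_ZbZb b a (ltnW ab) (leq_trans ar rD).
  by rewrite mulrC /P /Psi pair_sum_sym.
 have -> : \sum_(r <= a < 2 * r) \sum_(r <= b < 2 * r) (m a * m b + P a b) =
   mB ^+ 2 + \sum_(r <= a < 2 * r) \sum_(r <= b < 2 * r) P a b.
  rewrite expr2 /mB mulr_suml -big_split/=; apply: eq_bigr => a _.
  by rewrite big_split/= mulr_sumr.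
 by rewrite lerD2l; exact: (Psi_sum al01 Ck0 ck0 q4 H0 phi01 Kk phil e0).
have mB2 : 0 < mB ^+ 2 by rewrite exprn_gt0.
have nV : nice (fun e => (-(2 * mB)) * Bb e + mB ^+ 2).
 by apply: nice_add; [exact: nice_scale|exact: nice_cst].
have nT : nice (fun e => Bb e * Bb e + ((-(2 * mB)) * Bb e + mB ^+ 2)) by exact: nice_add.
apply: (via (4 / mB ^+ 2 * E (fun e => Bb e * Bb e + ((-(2 * mB)) * Bb e + mB ^+ 2)))).
 rewrite -(EZ WL _ nT); apply: (Ele WL bad_nice (nice_scale _ nT)) => e.
 have -> : Bb e * Bb e + (- (2 * mB) * Bb e + mB ^+ 2) = (mB - Bb e) ^+ 2 by ring.
 case: (boolP (bad e)) => [bd|_]; last by rewrite mulr_ge0 ?sqr_ge0// divr_ge0// ltW.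
 rewrite mulrAC ler_pdivlMr// mul1r.
 have -> : 4 * (mB - Bb e) ^+ 2 = (2 * (mB - Bb e)) ^+ 2 by ring.
 rewrite ler_sqr ?nnegrE ?(ltW mB0)//; move: bd; rewrite /bad; lra.
rewrite (ED WL nBB nV) (EL WL _ nB (nice_cst _)) (EC WL) E_Bb.
rewrite mulrAC ler_pdivrMr//.
have -> : 4 * pairA al Ck ck q * eps * mB ^+ 2 = 4 * (pairA al Ck ck q * eps * mB ^+ 2) by ring.
rewrite ler_pM2l//.
move: S2; rewrite !expr2; lra.
Qed.
End second_moment.

(** * Chaining good blocks *)

Lemma block_gap (q r b0 b i j : nat) : (4 < q)%N -> (b0 < b)%N -> (i < b0 * (q * r) + (q - 1) * r)%N ->
 (b * (q * r) + r <= j)%N -> (2 * r <= j - i)%N.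
move=> q4 bb ib jb.
have h1 : (b0.+1 * (q * r) <= b * (q * r))%N by rewrite leq_mul2r bb orbT.
have h2 : (b0.+1 * (q * r) = b0 * (q * r) + (q - 1) * r + r)%N by nia.
lia.
Qed.

Lemma block_span (q r b0 b i j : nat) : (4 < q)%N -> (b0 < b)%N -> (b0 * (q * r) <= i)%N ->
 (j < b * (q * r) + 2 * r)%N -> (j - i <= 2 * (b - b0) * (q * r))%N.
move=> q4 bb ib jb.
have h1 : (b * (q * r) = b0 * (q * r) + (b - b0) * (q * r))%N by rewrite -mulnDl subnKC// ltnW.
have h2 : (2 * r <= (b - b0) * (q * r))%N.
 by rewrite mulnA leq_mul2r; apply/orP; right; rewrite (leq_trans _ (leq_mul (_ : 1 <= b - b0)%N (leqnn q)))// ?mul1n ?subn_gt0//; lia.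
nia.
Qed.

Lemma block_end (q r : nat) : (4 < q)%N -> ((q - 1) * r <= q * r)%N.
by move=> q4; rewrite leq_mul2r leq_subr orbT. Qed.

Lemma start_in_block (q r : nat) : (4 < q)%N -> (2 * r <= q * r)%N.
by move=> q4; rewrite leq_mul2r (leq_trans _ q4) ?orbT. Qed.

Lemma glog_incr {R : realType} (L : R) i j e : 0 < L -> glog L (incr i j e) <= \sum_(i <= k < j) glog L (e k).
move=> L0.
case: (leqP i j) => ij; last by rewrite /incr !big_geq ?(ltnW ij)// glog0.
rewrite -(subnKC ij); elim: (j - i)%N => [|n IH]; first by rewrite addn0 /incr !big_geq// glog0.
rewrite addnS /incr !big_nat_recr ?leq_addr//=.
apply: (via (glog L (incr i (i + n) e) + glog L (e (i + n)%N))); last by rewrite lerD2r.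
exact: glog_sub.
Qed.

Lemma link_shift {R : realType} (p : R -> int -> R) rho h i j k e : link p rho h (k + i) (k + j) e = link p rho h i j (shift k e).
rewrite /link subnDl; congr (p _ _).
by rewrite /incr [(k + i)%N]addnC [(k + j)%N]addnC big_addn addnK; apply: eq_bigr => x _; rewrite /shift addnC.
Qed.

Lemma ln_link_bound {R : realType} (p : R -> int -> R) (a cL t : R) x : 0 < cL -> link_bound p a cL ->
 2 <= t -> 0 < p t x /\ ln cL - a * ln t - 2 * ln (1 + (absz x)%:R * t `^ (- a)) <= ln (p t x).
move=> cL0 plink t2; have t0 : 0 < t by lra.
have q0 : 0 < 1 + (absz x)%:R * t `^ (- a) by rewrite ltr_wpDr// mulr_ge0 ?powR_ge0.
have low := plink t x t2.
have c0 : 0 < cL * t `^ (- a) by rewrite mulr_gt0 ?powR_gt0.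
have low0 := mulr_gt0 c0 (powR_gt0 (- 2) q0); have lp := lt_le_trans low0 low.
split => //; apply: (via (ln (cL * t `^ (- a) * (1 + (absz x)%:R * t `^ (- a)) `^ (- 2)))).
 by rewrite (lnM (x := cL * _)) ?posrE ?powR_gt0// (lnM (x := cL)) ?posrE ?powR_gt0// !ln_powR !mulNr.
by rewrite ler_ln ?posrE.
Qed.

Section chain.
Context {R : realType}.
Variables (p : R -> int -> R) (rho h z a cL mb : R) (q r : nat) (B : (nat -> int) -> R).
Variables (J : int -> R).
Hypotheses (HE : heat J p) (rho01 : 0 <= rho <= 1 / 2) (h0 : 0 < h) (z0 : 0 < z) (a0 : 0 < a)
 (cL0 : 0 < cL) (q4 : (4 < q)%N).
Let l : R := r%:R * h.
Hypotheses (l2 : 2 <= l) (mb0 : 0 < mb) (plink : link_bound p a cL).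

Let l0 : 0 < l. exact: lt_le_trans l2. Qed.
Let L : R := l `^ a.
Let L0 : 0 < L. by rewrite powR_gt0. Qed.
Let s : nat := (q * r)%N.
Let C : nat := ((q - 2) * r)%N.
Let D : nat := ((q - 1) * r)%N.
Let f (i : nat) : R := (C <= i)%N%:R.
Let rho1 : 0 <= rho <= 1.
by case/andP: rho01 => -> /= ?; lra. Qed.
Let r0 : (0 < r)%N.
by rewrite lt0n; apply/eqP => rE; move: l0; rewrite /l rE mul0r ltxx. Qed.

Let Bb (e : nat -> int) : R := \sum_(r <= i < 2 * r) paths p rho h z f D i e.

Definition disp (e : nat -> int) (b : nat) : R := \sum_(b * s <= k < b.+1 * s) glog L (e k).

Lemma disp_ge0 e b : 0 <= disp e b.
by apply: sumr_ge0 => k _; exact: glog_ge0. Qed.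

Lemma disp_cat e b0 b : (b0 <= b)%N ->
 \sum_(b0 <= k < b) disp e k = \sum_(b0 * s <= k < b * s) glog L (e k).
elim: b => [|b IH]; first by rewrite leqn0 => /eqP ->; rewrite !big_geq.
rewrite leq_eqVlt => /predU1P[->|]; first by rewrite !big_geq.
rewrite ltnS => bb; rewrite big_nat_recr//= IH// [RHS](cat_nat (b * s))//= ?leq_mul2r ?bb ?orbT//.
by rewrite leqnSn orbT.
Qed.

Lemma link_lower e b0 b i j : (b0 < b)%N -> (b0 * s <= i < b0 * s + D)%N ->
 (b * s + r <= j < b * s + 2 * r)%N ->
 0 < link p rho h i j e /\
 ln cL - a * ln l - a * ln (2 * q%:R) - a * (b - b0.+1)%:R - 2 * (\sum_(b0 <= k < b.+1) disp e k)
  <= ln (link p rho h i j e).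
move=> bb /andP[ib0 ib1] /andP[jb0 jb1].
have gap := block_gap q4 bb ib1 jb0.
have span := block_span q4 bb ib0 jb1.
set t := (1 - rho) * ((j - i)%:R * h).
have [r0' r1'] := andP rho01.
have gapR : 2 * l <= (j - i)%:R * h.
 by rewrite /l mulrA ler_wpM2r ?(ltW h0)// -natrM ler_nat.
have tl : l <= t.
 rewrite /t; have : 0 <= (1 / 2 - rho) * ((j - i)%:R * h).
  by rewrite mulr_ge0 ?subr_ge0// mulr_ge0// ltW.
 by lra.
have t2 : 2 <= t by exact: le_trans tl.
have t0 : 0 < t by exact: lt_le_trans t2.
have thi : t <= (2 * (b - b0)%:R * q%:R) * l.
 apply: (via ((j - i)%:R * h)).
  by rewrite ler_piMl ?mulr_ge0 ?(ltW h0)// gerBl.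
 rewrite /l mulrA ler_wpM2r ?(ltW h0)//.
 by rewrite -[_ * r%:R]mulrA -!natrM ler_nat.
have q0 : 0 < 1 + (absz (incr i j e))%:R * t `^ (- a).
 by rewrite ltr_wpDr// mulr_ge0 ?powR_ge0.
have [lp low] := ln_link_bound (incr i j e) cL0 plink t2.
split; first exact: lp.
apply: (le_trans _ low).
have bR : 1 <= (b - b0)%:R :> R by rewrite ler1n subn_gt0.
have qR : 1 <= q%:R :> R by rewrite ler1n (leq_trans _ q4).
have lnt : ln t <= ln l + ln (2 * q%:R) + (b - b0.+1)%:R.
 apply: (via (ln (2 * (b - b0)%:R * q%:R * l))).
  rewrite ler_ln ?posrE// !mulr_gt0// ?ltr0n ?subn_gt0// (leq_trans _ q4)//.
 have -> : 2 * (b - b0)%:R * q%:R * l = l * (2 * q%:R) * (b - b0)%:R by ring.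
 rewrite !lnM ?posrE ?mulr_gt0 ?ltr0n ?subn_gt0// ?(leq_trans _ q4)//.
 rewrite lerD2l; have : ((b - b0)%:R : R) = 1 + (b - b0.+1)%:R by rewrite nat1r subnSK.
 move=> ->; apply: le_ln1Dx; exact: lt_le_trans (ler0n _ _).
have G : ln (1 + (absz (incr i j e))%:R * t `^ (- a)) <= \sum_(b0 <= k < b.+1) disp e k.
 apply: (via (glog L (incr i j e))).
  rewrite /glog ler_ln ?posrE//; last by rewrite ltr_wpDr// divr_ge0// ltW.
  rewrite lerD2l ler_wpM2l// /L -powRN.
  by apply: pow_leN => //; exact: ltW.
 apply: (le_trans (glog_incr i j e L0)); rewrite disp_cat ?leqW 1?ltnW//.
 have jS : (j <= b.+1 * s)%N.
  by rewrite mulSn addnC (leq_trans (ltnW jb1))// leq_add2l start_in_block.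
 case: (leqP i j) => ij; last by rewrite big_geq ?(ltnW ij)// sumr_ge0// => k _; exact: glog_ge0.
 rewrite [leRHS](cat_nat i)//=; last exact: leq_trans jS.
 rewrite [X in _ <= _ + X](cat_nat j)//=.
 rewrite addrCA lerDl addr_ge0// sumr_ge0// => k _; exact: glog_ge0.
have := ler_wpM2l (ltW a0) lnt; rewrite !mulrDr; lra.
Qed.

Variables (d m : nat).
Hypothesis md : (m * s <= d)%N.

Definition Phi (i : nat) (e : nat -> int) : R := paths p rho h z (fun=> 1) d i e.

(** The weight of the paths from [i] whose next contact lies in block [b] or
    later. *)
Definition Om (i b : nat) (e : nat -> int) : R :=
 1 + z * \sum_(b * s <= j < d) link p rho h i j e * Phi j e.

Let ltz : 0 <= z. exact: ltW. Qed.

Lemma Phi_ge0 i e : 0 <= Phi i e.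
exact: (paths_ge0 HE rho1 h0 ltz). Qed.

Let lk0 i j e : 0 <= link p rho h i j e. exact: (link_ge0 HE rho1 h0). Qed.
Lemma Om_ge1 i b e : 1 <= Om i b e.
by rewrite /Om lerDl mulr_ge0// sumr_ge0// => j _; rewrite mulr_ge0 ?Phi_ge0.
Qed.

Lemma Om_decr i b b' e : (b <= b')%N -> Om i b' e <= Om i b e.
move=> bb; rewrite /Om lerD2l ler_wpM2l//.
case: (leqP (b' * s) d) => bd; last first.
 by rewrite big_geq ?(ltnW bd)// sumr_ge0// => j _; rewrite mulr_ge0 ?Phi_ge0.
rewrite [leRHS](cat_nat (b' * s))//= ?leq_mul2r ?bb ?orbT// lerDr sumr_ge0// => j _.
by rewrite mulr_ge0 ?Phi_ge0.
Qed.

Lemma Phi_block e b mu : (b < m)%N -> 0 <= mu ->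
 (forall i, (b * s <= i < b * s + D)%N -> mu <= Om i b.+1 e) ->
 forall i, (i < D)%N -> mu * paths p rho h z f D i (shift (b * s) e) <= Phi (b * s + i) e.
move=> bm mu0 hmu; apply: (@backward_ind _ D) => i IH iD.
have bsd : (b.+1 * s <= d)%N by rewrite (leq_trans _ md)// leq_mul2r bm orbT.
have Ds : (b * s + D <= b.+1 * s)%N by rewrite mulSn addnC leq_add2r block_end.
have iS : ((b * s + i).+1 <= b * s + D)%N by rewrite ltn_add2l.
rewrite pathsE /Phi pathsE -/(Phi _ _).
rewrite [X in _ <= _ + z * X](cat_nat (b.+1 * s))//=; last exact: leq_trans iS Ds.
rewrite [z * (_ + _)]mulrDr addrCA mulrDr addrC; apply: lerD.
 have HO := hmu (b * s + i)%N; rewrite leq_addr ltn_add2l iD in HO.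
 rewrite /f; case: (C <= i)%N; last by rewrite mulr0 (le_trans ler01)//; exact: Om_ge1.
 by rewrite mulr1; exact: HO.
rewrite mulrCA; apply: ler_wpM2l => //; rewrite mulr_sumr.
rewrite [leRHS](cat_nat (b * s + D))//=.
rewrite -[leLHS]addr0; apply: lerD; last by rewrite sumr_ge0// => j _; rewrite mulr_ge0 ?Phi_ge0.
rewrite -[(b * s + i).+1]addnS [(b * s + i.+1)%N]addnC big_addn [(b * s + D)%N]addnC addnK.
apply: ler_sum_nat => j /andP[ij jD].
rewrite mulrCA [(j + b * s)%N]addnC link_shift; apply: ler_wpM2l => //.
by apply: IH; rewrite ?ij.
Qed.

Definition isbad (e : nat -> int) : bool := Bb e < mb / 2.

(** The logarithm of a typical block weight together with the cost of one
    bridge over a distance [l]. *)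
Definition Lam : R := ln (z * (mb / 2)) + ln cL - a * ln l - a * ln (2 * q%:R).

(** A bad block is skipped; the term [- a] pays for the bridge that becomes
    longer by one block. *)
Definition gain (e : nat -> int) (b : nat) : R :=
 (if isbad (shift (b * s) e) then - a else Lam) - 4 * disp e b.

(** Backward induction on [b]: a good block is entered by a bridge into its
    start window and left from its end window; over a bad block the bridge is
    prolonged. *)
Lemma chain_step e : forall b b0 i, (b <= m)%N -> (b0 < b)%N -> (b0 * s <= i < b0 * s + D)%N ->
 \sum_(b <= k < m) gain e k - a * (b - b0.+1)%:R - 2 * \sum_(b0 <= k < b) disp e k <= ln (Om i b e).
apply: (@backward_ind _ m.+1) => b IH b0 i bm b0b ib.
have O0 k j : 0 < Om j k e by apply: lt_le_trans (Om_ge1 j k e).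
have ds k k' : 0 <= \sum_(k <= x < k') disp e x by apply: sumr_ge0 => x _; exact: disp_ge0.
move: bm; rewrite leq_eqVlt => /predU1P[->|bm].
 rewrite big_geq// sub0r; apply: (via 0); last by rewrite ln_ge0// Om_ge1.
 rewrite -opprD oppr_le0 addr_ge0// mulr_ge0//; exact: ltW.
have IH1 : (b < b.+1 < m.+1)%N by rewrite ltnSn ltnS.
rewrite big_ltn// -[gain e b]/(_ - 4 * disp e b); case: (boolP (isbad _)) => [_|good].
 have h1 := IH b.+1 IH1 b0 i bm (ltnW b0b) ib.
 apply: le_trans (_ : _ <= ln (Om i b.+1 e)) _; last by rewrite ler_ln ?posrE//; exact: Om_decr.
 move: h1; rewrite big_nat_recr ?(ltnW b0b)//=.
 have -> : (b.+1 - b0.+1 = (b - b0.+1).+1)%N by rewrite -subSn.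
 by rewrite -natr1; have := disp_ge0 e b; lra.
pose lmu := \sum_(b.+1 <= k < m) gain e k - 2 * disp e b.
have hmu j : (b * s <= j < b * s + D)%N -> expR lmu <= Om j b.+1 e.
 move=> jb; have := IH b.+1 IH1 b j bm (ltnSn b) jb.
 rewrite subnn mulr0 subr0 big_nat1 => h1.
 by rewrite -[Om _ _ _]lnK ?posrE// ler_expR.
have PB := Phi_block bm (expR_ge0 _) hmu.
pose lw := ln cL - a * ln l - a * ln (2 * q%:R) - a * (b - b0.+1)%:R - 2 * (\sum_(b0 <= k < b.+1) disp e k).
have big : expR lw * (z * (mb / 2)) * expR lmu <= Om i b e.
 have rs : (b * s + 2 * r <= d)%N.
  rewrite (leq_trans _ md)// (leq_trans (_ : _ <= b.+1 * s)%N)//.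
   by rewrite mulSn addnC leq_add2r start_in_block.
  by rewrite leq_mul2r bm orbT.
 apply: (via (z * \sum_(r <= x < 2 * r) expR lw * (expR lmu * paths p rho h z f D x (shift (b * s) e)))).
  rewrite -mulr_sumr -mulr_sumr.
  have -> : expR lw * (z * (mb / 2)) * expR lmu = z * (expR lw * (expR lmu * (mb / 2))) by ring.
  do 3!(apply: ler_wpM2l; rewrite ?expR_ge0//).
  by move: good; rewrite /isbad -leNgt.
 rewrite /Om; apply: ler_wpDl => //; apply: ler_wpM2l => //.
 rewrite [leRHS](cat_nat (b * s + r))//= ?leq_addr//; last first.
  by rewrite (leq_trans _ rs)// leq_add2l leq_pmull.
 rewrite [X in _ <= _ + X](cat_nat (b * s + 2 * r))//= ?leq_add2l ?leq_pmull//.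
 rewrite -[leLHS]add0r; apply: lerD.
  by rewrite sumr_ge0// => j _; rewrite mulr_ge0 ?Phi_ge0.
 rewrite -[leLHS]addr0; apply: lerD; last first.
  by rewrite sumr_ge0// => j _; rewrite mulr_ge0 ?Phi_ge0.
 rewrite [(b * s + r)%N]addnC big_addn [(b * s + 2 * r)%N]addnC addnK.
 apply: ler_sum_nat => x /andP[rx x2]; rewrite addnC.
 have jb : (b * s + r <= b * s + x < b * s + 2 * r)%N by rewrite leq_add2l ltn_add2l rx.
 have [w0 wl] := link_lower e b0b ib jb.
 apply: ler_pM.
 - exact: expR_ge0.
 - by rewrite mulr_ge0 ?expR_ge0//; exact: (paths_ge0 HE rho1 h0 ltz).
 - by rewrite -[leRHS]lnK ?posrE// ler_expR.
 - by apply: PB; rewrite (leq_trans x2)// two_r_le_D.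
have zm : 0 < z * (mb / 2) by rewrite mulr_gt0// divr_gt0.
have P0 : 0 < expR lw * (z * (mb / 2)) * expR lmu.
 by rewrite mulr_gt0 ?expR_gt0// mulr_gt0 ?expR_gt0.
apply: le_trans (_ : ln (expR lw * (z * (mb / 2)) * expR lmu) <= _); last by rewrite ler_ln ?posrE.
rewrite lnM ?posrE ?expR_gt0// ?mulr_gt0 ?expR_gt0//.
rewrite lnM ?posrE ?expR_gt0// !expRK /lw /lmu /Lam.
rewrite big_nat_recr ?(ltnW b0b)//=; lra.
Qed.

Lemma chain_bound e : (0 < m)%N ->
 \sum_(1 <= k < m) gain e k - 2 * disp e 0 <= ln (Phi 0 e).
move=> m0; have D0 : (0 < D)%N by rewrite muln_gt0 r0 subn_gt0 (leq_trans _ q4).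
have := @chain_step e 1 0 0 m0 isT; rewrite mul0n add0n D0 => /(_ isT).
rewrite subnn mulr0 subr0 big_nat1 => /le_trans; apply.
have O0 : 0 < Om 0 1 e by apply: lt_le_trans (Om_ge1 0 1 e).
have OP : Om 0 1 e <= Phi 0 e.
 rewrite /Phi pathsE /Om lerD2l ler_wpM2l//.
 have s0 : (0 < s)%N by rewrite muln_gt0 r0 (leq_trans _ q4).
 rewrite mul1n [leRHS](cat_nat s)//=.
  by rewrite lerDr sumr_ge0// => j _; rewrite mulr_ge0 ?Phi_ge0.
 by rewrite (leq_trans _ md)// leq_pmull.
by rewrite ler_ln ?posrE//; exact: lt_le_trans OP.
Qed.

(** Truncation makes the displacements bounded functionals; the level [M] is
    large enough for the bound to become trivial when it is exceeded. *)
Definition tdisp (M : R) (e : nat -> int) : R := Num.min (\sum_(0 <= k < s) glog L (e k)) M.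

Definition tgain (M : R) (e : nat -> int) : R := (if isbad e then - a else Lam) - 4 * tdisp M e.

Lemma disp_shift e b : disp e b = \sum_(0 <= k < s) glog L (shift (b * s) e k).
rewrite /disp mulSn -{1}[(b * s)%N]add0n big_addn addnK; apply: eq_bigr => k _.
by rewrite /shift addnC.
Qed.

Lemma chain_bound_trunc e M : (0 < m)%N -> m%:R * `|Lam| <= M ->
 \sum_(1 <= k < m) tgain M (shift (k * s) e) - 2 * tdisp M e <= ln (Phi 0 e).
move=> m0 mM.
have M0 : 0 <= M by apply: le_trans mM; rewrite mulr_ge0.
have t0 e' : 0 <= tdisp M e'.
 by rewrite le_min M0 andbT sumr_ge0// => k _; exact: glog_ge0.
have d0E : disp e 0 = \sum_(0 <= k < s) glog L (e k) by rewrite /disp mul0n mul1n.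
case: (boolP [forall k : 'I_m, disp e k <= M]) => [/forallP small|/forallPn[k0 /negbTE hk]].
 have dE k : (k < m)%N -> tdisp M (shift (k * s) e) = disp e k.
  move=> km; rewrite /tdisp -disp_shift; apply/min_idPl; exact: (small (Ordinal km)).
 have -> : tdisp M e = disp e 0.
  by rewrite /tdisp -d0E; apply/min_idPl; exact: (small (Ordinal m0)).
 apply: le_trans (chain_bound e m0); rewrite lerD2r; apply: ler_sum_nat => k /andP[_ km].
 by rewrite /tgain /gain dE.
apply: (via 0); last first.
 rewrite ln_ge0// /Phi pathsE lerDl mulr_ge0// sumr_ge0// => j _.
 by rewrite mulr_ge0 ?Phi_ge0.
have big : tdisp M (shift (k0 * s) e) = M.
 rewrite /tdisp -disp_shift; apply/min_idPr; rewrite leNgt; apply/negP => /ltW.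
 by rewrite hk.
have tg e' : tgain M e' <= `|Lam| - 4 * tdisp M e'.
 rewrite /tgain lerD2r; case: ifP => _; last exact: ler_norm.
 by rewrite (le_trans _ (normr_ge0 _))// oppr_le0 ltW.
have mS : (m.-1%:R : R) <= m%:R by rewrite ler_nat leq_pred.
have L1 := normr_ge0 Lam.
have S1 : \sum_(1 <= k < m) tgain M (shift (k * s) e) <= m%:R * `|Lam| - 4 * \sum_(1 <= k < m) tdisp M (shift (k * s) e).
 rewrite mulr_sumr; apply: (via (\sum_(1 <= k < m) (`|Lam| - 4 * tdisp M (shift (k * s) e)))).
  by apply: ler_sum => k _; exact: tg.
 rewrite big_split/= sumrN lerD2r sumr_const_nat subn1 -[_ *+ _]mulr_natl.
 by rewrite ler_wpM2r.
have T0 : 0 <= \sum_(1 <= k < m) tdisp M (shift (k * s) e) by rewrite sumr_ge0.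
have TM : M <= 4 * (\sum_(1 <= k < m) tdisp M (shift (k * s) e)) + 2 * tdisp M e.
 case: (posnP k0) => k00.
  have : tdisp M e = M.
   rewrite -[RHS]big; congr (tdisp M _); apply/funext => x; by rewrite k00 mul0n /shift add0n.
  by lra.
 have : tdisp M (shift (k0 * s) e) <= \sum_(1 <= k < m) tdisp M (shift (k * s) e).
  rewrite (@bigD1_seq _ _ _ _ _ (k0 : nat))//= ?mem_index_iota ?k00 ?ltn_ord ?iota_uniq//.
  by rewrite lerDl sumr_ge0.
 have := t0 e; rewrite big; lra.
lra.
Qed.
End chain.

(** * The mean gain of a chain *)

Lemma minr_sum_le {R : realType} (n : nat) (F : nat -> R) (M : R) : 0 <= M -> (forall k, 0 <= F k) ->
 Num.min (\sum_(0 <= k < n) F k) M <= \sum_(0 <= k < n) Num.min (F k) M.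
move=> M0 F0; elim: n => [|n IH]; first by rewrite !big_geq// ge_min lexx.
rewrite !big_nat_recr//=; set A := \sum_(0 <= k < n) F k in IH *.
apply: le_trans (_ : Num.min A M + Num.min (F n) M <= _); last by rewrite lerD2r.
have A0 : 0 <= A by apply: sumr_ge0.
have Fn := F0 n.
by rewrite !minEle; do 3!case: ifPn; rewrite -?ltNge; lra.
Qed.

Lemma block_index (q r i j : nat) : (4 < q)%N -> (i < 2 * r)%N -> ((q - 2) * r <= j)%N ->
 ((q - 4) * r <= j - i)%N.
move=> q4 ir qj; have : ((q - 2) * r = (q - 4) * r + 2 * r)%N by rewrite -mulnDl; congr (_ * _)%N; lia.
lia.
Qed.

Lemma nice_ln {R : realType} (F : (nat -> int) -> R) : nice F -> (forall e, 1 <= F e) -> nice (fun e => ln (F e)).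
move=> [[n cF] [M FM]] F1; apply: (nice_cyl (n := n) (M := M)).
 by move=> e e' h'; rewrite (cF e e').
move=> e; rewrite ln_ge0//=; apply: le_trans (FM e).
apply: le_trans (ler_norm _); have e1 := F1 e.
have := @le_ln1Dx R (F e - 1); rewrite (_ : 1 + (F e - 1) = F e); last by ring.
by move=> h1; apply: (le_trans (h1 _)); lra.
Qed.

(** One increment has mean displacement [delta * C], since [heat_sub] counts
    the jumps. *)
Lemma E_step_glog {R : realType} (J : int -> R) (p : R -> int -> R) (E : ((nat -> int) -> R) -> R)
  (delta gamma Cg L : R) (k : nat) (M : R) :
 heat J p -> walk_law J delta E -> 0 <= delta -> 1 <= L ->
 (forall l, 1 <= l -> (\esum_x (glog l x * J x)%:E <= (Cg * l `^ (- gamma))%:E)%E) ->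
 0 <= M -> E (fun e => Num.min (glog L (e k)) M) <= delta * (Cg * L `^ (- gamma)).
move=> HE WL t0 L1 glogJ M0; have L0 : 0 < L by exact: lt_le_trans L1.
pose g (y : int) : R := Num.min (glog L y) M.
have gM y : 0 <= g y <= M by rewrite /g le_min glog_ge0// M0 ge_min lexx orbT.
have -> : E (fun e : nat -> int => g (e k)) = E (fun e => g (incr k k.+1 e)).
 by congr E; apply/funext => e; rewrite /incr big_nat1.
rewrite (@E_incr _ _ _ _ WL k k.+1 g M (leqnSn k) gM) subSnn mulr1.
have ub : (\esum_y ((g y)%:E * pt J delta y) <= (delta * (Cg * L `^ (- gamma)))%:E)%E.
 apply: (via (\esum_y (glog L y * p delta y)%:E)).
  apply: le_esum => y _; rewrite (heat_pt HE)// -EFinM lee_fin ler_wpM2r ?(heat_ge0 HE)//.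
  by rewrite /g ge_min lexx.
 apply: (le_trans (heat_sub HE t0 (glog0 L) (fun y => glog_ge0 y L0) (fun x y => glog_sub x y L0))).
 by rewrite [leRHS]EFinM lee_wpmul2l// ?lee_fin//; exact: glogJ.
have nn : (0 <= \esum_y ((g y)%:E * pt J delta y))%E.
 by apply: esum_ge0 => y _; rewrite (heat_pt HE)// -EFinM lee_fin mulr_ge0 ?(heat_ge0 HE)//; case/andP: (gM y).
rewrite /Et -lee_fin fineK// ge0_fin_numE//; exact: le_lt_trans ub (ltry _).
Qed.

Section expected_chain.
Context {R : realType}.
Variables (J : int -> R) (p : R -> int -> R) (E : ((nat -> int) -> R) -> R).
Variables (rho h z a cL mb gamma Cg : R) (q r : nat).
Hypotheses (HE : heat J p) (rho01 : 0 <= rho <= 1 / 2) (h0 : 0 < h) (z0 : 0 < z) (a0 : 0 < a)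
 (cL0 : 0 < cL) (q4 : (4 < q)%N) (l2 : 2 <= r%:R * h) (mb0 : 0 < mb) (plink : link_bound p a cL)
 (WL : walk_law J (rho * h) E) (ag : a * gamma = 1).
Hypothesis glogJ : forall l, 1 <= l ->
 (\esum_x (glog l x * J x)%:E <= (Cg * l `^ (- gamma))%:E)%E.

Let l : R := r%:R * h.
Let l0 : 0 < l. exact: lt_le_trans l2. Qed.
Let L : R := l `^ a.
Let L0 : 0 < L. by rewrite powR_gt0. Qed.
Let rho1 : 0 <= rho <= 1.
by case/andP: rho01 => -> /= ?; lra. Qed.
Let rho0 : 0 <= rho. by case/andP: rho01. Qed.
Lemma E_tdisp M : 0 <= M -> E (tdisp h a q r M) <= q%:R * (rho * Cg).
move=> M0.
pose g (y : int) : R := Num.min (glog L y) M.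
have gM y : 0 <= g y <= M by rewrite /g le_min glog_ge0// M0 ge_min lexx orbT.
have ng k : nice (fun e : nat -> int => g (e k)).
 by apply: (nice_cyl (n := k.+1) (M := M)) => // e e' h'; rewrite h'.
have nt : nice (tdisp h a q r M).
 apply: (nice_cyl (n := (q * r)%N) (M := M)).
  by move=> e e' h'; congr Num.min; apply: eq_big_nat => k /andP[_ ks]; rewrite h'.
 move=> e; rewrite /tdisp le_min M0 andbT ge_min lexx orbT andbT sumr_ge0// => k _.
 exact: glog_ge0.
apply: (via (E (fun e => \sum_(0 <= k < q * r) g (e k)))).
 apply: (Ele WL nt); first exact: nice_sum.
 by move=> e; apply: minr_sum_le => // k; exact: glog_ge0.
rewrite (Esum WL)//.
have L1 : 1 <= L by rewrite -(powRr0 l) ler_powR ?(ltW a0)// (le_trans _ l2)// ler1n.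
have t0 : 0 <= rho * h by rewrite mulr_ge0// ltW.
have Eg k : E (fun e : nat -> int => g (e k)) <= rho * h * (Cg / l).
 apply: (le_trans (E_step_glog k HE WL t0 L1 glogJ M0)).
 by rewrite /L -powRrM mulrN ag powR_inv1//; exact: ltW.
apply: (via (\sum_(0 <= k < q * r) rho * h * (Cg / l))); first by apply: ler_sum => k _; exact: Eg.
rewrite sumr_const_nat subn0 -[_ *+ _]mulr_natl natrM /l.
have r0 : r%:R != 0 :> R by apply/eqP => rE; move: l0; rewrite /l rE mul0r ltxx.
have hn : h != 0 by rewrite gt_eqF.
by apply: eq_ler; field; rewrite r0 hn.
Qed.

Variables (d m : nat) (dl : R).
Hypotheses (md : (m * (q * r) <= d)%N) (m0 : (0 < m)%N)
 (bad_le : E (fun e => (isbad p rho h z mb q r e)%:R) <= dl)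
 (Lam0 : 0 <= a + Lam h z a cL mb q r).

Lemma Phi_ge1 i e : 1 <= Phi p rho h z d i e.
rewrite /Phi pathsE lerDl mulr_ge0 ?(ltW z0)// sumr_ge0// => j _.
by rewrite mulr_ge0 ?(link_ge0 HE rho1 h0)// (paths_ge0 HE rho1 h0 (ltW z0)).
Qed.

Lemma Phi_nice i : nice (Phi p rho h z d i).
by apply: (paths_nice HE rho1 h0 (ltW z0)). Qed.

Lemma chain_expectation :
 m.-1%:R * (Lam h z a cL mb q r - (a + Lam h z a cL mb q r) * dl - 4 * (q%:R * (rho * Cg)))
  - 2 * (q%:R * (rho * Cg)) <= E (fun e => ln (Phi p rho h z d 0 e)).
pose La := Lam h z a cL mb q r; have La0 : 0 <= a + La := Lam0; rewrite -/La.
pose M := m%:R * `|La|.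
have M0 : 0 <= M by rewrite mulr_ge0.
have nt : nice (tdisp h a q r M).
 apply: (nice_cyl (n := (q * r)%N) (M := M)).
  by move=> e e' h'; congr Num.min; apply: eq_big_nat => k /andP[_ ks]; rewrite h'.
 move=> e; rewrite /tdisp le_min M0 andbT ge_min lexx orbT andbT sumr_ge0// => k _.
 exact: glog_ge0.
have nb : nice (fun e => (isbad p rho h z mb q r e)%:R : R).
 apply: (nice_dep (a := 0%N) (b := ((q - 1) * r)%N) (M := 1)); last first.
  by move=> e; case: isbad; rewrite ?ler01 ?lexx.
 move=> e e' h'; congr (_%:R); rewrite /isbad; congr (nat_of_bool (_ < _)).
 apply: eq_big_nat => i /andP[ri ir]; apply: paths_dep => k /andP[ik kD].
 by apply: h'; rewrite kD.
have tgE : tgain p rho h z a cL mb q r M =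
  fun e => (La + - (a + La) * (isbad p rho h z mb q r e)%:R) - 4 * tdisp h a q r M e.
 apply/funext => e; rewrite /tgain -/La; congr (_ - _); case: isbad => /=; lra.
have ntg : nice (tgain p rho h z a cL mb q r M).
 rewrite tgE; apply: nice_add; last by apply: nice_opp; exact: nice_scale.
 by apply: nice_add; [exact: nice_cst|exact: nice_scale].
have nP := nice_ln (Phi_nice 0) (Phi_ge1 0).
have Etg : La - (a + La) * dl - 4 * (q%:R * (rho * Cg)) <= E (tgain p rho h z a cL mb q r M).
 rewrite tgE (EB WL); last exact: nice_scale; last first.
  by apply: nice_add; [exact: nice_cst|exact: nice_scale].
 rewrite (ED WL (nice_cst _) (nice_scale _ nb)) (EC WL) !(EZ WL)//.
 have h1 := ler_wpM2l La0 bad_le; have h2 := E_tdisp M0.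
 by rewrite mulNr; lra.
have ns : nice (fun e => \sum_(1 <= k < m) tgain p rho h z a cL mb q r M (shift (k * (q * r)) e)).
 by apply: nice_sum => k _; exact: (nice_shift (k * (q * r)) ntg).
apply: (via (E (fun e => \sum_(1 <= k < m) tgain p rho h z a cL mb q r M (shift (k * (q * r)) e) -
   2 * tdisp h a q r M e))).
 rewrite (EB WL ns (nice_scale _ nt)) (EZ WL _ nt) (Esum WL); last first.
  by move=> k _; exact: (nice_shift (k * (q * r)) ntg).
 have h2 := E_tdisp M0; apply: lerB; last by rewrite ler_pM2l.
 apply: (via (\sum_(1 <= k < m) (E (tgain p rho h z a cL mb q r M)))).
  by rewrite sumr_const_nat subn1 -[leRHS]mulr_natl ler_wpM2l.
 by apply: ler_sum => k _; rewrite (E_shift WL).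
apply: (Ele WL) => //; first by apply: nice_add => //; apply: nice_opp; exact: nice_scale.
by move=> e; apply: (chain_bound_trunc HE).
Qed.
End expected_chain.

Lemma block_width (q r : nat) : (4 < q)%N -> ((q - 1) * r - (q - 2) * r = r)%N.
by move=> q4; rewrite -mulnBl -[RHS]mul1n; congr (_ * _)%N; lia. Qed.

Lemma block_mid (q r : nat) : (4 < q)%N ->
 (2 * r <= (q - 2) * r)%N /\ ((q - 2) * r <= (q - 1) * r)%N.
by move=> q4; rewrite !leq_mul2r; split; apply/orP; right; lia. Qed.

Section block_gain.
Context {R : realType}.
Variables (al Ck ck bz cL : R) (q H r : nat) (phi z : R) (kap : nat -> R).
Let h : R := H%:R^-1.
Hypotheses (al01 : 0 < al < 1 / 2) (Ck0 : 0 < Ck) (ck0 : 0 < ck) (q4 : (4 < q)%N)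
 (H0 : (0 < H)%N) (phi01 : 0 < phi <= 1) (Kk : rkernel al Ck ck h phi kap)
 (phil : 1 <= phi * (r%:R * h) <= 2) (bz0 : 0 < bz) (bz_le : bz * h <= z) (cL0 : 0 < cL).
Let l : R := r%:R * h.
Let a : R := 1 + al.

Definition gain_cst : R := ln (bz * u_all_const al Ck * cL / 2).

Let h01 : 0 < h <= 1.
by rewrite invr_gt0 ltr0n H0 invf_le1 ?ler1n ?ltr0n. Qed.
Let al1 : 0 < al < 1. by case/andP: al01 => -> /= ?; lra. Qed.
Let phi0 : 0 < phi. by case/andP: phi01. Qed.
Let l0 : 0 < l.
by case/andP: phil => h1 _; rewrite -(pmulr_rgt0 _ phi0); exact: lt_le_trans h1. Qed.

(** The density is at least of order [h * phi `^ (1 - al)] everywhere, and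
    [growth] contributes the exponential of the time between the windows. *)
Lemma mB_lower : l * r%:R * (u_all_const al Ck * (phi `^ (1 - al))) * expR ((q - 4)%:R * (phi * l)) <= mB q H r phi kap.
have h0 : 0 < h by case/andP: h01.
have uc0 : 0 < u_all_const al Ck by apply: u_all_const_gt0.
pose w := u_all_const al Ck * (h * phi `^ (1 - al)) * expR ((q - 4)%:R * (phi * l)).
have w0 : 0 <= w by rewrite !mulr_ge0 ?powR_ge0 ?expR_ge0 ?(ltW h0) ?(ltW uc0).
have wE i j : (i < 2 * r)%N -> ((q - 2) * r <= j)%N -> w <= ff H phi kap (j - i).
 move=> ir qj; apply: ler_pM; rewrite ?expR_ge0//.
 - by rewrite !mulr_ge0 ?powR_ge0 ?(ltW h0) ?(ltW uc0).
 - exact: (u_all al1 Ck0 ck0 h01 phi01 Kk).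
 rewrite ler_expR mulrCA ler_wpM2l ?(ltW phi0)// /l mulrA ler_wpM2r ?(ltW h0)//.
 by rewrite -natrM ler_nat; exact: block_index.
apply: (via (\sum_(r <= i < 2 * r) \sum_((q - 2) * r <= j < (q - 1) * r) w)).
 rewrite !sumr_const_nat -[leRHS]mulr_natl -[X in _ <= _ * X]mulr_natl.
 have -> : (2 * r - r = r)%N by rewrite mulSn mul1n addnK.
 rewrite block_width//.
 by apply: eq_ler; rewrite /w /l; ring.
apply: ler_sum_nat => i /andP[ri ir].
have [b1 b2] := block_mid r q4.
have i1 : (i <= (q - 2) * r)%N by apply: leq_trans (ltnW ir) b1.
rewrite /mm [leRHS](@big_cat_nat _ _ _ ((q - 2) * r))//=.
rewrite -[leLHS]add0r; apply: lerD.
 apply: sumr_ge0 => j _; apply: mulr_ge0; first by case: (_ <= _)%N.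
 apply: mulr_ge0; last exact: expR_ge0.
 exact: (u_ge0 ck0 h01 Kk).
by apply: ler_sum_nat => j /andP[qj _]; rewrite qj mul1r; exact: wE.
Qed.

Lemma mB_gt0 : 0 < mB q H r phi kap.
apply: lt_le_trans mB_lower; have uc0 : 0 < u_all_const al Ck by apply: u_all_const_gt0.
have r0 : 0 < r%:R :> R.
 by rewrite ltr0n lt0n; apply/eqP => rE; move: l0; rewrite /l rE mul0r ltxx.
by do ![apply: mulr_gt0 => //]; rewrite ?powR_gt0 ?expR_gt0.
Qed.

(** The powers of [l] and [phi] cancel: the prefactor does not depend on the
    correlation length. *)
Lemma Lam_lower : (q - 4)%:R * (phi * l) + gain_cst - a * ln (2 * q%:R) <= Lam h z a cL (mB q H r phi kap) q r.
have h0 : 0 < h by case/andP: h01.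
have uc0 : 0 < u_all_const al Ck by apply: u_all_const_gt0.
have z0 : 0 < z by apply: lt_le_trans bz_le; rewrite mulr_gt0.
have P1 : (bz * u_all_const al Ck / 2) * l `^ a * expR ((q - 4)%:R * (phi * l)) <= z * (mB q H r phi kap / 2).
 apply: (via (bz * h * ((l * r%:R * (u_all_const al Ck * (phi `^ (1 - al))) * expR ((q - 4)%:R * (phi * l))) / 2))); last first.
  apply: ler_pM => //.
  - by rewrite mulr_ge0 ?(ltW bz0) ?(ltW h0).
  - by do ?[apply: mulr_ge0]; rewrite ?powR_ge0 ?expR_ge0 ?(ltW uc0)// ltW.
  - by rewrite ler_wpM2r//; exact: mB_lower.
 have -> : bz * h * (l * r%:R * (u_all_const al Ck * phi `^ (1 - al)) * expR ((q - 4)%:R * (phi * l)) / 2) =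
  (bz * u_all_const al Ck / 2) * (l * (l * phi `^ (1 - al))) * expR ((q - 4)%:R * (phi * l)) by rewrite /l; ring.
 apply: ler_wpM2r; first exact: expR_ge0.
 apply: ler_wpM2l.
 - by rewrite divr_ge0// mulr_ge0 ?(ltW bz0) ?(ltW uc0).
 - rewrite /a powD// powRr1 ?(ltW l0)// ler_wpM2l ?(ltW l0)//.
  have -> : l `^ al = l * l^-1 `^ (1 - al).
   rewrite -powR_inv1 ?(ltW l0)// -powRrM -{2}(powRr1 (ltW l0)) -powD//.
   by congr (_ `^ _); ring.
  rewrite ler_wpM2l ?(ltW l0)//; apply: ge0_ler_powR.
  + by case/andP: al1 => _ ?; lra.
  + by rewrite nnegrE invr_ge0 ltW.
  + by rewrite nnegrE ltW.
  + by rewrite -[l^-1]mul1r ler_pdivrMr//; case/andP: phil.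
have B0 : 0 < bz * u_all_const al Ck / 2 by rewrite divr_gt0// mulr_gt0.
have W0 : 0 < (bz * u_all_const al Ck / 2) * l `^ a by rewrite mulr_gt0 ?powR_gt0.
have G0 : 0 < (bz * u_all_const al Ck / 2) * l `^ a * expR ((q - 4)%:R * (phi * l)).
 by rewrite mulr_gt0 ?expR_gt0.
have L1 : ln ((bz * u_all_const al Ck / 2) * l `^ a * expR ((q - 4)%:R * (phi * l))) <= ln (z * (mB q H r phi kap / 2)).
 by rewrite ler_ln ?posrE// (lt_le_trans G0).
move: L1; rewrite lnM ?posrE ?expR_gt0// lnM ?posrE ?powR_gt0// ln_powR expRK.
rewrite /Lam -/l /gain_cst => L1.
have -> : ln (bz * u_all_const al Ck * cL / 2) = ln (bz * u_all_const al Ck / 2) + ln cL.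
 by rewrite -lnM ?posrE//; congr ln; ring.
lra.
Qed.
End block_gain.

(** * A lower bound uniform in the mesh *)

Lemma ln_le_sq {R : realType} (n : nat) : (0 < n)%N -> ln (2 * (2 * n ^ 2)%:R) <= 4 * n%:R :> R.
move=> n0; have n0R : 0 < n%:R :> R by rewrite ltr0n.
have -> : 2 * (2 * n ^ 2)%:R = (2 * n%:R) ^+ 2 :> R by rewrite natrM natrX; ring.
rewrite lnXn ?mulr_gt0// -[leLHS]mulr_natl.
have := @le_ln1Dx R (2 * n%:R - 1); rewrite (_ : 1 + (2 * n%:R - 1) = 2 * n%:R); last by ring.
move=> h1; have := h1 ltac:(lra); lra.
Qed.

Lemma small_log_cost {R : realType} (A a e : R) : 0 <= A -> 0 <= a -> 0 < e ->
 exists2 q : nat, (4 < q)%N & A + a * ln (2 * q%:R) <= e * q%:R.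
move=> A0 a0 e0; pose n := (Num.truncn ((A + 4 * a) / e)).+2; exists (2 * n ^ 2)%N.
 by rewrite /n -mulnn !mulSn; lia.
have n1 : 1 <= n%:R :> R by rewrite ler1n.
have nb : (A + 4 * a) <= e * n%:R.
 rewrite [leRHS]mulrC -ler_pdivrMr// ltW// (lt_le_trans (truncnS_gt _))//.
 by rewrite ler_nat.
have := ler_wpM2l a0 (@ln_le_sq R n isT).
have -> : (2 * n ^ 2)%:R = 2 * n%:R ^+ 2 :> R by rewrite natrM natrX.
have e1 : A + a * (4 * n%:R) <= e * (2 * n%:R ^+ 2).
 have := ler_wpM2r (le_trans ler01 n1) nb; have := ler_wpM2l A0 n1.
 have := mulr_ge0 (ltW e0) (sqr_ge0 (n%:R : R)).
 rewrite expr2 mulrA; set t := e * n%:R * n%:R; nra.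
lra.
Qed.

Lemma block_count (d s : nat) : (0 < s)%N -> (d <= (d %/ s).-1 * s + 2 * s)%N.
move=> s0; have := divn_eq d s; have := ltn_pmod d s0.
by case: (d %/ s)%N => [|m] /=; rewrite ?mul0n ?mulSn; lia.
Qed.

Lemma affine_gain {R : realType} (x Q k t e : R) : 1 <= x -> 0 <= t -> 4 + `|k| + t <= e * Q ->
 (1 - e) * (Q * x) <= (Q - 4) * x + k - t.
move=> x1 t0 kt; have x0 : 0 <= x by exact: le_trans x1.
have h1 := ler_wpM2r x0 kt; have h2 := ler_norm (- k); rewrite normrN in h2.
have h3 := ler_wpM2l (normr_ge0 k) x1; have h4 := ler_wpM2l t0 x1.
rewrite !mulrDl in h1; rewrite !mulr1 in h3 h4; rewrite !mulrBl mul1r.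
have -> : e * (Q * x) = e * Q * x by ring.
lra.
Qed.

Lemma affine_margin {R : realType} (w La a dl c e Q : R) : 0 < e -> e <= 1 -> 0 <= w -> 0 <= a -> 0 <= dl ->
 0 <= c -> Q <= w -> (1 - e / 2) * w <= La -> (1 + a) * dl + 4 * c <= e / 2 -> 1 <= w ->
 (1 - e) * w <= La - (a + La) * dl - 4 * (Q * c).
move=> e0 e1 w0 a0 dl0 c0 Qw Ll b w1.
have adl : 0 <= a * dl by exact: mulr_ge0.
have dl1 : 0 <= 1 - dl by move: b; rewrite mulrDl mul1r; lra.
have k1 := ler_wpM2r dl1 Ll.
have k2 := ler_wpM2r w0 b.
have k3 := ler_wpM2l adl w1.
have k4 := ler_wpM2r c0 Qw.
have k5 : 0 <= e * w * dl by rewrite !mulr_ge0// ltW.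
have -> : La - (a + La) * dl - 4 * (Q * c) = La * (1 - dl) - a * dl - 4 * (Q * c) by ring.
have E1 : (1 - e / 2) * w * (1 - dl) = w - e * w / 2 - dl * w + e * w * dl / 2 by field.
have E2 : ((1 + a) * dl + 4 * c) * w = dl * w + a * dl * w + 4 * (w * c) by ring.
have E3 : e / 2 * w = e * w / 2 by field.
have E4 : (1 - e) * w = w - e * w by ring.
rewrite E1 in k1; rewrite E2 E3 in k2; rewrite mulr1 in k3; rewrite E4.
lra.
Qed.

Section uniform_lower_bound.
Context {R : realType}.
Variables (J : int -> R) (p : R -> int -> R) (gamma cJ CJ : R).
Hypotheses (HE : heat J p) (g23 : 2 / 3 < gamma < 1) (cJ0 : 0 < cJ)
 (Jlo : forall x : int, cJ * (1 + (absz x)%:R) `^ (- (1 + gamma)) <= J x)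
 (Jhi : forall x : int, J x <= CJ * (1 + (absz x)%:R) `^ (- (1 + gamma))).

Let al : R := gamma^-1 - 1.
Let g01 : 0 < gamma < 1.
by case/andP: g23 => h1 ->; rewrite andbT; lra. Qed.

Lemma alpha_range : 0 < al < 1 / 2.
case/andP: g23 => h1 h2; have g0 : 0 < gamma by lra.
rewrite /al subr_gt0 invf_gt1// h2/= ltrBlDr -div1r ltr_pdivrMr//; lra.
Qed.

(** The number [q] of correlation lengths per block is chosen first, large
    against the logarithmic cost of bridges; then [rho], small against the
    constants depending on [q]. Neither depends on [phi], [H] or [z]. *)
Lemma uniform_lower_bound (Ck ck bz eps : R) : 0 < Ck -> 0 < ck -> 0 < bz -> 0 < eps <= 1 ->
 exists2 rho_e : R, 0 < rho_e <= 1 / 4 & exists K : R,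
 forall (rho : R) (H : nat) (phi z : R) (kap : nat -> R) E,
 0 <= rho <= rho_e -> (0 < H)%N -> 0 < phi <= 1 / 2 ->
 rkernel al Ck ck H%:R^-1 phi kap -> bz * H%:R^-1 <= z ->
 (forall n, kk H phi kap n.+1 = z * p (n.+1%:R * H%:R^-1) 0) ->
 walk_law J (rho * H%:R^-1) E ->
 forall d, (1 - eps) * (phi * (d%:R * H%:R^-1)) - K <= E (fun e => ln (Phi p rho H%:R^-1 z d 0 e)).
move=> Ck0 ck0 bz0 /andP[eps0 eps1].
have al01 := alpha_range.
have aE : 1 + al = gamma^-1 by rewrite /al; ring.
pose a : R := 1 + al; have a0 : 0 < a by rewrite /a aE invr_gt0; case/andP: g01.
have [cL cL0 plink] := heat_link HE g01 cJ0 Jlo Jhi.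
have [Cs Cs0 slow] := heat_slow HE g01 cJ0 Jlo Jhi.
have [Cg Cg0 glogJ] := glog_J g01 cJ0 Jlo Jhi.
pose ka := gain_cst al Ck bz cL.
have eps20 : 0 < eps / 2 by rewrite divr_gt0.
(* The logarithmic cost of the bridges is charged to one half of [eps], *)
have [q q4 qb] := small_log_cost (A := 4 + `|ka|) ltac:(by rewrite addr_ge0) (ltW a0) eps20.
pose A := `|pairA al Ck ck q|; have A0 : 0 <= A by rewrite /A.
have e00 := @pair_e0_gt0 _ _ _ _ q al01 Ck0 ck0.
pose Q := (1 + a) * (4 * A * Cs) + 4 * Cg.
have Q0 : 0 < Q.
 apply: ltr_wpDl; last by rewrite mulr_gt0.
 apply: mulr_ge0; first by rewrite addr_ge0// ltW.
 by apply: mulr_ge0; [rewrite mulr_ge0|exact: ltW].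
(* bad blocks and displacements to the other half. *)
pose rhom : R := Num.min (1 / 4) (Num.min (pair_e0 al Ck ck q / Cs) (eps / 2 / Q)).
have rhom0 : 0 < rhom by rewrite /rhom !lt_min; apply/and3P; split; apply: divr_gt0.
exists rhom; first by rewrite rhom0 /rhom ge_min lexx.
exists (4 * q%:R + 2 * (q%:R * Cg)) => rho H phi z kap E /andP[rho0].
rewrite /rhom !le_min => /andP[rho4 /andP[rhoe rhoQ]] H0 /andP[phi0 phi2] Kk bzz kkE WL d.
set h : R := H%:R^-1 in Kk bzz kkE WL *.
have h0 : 0 < h by rewrite invr_gt0 ltr0n.
have h1 : h <= 1 by rewrite invf_le1 ?ler1n ?ltr0n.
have phi01 : 0 < phi <= 1 by rewrite phi0 (le_trans phi2)//; lra.
pose r := (Num.truncn (H%:R / phi)).+1.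
have rlo : H%:R / phi <= r%:R by rewrite ltW// truncnS_gt.
have rhi : r%:R <= H%:R / phi + 1.
 by rewrite /r -natr1 lerD2r; rewrite truncn_le divr_ge0// ltW.
have hH : h * H%:R = 1 by rewrite mulVf// pnatr_eq0 -lt0n.
have ph0 : 0 < phi * h by rewrite mulr_gt0.
have phH : phi * h * (H%:R / phi) = 1.
 have -> : phi * h * (H%:R / phi) = (h * H%:R) * (phi / phi) by ring.
 by rewrite hH mul1r divff// gt_eqF.
have phil : 1 <= phi * (r%:R * h) <= 2.
 have -> : phi * (r%:R * h) = phi * h * r%:R by ring.
 rewrite -{1}phH ler_wpM2l ?(ltW ph0)//=.
 apply: (le_trans (ler_wpM2l (ltW ph0) rhi)); rewrite mulrDr phH mulr1.
 have : phi * h <= 1 * 1 by apply: ler_pM => //; [exact: ltW|exact: ltW|case/andP: phi01].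
 lra.
have [phil1 phil2] := andP phil.
set l := r%:R * h in phil phil1 phil2 *.
have l2 : 2 <= l.
 have l0 : 0 <= l by rewrite mulr_ge0 // ltW.
 have := ler_wpM2r l0 phi2; lra.
have z0 : 0 < z by apply: lt_le_trans bzz; rewrite mulr_gt0.
have mB0 := mB_gt0 al01 Ck0 ck0 q4 H0 phi01 Kk phil.
have LL := Lam_lower al01 Ck0 ck0 q4 H0 phi01 Kk phil bz0 bzz cL0.
set La := Lam _ _ _ _ _ _ _ in LL.
have := erefl La; rewrite {1}/La => LaE; clearbody La.
have q1 : 4 <= q%:R :> R by rewrite ler_nat ltnW.
have qR : (q - 4)%:R = q%:R - 4 :> R by rewrite natrB// ltnW.
pose w := q%:R * (phi * l).
have w0 : q%:R <= w by rewrite /w ler_peMr//; lra.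
have LaL : (1 - eps / 2) * w <= La.
 apply: le_trans LL; rewrite qR -/a -/ka /w.
 apply: affine_gain => //; rewrite mulr_ge0 ?(ltW a0)// ln_ge0//; lra.
have La0 : 0 <= La by apply: le_trans LaL; rewrite mulr_ge0//; lra.
pose dl := 4 * A * (Cs * rho).
have dl0 : 0 <= dl by rewrite /dl !mulr_ge0// ltW.
have rho01 : 0 <= rho <= 1 by rewrite rho0/=; lra.
have rho12 : 0 <= rho <= 1 / 2 by rewrite rho0/=; lra.
have bad_le : E (fun e => (isbad p rho h z (mB q H r phi kap) q r e)%:R) <= dl.
 have e01 : 0 <= Cs * rho <= pair_e0 al Ck ck q.
  by rewrite mulr_ge0 ?(ltW Cs0)//= mulrC -ler_pdivlMr.
 have sl n : p ((1 - rho) * (n.+1%:R * h)) 0 <= (1 + Cs * rho) * p (n.+1%:R * h) 0.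
  by apply: slow; rewrite ?rho0 ?rho4// mulr_ge0// ltW.
 apply: le_trans (E_bad HE rho01 (ltW z0) al01 Ck0 ck0 q4 H0 phi01 Kk phil WL kkE e01 sl mB0) _.
 rewrite /dl; apply: ler_wpM2r; first by rewrite mulr_ge0// ltW.
 by rewrite ler_pM2l// ler_norm.
have rQ : (1 + a) * dl + 4 * (rho * Cg) <= eps / 2.
 have -> : (1 + a) * dl + 4 * (rho * Cg) = rho * Q by rewrite /dl /Q; ring.
 by rewrite -ler_pdivlMr.
pose G := La - (a + La) * dl - 4 * (q%:R * (rho * Cg)).
have GL : (1 - eps) * w <= G.
 by apply: (affine_margin eps0 eps1 _ (ltW a0) dl0) => //; [lra|rewrite mulr_ge0// ltW|lra].
have s0 : (0 < q * r)%N by rewrite muln_gt0 (leq_trans _ q4).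
pose m := (d %/ (q * r))%N.
have dm := block_count d s0; rewrite -/m in dm.
have w2 : w <= 2 * q%:R by rewrite /w mulrC ler_wpM2r.
have dR : phi * (d%:R * h) <= m.-1%:R * w + 2 * w.
 have : (d%:R : R) <= m.-1%:R * (q%:R * r%:R) + 2 * (q%:R * r%:R).
  by rewrite -!natrM -natrD ler_nat.
 move=> /(ler_wpM2l (ltW ph0)) h2.
 rewrite /w /l; move: h2; rewrite !(mulrDr, mulrDl); lra.
have rC1 : 2 * (q%:R * (rho * Cg)) <= 2 * (q%:R * Cg).
 by rewrite ler_pM2l// ler_wpM2l// ler_piMl ?(ltW Cg0)//; case/andP: rho01.
have e1 : 0 <= 1 - eps by lra.
have k1 := ler_wpM2l e1 dR.
have k2 : (1 - eps) * (2 * w) <= 4 * q%:R.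
 have h2 : 0 <= eps * (2 * w) by rewrite mulr_ge0 ?(ltW eps0)//; lra.
 rewrite mulrBl mul1r; lra.
have P0 : 0 <= 2 * (q%:R * (rho * Cg)) by rewrite !mulr_ge0// ltW.
have P1 : 0 <= q%:R * Cg by rewrite mulr_ge0// ltW.
case: (posnP m) => [mE|m0].
 apply: (via 0).
  by move: k1; rewrite mE /= mul0r add0r; lra.
 have nP := nice_ln (Phi_nice HE rho12 h0 z0 d 0) (Phi_ge1 HE rho12 h0 z0 d 0).
 apply: (E_ge0 WL) => // e; rewrite ln_ge0//; exact: (Phi_ge1 HE rho12 h0 z0).
have ag : a * gamma = 1 by rewrite /a aE mulVf// gt_eqF//; case/andP: g01.
have plink' : link_bound p a cL by rewrite /a aE.
have aL0 : 0 <= a + Lam h z a cL (mB q H r phi kap) q r by rewrite LaE addr_ge0// ltW.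
have := chain_expectation HE rho12 h0 z0 a0 cL0 q4 l2 mB0 plink' WL ag glogJ (leq_trunc_div d _) m0 bad_le aL0.
rewrite -/m LaE -/G => ce; apply: le_trans ce.
have := ler_wpM2l (ler0n R m.-1) GL; move: k1; rewrite mulrDr; lra.
Qed.
End uniform_lower_bound.

(** * Splitting into blocks *)

Section block_splitting.
Context {R : realType}.
Variables (J : int -> R) (p : R -> int -> R) (rho h z : R).
Hypotheses (HE : heat J p) (rho1 : 0 <= rho <= 1) (h0 : 0 < h) (z0 : 0 < z).
Implicit Types (e : nat -> int).

Local Notation Phi := (Phi p rho h z).
Local Notation link := (link p rho h).
Local Notation paths := (paths p rho h z).

Let z0' : 0 <= z. exact: ltW. Qed.
Let P0 d i e : 0 <= Phi d i e. exact: (paths_ge0 HE rho1 h0 z0'). Qed.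
Let lk0 i j e : 0 <= link i j e. exact: (link_ge0 HE rho1 h0). Qed.
(** The path sum with free starting point is submultiplicative under
    concatenation, and differs from [Phi] by at most one bridge. *)
Definition Zc (d : nat) e : R := 1 + z * \sum_(0 <= i < d) Phi d i e.

Lemma PhiE d i e : Phi d i e = 1 + z * \sum_(i.+1 <= j < d) link i j e * Phi d j e.
exact: pathsE. Qed.

Lemma sum_shift (F : nat -> R) a b c : \sum_(a + b <= j < a + c) F j = \sum_(b <= j < c) F (a + j)%N.
by rewrite [(a + b)%N]addnC [(a + c)%N]addnC big_addn addnK; apply: eq_bigr => j _; rewrite addnC. Qed.

Lemma sum_shift0 (F : nat -> R) a c : \sum_(a <= j < a + c) F j = \sum_(0 <= j < c) F (a + j)%N.
by rewrite -{1}[a]addn0 sum_shift. Qed.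

Lemma Phi_shift a c i e : Phi (a + c) (a + i) e = Phi c i (shift a e).
move: i; apply: (@backward_ind _ c) => i IH; rewrite !PhiE -addnS sum_shift.
congr (_ + _ * _); apply: eq_big_nat => j ij.
by rewrite IH// link_shift.
Qed.

Lemma Zc_ge1 d e : 1 <= Zc d e.
by rewrite /Zc lerDl mulr_ge0// sumr_ge0. Qed.

Lemma Zc_tail a c i e : 1 + z * \sum_(a <= j < a + c) link i j e * Phi (a + c) j e <= Zc c (shift a e).
rewrite /Zc lerD2l ler_wpM2l// -{1}[a]addn0 sum_shift; apply: ler_sum => j _.
by rewrite Phi_shift ler_piMl// (link_le1 HE rho1 h0).
Qed.

Lemma Phi_cat a c i e : (i < a)%N -> Phi (a + c) i e <= Phi a i e * Zc c (shift a e).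
move: i; apply: (@backward_ind _ a) => i IH ia.
rewrite PhiE [leRHS]mulrC PhiE mulrDr mulr1 [X in _ + _ * X](cat_nat a)//= ?leq_addr//.
rewrite mulrDr addrCA addrC; apply: lerD; first exact: Zc_tail.
rewrite mulrCA; apply: ler_wpM2l => //; rewrite mulr_sumr; apply: ler_sum_nat => j /andP[ij ja].
by rewrite mulrCA; apply: ler_wpM2l => //; rewrite mulrC; apply: IH => //; rewrite ij.
Qed.

Lemma Zc_cat a c e : Zc (a + c) e <= Zc a e * Zc c (shift a e).
rewrite {1}/Zc (cat_nat a)//= ?leq_addr// mulrDr addrCA.
rewrite [leRHS]mulrC {2}/Zc mulrDr mulr1 [leRHS]addrC; apply: lerD.
 rewrite mulrCA; apply: ler_wpM2l => //; rewrite mulr_sumr; apply: ler_sum_nat => j /andP[_ ja].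
 by rewrite mulrC; exact: Phi_cat.
rewrite /Zc lerD2l ler_wpM2l// -{1}[a]addn0 sum_shift; apply: ler_sum => j _.
by rewrite Phi_shift.
Qed.

Lemma Zc_le c e : Zc c e <= (1 + z) ^+ c.
elim: c e => [|c IH] e; first by rewrite /Zc big_geq// mulr0 addr0 expr0.
rewrite -addn1; apply: (le_trans (Zc_cat c 1 e)); rewrite addn1 exprSr.
apply: ler_pM; rewrite ?(le_trans ler01 (Zc_ge1 _ _))//.
by rewrite /Zc big_nat1 PhiE big_geq// mulr0 addr0 mulr1.
Qed.

Lemma Zc_ge d e : 1 + z * d%:R <= Zc d e.
rewrite /Zc lerD2l ler_wpM2l// -[d in leLHS]subn0 -[_%:R]mulr1 mulr_natl -sumr_const_nat.
by apply: ler_sum => j _; rewrite PhiE lerDl mulr_ge0// sumr_ge0// => k _; rewrite mulr_ge0.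
Qed.

Lemma Phi0_le d e : Phi d 0 e <= Zc d e.
case: d => [|d]; first by rewrite PhiE /Zc !big_geq// mulr0.
rewrite -add1n; apply: (le_trans (@Phi_cat 1 d 0 e isT)).
rewrite PhiE big_geq// mulr0 addr0 mul1r /Zc lerD2l ler_wpM2l//.
rewrite [leRHS](cat_nat 1)//= big_nat1 -{1}[1%N in X in _ + X]addn0 sum_shift ler_wpDl//.
by apply: ler_sum => j _; rewrite Phi_shift.
Qed.

Lemma Zc_blocks s m e : Zc (m * s) e <= \prod_(0 <= b < m) Zc s (shift (b * s) e).
elim: m => [|m IH]; first by rewrite mul0n /Zc !big_geq// mulr0 addr0.
rewrite mulSn addnC; apply: (le_trans (Zc_cat _ _ _)); rewrite big_nat_recr//=.
by apply: ler_wpM2r => //; rewrite (le_trans ler01)// Zc_ge1.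
Qed.

Lemma Phi_block_lower d a D c mu e : (a + D <= c)%N -> (c <= d)%N -> 0 <= mu ->
 (forall i, (i < D)%N -> mu <= 1 + z * \sum_(c <= j < d) link (a + i) j e * Phi d j e) ->
 forall i, (i < D)%N -> mu * Phi D i (shift a e) <= Phi d (a + i) e.
move=> aDc cd mu0 hmu; apply: (@backward_ind _ D) => i IH iD.
have ad : (a + D <= d)%N by exact: leq_trans cd.
rewrite PhiE [leRHS]PhiE -addnS [X in _ <= 1 + _ * X](cat_nat c)//=; last first.
 by rewrite (leq_trans _ aDc)// leq_add2l.
rewrite [z * (_ + _)]mulrDr addrCA [leLHS]mulrDr mulr1 [leLHS]addrC; apply: lerD; last exact: hmu.
rewrite mulrCA; apply: ler_wpM2l => //; rewrite mulr_sumr.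
rewrite [leRHS](cat_nat (a + D))//= ?leq_add2l//.
rewrite -[leLHS]addr0; apply: lerD; last by rewrite sumr_ge0// => j _; rewrite mulr_ge0.
rewrite sum_shift; apply: ler_sum_nat => j /andP[ij jD].
by rewrite mulrCA link_shift; apply: ler_wpM2l => //; apply: IH; rewrite ?ij.
Qed.

End block_splitting.

Lemma gap_bounds (n H b i j : nat) : (4 < n)%N -> (0 < b)%N ->
 (b.-1 * (n * H) <= i < b.-1 * (n * H) + (n - 4) * H)%N -> (b * (n * H) <= j < b * (n * H) + (n - 4) * H)%N ->
 (4 * H <= j - i)%N && (j - i <= 2 * n * H)%N.
move=> n4; case: b => // b _ /= /andP[i1 i2]; rewrite mulSn => /andP[j1 j2].
have e1 : ((n - 4) * H + 4 * H = n * H)%N by rewrite -mulnDl subnK// ltnW.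
have e2 : (2 * n * H = n * H + n * H)%N by rewrite -mulnA mulSn mul1n.
apply/andP; split; lia.
Qed.

Section block_sandwich.
Context {R : realType}.
Variables (J : int -> R) (p : R -> int -> R) (rho z a cL bt Bt : R) (H n : nat).
Let h : R := H%:R^-1.
Hypotheses (HE : heat J p) (rho01 : 0 <= rho <= 1 / 2) (H0 : (0 < H)%N) (n4 : (4 < n)%N)
 (z0 : 0 < z) (a0 : 0 < a) (cL0 : 0 < cL) (bt0 : 0 < bt) (zbt : bt <= z * H%:R <= Bt)
 (plink : link_bound p a cL).
Implicit Types (e : nat -> int).

Let h0 : 0 < h. by rewrite invr_gt0 ltr0n. Qed.
Let rho1 : 0 <= rho <= 1.
by case/andP: rho01 => -> /= ?; lra. Qed.
Let s : nat := (n * H)%N.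
Let D : nat := ((n - 4) * H)%N.
Let L : R := n%:R `^ a.
Let Hh : H%:R * h = 1. by rewrite divff// pnatr_eq0 -lt0n. Qed.
Let n1 : 1 <= n%:R :> R. by rewrite ler1n (leq_trans _ n4). Qed.
Let L0 : 0 < L. by rewrite powR_gt0// (lt_le_trans ltr01). Qed.

Local Notation Phi := (Phi p rho h z).
Local Notation link := (link p rho h).
Local Notation Zc := (Zc p rho h z).

Definition block_log e : R := ln (Zc D e).
Definition link_cost : R := ln (1 + bt^-1) - ln cL + a * ln (2 * n%:R) + 2 * a * ln n%:R.

Let Zge1 d e : 1 <= Zc d e. exact: (Zc_ge1 HE rho1 h0 z0). Qed.
Let Zgt0 d e : 0 < Zc d e. exact: lt_le_trans (Zge1 d e). Qed.
Lemma ln_Zc_le d m e : (d <= m * H)%N -> ln (Zc d e) <= m%:R * Bt.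
move=> dm; case/andP: zbt => _ zB.
have z1 : 0 < 1 + z by rewrite addr_gt0.
apply: (via (ln ((1 + z) ^+ d))).
 by rewrite ler_ln ?posrE ?exprn_gt0//; exact: (Zc_le HE rho1 h0 z0).
rewrite lnXn// -[leLHS]mulr_natl; apply: (via (d%:R * z)).
 by rewrite ler_wpM2l// le_ln1Dx// (lt_trans _ z0)// ltrN10.
apply: (via (m%:R * (z * H%:R))); last by rewrite ler_wpM2l.
by rewrite [z * _]mulrC mulrA ler_wpM2r ?(ltW z0)// -natrM ler_nat.
Qed.

Lemma block_log_bounds e : 0 <= block_log e <= n%:R * Bt.
rewrite /block_log ln_ge0//=; apply: ln_Zc_le.
by rewrite leq_mul2r leq_subr orbT.
Qed.

Lemma block_upper m e : ln (Phi (m * s) 0 e) <= \sum_(0 <= b < m) (block_log (shift (b * s) e) + 4 * Bt).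
have Pgt : 0 < Phi (m * s) 0 e.
 apply: lt_le_trans ltr01 _; rewrite /Phi pathsE lerDl mulr_ge0 ?(ltW z0)// sumr_ge0// => j _.
 by rewrite mulr_ge0 ?(link_ge0 HE rho1 h0) ?(paths_ge0 HE rho1 h0 (ltW z0)).
apply: (via (ln (\prod_(0 <= b < m) Zc s (shift (b * s) e)))).
 rewrite ler_ln ?posrE//; last by rewrite prodr_gt0.
 by apply: le_trans (Phi0_le HE rho1 h0 z0 _ _) _; exact: (Zc_blocks HE rho1 h0 z0).
elim: m {Pgt} => [|m IH]; first by rewrite !big_geq// ln1.
rewrite !big_nat_recr//= lnM ?posrE ?prodr_gt0//; apply: lerD => //.
have sE : s = (D + 4 * H)%N by rewrite /s /D -mulnDl subnK// ltnW.
apply: (via (ln (Zc D (shift (m * s) e) * Zc (4 * H) (shift D (shift (m * s) e))))).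
 by rewrite ler_ln ?posrE ?mulr_gt0// {1}sE; exact: (Zc_cat HE rho1 h0 z0).
by rewrite lnM ?posrE// lerD2l; exact: ln_Zc_le.
Qed.

Let disp e b := \sum_(b * s <= k < b.+1 * s) glog L (e k).
Let disp0 e b : 0 <= disp e b. by apply: sumr_ge0 => k _; exact: glog_ge0. Qed.
Let Ds : (D <= s)%N. by rewrite leq_mul2r leq_subr orbT. Qed.
(** Bridges between neighbouring blocks last at least four and at most [2 * n]
    time units, hence the logarithmic cost. *)
Lemma block_link e b i j : (0 < b)%N -> (b.-1 * s <= i < b.-1 * s + D)%N -> (b * s <= j < b * s + D)%N ->
 0 < link i j e /\
 ln cL - a * ln (2 * n%:R) - 2 * a * ln n%:R - 2 * (disp e b.-1 + disp e b) <= ln (link i j e).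
move=> b0 ib jb; have /andP[gap span] := gap_bounds n4 b0 ib jb.
set t := (1 - rho) * ((j - i)%:R * h).
have gapR : 4 <= (j - i)%:R * h.
 have -> : 4 = (4 * H)%:R * h by rewrite natrM -mulrA Hh mulr1.
 by rewrite ler_wpM2r ?(ltW h0)// ler_nat.
have spanR : (j - i)%:R * h <= 2 * n%:R.
 have -> : 2 * n%:R = (2 * n * H)%:R * h by rewrite !natrM -mulrA Hh mulr1.
 by rewrite ler_wpM2r ?(ltW h0)// ler_nat.
have [r0' r1'] := andP rho01.
have t2 : 2 <= t.
 rewrite /t; have : 0 <= (1 / 2 - rho) * ((j - i)%:R * h) by rewrite mulr_ge0 ?subr_ge0//; lra.
 by lra.
have tn : t <= 2 * n%:R.
 apply: le_trans spanR; rewrite /t ler_piMl ?gerBl//; lra.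
have t0 : 0 < t by lra.
set x := incr i j e.
have q0 : 0 < 1 + (absz x)%:R * t `^ (- a) by rewrite ltr_wpDr// mulr_ge0 ?powR_ge0.
have [lp low] := ln_link_bound x cL0 plink t2.
split; first exact: lp.
apply: (le_trans _ low).
have lnt : ln t <= ln (2 * n%:R) by rewrite ler_ln ?posrE//; lra.
have G : ln (1 + (absz x)%:R * t `^ (- a)) <= a * ln n%:R + glog L x.
 rewrite /glog -ln_powR -/L -lnM ?posrE//; last by rewrite ltr_wpDr// divr_ge0// ltW.
 have k0 : 0 < 1 + (absz x)%:R / L by rewrite ltr_wpDr// divr_ge0// ltW.
 rewrite ler_ln ?posrE ?mulr_gt0// mulrDr mulr1 mulrCA mulfV ?gt_eqF// mulr1; apply: lerD.
  by have : n%:R `^ 0 <= L by [rewrite ler_powR ?(ltW a0)]; rewrite powRr0.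
 rewrite ler_piMr//; have : t `^ (- a) <= 1 `^ (- a) by apply: pow_leN; rewrite ?(ltW a0)//; lra.
 by rewrite powR1.
have G2 : glog L x <= disp e b.-1 + disp e b.
 apply: (le_trans (glog_incr i j e L0)).
 have bE : b.-1.+1 = b by rewrite prednK.
 rewrite /disp bE -(cat_nat (b * s))//= ?leq_mul2r ?leq_pred ?leqnSn ?orbT//.
 case/andP: ib jb => i1 _ /andP[_ j2].
 have jS : (j <= b.+1 * s)%N by rewrite mulSn addnC (leq_trans (ltnW j2))// leq_add2l.
 case: (leqP i j) => ij; last by rewrite big_geq ?(ltnW ij)// sumr_ge0// => k _; exact: glog_ge0.
 rewrite [leRHS](cat_nat i)//=; last exact: leq_trans jS.
 rewrite [X in _ <= _ + X](cat_nat j)//=.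
 rewrite addrCA lerDl addr_ge0// sumr_ge0// => k _; exact: glog_ge0.
have := ler_wpM2l (ltW a0) lnt; lra.
Qed.

(** Paths visiting all blocks; each of the bridges between them costs
    [link_cost] and the displacements of the two blocks it crosses. *)
Lemma block_lower m e : (0 < m)%N ->
 \sum_(1 <= b < m) (block_log (shift (b * s) e) - link_cost) - 4 * \sum_(0 <= k < m * s) glog L (e k)
  <= ln (Phi (m * s) 0 e).
move=> m0; pose d := (m * s)%N.
have P0 i : 0 <= Phi d i e by exact: (paths_ge0 HE rho1 h0 (ltW z0)).
have lk0 i j : 0 <= link i j e by exact: (link_ge0 HE rho1 h0).
pose Om i b := 1 + z * \sum_(b * s <= j < d) link i j e * Phi d j e.
have Om1 i b : 1 <= Om i b by rewrite /Om lerDl mulr_ge0 ?(ltW z0)// sumr_ge0// => j _; rewrite mulr_ge0.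
pose g k := block_log (shift (k * s) e) - link_cost - 2 * (disp e k.-1 + disp e k).
have PB b mu i : (b < m)%N -> 0 <= mu -> (i < D)%N ->
  (forall x, (x < D)%N -> mu <= Om (b * s + x)%N b.+1) -> mu * Phi D i (shift (b * s) e) <= Phi d (b * s + i) e.
 move=> bm mu0 iD hmu; apply: (Phi_block_lower HE rho1 h0 z0 (c := (b.+1 * s)%N)) => //.
  by rewrite mulSn addnC leq_add2r.
 by rewrite leq_mul2r bm orbT.
have step : forall b, (b <= m)%N -> (0 < b)%N -> forall i, (b.-1 * s <= i < b.-1 * s + D)%N ->
  \sum_(b <= k < m) g k <= ln (Om i b).
 apply: (@backward_ind _ m.+1) => b IH; rewrite leq_eqVlt => /predU1P[->|bm] b0 i ib.
  by rewrite big_geq// ln_ge0.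
 have hmu x : (x < D)%N -> expR (\sum_(b.+1 <= k < m) g k) <= Om (b * s + x)%N b.+1.
  move=> xD; rewrite -[leRHS]lnK ?posrE ?(lt_le_trans ltr01)// ler_expR; apply: IH => //.
   by rewrite ltnSn ltnS.
  by rewrite /= leq_addr ltn_add2l.
 pose lw := ln cL - a * ln (2 * n%:R) - 2 * a * ln n%:R - 2 * (disp e b.-1 + disp e b).
 have big : expR lw * (expR (\sum_(b.+1 <= k < m) g k) * (Zc D (shift (b * s) e) - 1)) <= Om i b.
  rewrite /Zc addrAC subrr add0r.
  have -> : expR lw * (expR (\sum_(b.+1 <= k < m) g k) * (z * \sum_(0 <= x < D) Phi D x (shift (b * s) e))) =
   z * \sum_(0 <= x < D) expR lw * (expR (\sum_(b.+1 <= k < m) g k) * Phi D x (shift (b * s) e)).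
   by rewrite -mulr_sumr -mulr_sumr; ring.
  rewrite /Om ler_wpDl// ler_wpM2l ?(ltW z0)//.
  have bD : (b * s + D <= d)%N.
   by rewrite (leq_trans (_ : _ <= b.+1 * s)%N) ?leq_mul2r ?bm ?orbT// mulSn addnC leq_add2r.
  rewrite [leRHS](cat_nat (b * s + D))//= ?leq_addr// ler_wpDr//.
   by rewrite sumr_ge0// => j _; rewrite mulr_ge0.
  rewrite [leRHS]sum_shift0; apply: ler_sum_nat => x /andP[_ xD].
  have jb : (b * s <= b * s + x < b * s + D)%N by rewrite leq_addr ltn_add2l.
  have [w0 wl] := block_link e b0 ib jb.
  apply: ler_pM; rewrite ?expR_ge0 ?mulr_ge0 ?expR_ge0//.
  - exact: (paths_ge0 HE rho1 h0 (ltW z0)).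
  - by rewrite -[leRHS]lnK ?posrE// ler_expR.
  - by apply: PB => //; exact: expR_ge0.
 have Zlow : Zc D (shift (b * s) e) * (1 + bt^-1)^-1 <= Zc D (shift (b * s) e) - 1.
  have Z1 : 1 + bt <= Zc D (shift (b * s) e).
   apply: le_trans (Zc_ge HE rho1 h0 z0 _ _); rewrite lerD2l; case/andP: zbt => zb _.
   apply: (le_trans zb); rewrite ler_wpM2l ?(ltW z0)// ler_nat /D leq_pmull// subn_gt0//.
  rewrite ler_pdivrMr ?addr_gt0 ?invr_gt0// mulrDr mulr1.
  have : bt * bt^-1 <= (Zc D (shift (b * s) e) - 1) * bt^-1.
   by rewrite ler_wpM2r ?invr_ge0 ?(ltW bt0)//; lra.
  rewrite mulfV ?gt_eqF//; lra.
 have q1 : 0 < 1 + bt^-1 by rewrite addr_gt0 ?invr_gt0.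
 have big2 : expR lw * (expR (\sum_(b.+1 <= k < m) g k) * (Zc D (shift (b * s) e) * (1 + bt^-1)^-1)) <= Om i b.
  by apply: le_trans big; rewrite !ler_wpM2l ?expR_ge0.
 have := big2; rewrite -ler_ln ?posrE; last 2 first.
 - by rewrite !mulr_gt0 ?expR_gt0 ?invr_gt0.
 - exact: lt_le_trans (Om1 i b).
 rewrite lnM ?posrE ?expR_gt0 ?mulr_gt0 ?expR_gt0 ?invr_gt0//.
 rewrite lnM ?posrE ?expR_gt0 ?mulr_gt0 ?invr_gt0//.
 rewrite lnM ?posrE ?invr_gt0// lnV ?posrE// !expRK => h1; apply: le_trans h1.
 rewrite big_ltn// /lw [g b]/g /link_cost /block_log; lra.
have [D0 s0] : (0 < D)%N /\ (0 < s)%N by rewrite !muln_gt0 H0 subn_gt0 n4 (leq_trans _ n4).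
have OP : Om 0%N 1%N <= Phi d 0 e.
 have := PB 0%N (Om 0%N 1%N) 0%N m0 (le_trans ler01 (Om1 _ _)) D0.
 rewrite mul0n addn0 => _.
 rewrite /Om PhiE lerD2l ler_wpM2l ?(ltW z0)// mul1n [leRHS](cat_nat s)//=; last by rewrite leq_pmull.
 by rewrite ler_wpDl// sumr_ge0// => j _; rewrite mulr_ge0.
have OL : ln (Om 0%N 1%N) <= ln (Phi d 0 e) by rewrite ler_ln ?posrE ?(lt_le_trans ltr01)// (le_trans _ OP).
apply: le_trans OL; have := step 1%N m0 isT 0%N; rewrite mul0n add0n D0 => /(_ isT) h1.
apply: le_trans h1.
have dsum : \sum_(0 <= k < m * s) glog L (e k) = \sum_(0 <= b < m) disp e b.
 elim: (m) => [|k IH]; first by rewrite mul0n !big_geq.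
 rewrite big_nat_recr//= -IH (cat_nat (k * s))//= leq_mul2r leqnSn orbT//.
rewrite dsum /g [leRHS]sumrB lerD2l lerN2 -mulr_sumr big_split/=.
have e1 : \sum_(1 <= k < m) disp e k.-1 <= \sum_(0 <= b < m) disp e b.
 by rewrite big_add1 [leRHS](@big_cat_nat _ _ _ m.-1)//= ?leq_pred// lerDl sumr_ge0.
have e2 : \sum_(1 <= k < m) disp e k <= \sum_(0 <= b < m) disp e b.
 by rewrite [leRHS](cat_nat 1)//= lerDr sumr_ge0.
lra.
Qed.
End block_sandwich.

(** * Concentration of the log partition function *)

Lemma nice_norm {R : realType} (F : (nat -> int) -> R) : nice F -> nice (fun e => `|F e|).
move=> [[n cF] [M FM]]; split; first by exists n => e e' h; rewrite (cF e e').
by exists M => e; rewrite normr_id.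
Qed.

Section iid_sums.
Context {R : realType}.
Variables (J : int -> R) (delta : R) (E : ((nat -> int) -> R) -> R).
Hypothesis WL : walk_law J delta E.

Lemma iid_variance (F : (nat -> int) -> R) (s m : nat) (B : R) :
 dep 0 s F -> (forall e, `|F e| <= B) -> E F = 0 ->
 E (fun e => (\sum_(0 <= b < m) F (shift (b * s) e)) ^+ 2) <= m%:R * B ^+ 2.
move=> dF FB EF.
have nF : nice F by split; [exists s; exact: dep_cyl dF|exists B].
have nS b : nice (fun e => F (shift (b * s) e)) by exact: nice_shift.
have nsum k : nice (fun e => \sum_(0 <= b < k) F (shift (b * s) e)) by exact: nice_sum.
elim: m => [|m IH].
 have -> : (fun e : nat -> int => (\sum_(0 <= b < 0) F (shift (b * s) e)) ^+ 2) = fun=> 0.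
  by apply/funext => e; rewrite big_geq// expr0n.
 by rewrite (EC WL) mul0r.
pose S e := \sum_(0 <= b < m) F (shift (b * s) e).
pose G e := F (shift (m * s) e).
have -> : (fun e : nat -> int => (\sum_(0 <= b < m.+1) F (shift (b * s) e)) ^+ 2) =
  fun e => S e ^+ 2 + (2 * (S e * G e) + G e * G e).
 by apply/funext => e; rewrite big_nat_recr//= -/(S e) -/(G e); ring.
have nSS : nice S by exact: nsum.
have nG : nice G by exact: nS.
have nS2 : nice (fun e => S e ^+ 2) by under [X in nice X]funext do rewrite expr2; exact: nice_mul.
rewrite (ED WL nS2); last by apply: nice_add; [exact: nice_scale (nice_mul nSS nG)|exact: nice_mul].
rewrite (EL WL _ (nice_mul nSS nG) (nice_mul nG nG)).
have dS : dep 0 (m * s) S.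
 move=> e e' h; apply: eq_big_nat => b /andP[_ bm]; apply: dF => l /andP[_ ls].
 apply: h; rewrite /=; apply: (@leq_trans (b * s + s)); first by rewrite ltn_add2l.
 by rewrite addnC -mulSn leq_mul2r bm orbT.
have dG : dep (m * s) (m * s + s) G.
 move=> e e' h; apply: dF => l /andP[_ ls]; apply: h.
 by rewrite leq_addr ltn_add2l.
rewrite (E_indep WL nSS nG dS dG) (E_shift WL _ nF) EF mulr0 mulr0 add0r.
rewrite -natr1 mulrDl mul1r lerD//.
rewrite -(EC WL (B ^+ 2)); apply: (Ele WL (nice_mul nG nG) (nice_cst _)) => e.
by rewrite -expr2 -real_normK ?num_real// ler_sqr ?nnegrE//; apply: le_trans (FB (shift (m * s) e)).
Qed.

Lemma iid_l1 (F : (nat -> int) -> R) (s m : nat) (B : R) : (0 < m)%N -> 0 < B ->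
 dep 0 s F -> (forall e, 0 <= F e <= B) ->
 E (fun e => `|\sum_(0 <= b < m) F (shift (b * s) e) - m%:R * E F|) <= Num.sqrt m%:R * B.
move=> m0 B0 dF FB.
have nF : nice F by exact: (nice_dep dF FB).
have EF0 : 0 <= E F by apply: (E_ge0 WL nF) => e; case/andP: (FB e).
have EFB : E F <= B by rewrite -(EC WL B); apply: (Ele WL nF (nice_cst B)) => e; case/andP: (FB e).
pose G e := F e - E F.
have nG : nice G by apply: nice_add => //; exact: nice_cst.
have sG e : \sum_(0 <= b < m) F (shift (b * s) e) - m%:R * E F = \sum_(0 <= b < m) G (shift (b * s) e).
 by rewrite /G sumrB sumr_const_nat subn0 mulr_natl.
have V : E (fun e => (\sum_(0 <= b < m) G (shift (b * s) e)) ^+ 2) <= m%:R * B ^+ 2.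
 apply: iid_variance.
 - by move=> e e' h; rewrite /G (dF e e').
 - by move=> e; have /andP[? ?] := FB e; rewrite ler_norml /G; lra.
 - by rewrite /G (ED WL nF (nice_cst _)) (EC WL) subrr.
pose l := Num.sqrt m%:R * B; have l0 : 0 < l by rewrite mulr_gt0// sqrtr_gt0 ltr0n.
have l2 : l ^+ 2 = m%:R * B ^+ 2 by rewrite exprMn sqr_sqrtr.
have nS : nice (fun e => \sum_(0 <= b < m) G (shift (b * s) e)).
 by apply: nice_sum => b _; exact: (nice_shift (b * s) nG).
have nS2 : nice (fun e => (\sum_(0 <= b < m) G (shift (b * s) e)) ^+ 2).
 by under [X in nice X]funext do rewrite expr2; exact: nice_mul.
apply: (via (E (fun e => (2 * l)^-1 * (\sum_(0 <= b < m) G (shift (b * s) e)) ^+ 2 + l / 2))).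
 apply: (Ele WL).
 - by under [X in nice X]funext do rewrite sG; exact: nice_norm.
 - by apply: nice_add; [exact: nice_scale|exact: nice_cst].
 move=> e; rewrite sG; set x := \sum_(_ <= b < _) _.
 have : 0 <= (2 * l)^-1 * (`|x| - l) ^+ 2 by rewrite mulr_ge0 ?sqr_ge0// invr_ge0 mulr_ge0// ltW.
 have -> : (2 * l)^-1 * (`|x| - l) ^+ 2 = (2 * l)^-1 * `|x| ^+ 2 + l / 2 - `|x|.
  by field; rewrite gt_eqF.
 by rewrite real_normK ?num_real//; lra.
rewrite (EL WL _ nS2 (nice_cst _)) (EC WL) -/l.
have : (2 * l)^-1 * E (fun e => (\sum_(0 <= b < m) G (shift (b * s) e)) ^+ 2) <= (2 * l)^-1 * l ^+ 2.
 by rewrite l2 ler_wpM2l// invr_ge0 mulr_ge0// ltW.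
have -> : (2 * l)^-1 * l ^+ 2 = l / 2 by field; rewrite gt_eqF.
lra.
Qed.
End iid_sums.

Section block_concentration.
Context {R : realType}.
Variables (J : int -> R) (p : R -> int -> R) (E : ((nat -> int) -> R) -> R).
Variables (rho z a cL bt Bt gamma Cg : R) (H n : nat).
Let h : R := H%:R^-1.
Hypotheses (HE : heat J p) (rho01 : 0 <= rho <= 1 / 2) (H0 : (0 < H)%N) (n4 : (4 < n)%N)
 (z0 : 0 < z) (a0 : 0 < a) (cL0 : 0 < cL) (bt0 : 0 < bt) (zbt : bt <= z * H%:R <= Bt)
 (plink : link_bound p a cL) (WL : walk_law J (rho * h) E) (ag : a * gamma = 1) (Cg0 : 0 < Cg).
Hypothesis glogJ : forall l, 1 <= l ->
 (\esum_x (glog l x * J x)%:E <= (Cg * l `^ (- gamma))%:E)%E.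

Let h0 : 0 < h. by rewrite invr_gt0 ltr0n. Qed.
Let rho1 : 0 <= rho <= 1.
by case/andP: rho01 => -> /= ?; lra. Qed.
Let Bt0 : 0 < Bt. by case/andP: zbt => h1 h2; exact: lt_le_trans (le_trans h1 h2). Qed.
Let nR : 0 < n%:R :> R. by rewrite ltr0n (leq_trans _ n4). Qed.

Local Notation bl := (block_log p rho z H n).
Local Notation Phi := (Phi p rho h z).

Lemma Zc_dep d : dep 0 d (Zc p rho h z d).
move=> e e' h'; congr (_ + _ * _); apply: eq_big_nat => i /andP[_ id].
by apply: paths_dep => l /andP[il ld]; apply: h'; rewrite ld.
Qed.

(** Up to the bridging costs the logarithm is a sum of independent and
    identically distributed block contributions. *)
Lemma block_concentration m : (0 < m)%N ->
 E (fun e => `|ln (Phi (m * (n * H)) 0 e) - m%:R * E bl|)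
 <= m%:R * (`|link_cost a cL bt n| + 4 * Bt + 4 * Cg) + n%:R * Bt * (1 + Num.sqrt m%:R).
move=> m0; pose s := (n * H)%N; pose c0 := `|link_cost a cL bt n|.
pose M := m%:R * (n%:R * Bt); have M0 : 0 <= M by rewrite !mulr_ge0// ltW.
pose L := n%:R `^ a.
have n1 : 1 <= n%:R :> R by rewrite ler1n (leq_trans _ n4).
have L1 : 1 <= L by have : n%:R `^ 0 <= L by [rewrite ler_powR ?(ltW a0)]; rewrite powRr0.
have L0 : 0 < L by exact: lt_le_trans L1.
have blB e := block_log_bounds n HE rho01 H0 z0 zbt e.
have bd : dep 0 s bl.
 move=> e e' h'; rewrite /block_log; congr ln; apply: Zc_dep => l /andP[_ lD].
 by apply: h'; rewrite (leq_trans lD)// leq_mul2r leq_subr orbT.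
have nbl : nice bl by exact: (nice_dep bd blB).
pose S e := \sum_(0 <= b < m) bl (shift (b * s) e).
have nS : nice S by apply: nice_sum => b _; exact: (nice_shift (b * s) nbl).
have P1 e : 1 <= Phi (m * s) 0 e.
 rewrite /Phi pathsE lerDl mulr_ge0 ?(ltW z0)// sumr_ge0// => j _.
 by rewrite mulr_ge0 ?(link_ge0 HE rho1 h0)// (paths_ge0 HE rho1 h0 (ltW z0)).
have nX : nice (fun e => ln (Phi (m * s) 0 e)).
 by apply: nice_ln => //; apply: (paths_nice HE rho1 h0 (ltW z0)).
pose g (y : int) : R := Num.min (glog L y) M.
have gM y : 0 <= g y <= M by rewrite /g le_min glog_ge0// M0 ge_min lexx orbT.
have ng k : nice (fun e : nat -> int => g (e k)).
 by apply: (nice_cyl (n := k.+1) (M := M)) => // e e' h'; rewrite h'.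
pose U e := m%:R * (c0 + 4 * Bt) + n%:R * Bt + 4 * \sum_(0 <= k < m * s) g (e k).
have nsg : nice (fun e => \sum_(0 <= k < m * s) g (e k)) by exact: nice_sum.
have nU : nice U by apply: nice_add; [exact: nice_cst|exact: nice_scale].
have XS e : `|ln (Phi (m * s) 0 e) - S e| <= U e.
 have up := block_upper HE rho01 H0 n4 z0 zbt m e.
 have lo := block_lower HE rho01 H0 n4 z0 a0 cL0 bt0 zbt plink e m0.
 have X0 : 0 <= ln (Phi (m * s) 0 e) by exact: ln_ge0.
 have G0 : 0 <= \sum_(0 <= k < m * s) g (e k) by apply: sumr_ge0 => k _; case/andP: (gM (e k)).
 have mc : 0 <= m%:R * c0 by apply: mulr_ge0 => //; exact: normr_ge0.
 have mB : 0 <= m%:R * (4 * Bt) by rewrite !mulr_ge0// ltW.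
 have nB : 0 <= n%:R * Bt by rewrite mulr_ge0// ltW.
 rewrite ler_norml /U mulrDr; apply/andP; split; last first.
  move: up; rewrite big_split/= sumr_const_nat subn0 -/(S e) -[_ *+ m]mulr_natl; lra.
 have SM : S e <= M.
  rewrite /M mulr_natl -[m in leRHS]subn0 -sumr_const_nat; apply: ler_sum => b _.
  by case/andP: (blB (shift (b * s) e)).
 have gl := minr_sum_le (m * s) M0 (fun k => glog_ge0 (e k) L0).
 have lo2 : S e - n%:R * Bt - m%:R * c0 - 4 * \sum_(0 <= k < m * s) glog L (e k) <= ln (Phi (m * s) 0 e).
  apply: le_trans lo; rewrite lerD2r /S (@big_ltn _ _ _ 0)//= sumrB.
  have b0 : bl (shift (0 * s) e) <= n%:R * Bt by case/andP: (blB (shift (0 * s) e)).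
  have cc : \sum_(1 <= b < m) link_cost a cL bt n <= m%:R * c0.
   rewrite sumr_const_nat -[leLHS]mulr_natl; apply: (via ((m - 1)%:R * c0)).
    by rewrite ler_wpM2l// ler_norm.
   by rewrite ler_wpM2r ?normr_ge0// ler_nat leq_subr.
  lra.
 move: gl; rewrite minEle; case: ifP => [_|/negbT]; first by rewrite -/(S e); lra.
 by rewrite -ltNge => _ gl; lra.
have EU : E U <= m%:R * (c0 + 4 * Bt) + n%:R * Bt + 4 * (m%:R * Cg).
 rewrite (ED WL (nice_cst _) (nice_scale _ nsg)) (EC WL) (EZ WL _ nsg) (Esum WL)// lerD2l ler_pM2l//.
 have t0 : 0 <= rho * h by rewrite mulr_ge0 ?(ltW h0)//; case/andP: rho01.
 apply: (via (\sum_(0 <= k < m * s) rho * h * (Cg * L `^ (- gamma)))).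
  by apply: ler_sum => k _; exact: (E_step_glog k HE WL t0 L1 glogJ M0).
 rewrite sumr_const_nat subn0 -[leLHS]mulr_natl /L -powRrM mulrN ag powR_inv1 ?(ltW nR)// !natrM.
 have -> : m%:R * (n%:R * H%:R) * (rho * h * (Cg / n%:R)) = rho * (m%:R * Cg) * (n%:R / n%:R) * (H%:R / H%:R).
  by rewrite /h; ring.
 have nn : n%:R / n%:R = 1 :> R by rewrite divff// gt_eqF.
 have HH : H%:R / H%:R = 1 :> R by rewrite divff// pnatr_eq0 -lt0n.
 rewrite nn HH !mulr1 ler_piMl ?mulr_ge0 ?(ltW Cg0)//.
 by case/andP: rho1.
have I1 := iid_l1 WL m0 (mulr_gt0 nR Bt0) bd blB.
have nV : nice (fun e => `|S e - m%:R * E bl|).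
 by apply: nice_norm; apply: nice_add => //; exact: nice_cst.
apply: (via (E (fun e => U e + `|S e - m%:R * E bl|))).
 apply: (Ele WL).
 - by apply: nice_norm; apply: nice_add => //; exact: nice_cst.
 - exact: nice_add.
 move=> e; have -> : ln (Phi (m * (n * H)) 0 e) - m%:R * E bl = (ln (Phi (m * s) 0 e) - S e) + (S e - m%:R * E bl) by rewrite -/s; ring.
 by apply: (le_trans (ler_normD _ _)); rewrite lerD2r.
rewrite (ED WL nU nV) -/c0.
apply: (le_trans (lerD EU I1)).
by apply: eq_ler; ring.
Qed.
End block_concentration.

(** * Integrals without measurability *)

Section raw_integral.
Context {d : measure_display} {T : measurableType d} {R : realType}.
Variable mu : {measure set T -> \bar R}.

(** The integral of a nonnegative function is a supremum over simple functions,
    so monotonicity needs no measurability. It is used for occupation times,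
    about whose measurability in the environment nothing is known. *)
Lemma integral_mono (D : set T) (f g : T -> \bar R) :
 (forall x, D x -> (0 <= f x)%E) -> (forall x, D x -> (f x <= g x)%E) ->
 (\int[mu]_(x in D) f x <= \int[mu]_(x in D) g x)%E.
move=> f0 fg; rewrite !ge0_integralE//; last by move=> x Dx; exact: le_trans (f0 x Dx) (fg x Dx).
apply: le_ereal_sup => _ [h hf <-]; exists h => // x; apply: le_trans (hf x) _.
rewrite /patch; case: ifPn => // xD; apply: fg; exact: set_mem.
Qed.
End raw_integral.

Lemma expR_lip {R : realType} (M x y : R) : x <= M -> y <= M -> `|expR x - expR y| <= expR M * `|x - y|.
wlog xy : x y / y <= x.
 by move=> W xM yM; case/orP: (le_total y x) => h; [exact: W|rewrite (distrC (expR x)) (distrC x); exact: W].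
move=> xM yM; rewrite !ger0_norm ?subr_ge0 ?ler_expR//.
apply: (via (expR x * (x - y))); last by rewrite ler_wpM2r ?subr_ge0// ler_expR.
have := expR_ge1Dx (y - x); rewrite -(ler_pM2l (expR_gt0 x)) -expRD.
have -> : x + (y - x) = y by ring.
rewrite mulrDr mulr1 => h; have -> : expR x * (x - y) = - (expR x * (y - x)) by ring.
lra.
Qed.

Lemma ln_dist {R : realType} (x y : R) : 1 <= x -> 1 <= y -> `|ln x - ln y| <= `|x - y|.
wlog xy : x y / y <= x.
 by move=> W x1 y1; case/orP: (le_total y x) => h; [exact: W|rewrite (distrC (ln x)) (distrC x); exact: W].
move=> x1 y1; have x0 : 0 < x by exact: lt_le_trans x1.
have y0 : 0 < y by exact: lt_le_trans y1.
rewrite !ger0_norm ?subr_ge0 ?ler_ln ?posrE//.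
rewrite -ln_div ?posrE//; have := @le_ln1Dx R (x / y - 1).
have -> : 1 + (x / y - 1) = x / y by ring.
move=> h; apply: le_trans (h _) _; first by rewrite ltrBrDl subrr divr_gt0.
have -> : x / y - 1 = (x - y) / y by field; rewrite gt_eqF.
by rewrite ler_pdivrMr// ler_peMr// subr_ge0.
Qed.

Section step_functions.
Context {R : realType}.
Variables (h : R) (d : nat) (f : R -> bool) (g b : nat -> bool).
Hypotheses (h0 : 0 < h)
 (fg : forall i t, (i < d)%N -> ~~ b i -> i%:R * h <= t <= i.+1%:R * h -> f t = g i).

Let T : R := d%:R * h.
Local Notation mu := (@lebesgue_measure R).

Let Ic i : set R := `[i%:R * h, i.+1%:R * h]%classic.
Let Io i : set R := `[i%:R * h, i.+1%:R * h[%classic.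

Let len i : (i.+1%:R * h - i%:R * h) = h.
by rewrite -natr1 mulrDl mul1r addrAC subrr add0r. Qed.

Let ih i : i%:R * h < i.+1%:R * h.
by rewrite ltr_pM2r// ltr_nat. Qed.

Let int_step (A : nat -> set R) (c : nat -> bool) : (forall i, measurable (A i)) ->
 (\int[mu]_(t in `[0%R, T]) (\sum_(0 <= i < d) (c i)%:R * \1_(A i) t)%:E =
  \sum_(0 <= i < d) (c i)%:R%:E * mu (A i `&` `[0%R, T]%classic))%E.
move=> mA; under eq_integral do rewrite -sumEFin.
rewrite ge0_integral_sum//=; last first.
 move=> i; apply/measurable_EFinP; apply: measurable_funM => //.
 by apply: measurable_indic; exact: mA.
apply: eq_bigr => i _; under eq_integral do rewrite EFinM.
rewrite ge0_integralZl//; last first.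
 by apply/measurable_EFinP; apply: measurable_indic; exact: mA.
by rewrite integral_indic//; exact: mA.
Qed.

Lemma find_cell t : 0 <= t <= T -> t < T -> exists2 i, (i < d)%N & i%:R * h <= t < i.+1%:R * h.
move=> /andP[t0 _] tT; exists (Num.truncn (t / h)).
 rewrite -(ltr_nat R); apply: (@le_lt_trans _ _ (t / h)); last by rewrite ltr_pdivrMr.
 by rewrite truncn_le divr_ge0// ltW.
by rewrite -ler_pdivlMr// -ltr_pdivrMr// truncn_le divr_ge0 ?(ltW h0)//= truncnS_gt.
Qed.

Lemma occupation_upper : (0 < d)%N -> (\int[mu]_(t in `[0%R, T]) (f t)%:R%:E <=
 (h * (\sum_(0 <= i < d) (g i)%:R + \sum_(0 <= i < d) (b i)%:R))%:E)%E.
move=> dp; have mI i : measurable (Ic i) by exact: measurable_itv.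
apply: (via (\int[mu]_(t in `[0%R, T]) (\sum_(0 <= i < d) (g i || b i)%:R * \1_(Ic i) t)%:E)%E).
 apply: integral_mono => [t _|t /=]; first by rewrite lee_fin.
 rewrite in_itv/= lee_fin => /andP[t0 tT].
 case ft : (f t); last by apply: sumr_ge0 => i _; rewrite mulr_ge0.
 have [i id it] : exists2 i, (i < d)%N & i%:R * h <= t <= i.+1%:R * h.
  move: tT; rewrite le_eqVlt => /predU1P[tE|tT].
   exists d.-1; first by rewrite prednK.
   by rewrite tE prednK// lexx andbT ler_wpM2r ?(ltW h0)// ler_nat leq_pred.
  have [i id /andP[i1 i2]] := find_cell (t := t) (ltac:(by rewrite t0 ltW)) tT.
  by exists i => //; rewrite i1 ltW.
 rewrite (@bigD1_seq _ _ _ _ _ i)//= ?mem_index_iota ?iota_uniq//.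
 have -> : \1_(Ic i) t = 1 :> R by rewrite indicE mem_set//= in_itv/=.
 rewrite ler_wpDr//; first by apply: sumr_ge0 => j _; rewrite mulr_ge0.
 rewrite mulr1; case bi : (b i); first by rewrite orbT.
 by rewrite -(fg id _ it) ?bi// ft.
rewrite int_step// -big_split/= mulr_sumr -sumEFin; apply: lee_sum => i _.
apply: (via ((g i || b i)%:R%:E * h%:E)%E).
 rewrite lee_wpmul2l ?lee_fin//; apply: (via (mu (Ic i))).
  apply: le_measure; rewrite ?inE.
  by apply: measurableI; [exact: mI|exact: measurable_itv].
  exact: mI.
  exact: subIsetl.
 by rewrite lebesgue_measure_itv/= lte_fin ih -EFinD len.
rewrite -EFinM lee_fin mulrC ler_wpM2l ?(ltW h0)//.
by case: (g i); case: (b i) => //=; lra.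
Qed.

Lemma occupation_lower : ((h * (\sum_(0 <= i < d) (g i)%:R - \sum_(0 <= i < d) (b i)%:R))%:E <=
 \int[mu]_(t in `[0%R, T]) (f t)%:R%:E)%E.
have mI i : measurable (Io i) by exact: measurable_itv.
apply: (via (\int[mu]_(t in `[0%R, T]) (\sum_(0 <= i < d) (g i && ~~ b i)%:R * \1_(Io i) t)%:E)%E); last first.
 apply: integral_mono => [t _|t /=]; rewrite lee_fin; first by apply: sumr_ge0 => i _; rewrite mulr_ge0.
 rewrite in_itv/= => /andP[t0 tT].
 case: (ltP t T) => tT'; last first.
  rewrite big1_seq// => i /=; rewrite mem_index_iota => /andP[_ id].
  have nI : ~ Io i t.
   rewrite /Io /= in_itv/= => /andP[_ h2].
   have : t < T by apply: lt_le_trans h2 _; rewrite ler_wpM2r ?(ltW h0)// ler_nat.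
   by rewrite ltNge tT'.
  by rewrite indicE memNset// mulr0.
 have [i id /andP[i1 i2]] := find_cell (t := t) (ltac:(by rewrite t0 ltW)) tT'.
 rewrite (@bigD1_seq _ _ _ _ _ i)//= ?mem_index_iota ?iota_uniq//.
 rewrite [X in _ + X]big1 ?addr0 => [|j ji]; last first.
  suff nI : ~ Io j t by rewrite indicE memNset// mulr0.
  rewrite /Io /= in_itv/= => /andP[j1 j2]; move/eqP: ji; apply.
  have a1 : i%:R < j.+1%:R :> R by rewrite -(ltr_pM2r h0) (le_lt_trans i1).
  have a2 : j%:R < i.+1%:R :> R by rewrite -(ltr_pM2r h0) (le_lt_trans j1).
  by move: a1 a2; rewrite !ltr_nat !ltnS => a1 a2; apply/eqP; rewrite eqn_leq a1 a2.
 have -> : \1_(Io i) t = 1 :> R by rewrite indicE mem_set// /Io /= in_itv/= i1 i2.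
 rewrite mulr1; case bi : (b i); first by rewrite andbF.
 by rewrite andbT (fg id) ?bi// i1 ltW.
rewrite int_step// -sumrB mulr_sumr -sumEFin; rewrite big_seq [leRHS]big_seq; apply: lee_sum => i.
rewrite mem_index_iota => /andP[_ id].
have -> : mu (Io i `&` `[0%R, T]%classic) = h%:E.
 rewrite setIidl; first by rewrite lebesgue_measure_itv/= lte_fin ih -EFinD len.
 move=> t; rewrite /Io /= !in_itv/= => /andP[t1 t2]; apply/andP; split.
  by apply: le_trans t1; rewrite mulr_ge0// ltW.
 by apply: le_trans (ltW t2) _; rewrite ler_wpM2r ?(ltW h0)// ler_nat.
rewrite -EFinM lee_fin mulrC ler_wpM2r ?(ltW h0)//.
by case: (g i); case: (b i) => //=; lra.
Qed.
End step_functions.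

(** * Contact expansion *)

Lemma nice_prod {R : realType} (I : Type) (s : seq I) (F : I -> (nat -> int) -> R) :
 (forall i, nice (F i)) -> nice (fun e => \prod_(i <- s) F i e).
move=> nF; elim: s => [|i s IH].
 by under [X in nice X]funext do rewrite big_nil; exact: nice_cst.
by under [X in nice X]funext do rewrite big_cons; exact: nice_mul.
Qed.

Lemma prod_first {R : realType} (z : R) (c : nat -> R) d m :
 \prod_(m <= j < d) (1 + z * c j) = 1 + z * \sum_(m <= j < d) c j * \prod_(j.+1 <= k < d) (1 + z * c k).
move: m; apply: (@backward_ind _ d) => m IH; case: (ltnP m d) => md; last by rewrite !big_geq// mulr0 addr0.
have IH' : \prod_(m.+1 <= j < d) (1 + z * c j) =
  1 + z * \sum_(m.+1 <= j < d) c j * \prod_(j.+1 <= k < d) (1 + z * c k).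
 by case: (ltnP m.+1 d) => md'; [apply: IH; rewrite ltnSn|rewrite !big_geq// mulr0 addr0].
by rewrite big_ltn// [in RHS]big_ltn// mulrDl mul1r [in RHS]mulrDr addrCA -IH' mulrA addrC.
Qed.

Section contact_expansion.
Context {R : realType}.
Variables (J : int -> R) (p : R -> int -> R) (E : ((nat -> int) -> R) -> R) (rho h z : R).
Hypotheses (HE : heat J p) (rho1 : 0 <= rho <= 1) (h0 : 0 < h) (z0 : 0 < z)
 (WL : walk_law J ((1 - rho) * h) E).
Variable e2 : nat -> int.

Definition contact (i j : nat) (e : nat -> int) : R := (incr i j e == incr i j e2)%:R.
Definition contacts (d i : nat) (e : nat -> int) : R := \prod_(i.+1 <= j < d) (1 + z * contact i j e).

Let contact_dep i j : dep i j (contact i j).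
by move=> e e' h'; rewrite /contact (@incr_dep R i j (fun y => (y == incr i j e2)%:R) e e'). Qed.

Let contact_nice i j : nice (contact i j).
by apply: (nice_dep (@contact_dep i j) (M := 1)) => e; rewrite /contact; case: eqP; rewrite ?ler01 ?lexx.
Qed.

Lemma contacts_nice d i : nice (contacts d i).
by apply: nice_prod => j; apply: nice_add; [exact: nice_cst|exact: nice_scale]. Qed.

Let contacts_dep d i : dep i d (contacts d i).
move=> e e' h'; apply: eq_big_nat => j /andP[ij jd]; congr (_ + _ * _).
by apply: contact_dep => l /andP[il lj]; apply: h'; rewrite il (ltn_trans lj jd).
Qed.

Lemma incr_cat i j k e : (i <= j)%N -> (j <= k)%N -> incr i k e = incr i j e + incr j k e.
by move=> ij jk; rewrite /incr (cat_nat j). Qed.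

Lemma contactsE d i e : contacts d i e = 1 + z * \sum_(i.+1 <= j < d) contact i j e * contacts d j e.
rewrite /contacts prod_first; congr (_ + _ * _); apply: eq_big_nat => j /andP[ij jd].
case cij : (incr i j e == incr i j e2); last by rewrite /contact cij !mul0r.
congr (_ * _); apply: eq_big_nat => k /andP[jk kd]; congr (_ + _ * _); rewrite /contact.
by rewrite (incr_cat e (ltnW ij) (ltnW jk)) (incr_cat e2 (ltnW ij) (ltnW jk)) (eqP cij) (inj_eq (addrI _)).
Qed.

Lemma E_contact i j : (i <= j)%N -> E (contact i j) = link p rho h i j e2.
move=> ij; have t0 : 0 <= (1 - rho) * h * (j - i)%:R.
 by case/andP: rho1 => _ r1; rewrite !mulr_ge0 ?subr_ge0// ltW.
rewrite /contact (@E_incr _ _ _ _ WL i j (fun y => (y == incr i j e2)%:R) 1 ij); last first.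
 by move=> y; case: eqP; rewrite ?ler01 ?lexx.
rewrite /Et.
have -> : (\esum_y ((y == incr i j e2)%:R%:E * pt J ((1 - rho) * h * (j - i)%:R) y) =
  (p ((1 - rho) * h * (j - i)%:R) (incr i j e2))%:E)%E.
 rewrite (esum_delta (i := incr i j e2)) ?eqxx ?(heat_pt HE) ?mul1e// => [y|y /negPf -> //].
  by rewrite (heat_pt HE)// -EFinM lee_fin mulr_ge0// (heat_ge0 HE).
 by rewrite mul0e.
by rewrite /link; congr (p _ _) => /=; ring.
Qed.

(** Expanding the product of [1 + z * 1(contact)] over the grid according to
    the next contact gives the recursion of [paths]. *)
Lemma E_contacts d i : E (contacts d i) = Phi p rho h z d i e2.
move: i; apply: (@backward_ind _ d) => i IH; rewrite PhiE.
have n1 j : nice (fun e => contact i j e * contacts d j e) by apply: nice_mul => //; exact: contacts_nice.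
have n2 : nice (fun e => \sum_(i.+1 <= j < d) contact i j e * contacts d j e) by exact: nice_sum.
have -> : E (contacts d i) = E (fun e => 1 + z * \sum_(i.+1 <= j < d) contact i j e * contacts d j e).
 by congr E; apply/funext => e; rewrite contactsE.
rewrite (ED WL (nice_cst _) (nice_scale z n2)) (EC WL) (EZ WL z n2) (Esum WL)//.
congr (_ + _ * _); apply: eq_big_nat => j /andP[ij jd].
rewrite (E_indep WL (contact_nice i j) (contacts_nice d j) (@contact_dep i j) (@contacts_dep d j)).
by rewrite E_contact 1?ltnW// IH ?ij.
Qed.
End contact_expansion.

(** * Occupation times and partition functions *)

Section almost_sure_bounds.
Context {d : measure_display} {O : measurableType d} {R : realType}.
Variable P : probability O R.

Lemma bounded_integrable (G : O -> R) (K : R) : measurable_fun setT G -> (forall w, `|G w| <= K) ->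
 P.-integrable setT (EFin \o G).
move=> mG GK; apply: measurable_bounded_integrable => //.
- by rewrite [X in (X < _)%E]probability_setT ltry.
- by exists K; split; [exact: num_real|move=> x Kx w _; exact: le_trans (GK w) (ltW Kx)].
Qed.

Lemma integral_fineK (G : O -> R) (K : R) : measurable_fun setT G -> (forall w, `|G w| <= K) ->
 (\int[P]_w (G w)%:E = (\int[P]_w G w)%:E)%E.
move=> mG GK; rewrite /Rintegral fineK//.
exact: (integrable_fin_num measurableT (bounded_integrable mG GK)).
Qed.

Variables (N : set O) (f G : O -> R) (M K : R).
Hypotheses (mN : measurable N) (PN : P N = 1%E) (mG : measurable_fun setT G)
 (GK : forall w, `|G w| <= K) (f0 : forall w, 0 <= f w <= M).

Let mV : measurable_fun setT (\1_(~` N) : O -> R).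
by apply: measurable_indic; exact: measurableC. Qed.
Let V01 w : 0 <= (\1_(~` N) w : R) <= 1.
by rewrite indicE; case: (_ \in _); rewrite ?ler01 ?lexx. Qed.

Let iV : P.-integrable setT (EFin \o (\1_(~` N) : O -> R)).
by apply: (bounded_integrable (K := 1)) => // w; case/andP: (V01 w) => ? ?; rewrite ger0_norm. Qed.

Let EV : \int[P]_w (\1_(~` N) w : R) = 0.
rewrite /Rintegral integral_indic//; last exact: measurableC.
have E0 : P (~` N) = 0%E by rewrite probability_setC// PN subee.
by rewrite setIT -[RHS]/(fine 0%E); congr fine; exact: E0.
Qed.

Let M0 : 0 <= M.
by have /andP[h1 h2] := f0 point; exact: le_trans h1 h2. Qed.
Let K0 : 0 <= K.
exact: le_trans (normr_ge0 _) (GK point). Qed.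
Let EGV c : \int[P]_w (G w + c * \1_(~` N) w) = \int[P]_w G w.
have icV : P.-integrable setT (EFin \o (fun w => c * \1_(~` N) w)).
 by apply: eq_integrable (integrableZl measurableT c iV).
rewrite RintegralD//; last exact: bounded_integrable mG GK.
by rewrite RintegralZl// EV mulr0 addr0.
Qed.

Let mGV c : measurable_fun setT (fun w => G w + c * \1_(~` N) w).
by apply: measurable_funD => //; apply: measurable_funM. Qed.

Let bGV c w : `|G w + c * \1_(~` N) w| <= K + `|c|.
apply: (le_trans (ler_normD _ _)); apply: lerD => //; rewrite normrM ler_piMr//.
by case/andP: (V01 w) => ? ?; rewrite ger0_norm.
Qed.

Let GKl w : - K <= G w. by have := GK w; rewrite ler_norml => /andP[]. Qed.
Let GKu w : G w <= K. by have := GK w; rewrite ler_norml => /andP[]. Qed.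

Lemma integral_ae_upper : (forall w, N w -> f w <= G w) ->
 (\int[P]_w (f w)%:E <= (\int[P]_w G w)%:E)%E.
move=> fG; rewrite -(EGV (K + M)) -(integral_fineK (mGV (K + M)) (bGV (K + M))).
apply: integral_mono => w _; rewrite lee_fin; first by case/andP: (f0 w).
case: (pselect (N w)) => Nw.
 by rewrite indicE memNset ?mulr0 ?addr0; [exact: fG|move=> /(_ Nw)].
rewrite indicE mem_set// mulr1; case/andP: (f0 w) => _ fM; have := GKl w; lra.
Qed.

Lemma integral_ae_lower : (forall w, N w -> G w <= f w) ->
 ((\int[P]_w G w)%:E <= \int[P]_w (f w)%:E)%E.
move=> Gf; rewrite -(EGV (- K)).
pose L w := Num.max 0 (G w + - K * \1_(~` N) w).
apply: (via (\int[P]_w (L w)%:E)%E).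
 rewrite -(integral_fineK (mGV (- K)) (bGV (- K))).
 apply: le_integral => //; first exact: bounded_integrable (mGV _) (bGV _).
  apply: (bounded_integrable (K := K + `|- K|)).
   by apply: measurable_maxr => //; exact: mGV.
  move=> w; rewrite /L maxEle; case: ifP => _; last by rewrite normr0 addr_ge0.
  exact: bGV.
 by move=> w _; rewrite lee_fin /L le_max lexx orbT.
apply: integral_mono => w _; rewrite lee_fin /L ?le_max ?lexx//.
rewrite ge_max; case/andP: (f0 w) => -> _ /=; case: (pselect (N w)) => Nw.
 by rewrite indicE memNset ?mulr0 ?addr0; [exact: Gf|move=> /(_ Nw)].
rewrite indicE mem_set// mulr1; case/andP: (f0 w) => f0w _; have := GKu w; lra.
Qed.
End almost_sure_bounds.

Section grid_intervals.
Context {d : measure_display} {O : measurableType d} {R : realType}.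
Variables (P : probability O R) (J : int -> R) (W : R -> O -> int) (delta : R).
Hypotheses (hW : ctrw P J W) (delta0 : 0 <= delta).

Lemma grid_quiet : exists Q : nat -> set O, forall i,
 [/\ measurable (Q i), ((1 - delta)%:E <= P (Q i))%E &
   forall w u, Q i w -> delta * i%:R <= u <= delta * i.+1%:R -> W u w = W (delta * i%:R) w].
suff /choice [Q hQ] : forall i, exists A : set O, [/\ measurable A, ((1 - delta)%:E <= P A)%E &
   forall w u, A w -> delta * i%:R <= u <= delta * i.+1%:R -> W u w = W (delta * i%:R) w].
 by exists Q.
move=> i; have t0 : 0 <= delta * i%:R by rewrite mulr_ge0.
have [A [mA PA hA]] := ctrw_quiet hW t0 delta0; exists A; split => // w u Aw ui.
by apply: hA => //; have -> : delta * i%:R + delta = delta * i.+1%:R by rewrite -natr1 mulrDr mulr1.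
Qed.

Lemma incr_eps n w : incr 0 n (eps W delta w) = W (delta * n%:R) w - W (delta * 0%:R) w.
elim: n => [|n IH]; first by rewrite /incr big_geq// subrr.
rewrite /incr big_nat_recr//= -/(incr 0 n _) IH /eps; ring.
Qed.
End grid_intervals.

Section occupation_time.
Context {d : measure_display} {O : measurableType d} {R : realType}.
Variables (P : probability O R) (X : R -> O -> int) (y : R -> int).

Let fin (T : R) w : 0 <= T ->
 (0 <= \int[@lebesgue_measure R]_(t in `[0%R, T]) ((X t w == y t)%:R)%:E <= T%:E)%E.
move=> T0; apply/andP; split; first by apply: integral_ge0 => t _; rewrite lee_fin.
apply: (via (\int[@lebesgue_measure R]_(t in `[0%R, T]) (cst 1%E) t)%E).
 by apply: integral_mono => t _; rewrite lee_fin//; case: eqP.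
rewrite integral_cst//= mul1e lebesgue_measure_itv/= lte_fin.
by case: ifP => _; rewrite lee_fin ?subr0.
Qed.

Let collE (T : R) w : 0 <= T ->
 (\int[@lebesgue_measure R]_(t in `[0%R, T]) ((X t w == y t)%:R)%:E = (collision_time X y T w)%:E)%E.
move=> T0; have /andP[h1 h2] := fin w T0; rewrite /collision_time /Rintegral fineK// ge0_fin_numE//.
exact: le_lt_trans h2 (ltry _).
Qed.

Lemma collision_bounds (T : R) w : 0 <= T -> 0 <= collision_time X y T w <= T.
by move=> T0; have := fin w T0; rewrite collE// !lee_fin. Qed.

Lemma collision_mono (S T : R) w : 0 <= S -> S <= T -> collision_time X y S w <= collision_time X y T w.
move=> S0 ST; rewrite -lee_fin -!collE ?(le_trans S0)//.
rewrite integral_mkcond [leRHS]integral_mkcond; apply: integral_mono => t _.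
 by apply: erestrict_ge0 => x _; rewrite lee_fin.
rewrite /patch; case: ifPn => tS; last by case: ifP => _; rewrite lee_fin.
rewrite ifT//; move: tS; rewrite !inE /= !in_itv/= => /andP[-> tS]/=; exact: le_trans ST.
Qed.

Variable beta : R.
Hypothesis beta0 : 0 <= beta.

Lemma partition_bounds (T : R) : 0 <= T ->
 (\int[P]_w (expR (beta * collision_time X y T w))%:E = (partition_function P X y beta T)%:E)%E /\
 1 <= partition_function P X y beta T.
move=> T0.
have ge1 : (1%:E <= \int[P]_w (expR (beta * collision_time X y T w))%:E)%E.
 apply: (via (\int[P]_w (cst 1%E) w)%E); first by rewrite integral_cst//= mul1e probability_setT.
 apply: integral_mono => w _; first by [].
 by rewrite lee_fin -expR0 ler_expR mulr_ge0//; case/andP: (collision_bounds w T0).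
have le : (\int[P]_w (expR (beta * collision_time X y T w))%:E <= (expR (beta * T))%:E)%E.
 apply: (via (\int[P]_w (cst (expR (beta * T))%:E) w)%E).
  apply: integral_mono => w _; rewrite lee_fin ?expR_ge0//.
  by rewrite ler_expR ler_wpM2l//; case/andP: (collision_bounds w T0).
 by rewrite integral_cst//= probability_setT mule1.
have E : (\int[P]_w (expR (beta * collision_time X y T w))%:E = (partition_function P X y beta T)%:E)%E.
 rewrite /partition_function unlock fineK// ge0_fin_numE ?(le_trans _ ge1)//.
 exact: le_lt_trans le (ltry _).
by split => //; rewrite -lee_fin -E.
Qed.

Lemma partition_mono (S T : R) : 0 <= S -> S <= T ->
 partition_function P X y beta S <= partition_function P X y beta T.
move=> S0 ST; have T0 := le_trans S0 ST.
rewrite -lee_fin -(partition_bounds S0).1 -(partition_bounds T0).1.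
apply: integral_mono => w _; rewrite lee_fin ?expR_ge0//.
by rewrite ler_expR ler_wpM2l// collision_mono.
Qed.
End occupation_time.

(** * Comparison of the grid with continuous time *)

Section quenched_mesh.
Context {d1 d2 : measure_display} {O1 : measurableType d1} {O2 : measurableType d2} {R : realType}.
Variables (P1 : probability O1 R) (P2 : probability O2 R) (W1 : R -> O1 -> int) (W2 : R -> O2 -> int).
Variables (J : int -> R) (p : R -> int -> R) (rho beta : R) (H T : nat).
Hypotheses (hW1 : ctrw P1 J W1) (hW2 : ctrw P2 J W2) (HE : heat J p) (rho1 : 0 <= rho <= 1)
 (beta0 : 0 < beta) (H0 : (0 < H)%N) (T0 : (0 < T)%N).
Let h : R := H%:R^-1.
Let d : nat := (T * H)%N.
Let z : R := expR (beta * h) - 1.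
Let h0 : 0 < h. by rewrite invr_gt0 ltr0n. Qed.
Let bh0 : 0 < beta * h. by rewrite mulr_gt0. Qed.
Let z0 : 0 < z. by rewrite subr_gt0 expR_gt1. Qed.
Let dT : d%:R * h = T%:R.
by rewrite natrM -mulrA mulfV ?mulr1// pnatr_eq0 -lt0n. Qed.
Let s1 : R := (1 - rho) * h.
Let s2 : R := rho * h.
Let s10 : 0 <= s1. by rewrite mulr_ge0 ?(ltW h0)// subr_ge0; case/andP: rho1. Qed.
Let s20 : 0 <= s2. by rewrite mulr_ge0 ?(ltW h0)//; case/andP: rho1. Qed.

Definition X_ (t : R) : O1 -> int := W1 ((1 - rho) * t).
Definition Y_ (t : R) : O2 -> int := W2 (rho * t).

Let coll_bounds (y : R -> int) w : 0 <= collision_time X_ y T%:R w <= T%:R.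
exact: collision_bounds. Qed.

Let e1 w := eps W1 s1 w.
Let e2 w := eps W2 s2 w.

Let coll_grid (Q1 : nat -> set O1) (Q2 : nat -> set O2) w1 w2 :
 (forall i w u, Q1 i w -> s1 * i%:R <= u <= s1 * i.+1%:R -> W1 u w = W1 (s1 * i%:R) w) ->
 (forall i w u, Q2 i w -> s2 * i%:R <= u <= s2 * i.+1%:R -> W2 u w = W2 (s2 * i%:R) w) ->
 W1 0 w1 = 0 -> W2 0 w2 = 0 ->
 `|collision_time X_ (Y_ ^~ w2) T%:R w1 - h * \sum_(0 <= i < d) contact (e2 w2) 0 i (e1 w1)|
  <= h * (\sum_(0 <= i < d) \1_(~` Q1 i) w1 + \sum_(0 <= i < d) \1_(~` Q2 i) w2).
move=> hQ1 hQ2 W10 W20.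
pose f t := X_ t w1 == Y_ t w2.
pose g i := incr 0 i (e1 w1) == incr 0 i (e2 w2).
pose b i := (w1 \in ~` Q1 i) || (w2 \in ~` Q2 i).
have gE i : g i = (X_ (i%:R * h) w1 == Y_ (i%:R * h) w2).
 rewrite /g !incr_eps !mulr0 W10 W20 !subr0 /X_ /Y_ /s1 /s2.
 by congr (W1 _ _ == W2 _ _); ring.
have fg i t : (i < d)%N -> ~~ b i -> i%:R * h <= t <= i.+1%:R * h -> f t = g i.
 move=> _ /norP[/negP q1 /negP q2] /andP[t1 t2]; rewrite gE /f /X_ /Y_.
 have in1 : Q1 i w1 by apply: contrapT => q; apply: q1; exact: mem_set.
 have in2 : Q2 i w2 by apply: contrapT => q; apply: q2; exact: mem_set.
 have [r0 r1] := andP rho1.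
 have r1' : 0 <= 1 - rho by rewrite subr_ge0.
 rewrite (hQ1 i w1 ((1 - rho) * t) in1); last first.
  by rewrite /s1 -!mulrA ![h * _]mulrC !ler_wpM2l.
 rewrite (hQ2 i w2 (rho * t) in2); last by rewrite /s2 -!mulrA ![h * _]mulrC !ler_wpM2l.
 by congr (W1 _ _ == W2 _ _); rewrite /s1 /s2; ring.
have dp : (0 < d)%N by rewrite muln_gt0 T0.
have up := occupation_upper h0 fg dp.
have lo := occupation_lower h0 fg.
rewrite dT in up lo.
have nn : (0 <= \int[@lebesgue_measure R]_(t in `[0%R, T%:R]) ((f t)%:R)%:E)%E.
 by apply: integral_ge0 => t _; rewrite lee_fin.
have fin : (\int[@lebesgue_measure R]_(t in `[0%R, T%:R]) ((f t)%:R)%:E)%E \is a fin_num.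
 by rewrite ge0_fin_numE//; exact: le_lt_trans up (ltry _).
set A := collision_time _ _ _ _.
have AE : (\int[@lebesgue_measure R]_(t in `[0%R, T%:R]) ((f t)%:R)%:E)%E = A%:E by rewrite -[LHS]fineK.
rewrite AE !lee_fin in up lo.
have bB : \sum_(0 <= i < d) (b i)%:R <= \sum_(0 <= i < d) \1_(~` Q1 i) w1 + \sum_(0 <= i < d) \1_(~` Q2 i) w2 :> R.
 rewrite -big_split/=; apply: ler_sum => i _; rewrite /b !indicE.
 by case: (w1 \in _); case: (w2 \in _) => /=; lra.
have bB' := ler_wpM2l (ltW h0) bB.
rewrite -[\sum_(0 <= i < d) contact _ _ _ _]/(\sum_(0 <= i < d) (g i)%:R).
rewrite mulrDr in up; rewrite mulrBr in lo.
rewrite ler_norml; lra.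
Qed.

Let Phi0 w := Phi p rho h z d 0 (e2 w).

(** The occupation time is replaced by [h] times the number of contacts on the
    grid. The error is at most [h] times the number of grid intervals in which
    one of the walks jumps; for [Y] this number is [B], and for [X] it is
    integrated out. *)
Lemma partition_mesh : exists B : O2 -> R, [/\ measurable_fun setT B, forall w, 0 <= B w <= d%:R,
  \int[P2]_w B w <= T%:R &
  exists N, [/\ measurable N, P2 N = 1%E & forall w, N w ->
   `|ln (partition_function P1 X_ (Y_ ^~ w) beta T%:R) - ln (Phi0 w)|
    <= beta * h + beta * expR (beta * T%:R) * h * (T%:R + B w)]].
have [Q1 hQ1] := grid_quiet hW1 s10.
have [Q2 hQ2] := grid_quiet hW2 s20.
have mind (dd : measure_display) (OO : measurableType dd) (Q : nat -> set OO) : (forall i, measurable (Q i)) ->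
  measurable_fun setT (fun w => \sum_(0 <= i < d) \1_(~` Q i) w : R).
 move=> mQ; apply: measurable_sum => i; apply: measurable_indic; exact: measurableC.
have bind (OO : Type) (Q : nat -> set OO) w : 0 <= (\sum_(0 <= i < d) \1_(~` Q i) w : R) <= d%:R.
 rewrite sumr_ge0//= -[d in leRHS]subn0 -[_%:R]mulr1 mulr_natl -sumr_const_nat.
 by apply: ler_sum => i _; rewrite indicE; case: (_ \in _).
have eind (dd : measure_display) (OO : measurableType dd) (P : probability OO R) (Q : nat -> set OO) dl :
  (forall i, measurable (Q i) /\ ((1 - dl)%:E <= P (Q i))%E) ->
  \int[P]_w (\sum_(0 <= i < d) \1_(~` Q i) w) <= d%:R * dl.
 move=> mQ; rewrite /Rintegral; under eq_integral do rewrite -sumEFin.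
 rewrite ge0_integral_sum//; last first.
  by move=> i; apply/measurable_EFinP; apply: measurable_indic; apply: measurableC; case: (mQ i).
 have PQ i : (\int[P]_w (\1_(~` Q i) w)%:E <= dl%:E)%E.
  have [mQi PQi] := mQ i; rewrite integral_indic ?setIT//; last exact: measurableC.
  apply: (via (1 - P (Q i))%E); first by apply: eq_ler; exact: probability_setC.
  rewrite leeBlDr; last by rewrite fin_num_measure.
  by move: PQi; rewrite -(fineK (fin_num_measure P _ mQi)) -EFinD !lee_fin; lra.
 have ub : (\sum_(0 <= i < d) \int[P]_w (\1_(~` Q i) w)%:E <= (d%:R * dl)%:E)%E.
  apply: (via (\sum_(0 <= i < d) dl%:E)%E); first by apply: lee_sum => i _; exact: PQ.
  by rewrite sumEFin sumr_const_nat subn0 mulr_natl.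
 have lb : (0 <= \sum_(0 <= i < d) \int[P]_w (\1_(~` Q i) w)%:E)%E.
  by apply: sume_ge0 => i _; apply: integral_ge0 => w _; rewrite lee_fin.
 by rewrite -lee_fin fineK// ge0_fin_numE//; exact: le_lt_trans ub (ltry _).
have mQ1 i : measurable (Q1 i) by case: (hQ1 i).
have mQ2 i : measurable (Q2 i) by case: (hQ2 i).
pose B1 w : R := \sum_(0 <= i < d) \1_(~` Q1 i) w.
pose B2 w : R := \sum_(0 <= i < d) \1_(~` Q2 i) w.
have [rl rr] := andP rho1.
have dh s : 0 <= s <= 1 -> d%:R * (s * h) <= T%:R.
 by move=> /andP[sl sr]; rewrite mulrCA dT ler_piMl.
have EB1 : \int[P1]_w B1 w <= T%:R.
 apply: le_trans (dh (1 - rho) _); last by rewrite subr_ge0 rr gerBl.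
 by apply: eind => i; have [] := hQ1 i.
exists B2; split; [exact: mind|by move=> w; exact: bind| |].
 apply: le_trans (dh rho rho1).
 by apply: eind => i; have [] := hQ2 i.
have [N1 [mN1 PN1 W10]] := ctrw_W0 hW1.
have [N2 [mN2 PN2 W20]] := ctrw_W0 hW2.
exists N2; split => // w2 Nw2.
pose c := beta * expR (beta * T%:R) * h.
have c0 : 0 <= c by rewrite !mulr_ge0 ?expR_ge0 ?(ltW h0) ?(ltW beta0).
pose F e1 := \prod_(0 <= i < d) (1 + z * contact (e2 w2) 0 i e1).
have dp : (0 < d)%N by rewrite muln_gt0 T0.
have FE e : F e = (1 + z) * contacts z (e2 w2) d 0 e.
 rewrite /F big_ltn//; congr (_ * _).
 by rewrite /contact /incr !big_geq// eqxx mulr1.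
have Fx e : F e = expR (beta * (h * \sum_(0 <= i < d) contact (e2 w2) 0 i e)).
 rewrite !mulr_sumr expR_sum; apply: eq_bigr => i _.
 rewrite /contact; case: eqP => _; rewrite ?mulr1 ?mulr0 ?expR0 ?addr0//.
 by rewrite /z addrC subrK.
have nc := contacts_nice z (e2 w2) d 0.
have nF : nice F.
 have -> : F = fun e => (1 + z) * contacts z (e2 w2) d 0 e by apply/funext.
 exact: nice_scale.
have WL1 := grid_walk_law hW1 s10.
have EF : Ex P1 W1 s1 F = (1 + z) * Phi0 w2.
 have -> : F = fun e => (1 + z) * contacts z (e2 w2) d 0 e by apply/funext.
 by rewrite (EZ WL1)// (E_contacts z HE rho1 h0 WL1).
have [[nn cF] [MF FM]] := nF.
have mF : measurable_fun setT (fun w => F (e1 w)) by exact: measurable_cyl hW1 s10 _ _ cF.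
have mB1 : measurable_fun setT B1 by exact: mind.
have B1b w : 0 <= B1 w <= d%:R by exact: bind.
have iF : P1.-integrable setT (EFin \o (fun w => F (e1 w))).
 by apply: (@bounded_integrable _ _ _ P1 _ MF) => // w.
have iB1 : P1.-integrable setT (EFin \o B1).
 by apply: (@bounded_integrable _ _ _ P1 _ d%:R) => // w; case/andP: (B1b w) => ? ?; rewrite ger0_norm.
pose A w := collision_time X_ (Y_ ^~ w2) T%:R w.
pose f w := expR (beta * A w).
have fb w : 0 <= f w <= expR (beta * T%:R).
 by rewrite expR_ge0 ler_expR ler_wpM2l ?(ltW beta0)//; case/andP: (coll_bounds (Y_ ^~ w2) w).
have fF w : N1 w -> `|f w - F (e1 w)| <= c * (B1 w + B2 w2).
 move=> Nw.
 have q1 i w' u : Q1 i w' -> s1 * i%:R <= u <= s1 * i.+1%:R -> W1 u w' = W1 (s1 * i%:R) w'.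
  by have [_ _ q] := hQ1 i; exact: q.
 have q2 i w' u : Q2 i w' -> s2 * i%:R <= u <= s2 * i.+1%:R -> W2 u w' = W2 (s2 * i%:R) w'.
  by have [_ _ q] := hQ2 i; exact: q.
 have := coll_grid q1 q2 (W10 _ Nw) (W20 _ Nw2); rewrite -/(B1 w) -/(B2 w2) -/(A w) => AB.
 rewrite Fx; set S := \sum_(0 <= i < d) _ in AB *.
 have SM : beta * (h * S) <= beta * T%:R.
  rewrite ler_wpM2l ?(ltW beta0)// -dT mulrC ler_wpM2r ?(ltW h0)//.
  rewrite -[d in leRHS]subn0 -[_%:R]mulr1 mulr_natl -sumr_const_nat.
  by apply: ler_sum => i _; rewrite /contact; case: eqP.
 apply: le_trans (expR_lip (_ : _ <= beta * T%:R) SM) _.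
  by rewrite ler_wpM2l ?(ltW beta0)//; case/andP: (coll_bounds (Y_ ^~ w2) w).
 rewrite -mulrBr normrM (gtr0_norm beta0) /c.
 have -> : beta * expR (beta * T%:R) * h * (B1 w + B2 w2) = expR (beta * T%:R) * (beta * (h * (B1 w + B2 w2))) by ring.
 by rewrite ler_wpM2l ?expR_ge0// ler_wpM2l ?(ltW beta0).
pose G s w := F (e1 w) + s * (B1 w + B2 w2).
have mG s : measurable_fun setT (G s).
 by apply: measurable_funD => //; apply: measurable_funM => //; apply: measurable_funD.
have Gb s w : `|G s w| <= MF + `|s| * (d%:R + d%:R).
 apply: (le_trans (ler_normD _ _)); apply: lerD; first exact: FM.
 rewrite normrM ler_wpM2l//; have /andP[? ?] := B1b w; have /andP[? ?] := bind _ Q2 w2.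
 by rewrite ger0_norm ?addr_ge0// lerD.
have EG s : \int[P1]_w G s w = (1 + z) * Phi0 w2 + s * (\int[P1]_w B1 w + B2 w2).
 have iBB : P1.-integrable setT (EFin \o (fun w => B1 w + B2 w2)).
  apply: (@bounded_integrable _ _ _ P1 _ (d%:R + d%:R)); first exact: measurable_funD.
  move=> w; have /andP[? ?] := B1b w; have /andP[? ?] := bind _ Q2 w2.
  by rewrite ger0_norm ?addr_ge0// lerD.
 have ic : P1.-integrable setT (EFin \o (cst (B2 w2) : O1 -> R)).
  by apply: (@bounded_integrable _ _ _ P1 _ `|B2 w2|).
 rewrite RintegralD//; last by apply: eq_integrable (integrableZl measurableT s iBB).
 rewrite RintegralZl// RintegralD// Rintegral_cst//= probability_setT mulr1.
 by rewrite -EF.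
have up : (\int[P1]_w (f w)%:E <= (\int[P1]_w G c w)%:E)%E.
 apply: (integral_ae_upper mN1 PN1 (mG c) (Gb c) fb) => w Nw.
 by have := fF w Nw; rewrite ler_norml /G; lra.
have lo : ((\int[P1]_w G (- c) w)%:E <= \int[P1]_w (f w)%:E)%E.
 apply: (integral_ae_lower mN1 PN1 (mG (- c)) (Gb (- c)) fb) => w Nw.
 by have := fF w Nw; rewrite ler_norml /G mulNr; lra.
have [ZE ge1] := partition_bounds P1 X_ (Y_ ^~ w2) (ltW beta0) (ler0n R T).
set Z := partition_function _ _ _ _ _ in ZE ge1 *.
rewrite ZE !lee_fin in up lo.
have P1' : 1 <= Phi0 w2.
 rewrite /Phi0 PhiE lerDl mulr_ge0 ?(ltW z0)// sumr_ge0// => j _.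
 by rewrite mulr_ge0 ?(link_ge0 HE rho1 h0)// (paths_ge0 HE rho1 h0 (ltW z0)).
have zP : 1 <= (1 + z) * Phi0 w2.
 rewrite -[leLHS]mulr1; apply: ler_pM => //; by rewrite lerDl ltW.
have dist : `|Z - (1 + z) * Phi0 w2| <= c * (T%:R + B2 w2).
 rewrite EG in up; rewrite EG mulNr in lo.
 have : c * (\int[P1]_w B1 w + B2 w2) <= c * (T%:R + B2 w2) by rewrite ler_wpM2l// lerD2r.
 by rewrite ler_norml; lra.
have lnz : ln (1 + z) = beta * h by rewrite /z addrC subrK expRK.
have := le_trans (ln_dist ge1 zP) dist.
have z1 : 0 < 1 + z by rewrite addr_gt0.
rewrite lnM ?posrE// ?(lt_le_trans ltr01)// lnz !ler_norml -/c -/(B2 w2).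
by have := bh0; lra.
Qed.
End quenched_mesh.

(** * Limits along sparse times *)

Lemma cauchy_limit {R : realType} (x r : nat -> R) : (forall k, 0 <= r k) ->
 (forall k j, (k <= j)%N -> `|x k - x j| <= r k) -> exists F, forall k, `|x k - F| <= r k.
move=> r0 xr.
have xr' k j : (k <= j)%N -> x k - r k <= x j <= x k + r k.
 by move=> kj; have := xr k j kj; rewrite ler_norml; lra.
pose A := [set y | exists k, y = x k - r k].
have ubA j : ubound A (x j + r j).
 move=> _ [k ->]; case/orP: (leq_total k j) => kj.
  by have := xr' k j kj; have := r0 j; lra.
 by have := xr' j k kj; have := r0 k; lra.
have supA : has_sup A by split; [exists (x 0 - r 0); exists 0%N|exists (x 0%N + r 0%N); exact: ubA].
exists (sup A) => k; rewrite ler_norml.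
have h1 : x k - r k <= sup A by apply: ub_le_sup; [case: supA|exists k].
have h2 : sup A <= x k + r k by apply: ge_sup; [case: supA|exact: ubA].
lra.
Qed.

Lemma sum_inv_sq {R : realType} n : \sum_(0 <= k < n) (k.+1%:R ^- 2 : R) <= 2.
case: n => [|n]; first by rewrite big_geq.
suff : \sum_(0 <= k < n.+1) (k.+1%:R ^- 2 : R) <= 2 - n.+1%:R^-1.
 by move=> h; apply: (le_trans h); rewrite gerBl invr_ge0.
elim: n => [|n IH]; first by rewrite big_nat1 expr1n invr1; lra.
rewrite big_nat_recr//=; apply: (le_trans (lerD IH (lexx _))).
have y0 : 0 < n.+1%:R :> R by rewrite ltr0n.
rewrite -[n.+2%:R]natr1; set y : R := n.+1%:R in y0 *.
have y1 : 0 < y + 1 by rewrite addr_gt0.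
have : (y + 1) ^- 2 <= y^-1 - (y + 1)^-1.
 have -> : y^-1 - (y + 1)^-1 = (y * (y + 1))^-1 by field; rewrite !gt_eqF.
 rewrite lef_pV2 ?posrE ?exprn_gt0 ?mulr_gt0// expr2 ler_wpM2r ?(ltW y1)//; lra.
move: ((y + 1) ^- 2) (y^-1) ((y + 1)^-1) => A B D; lra.
Qed.

Lemma ae_cvg0 {d : measure_display} {O : measurableType d} {R : realType} (P : probability O R)
  (U : nat -> O -> R) (C : R) :
 (forall k, measurable_fun setT (U k)) -> (forall k w, 0 <= U k w) ->
 (forall k, (\int[P]_w (U k w)%:E <= (C * k.+1%:R ^- 2)%:E)%E) ->
 {ae P, forall w, U k w @[k --> \oo] --> (0 : R)}.
move=> mU U0 EU.
have C0 : 0 <= C.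
 have i0 : (0 <= \int[P]_w (U 0%N w)%:E)%E by apply: integral_ge0 => w _; rewrite lee_fin.
 by have := le_trans i0 (EU 0%N); rewrite expr1n invr1 mulr1 lee_fin.
have mE k : measurable_fun setT (fun w => (U k w)%:E) by apply/measurable_EFinP.
have E0 k w : setT w -> (0 <= (U k w)%:E)%E by rewrite lee_fin.
have IU : (\int[P]_w (\sum_(0 <= k <oo) (U k w)%:E) <= (C * 2)%:E)%E.
 rewrite (integral_nneseries P measurableT mE E0).
 apply: (via (\sum_(0 <= k <oo) (C * k.+1%:R ^- 2)%:E)%E).
  by apply: lee_nneseries => k *; [apply: integral_ge0 => w _; rewrite lee_fin|exact: EU].
 rewrite nneseries_esumT => [|k]; last by rewrite lee_fin mulr_ge0// invr_ge0 exprn_ge0.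
 apply: nat_esum_le => [k|N]; first by rewrite mulr_ge0// invr_ge0 exprn_ge0.
 by rewrite -mulr_sumr ler_wpM2l// sum_inv_sq.
have iS : P.-integrable setT (fun w => (\sum_(0 <= k <oo) (U k w)%:E)%E).
 apply/integrableP; split.
  by apply: ge0_emeasurable_sum => // k w _ _; rewrite lee_fin.
 under eq_integral => w _.
  rewrite gee0_abs; last by apply: nneseries_ge0 => k _ _; rewrite lee_fin.
  over.
 exact: le_lt_trans IU (ltry _).
have := integrable_ae measurableT iS; apply: filterS => w fin; have {}fin := fin Logic.I.
apply: cvg_series_cvg_0; apply: nondecreasing_is_cvgn.
 by apply/nondecreasing_seqP => n; rewrite /series /= big_nat_recr//= lerDl.
exists (fine (\sum_(0 <= k <oo) (U k w)%:E)%E) => _ [n _ <-].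
rewrite -lee_fin fineK// /series /= -sumEFin.
by apply: nneseries_lim_ge => k _ _; rewrite lee_fin.
Qed.

Lemma pow_ratio {R : realType} (x : R) n : 0 <= x <= 1 -> (1 + x) ^+ n <= 1 + (2 ^+ n) * x.
move=> /andP[x0 x1]; suff : (1 + x) ^+ n <= 1 + (2 ^+ n - 1) * x.
 by move=> h; apply: (le_trans h); rewrite lerD2l ler_wpM2r// gerBl.
elim: n => [|n IH]; first by rewrite !expr0 subrr mul0r addr0.
have p1 : 1 <= 2 ^+ n :> R by rewrite exprn_ege1// ler1n.
have x10 : 0 <= 1 + x by rewrite addr_ge0.
rewrite exprS [2 ^+ n.+1]exprS; apply: (le_trans (ler_wpM2l x10 IH)).
set a := 2 ^+ n - 1; have a0 : 0 <= a by rewrite subr_ge0.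
have h2 : a * x * x <= a * x by rewrite ler_piMr// mulr_ge0.
have -> : (1 + x) * (1 + a * x) = 1 + x + a * x + a * x * x by ring.
have -> : 1 + (2 * 2 ^+ n - 1) * x = 1 + x + a * x + a * x by rewrite /a; ring.
by rewrite lerD2l.
Qed.

Section interpolation.
Context {R : realType}.
(** Sparse enough for the fluctuations to be summable, with ratios of
    successive values tending to [1]; a perfect square, seen as [n] blocks of
    length [n]. *)
Definition horizon (k : nat) : nat := ((k + 5) ^ 16)%N.

Lemma horizon_gt0 k : (0 < horizon k)%N. by rewrite expn_gt0 addnS. Qed.
Lemma horizon_ge k : (k <= horizon k)%N.
by rewrite (leq_trans (leq_addr 5 k))// -{1}[(k + 5)%N]expn1 leq_pexp2l// addnS. Qed.

Lemma cvg_div_horizon (c : R) : (fun k => c / (horizon k)%:R) @ \oo --> (0 : R).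
apply/cvgrPdist_le => e e0; exists (Num.truncn (`|c| / e)).+1 => // k /= kk'.
have T0 : 0 < (horizon k)%:R :> R by rewrite ltr0n horizon_gt0.
rewrite sub0r normrN normrM normfV (gtr0_norm T0) ler_pdivrMr// [leRHS]mulrC -ler_pdivrMr//.
apply: (le_trans (ltW (truncnS_gt _))); rewrite ler_nat (leq_trans kk')// horizon_ge//.
Qed.

Lemma horizon_ratio (e : R) : 0 < e -> exists K, forall k, (K <= k)%N ->
 (horizon k.+1)%:R <= (1 + e) * (horizon k)%:R.
move=> e0; exists (Num.truncn (2 ^+ 16 / e)) => k Kk.
have y0 : 0 < (k + 5)%:R :> R by rewrite ltr0n addnS.
have ky : 2 ^+ 16 / e <= (k + 5)%:R.
 apply: (le_trans (ltW (truncnS_gt _))); rewrite ler_nat.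
 by rewrite (leq_ltn_trans Kk)// addnS ltnS leq_addr.
rewrite /horizon !natrX (_ : (k.+1 + 5)%:R = (k + 5)%:R * (1 + (k + 5)%:R^-1) :> R); last first.
 by rewrite mulrDr mulr1 mulfV ?gt_eqF// natr1.
rewrite exprMn mulrC ler_wpM2r ?exprn_ge0//.
pose x : R := (k + 5)%:R^-1.
have x1 : 0 <= x <= 1 by rewrite invr_ge0 ler0n invf_le1// ler1n addnS.
apply: (le_trans (pow_ratio 16 x1)); rewrite lerD2l.
by rewrite ler_pdivrMr// mulrC -ler_pdivrMr.
Qed.

(** Monotonicity of [g] in time controls it between successive horizons, whose
    ratio tends to [1]. *)
Lemma horizon_interpolation (g : R -> R) (F : R) :
 (forall s t, 0 <= s -> s <= t -> g s <= g t) -> (forall t, 0 <= t -> 0 <= g t) -> 0 <= F ->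
 (fun k => g (horizon k)%:R / (horizon k)%:R) @ \oo --> F ->
 t^-1 * g t @[t --> +oo] --> F.
move=> gm g0 F0 gF; apply/cvgrPdist_le => eta eta0.
pose e := Num.min 1 (eta / (F + 3)).
have e0 : 0 < e by rewrite lt_min ltr01 divr_gt0// ltr_wpDl.
have e1 : e <= 1 by rewrite ge_min lexx.
have eE : e * (F + 3) <= eta by rewrite -ler_pdivlMr ?ltr_wpDl// ge_min lexx orbT.
have [K1 _ hK1] : \forall k \near \oo, `|F - g (horizon k)%:R / (horizon k)%:R| <= e.
 by move/cvgrPdist_le : gF; apply.
have [K2 hK2] := horizon_ratio e0.
pose K := maxn K1 K2.
near=> t.
have tK : (horizon K)%:R <= t by near: t; apply: nbhs_pinfty_ge; exact: num_real.
have [k Kk /andP[kt tk]] : exists2 k, (K <= k)%N & (horizon k)%:R <= t < (horizon k.+1)%:R.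
 have exP : exists n, (K <= n)%N && ((horizon n)%:R <= t) by exists K; rewrite leqnn.
 have bnd n : (K <= n)%N && ((horizon n)%:R <= t) -> (n <= (Num.truncn t).+1)%N.
  move=> /andP[_ nt]; have : (n%:R : R) < (Num.truncn t).+1%:R.
   apply: le_lt_trans (truncnS_gt _); apply: le_trans nt; rewrite ler_nat; exact: horizon_ge.
  by rewrite ltr_nat => /ltnW.
 case: (ex_maxnP exP bnd) => n /andP[Kn nt] nmax; exists n => //.
 rewrite nt/= ltNge; apply/negP => h; have := nmax n.+1.
 by rewrite h andbT (leq_trans Kn)// => /(_ isT); rewrite ltnn.
have Tk0 j : 0 < (horizon j)%:R :> R by rewrite ltr0n horizon_gt0.
have t0 : 0 < t by exact: lt_le_trans kt.
have rk := hK2 k (leq_trans (leq_maxr _ _) Kk).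
have := hK1 k (leq_trans (leq_maxl _ _) Kk).
have := hK1 k.+1 (leq_trans (leq_maxl _ _) (leqW Kk)).
rewrite !ler_norml => /andP[a1 a2] /andP[b1 b2].
have up : t^-1 * g t <= (F + e) * (1 + e).
 apply: (via ((horizon k)%:R^-1 * g (horizon k.+1)%:R)).
  apply: ler_pM; rewrite ?invr_ge0 ?(ltW t0) ?g0 ?(ltW t0)//.
   by rewrite lef_pV2 ?posrE.
  by apply: gm; rewrite ltW.
 have -> : (horizon k)%:R^-1 * g (horizon k.+1)%:R =
   (g (horizon k.+1)%:R / (horizon k.+1)%:R) * ((horizon k.+1)%:R / (horizon k)%:R).
  by field; rewrite !gt_eqF.
 apply: ler_pM.
 - by rewrite divr_ge0 ?g0.
 - by rewrite divr_ge0.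
 - by lra.
 - by rewrite ler_pdivrMr.
have lo : (F - e) * (1 - e) <= t^-1 * g t.
 apply: (via ((horizon k.+1)%:R^-1 * g (horizon k)%:R)); last first.
  apply: ler_pM; rewrite ?invr_ge0 ?g0//.
   by rewrite lef_pV2 ?posrE// ltW.
  exact: gm.
 have -> : (horizon k.+1)%:R^-1 * g (horizon k)%:R =
   (g (horizon k)%:R / (horizon k)%:R) * ((horizon k)%:R / (horizon k.+1)%:R).
  by field; rewrite !gt_eqF.
 have q1 : 1 - e <= (horizon k)%:R / (horizon k.+1)%:R.
  rewrite ler_pdivlMr//; have : (1 - e) * (horizon k.+1)%:R <= (1 - e) * ((1 + e) * (horizon k)%:R).
   by rewrite ler_wpM2l// subr_ge0.
  move=> h; apply: (le_trans h); rewrite mulrA ler_piMl//.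
  have : 0 <= e * e by rewrite mulr_ge0// ltW.
  lra.
 have x0 : 0 <= g (horizon k)%:R / (horizon k)%:R by rewrite divr_ge0 ?g0.
 apply: (via ((g (horizon k)%:R / (horizon k)%:R) * (1 - e))).
  by rewrite ler_wpM2r ?subr_ge0//; lra.
 by rewrite ler_wpM2l.
have ee : 0 <= e * e by rewrite mulr_ge0// ltW.
have ee1 : e * e <= e by rewrite ler_piMl// ltW.
have eF : 0 <= e * F by rewrite mulr_ge0// ltW.
rewrite mulrDr in eE; rewrite mulrDr mulrDl in up; rewrite mulrBr mulrBl in lo.
apply/andP; split; lra.
Unshelve. all: by end_near.
Qed.
End interpolation.

Lemma near_decay {R : realType} (r : nat -> R) (C e : R) : (forall k, r k <= k.+1%:R ^- 2) ->
 0 <= C -> 0 < e -> \forall k \near \oo, C * r k <= e.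
move=> r1 C0 e0; exists (Num.truncn (C / e)) => // k /= kk.
have h1 : C * k.+1%:R^-1 <= e.
 rewrite ler_pdivrMr// [leRHS]mulrC -ler_pdivrMr//; apply: (le_trans (ltW (truncnS_gt _))).
 by rewrite ler_nat ltnS.
apply: le_trans h1; rewrite ler_wpM2l//; apply: (le_trans (r1 k)).
by rewrite lef_pV2 ?posrE ?exprn_gt0// ler_eXnr// ler1n.
Qed.

(** * Existence of the free energy *)

Lemma E_abs {R : realType} (J : int -> R) delta E (F : (nat -> int) -> R) : walk_law J delta E -> nice F ->
 `|E F| <= E (fun e => `|F e|).
move=> WL nF; have nA := nice_norm nF; rewrite ler_norml -(EN WL nA); apply/andP; split.
 by apply: (Ele WL (nice_opp nA) nF) => e; rewrite lerNl -normrN ler_norm.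
by apply: (Ele WL nF nA) => e; exact: ler_norm.
Qed.

Lemma ln_le_sqrt {R : realType} (x : R) : 0 < x -> ln x <= 2 * Num.sqrt x.
move=> x0; have s0 : 0 < Num.sqrt x by rewrite sqrtr_gt0.
have -> : ln x = ln (Num.sqrt x ^+ 2) by rewrite sqr_sqrtr// ltW.
rewrite lnXn// -[leLHS]mulr_natl ler_pM2l//.
have := @le_ln1Dx R (Num.sqrt x - 1); rewrite (_ : 1 + (Num.sqrt x - 1) = Num.sqrt x); last by ring.
move=> h; apply: (le_trans (h _)); lra.
Qed.

Section free_energy_existence.
Context {d1 d2 : measure_display} {O1 : measurableType d1} {O2 : measurableType d2} {R : realType}.
Variables (P1 : probability O1 R) (P2 : probability O2 R) (W1 : R -> O1 -> int) (W2 : R -> O2 -> int).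
Variables (J : int -> R) (p : R -> int -> R) (rho beta a cL gamma Cg : R).
Hypotheses (hW1 : ctrw P1 J W1) (hW2 : ctrw P2 J W2) (HE : heat J p) (rho01 : 0 <= rho <= 1 / 2)
 (beta0 : 0 < beta) (a0 : 0 < a) (cL0 : 0 < cL) (plink : link_bound p a cL) (ag : a * gamma = 1)
 (Cg0 : 0 < Cg).
Hypothesis glogJ : forall l, 1 <= l ->
 (\esum_x (glog l x * J x)%:E <= (Cg * l `^ (- gamma))%:E)%E.

Let rho1 : 0 <= rho <= 1.
by case/andP: rho01 => -> /= ?; lra. Qed.
Let rho0 : 0 <= rho. by case/andP: rho01. Qed.
Definition mesh_z (H : nat) : R := expR (beta * H%:R^-1) - 1.
Definition ln_Phi (H d : nat) (e : nat -> int) : R := ln (Phi p rho H%:R^-1 (mesh_z H) d 0 e).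
Local Notation EE H := (Ex P2 W2 (rho * H%:R^-1)).

Definition mesh_limit (Hs : nat -> nat) (F : R) :=
 (fun k => EE (Hs k) (ln_Phi (Hs k) (horizon k * Hs k)) / (horizon k)%:R) @ \oo --> F.

Let h0 H : (0 < H)%N -> 0 < H%:R^-1 :> R. by move=> H0; rewrite invr_gt0 ltr0n. Qed.
Let s0 H : 0 <= rho * H%:R^-1. by rewrite mulr_ge0// invr_ge0. Qed.
Let WL H : walk_law J (rho * H%:R^-1) (EE H).
exact: grid_walk_law hW2 (s0 H). Qed.

Lemma mesh_z_gt0 H : (0 < H)%N -> 0 < mesh_z H.
by move=> H0; rewrite subr_gt0 expR_gt1 mulr_gt0// h0. Qed.

Lemma mesh_z_bounds H : (0 < H)%N -> beta <= mesh_z H * H%:R <= beta * expR beta.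
move=> H0; have HR : 0 < H%:R :> R by rewrite ltr0n.
have hH : H%:R^-1 * H%:R = 1 :> R by rewrite mulVf// gt_eqF.
apply/andP; split.
 have := expR_ge1Dx (beta * H%:R^-1) => h1.
 apply: (via (beta * H%:R^-1 * H%:R)); first by rewrite -mulrA hH mulr1.
 by rewrite ler_wpM2r// /mesh_z; lra.
have x0 : 0 <= beta * H%:R^-1 by rewrite mulr_ge0// ltW// h0.
have xb : beta * H%:R^-1 <= beta by rewrite ler_piMr ?(ltW beta0)// invf_le1// ler1n.
have e1 : 1 <= expR (beta * H%:R^-1) by have := expR_ge1Dx (beta * H%:R^-1); lra.
have := expR_lip xb (ltW beta0 : 0 <= beta); rewrite expR0 subr0 (ger0_norm x0) ger0_norm ?subr_ge0//.
move=> h1; apply: (le_trans (ler_wpM2r (ltW HR) h1)).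
by rewrite -!mulrA hH mulr1 mulrC.
Qed.

Let Phi1 H d i e : (0 < H)%N -> 1 <= Phi p rho H%:R^-1 (mesh_z H) d i e.
by move=> H0; apply: (Phi_ge1 HE rho01 (h0 H0) (mesh_z_gt0 H0)). Qed.

Let nPhi H d : (0 < H)%N -> nice (ln_Phi H d).
move=> H0; apply: nice_ln => [|e]; last exact: Phi1.
exact: (Phi_nice HE rho01 (h0 H0) (mesh_z_gt0 H0)).
Qed.

Let ln_Phi_ge0 H d e : (0 < H)%N -> 0 <= ln_Phi H d e.
by move=> H0; rewrite ln_ge0// Phi1. Qed.

Lemma concentration : exists2 K : R, 0 < K & exists A : nat -> nat -> R,
 forall H n m, (0 < H)%N -> (4 < n)%N -> (0 < m)%N ->
  EE H (fun e => `|ln_Phi H (m * (n * H)) e - m%:R * A n H|)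
   <= K * (m%:R * Num.sqrt n%:R + n%:R * Num.sqrt m%:R).
pose Bt : R := beta * expR beta; have Bt0 : 0 < Bt by rewrite mulr_gt0 ?expR_gt0.
pose K0 : R := `|ln (1 + beta^-1) - ln cL|.
pose K : R := K0 + 7 * a + 4 * Bt + 4 * Cg + 2 * Bt.
have K00 : 0 <= K0 by rewrite /K0.
have [a7 B4 C4] : [/\ 0 <= 7 * a, 0 <= 4 * Bt & 0 <= 4 * Cg] by split; rewrite mulr_ge0// ltW.
have Kgt : 0 < K by rewrite /K; lra.
exists K => //.
exists (fun n H => EE H (block_log p rho (mesh_z H) H n)) => H n m H0 n4 m0.
have c := block_concentration HE rho01 H0 n4 (mesh_z_gt0 H0) a0 cL0 beta0 (mesh_z_bounds H0) plink (WL H) ag Cg0 glogJ m0.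
apply: le_trans c _.
have n1 : 1 <= n%:R :> R by rewrite ler1n (leq_trans _ n4).
have m1 : 1 <= m%:R :> R by rewrite ler1n.
set sn : R := Num.sqrt n%:R; set sm : R := Num.sqrt m%:R.
have sn1 : 1 <= sn by have := ler_wsqrtr n1; rewrite sqrtr1.
have sm1 : 1 <= sm by have := ler_wsqrtr m1; rewrite sqrtr1.
have lc : `|link_cost a cL beta n| <= (K0 + 7 * a) * sn.
 rewrite /link_cost -!addrA addrA; apply: (le_trans (ler_normD _ _)); rewrite -/K0.
 have l1 : ln (2 * n%:R) <= 3 * sn.
  have := @ln_le_sqrt R (2 * n%:R) ltac:(lra); rewrite sqrtrM// -/sn => h; apply: (le_trans h).
  rewrite mulrA ler_wpM2r//; first by lra.
  have : Num.sqrt 2 ^+ 2 <= (3 / 2) ^+ 2 :> R by rewrite sqr_sqrtr//; lra.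
  rewrite ler_sqr ?nnegrE ?sqrtr_ge0//; lra.
 have l2 : ln n%:R <= 2 * sn by apply: ln_le_sqrt; lra.
 have p1 : 0 <= a * ln (2 * n%:R) + 2 * a * ln n%:R.
  by rewrite addr_ge0// !mulr_ge0 ?(ltW a0)// ln_ge0//; lra.
 rewrite (ger0_norm p1).
 have q1 := ler_wpM2l (ltW a0) l1; have q2 := ler_wpM2l (ltW a0) l2.
 have q3 : K0 <= K0 * sn by rewrite ler_peMr.
 rewrite [X in _ <= X]mulrDl; lra.
have m0R : 0 <= m%:R :> R by [].
have n0R : 0 <= n%:R :> R by [].
have t1 : m%:R * (`|link_cost a cL beta n| + 4 * Bt + 4 * Cg) <= (K0 + 7 * a + 4 * Bt + 4 * Cg) * (m%:R * sn).
 rewrite [leRHS]mulrCA; apply: ler_wpM2l => //.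
 have := ler_wpM2l (_ : 0 <= 4 * Bt + 4 * Cg) sn1 => /(_ ltac:(lra)); rewrite !mulrDl mulr1; lra.
have t2 : n%:R * Bt * (1 + sm) <= 2 * Bt * (n%:R * sm).
 have := ler_wpM2l (_ : 0 <= n%:R * Bt) sm1 => /(_ ltac:(rewrite mulr_ge0// ltW//)).
 rewrite mulrDr mulr1; have -> : 2 * Bt * (n%:R * sm) = n%:R * Bt * sm + n%:R * Bt * sm by ring.
 lra.
have t3 : 0 <= (K0 + 7 * a + 4 * Bt + 4 * Cg) * (n%:R * sm).
 by rewrite !mulr_ge0// ?sqrtr_ge0//; lra.
have t4 : 0 <= 2 * Bt * (m%:R * sn) by rewrite !mulr_ge0// ?sqrtr_ge0// ltW.
rewrite -/Bt /K -/sn -/sm; move: t1 t2 t3 t4.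
set u := m%:R * sn; set v := n%:R * sm; set k1 := K0 + 7 * a + 4 * Bt + 4 * Cg.
move=> t1 t2 t3 t4; have -> : (k1 + 2 * Bt) * (u + v) = k1 * u + k1 * v + 2 * Bt * u + 2 * Bt * v by ring.
lra.
Qed.

Definition mesh_cst (T : nat) : R := beta + beta * expR (beta * T%:R) * (2 * T%:R).

(* the error of the mesh, as an integrable random variable of the environment *)
Lemma partition_error H T : (0 < H)%N -> (0 < T)%N -> exists U : O2 -> R,
 [/\ measurable_fun setT U, exists M : R, forall w, 0 <= U w <= M,
   \int[P2]_w U w <= mesh_cst T / H%:R &
   exists N, [/\ measurable N, P2 N = 1%E & forall w, N w ->
   `|ln (partition_function P1 (X_ W1 rho) (Y_ W2 rho ^~ w) beta T%:R)
    - ln_Phi H (T * H) (eps W2 (rho * H%:R^-1) w)| <= U w]].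
move=> H0 T0; have [B [mB B0 EB [N [mN PN NB]]]] := partition_mesh hW1 hW2 HE rho1 beta0 H0 T0.
pose c := beta * expR (beta * T%:R) * H%:R^-1.
have c0 : 0 <= c by rewrite !mulr_ge0 ?expR_ge0 ?(ltW (h0 H0))// ltW.
have bh : 0 <= beta * H%:R^-1 by rewrite mulr_ge0 ?(ltW (h0 H0))// ltW.
have iB : P2.-integrable setT (EFin \o B).
 by apply: (@bounded_integrable _ _ _ P2 _ (T * H)%:R) => // w; case/andP: (B0 w) => ? ?; rewrite ger0_norm.
pose U w := (beta * H%:R^-1 + c * T%:R) + c * B w; exists U; split.
- by apply: measurable_funD => //; apply: measurable_funM.
- exists ((beta * H%:R^-1 + c * T%:R) + c * (T * H)%:R) => w; have /andP[b1 b2] := B0 w.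
 apply/andP; split; last by rewrite /U lerD2l ler_wpM2l.
 by apply: addr_ge0; [apply: addr_ge0 => //; apply: mulr_ge0|apply: mulr_ge0].
- have icB : P2.-integrable setT (EFin \o (fun w => c * B w)).
  by apply: eq_integrable (integrableZl measurableT c iB).
 have ic : P2.-integrable setT (EFin \o (cst (beta * H%:R^-1 + c * T%:R) : O2 -> R)).
  by apply: (@bounded_integrable _ _ _ P2 _ `|beta * H%:R^-1 + c * T%:R|).
 rewrite /U RintegralD// RintegralZl// Rintegral_cst//= probability_setT mulr1.
 apply: (le_trans (lerD (lexx _) (ler_wpM2l c0 EB))).
 by apply: eq_ler; rewrite /c /mesh_cst; ring.
- exists N; split => // w Nw; apply: (le_trans (NB w Nw)).
 by apply: eq_ler; rewrite /U /c; ring.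
Qed.

Let ln_Phi_meas H d : (0 < H)%N -> measurable_fun setT (fun w => ln_Phi H d (eps W2 (rho * H%:R^-1) w)).
by move=> H0; have [[n cF] _] := nPhi d H0; exact: measurable_cyl hW2 (s0 H) _ _ cF. Qed.

(** Both grids approximate the same continuous partition function. *)
Lemma mesh_compare H H' T : (0 < H)%N -> (0 < H')%N -> (0 < T)%N ->
 EE H (ln_Phi H (T * H)) <= EE H' (ln_Phi H' (T * H')) + mesh_cst T / H%:R + mesh_cst T / H'%:R.
move=> H0 H'0 T0.
have [U [mU [M UM] EU [N [mN PN NU]]]] := partition_error H0 T0.
have [U' [mU' [M' UM'] EU' [N' [mN' PN' NU']]]] := partition_error H'0 T0.
have [_ [K FK]] := nPhi (T * H) H0; have [_ [K' FK']] := nPhi (T * H') H'0.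
pose f w := ln_Phi H (T * H) (eps W2 (rho * H%:R^-1) w).
pose f' w := ln_Phi H' (T * H') (eps W2 (rho * H'%:R^-1) w).
have iU : P2.-integrable setT (EFin \o U).
 by apply: (@bounded_integrable _ _ _ P2 _ M) => // w; case/andP: (UM w) => ? ?; rewrite ger0_norm.
have iU' : P2.-integrable setT (EFin \o U').
 by apply: (@bounded_integrable _ _ _ P2 _ M') => // w; case/andP: (UM' w) => ? ?; rewrite ger0_norm.
have if' : P2.-integrable setT (EFin \o f').
 by apply: (@bounded_integrable _ _ _ P2 _ K'); [exact: ln_Phi_meas|move=> w; exact: FK'].
pose G w := f' w + (U w + U' w).
have mG : measurable_fun setT G by apply: measurable_funD; [exact: ln_Phi_meas|exact: measurable_funD].
have GK w : `|G w| <= K' + (M + M').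
 apply: (le_trans (ler_normD _ _)); apply: lerD; first exact: FK'.
 have /andP[? ?] := UM w; have /andP[? ?] := UM' w; by rewrite ger0_norm ?addr_ge0// lerD.
have NN : P2 (N `&` N') = 1%E.
 by rewrite -PN'; apply: (ae_eq_measure mN PN) => //; [exact: measurableI|rewrite setIAC setIid setIC].
have fb w : 0 <= f w <= K.
 by rewrite ln_Phi_ge0//=; apply: le_trans (FK _); exact: ler_norm.
have := integral_ae_upper (measurableI _ _ mN mN') NN mG GK fb.
have -> : (\int[P2]_w (f w)%:E = (EE H (ln_Phi H (T * H)))%:E)%E.
 by have [[n cF] bF] := nPhi (T * H) H0; exact: (Ex_fin hW2 (s0 H) cF bF).
have -> : \int[P2]_w G w = EE H' (ln_Phi H' (T * H')) + (\int[P2]_w U w + \int[P2]_w U' w).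
 rewrite RintegralD//; last first.
  apply: (@bounded_integrable _ _ _ P2 _ (M + M')); first exact: measurable_funD.
  by move=> w; have /andP[? ?] := UM w; have /andP[? ?] := UM' w; rewrite ger0_norm ?addr_ge0// lerD.
 by rewrite RintegralD.
rewrite lee_fin => h.
have hh : forall w, (N `&` N') w -> f w <= G w.
 move=> w [Nw N'w]; have := NU w Nw; have := NU' w N'w.
 by rewrite !ler_norml /G /f /f'; lra.
have := h hh; lra.
Qed.

Lemma horizon_sq k : horizon k = ((k + 5) ^ 8 * (k + 5) ^ 8)%N.
by rewrite -expnD. Qed.

(** A time [n * m] can be cut into blocks of length [n] or of length [m];
    comparing the two shows that the block means are Cauchy, with errors
    summable along the horizons and any mesh. For each horizon the mesh is
    taken so fine that the error of [partition_mesh] is summable too; Markov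
    and Borel-Cantelli then give the almost sure limit along the horizons, and
    interpolation the full limit. *)
Lemma free_energy_exists : exists F (Hs : nat -> nat),
 [/\ is_free_energy P1 P2 W1 W2 rho beta F, 0 <= F, forall k, (k < Hs k)%N &
  mesh_limit Hs F].
have [K K0 [A hA]] := concentration.
pose N k := ((k + 5) ^ 8)%N.
pose r k : R := (k + 5)%:R ^- 4.
have y0 k : 0 < (k + 5)%:R :> R by rewrite ltr0n addnS.
have r0 k : 0 < r k by rewrite invr_gt0 exprn_gt0.
have r1 k : r k <= k.+1%:R ^- 2.
 rewrite /r lef_pV2 ?posrE ?exprn_gt0// -!natrX ler_nat.
 apply: (@leq_trans ((k + 5) ^ 2)); first by rewrite leq_exp2r// addnS ltnS leq_addr.
 by rewrite leq_pexp2l// addnS.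
have r_decr k j : (k <= j)%N -> r j <= r k.
 by move=> kj; rewrite /r lef_pV2 ?posrE ?exprn_gt0// ler_pXn2r ?nnegrE ?(ltW (y0 _))// ler_nat leq_add2r.
have N4 k : (4 < N k)%N.
 apply: (@leq_trans (k + 5)); first by rewrite leq_addl.
 by rewrite -{1}[(k + 5)%N]expn1 leq_pexp2l// addnS.
have N0 k : (0 < N k)%N by exact: leq_trans (N4 k).
have NR k : 0 < (N k)%:R :> R by rewrite ltr0n.
have sN k : Num.sqrt (N k)%:R = (N k)%:R * r k :> R.
 have -> : (N k)%:R = ((k + 5)%:R ^+ 4) ^+ 2 :> R by rewrite /N natrX -exprM.
 rewrite sqrtr_sqr ger0_norm ?exprn_ge0 ?(ltW (y0 k))// /r expr2 mulfK//.
have T0 k : (0 < horizon k)%N := horizon_gt0 k.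
have TR k : 1 <= (horizon k)%:R :> R by rewrite ler1n.
have TE k : (horizon k)%:R = (N k)%:R * (N k)%:R :> R by rewrite horizon_sq natrM.
pose f k H := A (N k) H / (N k)%:R.
have dev k H : (0 < H)%N ->
  EE H (fun e => `|ln_Phi H (horizon k * H) e - (horizon k)%:R * f k H|) <= (horizon k)%:R * (2 * K * r k).
 move=> H0; have := hA H (N k) (N k) H0 (N4 k) (N0 k).
 rewrite mulnA -horizon_sq sN => h1.
 have -> : (horizon k)%:R * f k H = (N k)%:R * A (N k) H.
  by rewrite TE /f -mulrA; congr (_ * _); rewrite mulrCA divff ?mulr1// gt_eqF.
 by apply: (le_trans h1); rewrite le_eqVlt TE; apply/orP; left; apply/eqP; ring.
have mean H d c : (0 < H)%N -> `|EE H (ln_Phi H d) - c| <= EE H (fun e => `|ln_Phi H d e - c|).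
 move=> H0; have nP := nPhi d H0.
 have -> : EE H (ln_Phi H d) - c = EE H (fun e => ln_Phi H d e - c).
  by rewrite (EB (WL H) nP (nice_cst c)) (EC (WL H)).
 by apply: (E_abs (WL H)); apply: nice_add => //; exact: nice_cst.
(* The time [N k * N j] is cut in both ways. *)
have cross k j H : (0 < H)%N -> `|f k H - f j H| <= 2 * K * (r k + r j).
 move=> H0.
 have h1 := le_trans (mean H _ _ H0) (hA H (N k) (N j) H0 (N4 k) (N0 j)).
 have h2 := le_trans (mean H _ _ H0) (hA H (N j) (N k) H0 (N4 j) (N0 k)).
 have e1 : (N k * (N j * H) = N j * (N k * H))%N by rewrite mulnCA.
 rewrite e1 in h2; rewrite !sN in h1 h2.
 have -> : f k H - f j H = ((N j)%:R * A (N k) H - (N k)%:R * A (N j) H) / ((N k)%:R * (N j)%:R).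
  by rewrite /f; field; rewrite !gt_eqF.
 rewrite normrM (ger0_norm (x := _^-1)) ?invr_ge0 ?mulr_ge0// ler_pdivrMr ?mulr_gt0//.
 set x := EE H _ in h1 h2.
 have -> : (N j)%:R * A (N k) H - (N k)%:R * A (N j) H = (x - (N k)%:R * A (N j) H) - (x - (N j)%:R * A (N k) H) by ring.
 apply: (le_trans (ler_normB _ _)); apply: (le_trans (lerD h2 h1)).
 by apply: eq_ler; ring.
(* Fine enough for the mesh error at horizon [k] to be at most [r k]. *)
pose b k := (Num.truncn (mesh_cst (horizon k) / r k)).+1.
pose Hs k := (\sum_(0 <= i < k.+1) (b i).+1)%N.
have HsS k : Hs k.+1 = (Hs k + (b k.+1).+1)%N by rewrite /Hs big_nat_recr.
have Hs0 : Hs 0%N = (b 0%N).+1 by rewrite /Hs big_nat1.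
have kH k : (k < Hs k)%N.
 elim: k => [|k IH]; first by rewrite Hs0.
 by rewrite HsS addnS ltnS; apply: (leq_trans IH); exact: leq_addr.
have Hpos k : (0 < Hs k)%N by exact: leq_ltn_trans (kH k).
have Hmono k j : (k <= j)%N -> (Hs k <= Hs j)%N.
 elim: j => [|j IH]; first by rewrite leqn0 => /eqP ->.
 by rewrite leq_eqVlt => /predU1P[->//|kj]; rewrite HsS (leq_trans (IH kj))// leq_addr.
have bH k : (b k <= Hs k)%N by case: k => [|k]; rewrite ?Hs0 ?HsS ?leqnSn// addnS leqW// leq_addl.
have Cr k j : (k <= j)%N -> mesh_cst (horizon k) / (Hs j)%:R <= r k.
 move=> kj; have HR : 0 < (Hs j)%:R :> R by rewrite ltr0n.
 rewrite ler_pdivrMr// mulrC -ler_pdivrMr//; apply: (le_trans (ltW (truncnS_gt _))).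
 by rewrite ler_nat (leq_trans (bH k))// Hmono.
clearbody Hs.
pose x k := EE (Hs k) (ln_Phi (Hs k) (horizon k * Hs k)) / (horizon k)%:R.
have xf k H : (0 < H)%N -> `|EE H (ln_Phi H (horizon k * H)) / (horizon k)%:R - f k H| <= 2 * K * r k.
 move=> H0; have t0 : 0 < (horizon k)%:R :> R by exact: lt_le_trans (TR k).
 have := le_trans (mean H (horizon k * H)%N ((horizon k)%:R * f k H) H0) (dev k H H0).
 have -> : EE H (ln_Phi H (horizon k * H)) / (horizon k)%:R - f k H =
   (EE H (ln_Phi H (horizon k * H)) - (horizon k)%:R * f k H) / (horizon k)%:R.
  by field; rewrite gt_eqF.
 by move=> h; rewrite normrM (ger0_norm (x := _^-1)) ?invr_ge0// ler_pdivrMr// [leRHS]mulrC.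
have Kr k : 0 <= K * r k by rewrite mulr_ge0// ltW.
have xx k j : (k <= j)%N -> `|x k - x j| <= (2 + 8 * K) * r k.
 move=> kj; set y := EE (Hs j) (ln_Phi (Hs j) (horizon k * Hs j)) / (horizon k)%:R.
 have t0 : 0 < (horizon k)%:R :> R by exact: lt_le_trans (TR k).
 have i1 : `|x k - y| <= 2 * r k.
  have m1 := mesh_compare (Hpos k) (Hpos j) (T0 k); have m2 := mesh_compare (Hpos j) (Hpos k) (T0 k).
  have c1 := Cr k k (leqnn k); have c2 := Cr k j kj.
  rewrite /x /y -mulrBl normrM (ger0_norm (x := _^-1)) ?invr_ge0// ler_pdivrMr//.
  have : 2 * r k * 1 <= 2 * r k * (horizon k)%:R by rewrite ler_wpM2l// mulr_ge0// ltW.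
  by rewrite ler_norml; lra.
 have i2 := xf k (Hs j) (Hpos j); have i3 := cross k j (Hs j) (Hpos j); have i4 := xf j (Hs j) (Hpos j).
 have rj : K * r j <= K * r k by rewrite ler_wpM2l ?(ltW K0)// r_decr.
 rewrite -/y -/(x j) in i2 i4; have := Kr k.
 move: i1 i2 i3 i4; rewrite !ler_norml mulrDr mulrDl -!mulrA; lra.
have K8 : 0 <= 2 + 8 * K by lra.
have Kr8 k : 0 <= (2 + 8 * K) * r k by rewrite mulr_ge0// ltW.
have [F hF] := cauchy_limit Kr8 xx.
have xF : x @ \oo --> F.
 apply/cvgrPdist_le => e e0.
 apply: filterS (near_decay r1 K8 e0) => k ke; rewrite distrC.
 exact: le_trans (hF k) ke.
have F0 : 0 <= F.
 rewrite -(cvg_lim (@Rhausdorff R) xF); apply: limr_ge; first by apply/cvg_ex; exists F.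
 apply: nearW => k; apply: divr_ge0 => //; apply: (E_ge0 (WL _) (nPhi _ (Hpos k))) => e.
 exact: ln_Phi_ge0.
exists F, Hs; split => //.
have /choice [U hU] : forall k, exists U : O2 -> R,
 [/\ measurable_fun setT U, exists M : R, forall w, 0 <= U w <= M,
   \int[P2]_w U w <= mesh_cst (horizon k) / (Hs k)%:R &
   exists N, [/\ measurable N, P2 N = 1%E & forall w, N w ->
   `|ln (partition_function P1 (X_ W1 rho) (Y_ W2 rho ^~ w) beta (horizon k)%:R)
    - ln_Phi (Hs k) (horizon k * Hs k) (eps W2 (rho * (Hs k)%:R^-1) w)| <= U w]].
 by move=> k; exact: partition_error (Hpos k) (T0 k).
pose D k (e : nat -> int) := `|ln_Phi (Hs k) (horizon k * Hs k) e - (horizon k)%:R * f k (Hs k)|.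
pose V k w := (horizon k)%:R^-1 * (U k w + D k (eps W2 (rho * (Hs k)%:R^-1) w)).
have nD k : nice (D k).
 by apply: nice_norm; apply: nice_add; [exact: nPhi|exact: nice_cst].
have mD k : measurable_fun setT (fun w => D k (eps W2 (rho * (Hs k)%:R^-1) w)).
 by have [[n cF] _] := nD k; exact: measurable_cyl hW2 (s0 _) _ _ cF.
have mV k : measurable_fun setT (V k).
 by apply: measurable_funM => //; apply: measurable_funD => //; case: (hU k).
have U0 k w : 0 <= U k w by have [_ [M UM] _ _] := hU k; case/andP: (UM w).
have V0 k w : 0 <= V k w by rewrite mulr_ge0 ?invr_ge0// addr_ge0 ?normr_ge0.
have EV k : (\int[P2]_w (V k w)%:E <= ((1 + 2 * K) * k.+1%:R ^- 2)%:E)%E.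
 have [mU [M UM] EU _] := hU k.
 have t0 : 0 < (horizon k)%:R :> R by exact: lt_le_trans (TR k).
 rewrite /V; under eq_integral do rewrite EFinM EFinD.
 rewrite ge0_integralZl ?lee_fin ?invr_ge0//; last 2 first.
 - by apply/measurable_EFinP; apply: measurable_funD.
 - by move=> w _; rewrite -EFinD lee_fin addr_ge0 ?normr_ge0.
 rewrite ge0_integralD//; last 4 first.
 - by move=> w _; rewrite lee_fin.
 - by apply/measurable_EFinP.
 - by move=> w _; rewrite lee_fin normr_ge0.
 - by apply/measurable_EFinP.
 have -> : (\int[P2]_w (U k w)%:E = (\int[P2]_w U k w)%:E)%E.
  by apply: (@integral_fineK _ _ _ P2 _ M) => // w; case/andP: (UM w) => ? ?; rewrite ger0_norm.
 have -> : (\int[P2]_w (D k (eps W2 (rho * (Hs k)%:R^-1) w))%:E = (EE (Hs k) (D k))%:E)%E.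
  by have [[n cF] bF] := nD k; exact: (Ex_fin hW2 (s0 _) cF bF).
 rewrite -EFinD -EFinM lee_fin [leLHS]mulrC ler_pdivrMr//.
 have d1' := dev k (Hs k) (Hpos k); rewrite -/(D k) in d1'.
 have c1 := Cr k k (leqnn k).
 apply: (via (r k * (horizon k)%:R + (horizon k)%:R * (2 * K * r k))).
  apply: lerD => //; apply: (le_trans EU); apply: (le_trans c1).
  by rewrite ler_peMr// ltW.
 have -> : r k * (horizon k)%:R + (horizon k)%:R * (2 * K * r k) = (1 + 2 * K) * r k * (horizon k)%:R by ring.
 by rewrite ler_wpM2r// ler_wpM2l//; lra.
have aeV := ae_cvg0 mV V0 EV.
have aeN : {ae P2, forall w k, `|ln (partition_function P1 (X_ W1 rho) (Y_ W2 rho ^~ w) beta (horizon k)%:R)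
    - ln_Phi (Hs k) (horizon k * Hs k) (eps W2 (rho * (Hs k)%:R^-1) w)| <= U k w}.
 apply/ae_foralln => k; have [_ _ _ [Nk [mN PN hN]]] := hU k.
 exists (~` Nk); split; first exact: measurableC.
  by apply: (etrans (probability_setC P2 mN)); rewrite PN subee.
 by move=> w /= nw Nw; apply: nw; exact: hN.
apply: filterS2 aeV aeN => w Vw Nw.
pose g t := ln (partition_function P1 (X_ W1 rho) (Y_ W2 rho ^~ w) beta t).
have Zb t : 0 <= t -> 1 <= partition_function P1 (X_ W1 rho) (Y_ W2 rho ^~ w) beta t.
 by move=> t0; have [] := partition_bounds P1 (X_ W1 rho) (Y_ W2 rho ^~ w) (ltW beta0) t0.
apply: (@horizon_interpolation R g F).
- move=> s t s0' st; rewrite /g ler_ln ?posrE ?(lt_le_trans ltr01) ?Zb ?(le_trans s0' st)//.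
 by apply: partition_mono => //; exact: ltW.
- by move=> t t0; rewrite /g ln_ge0// Zb.
- exact: F0.
apply/cvgrPdist_le => e e0.
have e2 : 0 < e / 2 by rewrite divr_gt0.
have V2 : \forall k \near \oo, V k w <= e / 2.
 move/cvgrPdist_le : Vw => /(_ _ e2); apply: filterS => k.
 by rewrite sub0r normrN ger0_norm.
pose C := 2 + 10 * K; have C0 : 0 < C by rewrite /C; lra.
have R2 : \forall k \near \oo, C * r k <= e / 2 := near_decay r1 (ltW C0) e2.
apply: filterS2 V2 R2 => k V2 R2.
have t0 : 0 < (horizon k)%:R :> R by exact: lt_le_trans (TR k).
have i1 := hF k; have i2 := xf k (Hs k) (Hpos k); rewrite -/(x k) in i2.
have i3 : `|g (horizon k)%:R / (horizon k)%:R - f k (Hs k)| <= V k w.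
 have -> : g (horizon k)%:R / (horizon k)%:R - f k (Hs k) =
   (horizon k)%:R^-1 * (g (horizon k)%:R - (horizon k)%:R * f k (Hs k)).
  by field; rewrite gt_eqF.
 rewrite normrM (ger0_norm (x := _^-1)) ?invr_ge0// /V ler_wpM2l ?invr_ge0//.
 have := Nw k; set l := ln_Phi _ _ _ => h1.
 have -> : g (horizon k)%:R - (horizon k)%:R * f k (Hs k) = (g (horizon k)%:R - l) + (l - (horizon k)%:R * f k (Hs k)) by ring.
 by apply: (le_trans (ler_normD _ _)); rewrite lerD2r.
move: i1 i2 i3 R2; rewrite /C !ler_norml !mulrDl -!mulrA; lra.
Qed.
End free_energy_existence.

(** * The tilted Green function *)

Section riemann_sums.
Context {R : realType}.
Variable f : R -> R.
Hypotheses (f0 : forall t, 0 <= t -> 0 <= f t)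
 (f_decr : forall s t, 0 <= s -> s <= t -> f t <= f s).
Local Notation mu := (@lebesgue_measure R).
Local Notation half_line := (`[0%R, +oo[%classic : set R).

Let cell (h : R) (j : nat) : set R := `[j%:R * h, j.+1%:R * h[%classic.

Let len h i : 0 < h -> mu (cell h i) = h%:E.
move=> h0; rewrite lebesgue_measure_itv/= lte_fin ltr_pM2r// ltr_nat ltnSn.
by rewrite -EFinD -natr1 mulrDl mul1r addrAC subrr add0r.
Qed.

Let cell_sub h i : 0 < h -> cell h i `<=` half_line.
move=> h0 t; rewrite /cell /= !in_itv/= andbT => /andP[h1 _]; apply: le_trans h1.
by rewrite mulr_ge0// ltW.
Qed.

Let cell_disj h i j t : 0 < h -> cell h i t -> cell h j t -> i = j.
move=> h0; rewrite /cell /= !in_itv/= => /andP[i1 i2] /andP[j1 j2].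
have a1 : i%:R < j.+1%:R :> R by rewrite -(ltr_pM2r h0) (le_lt_trans i1).
have a2 : j%:R < i.+1%:R :> R by rewrite -(ltr_pM2r h0) (le_lt_trans j1).
by move: a1 a2; rewrite !ltr_nat !ltnS => a1 a2; apply/eqP; rewrite eqn_leq a1 a2.
Qed.

Let mind h i : measurable_fun half_line (fun t => (\1_(cell h i) t)%:E : \bar R).
by apply/measurable_EFinP; apply: measurable_indic; exact: measurable_itv. Qed.

Let int_cell h i c : 0 < h -> 0 <= c -> (\int[mu]_(t in half_line) (c%:E * (\1_(cell h i) t)%:E) = (c * h)%:E)%E.
move=> h0 c0; rewrite ge0_integralZl//; last exact: mind.
rewrite integral_indic//; last exact: measurable_itv.
have -> : cell h i `&` half_line = cell h i by apply: setIidl; exact: cell_sub.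
by rewrite EFinM; congr (_ * _)%E; exact: len.
Qed.

Lemma riemann_lower (h : R) n : 0 < h ->
 ((h * \sum_(0 <= j < n) f (j.+1%:R * h))%:E <= \int[mu]_(t in half_line) (f t)%:E)%E.
move=> h0; have fj0 j : 0 <= f (j.+1%:R * h) by apply: f0; rewrite mulr_ge0// ltW.
apply: (via (\int[mu]_(t in half_line) \sum_(0 <= j < n) ((f (j.+1%:R * h))%:E * (\1_(cell h j) t)%:E))%E).
 rewrite ge0_integral_sum//; last 2 first.
 - by move=> j; apply: measurable_funeM; exact: mind.
 - by move=> j t _; rewrite -EFinM lee_fin mulr_ge0.
 rewrite (eq_bigr (fun j => (f (j.+1%:R * h) * h)%:E)); last by move=> j _; rewrite int_cell.
 by rewrite sumEFin -mulr_suml mulrC.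
apply: integral_mono => t t0.
 by apply: sume_ge0 => j _; rewrite -EFinM lee_fin mulr_ge0.
have tt : 0 <= t by move: t0; rewrite /= in_itv/= andbT.
under eq_bigr do rewrite -EFinM.
rewrite sumEFin lee_fin.
case: (pselect (exists2 j, (j < n)%N & cell h j t)) => [[j jn jt]|no]; last first.
 rewrite big1_seq ?f0// => j; rewrite mem_index_iota => /= jn.
 by rewrite indicE memNset ?mulr0// => jt; apply: no; exists j.
rewrite (@bigD1_seq _ _ _ _ _ j)//= ?mem_index_iota ?iota_uniq//.
rewrite [X in _ + X]big1 ?addr0 => [|i ij]; last first.
 rewrite indicE memNset ?mulr0// => it; move/eqP: ij; apply; exact: cell_disj it jt.
rewrite indicE mem_set// mulr1; apply: f_decr => //.
by move: jt; rewrite /cell /= in_itv/= => /andP[_ /ltW].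
Qed.

Lemma riemann_upper (h S : R) : 0 < h -> (forall n, h * \sum_(0 <= j < n) f (j%:R * h) <= S) ->
 (\int[mu]_(t in half_line) (f t)%:E <= S%:E)%E.
move=> h0 hS; have fj0 j : 0 <= f (j%:R * h) by apply: f0; rewrite mulr_ge0// ltW.
apply: (via (\int[mu]_(t in half_line) \sum_(0 <= j <oo) ((f (j%:R * h))%:E * (\1_(cell h j) t)%:E))%E).
 apply: integral_mono => t; rewrite /= in_itv/= andbT => t0; first by rewrite lee_fin f0.
 pose j := Num.truncn (t / h).
 have jt : cell h j t.
  rewrite /cell /= in_itv/= -ler_pdivlMr// -ltr_pdivrMr// truncn_le divr_ge0 ?(ltW h0)//=.
  exact: truncnS_gt.
 apply: (via (\sum_(0 <= i < j.+1) ((f (i%:R * h))%:E * (\1_(cell h i) t)%:E))%E); last first.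
  by apply: nneseries_lim_ge => i _ _; rewrite -EFinM lee_fin mulr_ge0.
 rewrite big_nat_recr//= -[leLHS]add0e; apply: leeD.
  by apply: sume_ge0 => i _; rewrite -EFinM lee_fin mulr_ge0.
 rewrite indicE mem_set// mule1 lee_fin; apply: f_decr; first by rewrite mulr_ge0// ltW.
 by move: jt; rewrite /cell /= in_itv/= => /andP[].
rewrite integral_nneseries//; last 2 first.
- by move=> j; apply: measurable_funeM; exact: mind.
- by move=> j t _; rewrite -EFinM lee_fin mulr_ge0.
under eq_eseriesr do rewrite int_cell//.
rewrite nneseries_esumT => [|j]; last by rewrite lee_fin mulr_ge0// ltW.
apply: nat_esum_le => [j|n]; first by rewrite mulr_ge0// ltW.
by rewrite -mulr_suml mulrC.
Qed.
End riemann_sums.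

Section green_function.
Context {R : realType}.
Variables (J : int -> R) (p : R -> int -> R) (gamma cJ : R).
Hypotheses (HE : heat J p) (g01 : 0 < gamma < 1) (cJ0 : 0 < cJ)
 (Jlo : forall x : int, cJ * (1 + (absz x)%:R) `^ (- (1 + gamma)) <= J x).

Definition damped (phi t : R) : R := p t 0 * expR (- (phi * t)).
Definition green (phi : R) : R := fine (\int[@lebesgue_measure R]_(t in `[0%R, +oo[) (damped phi t)%:E)%E.
Definition green_sum (phi h : R) (n : nat) : R := h * \sum_(0 <= j < n) damped phi (j.+1%:R * h).

Lemma green_sum0 phi h : green_sum phi h 0 = 0.
by rewrite /green_sum big_geq// mulr0. Qed.

Lemma damped_ge0 phi t : 0 <= t -> 0 <= damped phi t.
by move=> t0; rewrite mulr_ge0 ?expR_ge0// (heat_ge0 HE). Qed.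

Lemma damped_decr phi s t : 0 <= phi -> 0 <= s -> s <= t -> damped phi t <= damped phi s.
move=> phi0 s0 st; apply: ler_pM; rewrite ?expR_ge0 ?(heat_ge0 HE) ?(le_trans s0)//.
 exact: (heat_decr HE).
by rewrite ler_expR lerN2 ler_wpM2l.
Qed.

Lemma damped_le phi phi' t : 0 <= t -> phi <= phi' -> damped phi' t <= damped phi t.
by move=> t0 pp; rewrite /damped ler_wpM2l ?(heat_ge0 HE)// ler_expR lerN2 ler_wpM2r.
Qed.

Lemma damped0 phi : damped phi 0 = 1.
by rewrite /damped mulr0 oppr0 expR0 mulr1 (heat_init HE) eqxx. Qed.

Let upper_from phi h S : 0 <= phi -> 0 < h -> (forall n, green_sum phi h n <= S) ->
 (\int[@lebesgue_measure R]_(t in `[0%R, +oo[) (damped phi t)%:E <= (h + S)%:E)%E.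
move=> phi0 h0 hS; apply: (riemann_upper (damped_ge0 phi) _ h0) => [s t|[|n]]; first exact: damped_decr.
 rewrite big_geq// mulr0; apply: addr_ge0; first exact: ltW.
 by have := hS 0%N; rewrite green_sum0.
rewrite big_nat_recl//= mul0r damped0 mulrDr mulr1 lerD2l; exact: hS.
Qed.

Lemma green_sum_bounded phi : 0 <= phi -> exists S, forall n, green_sum phi 1 n <= S.
move=> phi0; have [C C0 hC] := heat_upper HE g01 cJ0 Jlo.
have [g0 g1] := andP g01.
pose al := gamma^-1 - 1; have al0 : 0 < al by rewrite /al subr_gt0 invf_gt1.
have one1 : 0 < (1 : R) <= 1 by rewrite ltr01 lexx.
exists (C * (2 `^ (1 + al) / al * X 1 0 `^ (- al))) => n.
rewrite /green_sum mul1r; apply: (via (C * \sum_(0 <= j < n) 1 * X 1 j `^ (- (1 + al)))).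
 rewrite mulr_sumr; apply: ler_sum => j _; rewrite mulr1.
 apply: (via (p j.+1%:R 0)).
  by rewrite /damped ler_piMr ?(heat_ge0 HE)// expR_le1 oppr_le0 mulr_ge0.
 apply: (le_trans (heat_decr HE (ler0n _ j) _)); first by rewrite ler_nat.
 rewrite mul1r; apply: (le_trans (hC _ (ler0n _ j))); rewrite /X mulr1.
 by have -> : 1 + al = gamma^-1 by rewrite /al; ring.
by rewrite ler_wpM2l ?(ltW C0)//; apply: pow_sum_high.
Qed.

Lemma greenE phi : 0 <= phi ->
 (\int[@lebesgue_measure R]_(t in `[0%R, +oo[) (damped phi t)%:E = (green phi)%:E)%E.
move=> phi0; have [S hS] := green_sum_bounded phi0.
rewrite /green fineK// ge0_fin_numE.
 exact: le_lt_trans (upper_from phi0 ltr01 hS) (ltry _).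
by apply: integral_ge0 => t; rewrite /= in_itv/= andbT lee_fin => t0; exact: damped_ge0.
Qed.

Lemma green_sum_le phi h n : 0 <= phi -> 0 < h -> green_sum phi h n <= green phi.
move=> phi0 h0; rewrite -lee_fin -greenE//; apply: riemann_lower => //; first exact: damped_ge0.
by move=> s t; exact: damped_decr.
Qed.

Lemma green_le phi h S : 0 <= phi -> 0 < h -> (forall n, green_sum phi h n <= S) -> green phi <= h + S.
by move=> phi0 h0 hS; rewrite -lee_fin -greenE//; exact: upper_from. Qed.

Lemma green_sum_ge phi h c : 0 <= phi -> 0 < h -> c < green phi - h -> exists n, c < green_sum phi h n.
move=> phi0 h0 cg; apply: contrapT => no.
have : green phi <= h + c.
 by apply: green_le => // n; rewrite leNgt; apply/negP => cn; apply: no; exists n.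
lra.
Qed.

Lemma green_sum_mono phi h n m : 0 < h -> (n <= m)%N -> green_sum phi h n <= green_sum phi h m.
move=> h0 nm; rewrite /green_sum ler_wpM2l ?(ltW h0)// [leRHS](cat_nat n)//= lerDl.
by apply: sumr_ge0 => j _; apply: damped_ge0; rewrite mulr_ge0// ltW.
Qed.

Lemma green_decr phi phi' : 0 <= phi -> phi <= phi' -> green phi' <= green phi.
move=> phi0 pp; rewrite -lee_fin -!greenE ?(le_trans phi0)//; apply: integral_mono => t.
 by rewrite /= in_itv/= andbT lee_fin => t0; exact: damped_ge0.
by rewrite /= in_itv/= andbT lee_fin => t0; exact: damped_le.
Qed.

Lemma green_gt0 phi : 0 <= phi -> 0 < green phi.
move=> phi0; apply: lt_le_trans (green_sum_le 1 phi0 ltr01).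
by rewrite /green_sum big_nat1 !mul1r mulr_gt0 ?expR_gt0// (heat_diag_gt0 HE).
Qed.

(** On a bounded initial interval the two integrands differ by a definite
    amount, and Riemann sums transfer the gap. *)
Lemma green_strict phi phi' : 0 <= phi -> phi < phi' -> green phi' < green phi.
move=> phi0 pp; have phi'0 : 0 <= phi' by rewrite (le_trans phi0)// ltW.
pose c := p 2 0 * (expR (- (phi' * 2)) * (phi' - phi)).
have c0 : 0 < c.
 by rewrite !mulr_gt0 ?expR_gt0 ?subr_gt0// (heat_diag_gt0 HE).
suff : green phi' <= green phi - c / 2 by lra.
pose H := (Num.truncn (2 / c)).+1; pose h : R := H%:R^-1.
have h0 : 0 < h by rewrite invr_gt0 ltr0n.
have hc : h <= c / 2.
 rewrite /h -[c / 2]invrK lef_pV2 ?posrE ?invr_gt0 ?divr_gt0// invf_div.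
 by rewrite ltW// truncnS_gt.
have hH : H%:R * h = 1 by rewrite mulfV// pnatr_eq0.
suff S n : green_sum phi' h n <= green phi - c.
 have := green_le phi'0 h0 S; lra.
apply: (le_trans (green_sum_mono phi' h0 (leq_maxl n (2 * H)))); set m := maxn _ _.
suff : green_sum phi' h m + c <= green_sum phi h m by have := green_sum_le m phi0 h0; lra.
have diff t : 0 <= t -> t <= 2 -> 1 <= t -> c <= damped phi t - damped phi' t.
 move=> t0 t2 t1; rewrite /damped -mulrBr /c; apply: ler_pM.
 - by rewrite (heat_ge0 HE).
 - by rewrite mulr_ge0 ?expR_ge0// subr_ge0 ltW.
 - exact: (heat_decr HE).
 have e1 := expR_ge1Dx ((phi' - phi) * t).
 have e2 : expR (- (phi * t)) = expR (- (phi' * t)) * expR ((phi' - phi) * t).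
  by rewrite -expRD; congr expR; ring.
 rewrite e2; have -> : expR (- (phi' * t)) * expR ((phi' - phi) * t) - expR (- (phi' * t)) =
  expR (- (phi' * t)) * (expR ((phi' - phi) * t) - 1) by ring.
 apply: ler_pM; rewrite ?expR_ge0 ?subr_ge0 ?(ltW pp)//.
  by rewrite ler_expR lerN2 ler_wpM2l.
 have : (phi' - phi) * 1 <= (phi' - phi) * t by rewrite ler_wpM2l// subr_ge0 ltW.
 lra.
rewrite -lerBrDl /green_sum -mulrBr -sumrB.
have d0 j : 0 <= damped phi (j.+1%:R * h) - damped phi' (j.+1%:R * h).
 by rewrite subr_ge0 damped_le ?(ltW pp)// mulr_ge0// ltW.
rewrite (cat_nat H)//=; last by rewrite (leq_trans _ (leq_maxr _ _))// leq_pmull.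
rewrite [X in _ + X](@big_cat_nat _ _ _ (2 * H)%N)//=; last 2 first.
- by rewrite leq_pmull.
- exact: leq_maxr.
have mid : H%:R * c <= \sum_(H <= j < 2 * H) (damped phi (j.+1%:R * h) - damped phi' (j.+1%:R * h)).
 have -> : H%:R * c = \sum_(H <= j < 2 * H) c.
  by rewrite sumr_const_nat mul2n -addnn addnK mulr_natl.
 apply: ler_sum_nat => j /andP[Hj j2]; apply: diff.
 - by rewrite mulr_ge0// ltW.
 - have -> : 2 = (2 * H)%:R * h by rewrite natrM -mulrA hH mulr1.
  by rewrite ler_wpM2r ?(ltW h0)// ler_nat.
 - apply: (via (H%:R * h)); first by rewrite hH.
  by rewrite ler_wpM2r ?(ltW h0)// ler_nat (leq_trans Hj).
have s1 : 0 <= \sum_(0 <= j < H) (damped phi (j.+1%:R * h) - damped phi' (j.+1%:R * h)) by apply: sumr_ge0.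
have s2 : 0 <= \sum_(2 * H <= j < m) (damped phi (j.+1%:R * h) - damped phi' (j.+1%:R * h)) by apply: sumr_ge0.
have := ler_wpM2l (ltW h0) mid; rewrite mulrA [h * _]mulrC hH mul1r => h1; apply: (le_trans h1).
by rewrite ler_wpM2l ?(ltW h0)//; lra.
Qed.

Lemma green_near0 c : c < green 0 -> exists2 phi, 0 < phi & c < green phi.
move=> cg; pose e := (green 0 - c) / 2; have e0 : 0 < e by rewrite /e divr_gt0// subr_gt0.
have [n hn] := green_sum_ge (phi := 0) (h := e) (c := c) (lexx 0) e0 ltac:(rewrite /e; lra).
set S := green_sum 0 e n in hn.
have S0 : 0 <= S by rewrite -(green_sum0 0 e) /S green_sum_mono.
case: (leP c 0) => c0.
 by exists 1 => //; apply: le_lt_trans c0 _; exact: green_gt0.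
have Sgt : 0 < S by exact: lt_trans hn.
pose phi := (S - c) / (2 * S * (n.+1%:R * e)).
have ne0 : 0 < n.+1%:R * e by rewrite mulr_gt0.
have phi0 : 0 < phi.
 by apply: divr_gt0; rewrite ?subr_gt0//; apply: mulr_gt0 => //; apply: mulr_gt0.
exists phi => //; apply: lt_le_trans (green_sum_le n (ltW phi0) e0).
have d1 : S * (1 - phi * (n.+1%:R * e)) <= green_sum phi e n.
 rewrite /S /green_sum mulrAC -mulrA ler_wpM2l ?(ltW e0)// mulr_sumr; apply: ler_sum_nat => j /andP[_ jn].
 rewrite /damped mul0r oppr0 expR0 mulr1 mulrC; apply: ler_wpM2l.
  by apply: (heat_ge0 HE); apply: mulr_ge0 => //; exact: ltW.
 apply: le_trans (expR_ge1Dx _); rewrite lerD2l lerN2 ler_wpM2l ?(ltW phi0)// ler_wpM2r ?(ltW e0)//.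
 by rewrite ler_nat ltnW.
apply: lt_le_trans d1; have -> : S * (1 - phi * (n.+1%:R * e)) = S - (S - c) / 2.
 by rewrite /phi; field; rewrite !gt_eqF.
lra.
Qed.
End green_function.

(** * Bounds on the free energy *)

Section lower_bound.
Context {R : realType}.
Variables (J : int -> R) (p : R -> int -> R) (gamma cJ CJ : R).
Hypotheses (HE : heat J p) (g23 : 2 / 3 < gamma < 1) (cJ0 : 0 < cJ)
 (Jlo : forall x : int, cJ * (1 + (absz x)%:R) `^ (- (1 + gamma)) <= J x)
 (Jhi : forall x : int, J x <= CJ * (1 + (absz x)%:R) `^ (- (1 + gamma))).

Let g01 : 0 < gamma < 1.
by case/andP: g23 => h1 ->; rewrite andbT; lra. Qed.
Let al : R := gamma^-1 - 1.

Lemma Phi_mono_z rho h z z' d i e : 0 <= rho <= 1 -> 0 < h -> 0 <= z -> z <= z' ->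
 Phi p rho h z d i e <= Phi p rho h z' d i e.
move=> rho1 h0 z0 zz; move: i; apply: (@backward_ind _ d) => i IH; rewrite !PhiE lerD2l.
have z'0 := le_trans z0 zz.
apply: ler_pM => //.
 apply: sumr_ge0 => j _; rewrite mulr_ge0 ?(link_ge0 HE rho1 h0)//.
 exact: (paths_ge0 HE rho1 h0 z0).
by apply: ler_sum_nat => j ij; rewrite ler_wpM2l ?(link_ge0 HE rho1 h0)// IH.
Qed.

Definition tilted (phi h z : R) (n : nat) : R := z * damped p phi (n%:R * h).

(** The kernel at the grid is normalised by its own total mass. This replaces
    the tuning of [phi] to [h] by that of [z], which is why no continuity in
    [phi] is needed. *)
Lemma tilted_rkernel (zlo zhi : R) : 0 < zlo -> 0 < zhi -> exists Ck ck : R, [/\ 0 < Ck, 0 < ck &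
 forall (phi b : R) (H : nat), 0 < phi -> (0 < H)%N -> 0 < b <= zhi -> zlo * green p phi <= 1 ->
  (exists n, b^-1 <= green_sum p phi H%:R^-1 n) ->
  exists z, [/\ zlo * H%:R^-1 <= z, z <= b * H%:R^-1 & rkernel al Ck ck H%:R^-1 phi (tilted phi H%:R^-1 z)]].
move=> zlo0 zhi0; have [Cp Cp0 hCp] := heat_upper HE g01 cJ0 Jlo.
have [cp cp0 hcp] := heat_lower HE g01 cJ0 Jlo Jhi.
exists (zhi * Cp), (zlo * cp); split; rewrite ?mulr_gt0// => phi b H phi0 H0 /andP[b0 bz] zG [n0 hn0].
set h : R := H%:R^-1 in hn0 *; have h0 : 0 < h by rewrite invr_gt0 ltr0n.
have aE : 1 + al = gamma^-1 by rewrite /al; ring.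
pose s n := \sum_(0 <= j < n) damped p phi (j.+1%:R * h).
have sE n : h * s n = green_sum p phi h n by [].
have t0 j : 0 <= j.+1%:R * h by rewrite mulr_ge0// ltW.
have sG n : h * s n <= green p phi by rewrite sE; exact: (green_sum_le HE g01 cJ0 Jlo _ (ltW phi0) h0).
have G0 : 0 < green p phi by exact: (green_gt0 HE g01 cJ0 Jlo (ltW phi0)).
pose A := [set y | exists n, y = s n].
have ubA : ubound A (green p phi / h) by move=> _ [n ->]; rewrite ler_pdivlMr// mulrC.
have supA : has_sup A by split; [exists (s 0%N); exists 0%N|exists (green p phi / h)].
pose S := sup A.
have sS n : s n <= S by apply: ub_le_sup; [case: supA|exists n].
have SG : S <= green p phi / h by apply: ge_sup; [case: supA|].
have Sb : (b * h)^-1 <= S.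
 by apply: le_trans (sS n0); rewrite invfM ler_pdivrMr// [leRHS]mulrC sE.
have S0 : 0 < S by apply: lt_le_trans Sb; rewrite invr_gt0 mulr_gt0.
pose z := S^-1; have z0 : 0 < z by rewrite invr_gt0.
have zl : zlo * h <= z.
 rewrite -[zlo * h]invrK lef_pV2 ?posrE ?invr_gt0 ?mulr_gt0//; apply: (le_trans SG).
 rewrite [leRHS]invfM; apply: ler_wpM2r; first by rewrite invr_ge0 ltW.
 by rewrite -[leRHS]mul1r ler_pdivlMr// mulrC.
have zh : z <= b * h by rewrite -[b * h]invrK lef_pV2 ?posrE ?invr_gt0 ?mulr_gt0.
exists z; split => //.
have kE j : tilted phi h z j.+1 = z * (p (j.+1%:R * h) 0 * expR (- (phi * (j.+1%:R * h)))) by [].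
have XE' j : X h j = 1 + j%:R * h by [].
split.
- move=> j; rewrite kE aE.
 apply: (via (z * p (j.+1%:R * h) 0)).
  rewrite ler_wpM2l ?(ltW z0)//; apply: ler_piMr; first exact: (heat_ge0 HE).
  by rewrite expR_le1 oppr_le0 mulr_ge0// ltW.
 have -> : zhi * Cp * (h * X h j.+1 `^ (- gamma^-1)) = (zhi * h) * (Cp * X h j.+1 `^ (- gamma^-1)) by ring.
 apply: ler_pM; rewrite ?(ltW z0) ?(heat_ge0 HE)//; last by rewrite XE'; exact: hCp.
 by apply: (le_trans zh); rewrite ler_pM2r.
- move=> j; rewrite kE aE.
 have -> : zlo * cp * (h * X h j.+1 `^ (- gamma^-1) * expR (- (phi * (j.+1%:R * h)))) =
   (zlo * h) * ((cp * X h j.+1 `^ (- gamma^-1)) * expR (- (phi * (j.+1%:R * h)))) by ring.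
 apply: ler_pM => //.
 + by rewrite mulr_ge0 ?(ltW zlo0)// ltW.
 + by rewrite !mulr_ge0 ?powR_ge0 ?expR_ge0 ?(ltW cp0).
 + by rewrite ler_wpM2r ?expR_ge0// XE'; exact: hcp.
- move=> j; rewrite !kE.
 pose u := j.+1%:R * h / 2; pose v := j.+3%:R * h / 2.
 have u0 : 0 <= u by rewrite divr_ge0.
 have v0 : 0 <= v by rewrite divr_ge0.
 have e1 : u + v = j.+2%:R * h by rewrite /u /v -[j.+3%:R]natr1 -[j.+2%:R]natr1; field.
 have e2 : u + u = j.+1%:R * h by rewrite /u; field.
 have e3 : v + v = j.+3%:R * h by rewrite /v; field.
 rewrite -e1 -e2 -e3; have L := heat_logconv HE u0 v0.
 have eE : expR (- (phi * (u + v))) ^+ 2 = expR (- (phi * (u + u))) * expR (- (phi * (v + v))).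
  by rewrite expr2 -!expRD; congr expR; ring.
 rewrite !exprMn eE.
 have -> : z * (p (u + u) 0 * expR (- (phi * (u + u)))) * (z * (p (v + v) 0 * expR (- (phi * (v + v))))) =
   z ^+ 2 * ((p (u + u) 0 * p (v + v) 0) * (expR (- (phi * (u + u))) * expR (- (phi * (v + v))))) by ring.
 by rewrite ler_wpM2l ?exprn_ge0 ?(ltW z0)// ler_wpM2r// mulr_ge0 ?expR_ge0.
- move=> N; under eq_bigr do rewrite kE.
 by rewrite -mulr_sumr -ler_pdivlMl// invrK mulr1; exact: sS.
- move=> e e0; have [_ [n ->] hn] := sup_adherent (mulr_gt0 e0 S0) supA.
 exists n; under eq_bigr do rewrite kE.
 rewrite -mulr_sumr -ler_pdivrMl// invrK mulrBr mulr1 mulrC; exact: ltW.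
- move=> j g; rewrite !kE.
 have -> : expR (- (phi * (g%:R * h))) * (z * (p (j.+1%:R * h) 0 * expR (- (phi * (j.+1%:R * h))))) =
  z * (p (j.+1%:R * h) 0 * expR (- (phi * ((j + g).+1%:R * h)))).
  have -> : expR (- (phi * ((j + g).+1%:R * h))) = expR (- (phi * (g%:R * h))) * expR (- (phi * (j.+1%:R * h))).
   by rewrite -expRD; congr expR; rewrite -addSn natrD; ring.
  by ring.
 rewrite ler_wpM2l ?(ltW z0)// ler_wpM2r ?expR_ge0//; apply: (heat_decr HE); first exact: t0.
 by rewrite ler_wpM2r ?(ltW h0)// ler_nat ltnS leq_addr.
Qed.

(** If [beta * G phi > 1] then, on fine grids, the normalising [z] is below
    [mesh_z beta], and the path sum increases with [z]. *)
Lemma free_energy_lower (b1 eps : R) : 0 < b1 -> 0 < eps <= 1 ->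
 exists2 rho_e : R, 0 < rho_e <= 1 / 4 &
 forall (d2 : measure_display) (O2 : measurableType d2) (P2 : probability O2 R) (W2 : R -> O2 -> int)
  (rho beta phi F : R) (Hs : nat -> nat),
 ctrw P2 J W2 -> 0 <= rho <= rho_e -> 0 < beta <= b1 -> 0 < phi <= 1 / 2 -> 1 < beta * green p phi ->
 (forall k, (k < Hs k)%N) ->
 mesh_limit P2 W2 p rho beta Hs F ->
 (1 - eps) * phi <= F.
move=> b10 eps01; have G0 := green_gt0 HE g01 cJ0 Jlo (lexx 0).
pose zlo := (green p 0)^-1; have zlo0 : 0 < zlo by rewrite invr_gt0.
have [Ck [ck [Ck0 ck0 hk]]] := tilted_rkernel zlo0 b10.
have [rho_e re [K hK]] := uniform_lower_bound HE g23 cJ0 Jlo Jhi Ck0 ck0 zlo0 eps01.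
exists rho_e => // d2 O2 P2 W2 rho beta phi F Hs hW2 rhoe /andP[beta0 betab] /andP[phi0 phi2] bG kH cF.
have rho0 : 0 <= rho by case/andP: rhoe.
have rho14 : rho <= 1 / 4 by case/andP: rhoe => _ h1; case/andP: re => _; exact: le_trans.
have rho12 : 0 <= rho <= 1 / 2 by rewrite rho0/=; lra.
have rho1 : 0 <= rho <= 1 by rewrite rho0/=; lra.
have gap : 0 < green p phi - beta^-1 by rewrite subr_gt0 -[beta^-1]mul1r ltr_pdivrMr// mulrC.
pose H0 := Num.truncn (green p phi - beta^-1)^-1.
have low k : (H0 <= k)%N -> (1 - eps) * phi - `|K| / (horizon k)%:R <=
  Ex P2 W2 (rho * (Hs k)%:R^-1) (ln_Phi p rho beta (Hs k) (horizon k * Hs k)) / (horizon k)%:R.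
 move=> Hk; set H := Hs k; have Hpos : (0 < H)%N by exact: leq_ltn_trans (kH k).
 have HR : 0 < H%:R :> R by rewrite ltr0n.
 have h0 : 0 < H%:R^-1 :> R by rewrite invr_gt0.
 have hgap : H%:R^-1 < green p phi - beta^-1.
  rewrite -[ltRHS]invrK ltf_pV2 ?posrE ?invr_gt0//; apply: (lt_le_trans (truncnS_gt _)).
  by rewrite ler_nat (leq_trans _ (kH k)).
 have [n hn] : exists n, beta^-1 < green_sum p phi H%:R^-1 n.
  by apply: (green_sum_ge HE g01 cJ0 Jlo (ltW phi0) h0); lra.
 have [z [zl zh rk]] : exists z, [/\ zlo * H%:R^-1 <= z, z <= beta * H%:R^-1 &
   rkernel al Ck ck H%:R^-1 phi (tilted phi H%:R^-1 z)].
  apply: hk => //; rewrite ?beta0//; last by exists n; exact: ltW.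
  by rewrite /zlo mulrC ler_pdivrMr// mul1r (green_decr HE g01 cJ0 Jlo (lexx 0) (ltW phi0)).
 have z0 : 0 < z by apply: lt_le_trans zl; rewrite mulr_gt0.
 have s0 : 0 <= rho * H%:R^-1 by rewrite mulr_ge0// ltW.
 have WL := grid_walk_law hW2 s0.
 have kkE m : kk H phi (tilted phi H%:R^-1 z) m.+1 = z * p (m.+1%:R * H%:R^-1) 0.
  by rewrite /kk /growth /tilted /damped -!mulrA -expRD addNr expR0 mulr1.
 have phi12 : 0 < phi <= 1 / 2 by rewrite phi0.
 have := hK rho H phi z _ _ rhoe Hpos phi12 rk zl kkE WL (horizon k * H)%N.
 rewrite natrM -[_ * H%:R * _]mulrA divff ?gt_eqF// mulr1 => lo.
 have zm : z <= mesh_z beta H.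
  apply: (le_trans zh); rewrite /mesh_z; have := expR_ge1Dx (beta * H%:R^-1); lra.
 have zm0 := lt_le_trans z0 zm.
 have T0 : 0 < (horizon k)%:R :> R by rewrite ltr0n horizon_gt0.
 have nA := nice_ln (Phi_nice HE rho12 h0 z0 (horizon k * H) 0) (Phi_ge1 HE rho12 h0 z0 _ _).
 have nB := nice_ln (Phi_nice HE rho12 h0 zm0 (horizon k * H) 0) (Phi_ge1 HE rho12 h0 zm0 _ _).
 have up : Ex P2 W2 (rho * H%:R^-1) (fun e => ln (Phi p rho H%:R^-1 z (horizon k * H) 0 e)) <=
   Ex P2 W2 (rho * H%:R^-1) (ln_Phi p rho beta H (horizon k * H)).
  apply: (Ele WL nA nB) => e; rewrite ler_ln ?posrE ?(lt_le_trans ltr01)// ?(Phi_ge1 HE rho12 h0)//.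
  exact: Phi_mono_z (ltW z0) zm.
 rewrite ler_pdivlMr// mulrBl divfK ?gt_eqF//; have := ler_norm K.
 by move: lo up; rewrite ?mulrA => lo up nK; apply: le_trans up; apply: le_trans lo; rewrite lerD2l lerN2.
have KT : (fun k => (1 - eps) * phi - `|K| / (horizon k)%:R) @ \oo --> (1 - eps) * phi.
 by rewrite -[X in _ --> X]subr0; apply: cvgB; [exact: cvg_cst|exact: cvg_div_horizon].
apply: (ler_cvg_to KT cF); exists H0 => // k /= Hk; exact: low.
Qed.
End lower_bound.

Lemma E_ln_le {R : realType} (J : int -> R) delta E (F : (nat -> int) -> R) : walk_law J delta E ->
 nice F -> (forall e, 1 <= F e) -> E (fun e => ln (F e)) <= ln (E F).
move=> WL nF F1; have m1 : 1 <= E F by rewrite -(EC WL 1); exact: (Ele WL (nice_cst 1) nF).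
have m0 : 0 < E F by exact: lt_le_trans m1.
apply: (via (E (fun e => (E F)^-1 * F e + (ln (E F) - 1)))).
 apply: (Ele WL (nice_ln nF F1)); first by apply: nice_add; [exact: nice_scale|exact: nice_cst].
 move=> e; have f0 : 0 < F e := lt_le_trans ltr01 (F1 e).
 have := @le_ln1Dx R ((E F)^-1 * F e - 1); rewrite (_ : 1 + _ = (E F)^-1 * F e); last by ring.
 rewrite lnM ?posrE ?invr_gt0// lnV ?posrE// => h.
 have := h ltac:(rewrite ltrBrDl subrr mulr_gt0 ?invr_gt0//); lra.
by rewrite (EL WL _ nF (nice_cst _)) (EC WL) mulVf ?gt_eqF//; lra.
Qed.

Lemma shifted_index i j d : (j < d - i.+1)%N ->
 (i < j + i.+1 < d)%N /\ (d - i = d - (j + i.+1) + j.+1)%N.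
lia. Qed.

Section upper_bound.
Context {R : realType}.
Variables (J : int -> R) (p : R -> int -> R) (gamma cJ : R).
Hypotheses (HE : heat J p) (g01 : 0 < gamma < 1) (cJ0 : 0 < cJ)
 (Jlo : forall x : int, cJ * (1 + (absz x)%:R) `^ (- (1 + gamma)) <= J x).

(** The exponential is a supersolution of the averaged recursion when the
    tilted kernel has mass less than [1]. *)
Lemma annealed_le (phi h z th : R) (d i : nat) : 0 <= phi -> 0 < h -> 0 <= z -> th < 1 ->
 (forall n, z * \sum_(0 <= j < n) damped p phi (j.+1%:R * h) <= th) ->
 volt (fun i j => z * p ((j - i)%:R * h) 0) (fun=> 1) d i <= (1 - th)^-1 * expR (phi * ((d - i)%:R * h)).
move=> phi0 h0 z0 th1 hth; have q0 : 0 < (1 - th)^-1 by rewrite invr_gt0 subr_gt0.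
move: i; apply: (@backward_ind _ d) => i IH; rewrite voltE.
set B := expR (phi * ((d - i)%:R * h)).
have B1 : 1 <= B by rewrite -expR0 ler_expR mulr_ge0// mulr_ge0// ltW.
apply: (via (1 + (1 - th)^-1 * B * (z * \sum_(0 <= j < d - i.+1) damped p phi (j.+1%:R * h)))).
 rewrite lerD2l -{1}[i.+1]add0n big_addn mulr_sumr mulr_sumr; apply: ler_sum_nat => j /andP[_ jd].
 have [jd' dE] := shifted_index jd.
 apply: (via (z * p ((j + i.+1 - i)%:R * h) 0 * ((1 - th)^-1 * expR (phi * ((d - (j + i.+1))%:R * h))))).
  apply: ler_wpM2l; last exact: IH.
  by apply: mulr_ge0 => //; apply: (heat_ge0 HE); apply: mulr_ge0 => //; exact: ltW.
 have -> : (j + i.+1 - i = j.+1)%N by rewrite addnS -addSn addnK.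
 rewrite /damped /B; have -> : (d - i)%:R = (d - (j + i.+1))%:R + j.+1%:R :> R.
  by rewrite -natrD dE.
 apply: eq_ler.
 have -> : expR (phi * (((d - (j + i.+1))%:R + j.+1%:R) * h)) =
   expR (phi * ((d - (j + i.+1))%:R * h)) * expR (phi * (j.+1%:R * h)) by rewrite -expRD; congr expR; ring.
 have ee : expR (phi * (j.+1%:R * h)) * expR (- (phi * (j.+1%:R * h))) = 1 by rewrite -expRD addrN expR0.
 set a := expR (phi * (j.+1%:R * h)) in ee *; set b := expR (- _) in ee *.
 transitivity (z * p (j.+1%:R * h) 0 * ((1 - th)^-1 * expR (phi * ((d - (j + i.+1))%:R * h))) * (a * b)).
  by rewrite ee mulr1.
 by ring.
have := ler_wpM2l (mulr_ge0 (ltW q0) (le_trans ler01 B1)) (hth (d - i.+1)%N).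
have e1 : (1 - th)^-1 * B * th = (1 - th)^-1 * B - B by field; rewrite subr_eq0 gt_eqF.
rewrite e1; lra.
Qed.

Lemma free_energy_upper (d2 : measure_display) (O2 : measurableType d2) (P2 : probability O2 R)
  (W2 : R -> O2 -> int) (rho beta phi F : R) (Hs : nat -> nat) :
 ctrw P2 J W2 -> 0 <= rho <= 1 / 2 -> 0 < beta -> 0 <= phi -> beta * green p phi < 1 ->
 (forall k, (k < Hs k)%N) ->
 mesh_limit P2 W2 p rho beta Hs F ->
 F <= phi.
move=> hW2 rho12 beta0 phi0 bG kH cF.
have rho0 : 0 <= rho by case/andP: rho12.
have rho1 : 0 <= rho <= 1 by case/andP: rho12 => -> /= ?; lra.
have G0 := green_gt0 HE g01 cJ0 Jlo phi0.
have bG0 : 0 < beta * green p phi by rewrite mulr_gt0.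
pose th := (1 + beta * green p phi) / 2.
have th1 : th < 1 by rewrite /th; lra.
pose qq := th / (beta * green p phi).
have q1 : 1 < qq by rewrite /qq ltr_pdivlMr// mul1r /th; lra.
have lq : 0 < ln qq by rewrite ln_gt0.
pose A := (1 - th)^-1; have A1 : 0 < A by rewrite invr_gt0 subr_gt0.
pose H0 := Num.truncn (beta / ln qq).
have up k : (H0 <= k)%N -> Ex P2 W2 (rho * (Hs k)%:R^-1) (ln_Phi p rho beta (Hs k) (horizon k * Hs k)) / (horizon k)%:R
  <= phi + `|ln A| / (horizon k)%:R.
 move=> Hk; set H := Hs k; have Hpos : (0 < H)%N by exact: leq_ltn_trans (kH k).
 have HR : 0 < H%:R :> R by rewrite ltr0n.
 have h0 : 0 < H%:R^-1 :> R by rewrite invr_gt0.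
 have z0 := mesh_z_gt0 beta0 Hpos.
 have s0 : 0 <= rho * H%:R^-1 by rewrite mulr_ge0// ltW.
 have WL := grid_walk_law hW2 s0.
 have T0 : 0 < (horizon k)%:R :> R by rewrite ltr0n horizon_gt0.
 set x := beta * H%:R^-1.
 have xq : expR x <= qq.
  rewrite -[leRHS]lnK ?posrE ?(lt_trans ltr01)// ler_expR /x ler_pdivrMr// mulrC -ler_pdivrMr//.
  by apply: (le_trans (ltW (truncnS_gt _))); rewrite ler_nat (leq_trans _ (kH k)).
 have zx : mesh_z beta H <= x * expR x.
  have := ler_wpM2l (expR_ge0 x) (expR_ge1Dx (- x)).
  rewrite -expRD addrN expR0 mulrDr mulr1 mulrN /mesh_z -/x [x * _]mulrC; lra.
 have hth n : mesh_z beta H * \sum_(0 <= j < n) damped p phi (j.+1%:R * H%:R^-1) <= th.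
  have gs := green_sum_le HE g01 cJ0 Jlo n phi0 h0.
  set S := \sum_(0 <= j < n) _; have S0 : 0 <= S.
   by apply: sumr_ge0 => j _; apply: (damped_ge0 HE); rewrite mulr_ge0// ltW.
  apply: (via (x * qq * S)).
   rewrite ler_wpM2r//; apply: (le_trans zx); rewrite ler_wpM2l// mulr_ge0 ?(ltW beta0)// ltW.
  have -> : x * qq * S = qq * beta * green_sum p phi H%:R^-1 n by rewrite /x /green_sum -/S; ring.
  apply: (via (qq * beta * green p phi)).
   by rewrite ler_wpM2l// mulr_ge0 ?(ltW beta0)// (le_trans ler01)// ltW.
  by rewrite -mulrA /qq divfK// gt_eqF.
 have nP := Phi_nice HE rho12 h0 z0 (horizon k * H) 0.
 have P1 := Phi_ge1 HE rho12 h0 z0 (horizon k * H) 0.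
 have f1 : forall i : nat, 0 <= (fun=> 1 : R) i by [].
 have EP := E_paths HE rho1 h0 (ltW z0) WL f1 (horizon k * H) 0.
 have V := annealed_le (horizon k * H) 0 phi0 h0 (ltW z0) th1 hth.
 rewrite -EP subn0 natrM -[_ * H%:R * _]mulrA divff ?gt_eqF// mulr1 in V.
 have J1 := E_ln_le WL nP P1.
 have m0 : 0 < Ex P2 W2 (rho * H%:R^-1) (Phi p rho H%:R^-1 (mesh_z beta H) (horizon k * H) 0).
  by apply: lt_le_trans ltr01 _; rewrite -[leLHS](EC WL); exact: (Ele WL (nice_cst 1) nP).
 have J2 : ln (Ex P2 W2 (rho * H%:R^-1) (Phi p rho H%:R^-1 (mesh_z beta H) (horizon k * H) 0)) <= ln A + phi * (horizon k)%:R.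
  rewrite -[phi * _ in leRHS]expRK -lnM ?posrE ?expR_gt0// ler_ln ?posrE ?mulr_gt0 ?expR_gt0//.
 rewrite ler_pdivrMr// mulrDl divfK ?gt_eqF//; have := ler_norm (ln A).
 move=> hA; rewrite /ln_Phi; apply: (le_trans J1); apply: (le_trans J2).
 rewrite addrC lerD2l; exact: hA.
have KT : (fun k => phi + `|ln A| / (horizon k)%:R) @ \oo --> phi.
 by rewrite -[X in _ --> X]addr0; apply: cvgD; [exact: cvg_cst|exact: cvg_div_horizon].
apply: (ler_cvg_to cF KT); exists H0 => // k /= Hk; exact: up.
Qed.
End upper_bound.

(** * Regularity of the kernel *)

Section kernel_bounds.
Context {R : realType}.
Variables (gamma : R) (J : int -> R).
Hypotheses (g01 : 0 < gamma < 1) (hJ : stable_kernel gamma J)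
 (hJtail : J x / `|x|%:~R `^ (- (1 + gamma)) @[x --> absz_infty] --> (1 : R)).

Lemma kernel_gt0 x : 0 < J x.
have [[phi [phi0 _ ->]] _ _] := hJ; apply: mulr_gt0; first by apply: phi0; rewrite ler0z.
by rewrite powR_gt0// addr_gt0// ?ltr01// ltr_wpDr// ler0z.
Qed.

Lemma kernel_sym x : J (- x) = J x.
by have [_ _ hd] := hJ; apply/eqP; rewrite eq_le !hd ?normrN. Qed.

Lemma kernel_tail : exists2 N : nat, (0 < N)%N & forall x : int, (N <= absz x)%N ->
 1 / 2 * (absz x)%:R `^ (- (1 + gamma)) <= J x <= 2 * (absz x)%:R `^ (- (1 + gamma)).
have half0 : 0 < 1 / 2 :> R by rewrite divr_gt0.
have FF : Filter absz_infty.
 apply: filter_from_filter; first by exists 0%N.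
 by move=> i j _ _; exists (maxn i j) => // x /=; rewrite geq_max => /andP[].
have /cvgrPdist_le hd := hJtail; have [N _ hN] := hd _ half0.
exists N.+1 => // x Nx; have := hN x (ltnW Nx); rewrite /= pmulrn -abszE.
have x0 : 0 < (absz x)%:R :> R by rewrite ltr0n (leq_trans _ Nx).
set w := _ `^ _; have w0 : 0 < w by rewrite powR_gt0.
rewrite ler_norml => /andP[h1 h2].
have h3 : 1 / 2 <= J x / w by lra.
have h4 : J x / w <= 2 by lra.
by move: h3 h4; rewrite ler_pdivlMr// ler_pdivrMr// => -> ->.
Qed.

(** The tail asymptotics outside a ball, positivity and monotonicity inside. *)
Lemma kernel_bounds : exists cJ CJ : R, [/\ 0 < cJ,
 forall x : int, cJ * (1 + (absz x)%:R) `^ (- (1 + gamma)) <= J x &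
 forall x : int, J x <= CJ * (1 + (absz x)%:R) `^ (- (1 + gamma))].
have [_ _ hd] := hJ; have [N N0 hN] := kernel_tail.
have s0 : 0 <= 1 + gamma by case/andP: g01 => *; rewrite addr_ge0// ltW.
pose w (n : nat) : R := (1 + n%:R) `^ (- (1 + gamma)).
have w0 n : 0 < w n by rewrite powR_gt0// ltr_pwDl.
have wN (m n : nat) : (m <= n)%N -> w n <= w m.
 by move=> mn; apply: pow_leN; rewrite ?ltr_pwDl ?lerD2l ?ler_nat.
have w1 n : w n <= 1.
 apply: (le_trans (wN _ _ (leq0n n))); rewrite /w addr0.
 by rewrite (_ : 1 `^ _ = 1) ?powR1.
have JN0 := kernel_gt0 N%:Z.
exists (Num.min (1 / 2) (J N%:Z)), (Num.max (2 * 2 `^ (1 + gamma)) (J 0 / w N)); split.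
- by rewrite lt_min JN0 divr_gt0.
- move=> x; rewrite -/(w _); have [Nx|Nx] := leqP N (absz x).
 + have /andP[lo _] := hN x Nx; apply: le_trans lo.
  apply: ler_pM; rewrite ?le_min ?(ltW JN0) ?(ltW (w0 _))//.
  * by rewrite divr_ge0.
  * by rewrite ge_min lexx.
  * apply: pow_leN => //; first by rewrite ltr0n (leq_trans N0).
   by rewrite lerDr.
 + apply: le_trans (hd x N%:Z _); last by rewrite -!abszE lez_nat ltnW.
  apply: (via (J N%:Z * w (absz x))); last by apply: ler_piMr; [exact: ltW|].
  by rewrite ler_wpM2r ?(ltW (w0 _))// ge_min lexx orbT.
- move=> x; rewrite -/(w _); have [Nx|Nx] := leqP N (absz x).
 + have /andP[_ hi] := hN x Nx; apply: (le_trans hi).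
  have x0 : 0 < (absz x)%:R :> R by rewrite ltr0n (leq_trans N0).
  apply: (via (2 * 2 `^ (1 + gamma) * w (absz x))).
   rewrite -mulrA ler_wpM2l// /w; apply: pow_scale; rewrite ?addr_gt0//.
   by rewrite mulr_natl mulr2n lerD2r ler1n (leq_trans N0).
  by rewrite ler_wpM2r ?(ltW (w0 _))// le_max lexx.
 + apply: (via (J 0 / w N * w (absz x))); last first.
   by rewrite ler_wpM2r ?(ltW (w0 _))// le_max lexx orbT.
  apply: (le_trans (hd 0 x _)); first by rewrite normr0.
  rewrite mulrAC ler_pdivlMr// ler_wpM2l ?(ltW (kernel_gt0 _))//.
  by apply: wN; exact: ltnW.
Qed.
End kernel_bounds.

(** * The critical point and the ratio *)

Section limf.
Context {R : realType}.

Lemma limf_einf_bounds (f : R -> R) (b b' c C : R) : b < b' ->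
 (forall x, b < x < b' -> c <= f x <= C) ->
 (c%:E <= limf_einf (fun x => (f x)%:E) b^'+ <= C%:E)%E.
move=> bb hf; have nb : \forall x \near b^'+, b < x < b'.
 by near=> x; apply/andP; split; near: x; [exact: nbhs_right_gt|exact: nbhs_right_lt].
rewrite limf_einfE; apply/andP; split.
 apply: le_trans (ereal_sup_ubound _); last by exists [set x | b < x < b'] => //; exact: nb.
 by apply: le_ereal_inf_tmp => _ [x /= hx <-]; rewrite lee_fin; case/andP: (hf x hx).
apply: ge_ereal_sup => _ [V hV <-].
have [x [Vx hx]] := filter_ex (filterI hV nb).
apply: (via (f x)%:E); first by apply: ereal_inf_lbound; exists x.
by rewrite lee_fin; case/andP: (hf x hx).
Unshelve. all: by end_near. Qed.

End limf.

(** The supremum of the [f] with [beta * g f > 1]; strict monotonicity makes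
    the inequality strict above it. *)
Lemma threshold {R : realType} (g : R -> R) (beta : R) :
 (forall f, 0 <= f -> 0 < g f) -> (forall f f', 0 <= f -> f < f' -> g f' < g f) ->
 (forall c, c < g 0 -> exists2 f, 0 < f & c < g f) -> (g 0)^-1 < beta < (g (1 / 2))^-1 ->
 exists phi, [/\ 0 < phi <= 1 / 2,
  forall f, 0 <= f < phi -> 1 < beta * g f & forall f, phi < f -> beta * g f < 1].
move=> g_gt0 g_decr g_near0 /andP[b0 b2].
have half0 : 0 <= 1 / 2 :> R by rewrite divr_ge0.
have g00 := g_gt0 0 (lexx 0); have g20 := g_gt0 _ half0.
have bpos : 0 < beta by apply: lt_trans b0; rewrite invr_gt0.
have inA f : (1 < beta * g f) = (beta^-1 < g f) by rewrite -ltr_pdivrMl// mulr1.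
pose A := [set f | 0 <= f /\ 1 < beta * g f].
have ubA : ubound A (1 / 2).
 move=> f [f0 bf]; rewrite leNgt; apply/negP => f2.
 have := lt_trans bf (_ : beta * g f < beta * g (1 / 2)); rewrite ltr_pM2l// => /(_ (g_decr _ _ half0 f2)).
 by rewrite inA -[ltRHS]invrK ltf_pV2 ?posrE ?invr_gt0// ltNge (ltW b2).
have [f1 f10 hf1] : exists2 f, 0 < f & beta^-1 < g f.
 by apply: g_near0; rewrite -[ltRHS]invrK ltf_pV2 ?posrE ?invr_gt0.
have Af1 : A f1 by split; [exact: ltW|rewrite inA].
have supA : has_sup A by split; [exists f1|exists (1 / 2)].
have leA f : A f -> f <= sup A by move=> Af; apply: ub_le_sup => //; case: supA.
have s0 : 0 < sup A by apply: lt_le_trans f10 _; exact: leA.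
exists (sup A); split.
- by rewrite s0; apply: ge_sup => //; exists f1.
- move=> f /andP[f0 fs]; have [f' [_ Af'] ff'] := sup_gt (ex_intro _ f1 Af1) fs.
 by apply: (lt_trans Af'); rewrite ltr_pM2l// g_decr.
- move=> f sf; have [m /andP[sm mf]] : exists m, sup A < m < f by exists ((sup A + f) / 2); lra.
 have m0 := ltW (lt_trans s0 sm).
 apply: (@lt_le_trans _ _ (beta * g m)); first by rewrite ltr_pM2l// g_decr.
 by rewrite leNgt; apply/negP => h; have := leA m (conj m0 h); rewrite leNgt sm.
Qed.

Lemma between {R : realType} (x y e : R) : x < y -> 0 < e -> exists b, [/\ x < b, b < y & b <= x + e].
move=> xy e0; exists (Num.min (x + e) ((x + y) / 2)); split.
- by rewrite lt_min; apply/andP; split; lra.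
- by rewrite gt_min; apply/orP; right; lra.
- by rewrite ge_min lexx.
Qed.

Section assembly.
Context {R : realType}.
Variables (gamma cJ CJ : R) (J : int -> R).
Hypotheses (g23 : 2 / 3 < gamma < 1) (Jsym : forall x, J (- x) = J x)
 (J1 : (\esum_x (J x)%:E = 1)%E) (cJ0 : 0 < cJ)
 (Jlo : forall x : int, cJ * (1 + (absz x)%:R) `^ (- (1 + gamma)) <= J x)
 (Jhi : forall x : int, J x <= CJ * (1 + (absz x)%:R) `^ (- (1 + gamma))).
Variables (d1 d2 : measure_display) (O1 : measurableType d1) (O2 : measurableType d2).
Variables (P1 : probability O1 R) (P2 : probability O2 R).
Variables (W1 : R -> O1 -> int) (W2 : R -> O2 -> int).
Hypotheses (hW1 : ctrw P1 J W1) (hW2 : ctrw P2 J W2).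

Let g01 : 0 < gamma < 1.
by case/andP: g23 => h1 ->; rewrite andbT; lra. Qed.
Local Notation p := (hp J).
Local Notation G := (green p).
Local Notation F := (free_energy P1 P2 W1 W2).

Let HE : heat J p. exact: walk_heat hW1 Jsym J1. Qed.

Lemma beta0E : beta0 P1 W1 = (G 0)^-1.
rewrite /beta0 /green; congr (fine _)^-1; apply: eq_integral => t.
rewrite inE/= in_itv/= andbT => t0; rewrite /damped mul0r oppr0 expR0 mulr1.
exact: (W_law hW1).
Qed.

Lemma free_energyE rho beta f : is_free_energy P1 P2 W1 W2 rho beta f -> F rho beta = f.
move=> hf; have hg : is_free_energy P1 P2 W1 W2 rho beta (F rho beta) by exact: getI hf.
have PF : ProperFilter (almost_everywhere P2).
 have P0 : (0%R < P2 setT)%E by rewrite probability_setT lte01.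
 exact: ae_properfilter_algebraOfSetsType P0.
have [w [h1 h2]] := filter_ex (filterI hg hf).
exact: (cvg_unique _ h1 h2).
Qed.

Lemma free_energy_limit rho beta : 0 <= rho <= 1 / 2 -> 0 < beta -> exists Hs : nat -> nat,
 [/\ 0 <= F rho beta, forall k, (k < Hs k)%N &
  mesh_limit P2 W2 p rho beta Hs (F rho beta)].
move=> rho12 b0; have [cL cL0 hL] := heat_link HE g01 cJ0 Jlo Jhi.
have [Cg Cg0 hg] := glog_J g01 cJ0 Jlo Jhi.
have gg : gamma^-1 * gamma = 1 by rewrite mulVf// gt_eqF//; case/andP: g01.
have g10 : 0 < gamma^-1 by rewrite invr_gt0; case/andP: g01.
have [f [Hs [h1 h2 h3 h4]]] := free_energy_exists hW1 hW2 HE rho12 b0 g10 cL0 hL gg Cg0 hg.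
by exists Hs; rewrite (free_energyE h1).
Qed.

Definition critical (beta phi : R) := [/\ 0 < phi <= 1 / 2,
 forall f, 0 <= f < phi -> 1 < beta * G f & forall f, phi < f -> beta * G f < 1].

Lemma critical_exists beta : (G 0)^-1 < beta < (G (1 / 2))^-1 -> exists phi, critical beta phi.
apply: threshold => [f|f f'|c].
- exact: (green_gt0 HE g01 cJ0 Jlo).
- exact: (green_strict HE g01 cJ0 Jlo).
- exact: (green_near0 HE g01 cJ0 Jlo).
Qed.

Lemma free_energy_le beta phi rho : 0 < beta -> critical beta phi -> 0 <= rho <= 1 / 2 -> F rho beta <= phi.
move=> b0 [/andP[p0 p2] _ hu] rho12; have [Hs [f0 kH cF]] := free_energy_limit rho12 b0.
apply/ler_addgt0Pr => e e0.
apply: (free_energy_upper HE g01 cJ0 Jlo hW2 rho12 b0 _ _ kH cF); last by apply: hu; rewrite ltrDl.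
by rewrite addr_ge0 ?ltW.
Qed.

Lemma free_energy_subcritical beta rho : 0 < beta < (G 0)^-1 -> 0 <= rho <= 1 / 2 -> F rho beta <= 0.
move=> /andP[b0 b1] rho12; have [Hs [f0 kH cF]] := free_energy_limit rho12 b0.
apply: (free_energy_upper HE g01 cJ0 Jlo hW2 rho12 b0 (lexx 0) _ kH cF).
by rewrite -ltr_pdivlMr ?div1r// (green_gt0 HE g01 cJ0 Jlo).
Qed.

(** The lower bound holds for every [f < phi]; let [f] tend to [phi]. *)
Lemma free_energy_ge (eps : R) : 0 < eps <= 1 -> exists2 rho_e : R, 0 < rho_e <= 1 / 4 &
 forall rho beta phi, 0 <= rho <= rho_e -> 0 < beta < (G (1 / 2))^-1 -> critical beta phi ->
 (1 - eps) * phi <= F rho beta.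
move=> eps01; have half0 : 0 <= 1 / 2 :> R by rewrite divr_ge0.
have G2 := green_gt0 HE g01 cJ0 Jlo half0.
have iG : 0 < (G (1 / 2))^-1 by rewrite invr_gt0.
have [rho_e re hr] := free_energy_lower HE g23 cJ0 Jlo Jhi iG eps01.
exists rho_e => // rho beta phi rhoe /andP[b0 b1] [/andP[p0 p2] hl _].
have rho12 : 0 <= rho <= 1 / 2.
 by case/andP: rhoe => -> h1; case/andP: re => _ h2 /=; lra.
have [Hs [f0 kH cF]] := free_energy_limit rho12 b0.
apply/ler_addgt0Pr => e e0; have /andP[e1 e2] := eps01.
pose f := Num.max (phi - e) (phi / 2).
have f1 : phi - e <= f by rewrite le_max lexx.
have f2 : phi / 2 <= f by rewrite le_max lexx orbT.
have f3 : f < phi by rewrite gt_max; apply/andP; split; lra.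
have fpos : 0 < f by lra.
have bb : 0 < beta <= (G (1 / 2))^-1 by rewrite b0 ltW.
have ff : 0 < f <= 1 / 2 by rewrite fpos; lra.
have := hr _ _ P2 W2 rho beta f (F rho beta) Hs hW2 rhoe bb ff (hl f ltac:(by rewrite (ltW fpos))) kH cF.
have : (1 - eps) * (phi - f) <= e.
 by apply: (via (1 * (phi - f))); [rewrite ler_wpM2r|]; lra.
rewrite mulrBr; lra.
Qed.

Lemma free_energy0 beta phi : 0 < beta < (G (1 / 2))^-1 -> critical beta phi -> F 0 beta = phi.
move=> b01 crit; have b0 : 0 < beta by case/andP: b01.
have r0 : 0 <= (0 : R) <= 1 / 2 by apply/andP; split => //; exact: divr_ge0.
apply/eqP; rewrite eq_le (free_energy_le b0 crit r0)/=.
have [/andP[p0 p2] _ _] := crit.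
apply/ler_addgt0Pr => e e0; pose eps : R := Num.min 1 e.
have e1 : 0 < eps <= 1 by rewrite lt_min ltr01 e0/= ge_min lexx.
have e2 : eps <= e by rewrite ge_min lexx orbT.
have [rho_e /andP[re _] h] := free_energy_ge e1.
have := h 0 beta phi ltac:(by rewrite lexx ltW) b01 crit.
have : eps * phi <= e.
 apply: le_trans e2; apply: ler_piMr; last by lra.
 by case/andP: e1 => /ltW.
by rewrite mulrBl mul1r; lra.
Qed.

Lemma window : (G 0)^-1 < (G (1 / 2))^-1.
have half0 : 0 < 1 / 2 :> R by rewrite divr_gt0.
rewrite ltf_pV2 ?posrE ?(green_gt0 HE g01 cJ0 Jlo)// ?ltW//.
exact: (green_strict HE g01 cJ0 Jlo).
Qed.

Let G0_gt0 : 0 < (G 0)^-1.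
by rewrite invr_gt0 (green_gt0 HE g01 cJ0 Jlo).
Qed.
Lemma critical_point_unchanged : exists2 rho0 : R, 0 < rho0 < 1 &
 forall rho : R, 0 <= rho < rho0 -> beta_c P1 P2 W1 W2 rho = (beta0 P1 W1)%:E.
have half1 : 0 < (1 / 2 : R) <= 1 by apply/andP; split; lra.
have [rho_e /andP[r0 r1] hr] := free_energy_ge half1.
exists rho_e; first by rewrite r0/=; lra.
move=> rho /andP[rho0 rhoe]; rewrite beta0E.
have rho12 : 0 <= rho <= 1 / 2 by rewrite rho0/=; lra.
apply/eqP; rewrite eq_le; apply/andP; split; last first.
 apply: le_ereal_inf_tmp => _ [b [b0 fb] <-]; rewrite lee_fin leNgt; apply/negP => bG.
 by have := free_energy_subcritical (beta := b) ltac:(by rewrite b0) rho12; rewrite leNgt fb.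
apply/lee_addgt0Pr => e e0; have win := window.
have [b [b1 b2 b3]] := between win e0.
have [phi crit] := critical_exists (beta := b) ltac:(by rewrite b1).
have bpos := lt_trans G0_gt0 b1.
have := hr rho b phi ltac:(by rewrite rho0 ltW) ltac:(by rewrite bpos) crit => hF.
apply: (via b%:E); last by rewrite -EFinD lee_fin.
apply: ereal_inf_lbound; exists b => //; split => //.
by apply: lt_le_trans hF; case: crit => /andP[p0 _] _ _; apply: mulr_gt0 => //; lra.
Qed.

Lemma free_energy_ratio : limf_einf (fun beta : R => (F rho beta / F 0 beta)%:E) (beta0 P1 W1)^'+
   @[rho --> 0^'+] --> 1%E.
have bounds (eps : R) : 0 < eps <= 1 -> \forall rho \near 0^'+,
 ((1 - eps)%:E <= limf_einf (fun beta : R => (F rho beta / F 0 beta)%:E) (beta0 P1 W1)^'+ <= 1%:E)%E.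
 move=> eps01; have [rho_e /andP[r0 r1] hr] := free_energy_ge eps01.
 near=> rho; have rho0 : 0 < rho by near: rho; exact: nbhs_right_gt.
 have rhoe : rho < rho_e by near: rho; exact: nbhs_right_lt.
 rewrite beta0E; apply: (limf_einf_bounds window) => b /andP[b1 b2].
 have bpos := lt_trans G0_gt0 b1.
 have bb : 0 < b < (G (1 / 2))^-1 by rewrite bpos.
 have [phi crit] := critical_exists (beta := b) ltac:(by rewrite b1).
 have p0 : 0 < phi by case: crit => /andP[].
 rewrite (free_energy0 bb crit) ler_pdivlMr// ler_pdivrMr// mul1r.
 rewrite hr//=; last by rewrite (ltW rho0) ltW.
 by apply: free_energy_le => //; rewrite (ltW rho0)/=; lra.
apply/fine_cvgP; split.
 have h1 := bounds 1 ltac:(by rewrite ltr01 lexx).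
 apply: filterS h1 => rho /andP[h1 h2]; rewrite fin_numElt.
 by rewrite (lt_le_trans _ h1) ?ltNyr//= (le_lt_trans h2) ?ltry.
apply/cvgrPdist_le => e e0; pose eps : R := Num.min 1 e.
have e1 : 0 < eps <= 1 by rewrite lt_min ltr01 e0/= ge_min lexx.
have e2 : eps <= e by rewrite ge_min lexx orbT.
have h1 := bounds eps e1.
apply: filterS h1 => rho /=; case: (limf_einf _ _) => [r| |]/andP[]//.
by rewrite !lee_fin => h2 h3; rewrite ler_norml /=; apply/andP; split; lra.
Unshelve. all: by end_near. Qed.

End assembly.

Theorem theorem2p1 (R : realType) (gamma : R) (J : int -> R)
    (hgamma : 2 / 3 < gamma < 1)
    (hJ : stable_kernel gamma J)
    (hJtail : J x / `|x|%:~R `^ (- (1 + gamma)) @[x --> absz_infty] --> (1 : R))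
    (d1 d2 : measure_display) (O1 : measurableType d1) (O2 : measurableType d2)
    (P1 : probability O1 R) (P2 : probability O2 R)
    (W1 : R -> O1 -> int) (W2 : R -> O2 -> int)
    (hW1 : ctrw P1 J W1) (hW2 : ctrw P2 J W2) :
  let F := free_energy P1 P2 W1 W2 in
  let b0 := beta0 P1 W1 in
  (exists2 rho0 : R, 0 < rho0 < 1 &
     forall rho : R, 0 <= rho < rho0 -> beta_c P1 P2 W1 W2 rho = b0%:E) /\
  (limf_einf (fun beta : R => (F rho beta / F 0 beta)%:E) b0^'+
     @[rho --> 0^'+] --> 1%E).
Proof.
have g01 : 0 < gamma < 1 by case/andP: hgamma => h1 ->; rewrite andbT; lra.
have [_ J1 _] := hJ; have [cJ [CJ [cJ0 Jlo Jhi]]] := kernel_bounds g01 hJ hJtail.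
split; first exact: (critical_point_unchanged hgamma (kernel_sym hJ) J1 cJ0 Jlo Jhi hW1 hW2).
exact: (free_energy_ratio hgamma (kernel_sym hJ) J1 cJ0 Jlo Jhi hW1 hW2).
Qed.
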